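(* Let $\{\mathcal{S}(t)\}_{t\ge0}$ be the generalized Skellam process and let $\{H_f(t)\}_{t\ge0}$ be an independent inverse subordinator associated with the Bernštein function $f$ with Lévy measure $\bar\nu$. Assume that $\bar\nu(0,\infty)=\infty$ and that $\nu(s)=c_1+\bar\nu(s,\infty)$ is absolutely continuous. Let $\bar p_f(n,t)=\Pr\{\mathcal{S}(H_f(t))=n\}$. Then $${}^{f}\mathscr{D}_t\,\bar p_f(n,t)=\Lambda\big(\bar p_f(n-1,t)-\bar p_f(n,t)\big)-\bar\Lambda\big(\bar p_f(n,t)-\bar p_f(n+1,t)\big),\qquad n\in\mathbb{Z},$$ with initial conditions $\bar p_f(0,0)=1$ and $\bar p_f(n,0)=0$ for $n\ne0$, where ${}^{f}\mathscr{D}_t$ is the generalized Caputo derivative with respect to $f$.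
   Context: Fix an integer $k\ge1$ and positive rates $\lambda_1,\dots,\lambda_k,\mu_1,\dots,\mu_k$; $\Lambda=\lambda_1+\dots+\lambda_k$, $\bar\Lambda=\mu_1+\dots+\mu_k$. The generalized counting process (GCP) with rates $\lambda_1,\dots,\lambda_k$ is a Lévy process started at $0$ performing jumps of size $j\in\{1,\dots,k\}$ at rate $\lambda_j$. The generalized Skellam process (GSP) is $\mathcal{S}(t)=M_1(t)-M_2(t)$, with $M_1,M_2$ independent GCPs with rates $\lambda_j$ and $\mu_j$, respectively. The paper uses throughout that the state probabilities $p(n,t)=\Pr\{\mathcal{S}(t)=n\}$ satisfy $\frac{\mathrm{d}}{\mathrm{d}t}p(n,t)=\Lambda(p(n-1,t)-p(n,t))-\bar\Lambda(p(n,t)-p(n+1,t))$, $n\in\mathbb{Z}$, with $p(0,0)=1$, $p(n,0)=0$ for $n\ne0$. A subordinator $\{D_f(t)\}_{t\ge0}$ is a one-dimensional Lévy process with non-decreasing paths, $D_f(0)=0$ a.s. and $\mathbb{E}(e^{-sD_f(t)})=e^{-tf(s)}$, $s>0$, where $f(s)=c_1+c_2s+\int_0^\infty(1-e^{-sx})\bar\nu(\mathrm{d}x)$, $c_1,c_2\ge0$, is a Bernštein function and $\bar\nu$ is a non-negative measure on $(0,\infty)$ with $\int_0^\infty(x\wedge1)\bar\nu(\mathrm{d}x)<\infty$. The inverse subordinator is $H_f(t)=\inf\{x\ge0:D_f(x)>t\}$. The process $\mathcal{S}(H_f(t))$ is the time-changed generalized Skellam process-II (TCGSP-II). The generalized Caputo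 derivative of an absolutely continuous function $w$ is ${}^{f}\mathscr{D}_tw(t)=c_2\frac{\mathrm{d}}{\mathrm{d}t}w(t)+\int_0^t\frac{\partial}{\partial t}w(t-s)\,\nu(s)\,\mathrm{d}s$, with $\nu(s)=c_1+\bar\nu(s,\infty)$.
   Formalization: For k≥2 the stated equations fail for a process with jumps of size up to k (P(S(h)=2)=λ₂h+o(h)); S is then any càdlàg integer-valued process whose state probabilities satisfy the stated equations and initial conditions. For k=1, S may be the generalized Skellam process itself. *)

(* Defs.v *)
From HB Require Import structures.
From mathcomp Require Import all_boot all_order all_algebra.
From mathcomp Require Import all_classical all_reals all_analysis.
From mathcomp Require Import measurable_realfun.
Set Implicit Arguments.
Unset Strict Implicit.
Unset Printing Implicit Defensive.
Import Order.TTheory GRing.Theory Num.Theory.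
Import numFieldNormedType.Exports.
Local Open Scope classical_set_scope.
Local Open Scope ring_scope.

HB.instance Definition _ := isPointed.Build int 0.

HB.instance Definition _ := @isMeasurable.Build default_measure_display
  int discrete_measurable discrete_measurable0
  discrete_measurableC discrete_measurableU.

Section processes.
Context d (T : measurableType d) (R : realType) (P : probability T R).

Definition process_sigma d' (U : measurableType d') (X : R -> T -> U)
    (I : set R) : set (set T) :=
  <<s [set X t @^-1` B | t in I & B in measurable] >>.

Definition independent_classes (F G : set (set T)) : Prop :=
  forall A B, F A -> G B -> P (A `&` B) = (P A * P B)%E.

Definition independent_processes d1 (U : measurableType d1)
    d2 (V : measurableType d2) (X : R -> T -> U) (Y : R -> T -> V) : Prop :=
  independent_classes (process_sigma X [set t | 0 <= t])
                      (process_sigma Y [set t | 0 <= t]).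

Definition cadlag (U : topologicalType) (x : R -> U) : Prop :=
  (forall t, 0 <= t -> x u @[u --> t^'+] --> x t) /\
  (forall t, 0 < t -> exists l : U, x u @[u --> t^'-] --> l).

Definition int_process (X : R -> T -> int) : Prop :=
  (forall t, 0 <= t -> measurable_fun setT (X t)) /\
  (forall w, cadlag (fun t => (X t w)%:~R : R)).

Definition state_prob (X : R -> T -> int) (n : int) (t : R) : R :=
  fine (P [set w | X t w = n]).

Definition levy_int (X : R -> T -> int) : Prop :=
  [/\ int_process X,
      {ae P, forall w, X 0 w = 0},
      forall s h : R, 0 <= s -> 0 <= h -> forall n,
        P [set w | X (s + h) w - X s w = n] = P [set w | X h w = n] &
      forall s h : R, 0 <= s -> 0 <= h -> forall n A,
        process_sigma X `[0, s] A ->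
        P (A `&` [set w | X (s + h) w - X s w = n]) =
        (P A * P [set w | (X (s + h) w - X s w = n)%R])%E ].

(* [rate i] is the rate of the jumps of size [i + 1]: in a time interval of
   length h, the process jumps by j with probability rate_j h + o(h), and does
   not move with probability 1 - (sum of the rates) h + o(h). *)
Definition gcp (k : nat) (rate : 'I_k -> R) (M : R -> T -> int) : Prop :=
  [/\ levy_int M,
      forall i : 'I_k, h^-1 * state_prob M i.+1%:Z h @[h --> 0^'+] --> rate i &
      h^-1 * (1 - state_prob M 0 h) @[h --> 0^'+] --> \sum_i rate i].

Definition gsp (k : nat) (lam mu : 'I_k -> R) (S : R -> T -> int) : Prop :=
  exists M1 M2 : R -> T -> int,
    [/\ gcp lam M1, gcp mu M2, independent_processes M1 M2 &
        forall t w, S t w = M1 t w - M2 t w].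

(* Right-hand side of the state equations, for a family of functions p. *)
Definition skellam_rhs (Lam Mu : R) (p : int -> R -> R) (n : int) (t : R) : R :=
  Lam * (p (n - 1) t - p n t) - Mu * (p n t - p (n + 1) t).

(* The forward equations of the Skellam process with rates Lam and Mu. A [gsp]
   satisfies them with Lam, Mu the sums of its rates only when all its jumps
   have size 1 (k = 1): if k >= 2, then P(S(h) = 2) = lam_2 h + o(h), whereas
   the equations force P(S(h) = 2) = o(h). Requiring both would thus be
   contradictory for k >= 2. *)
Definition skellam_state_equations (Lam Mu : R) (S : R -> T -> int) : Prop :=
  [/\ int_process S,
      state_prob S 0 0 = 1,
      forall n, n != 0 -> state_prob S n 0 = 0 &
      forall (n : int) (t : R), 0 < t ->
        is_derive t 1 (state_prob S n) (skellam_rhs Lam Mu (state_prob S) n t)].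

End processes.

Section bernstein.
Context (R : realType) (c1 c2 : R) (nubar : {measure set R -> \bar R}).

(* [nubar] is a measure on the whole line, but only its restriction to
   (0, +oo) is ever used. *)
Definition bernstein_triplet : Prop :=
  [/\ 0 <= c1, 0 <= c2 &
      (\int[nubar]_(x in `]0%R, +oo[) (Num.min x 1)%:E < +oo)%E].

Definition bernstein (s : R) : R :=
  c1 + c2 * s + \int[nubar]_(x in `]0, +oo[) (1 - expR (- (s * x))).

(* Meaningful for s > 0, where the tail of [nubar] is finite. *)
Definition levy_tail (s : R) : R := c1 + fine (nubar `]s, +oo[%classic).

End bernstein.

Section subordinators.
Context d (T : measurableType d) (R : realType) (P : probability T R).

(* When c1 > 0, the subordinator is killed at rate c1, i.e., it is sent to +oo:
   this is why it takes its values in \bar R. The increments are then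
   independent of the past and stationary as long as the process is finite;
   for c1 = 0, the process is a.s. finite and this is the usual requirement.
   In the Laplace transform, exp(-s * +oo) = 0. *)
Definition subordinator (c1 c2 : R) (nubar : {measure set R -> \bar R})
    (D : R -> T -> \bar R) : Prop :=
  [/\ forall t, 0 <= t -> measurable_fun setT (D t),
      {ae P, forall w, D 0 w = 0%E},
      forall w, cadlag (D ^~ w) /\
        (forall s t : R, 0 <= s -> s <= t -> (D s w <= D t w)%E),
      forall s h : R, 0 <= s -> 0 <= h -> forall A (B : set (\bar R)),
        process_sigma D `[0, s] A -> measurable B ->
        P (A `&` [set w | (D s w < +oo)%E /\ B (D (s + h)%R w - D s w)%E]) =
        (P (A `&` [set w | (D s w < +oo)%E]) * P (D h @^-1` B))%E &
      forall t s : R, 0 <= t -> 0 < s ->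
        (\int[P]_w expeR (- (s%:E * D t w)) =
         (expR (- (t * bernstein c1 c2 nubar s)))%:E)%E ].

(* The infimum is over an a.s. nonempty set; [inf] is 0 on the exceptional
   null event. *)
Definition inverse_subordinator (D : R -> T -> \bar R) (t : R) (w : T) : R :=
  inf [set x | 0 <= x /\ (t%:E < D x w)%E].

Definition time_change (S : R -> T -> int) (H : R -> T -> R)
    (t : R) (w : T) : int := S (H t w) w.

End subordinators.

Section caputo.
Context (R : realType).

(* Absolute continuity on [a, b]. *)
Definition abs_cont (a b : R) (f : R -> R) : Prop :=
  forall e, 0 < e -> exists2 delta, 0 < delta &
  forall (n : nat) (x y : 'I_n -> R),
    (forall i, a <= x i /\ x i <= y i /\ y i <= b) ->
    trivIset setT (fun i => `]x i, y i[%classic) ->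
    \sum_i (y i - x i) < delta -> \sum_i `|f (y i) - f (x i)| < e.

Definition caputo_integrand (nu w : R -> R) (t s : R) : R :=
  derive1 (fun u => w (u - s)) t * nu s.

Definition gen_caputo (c2 : R) (nu w : R -> R) (t : R) : R :=
  c2 * derive1 w t +
  \int[lebesgue_measure]_(s in `]0, t[) caputo_integrand nu w t s.

(* [gen_caputo c2 nu w t] is not a junk value; the term c2 w'(t) is absent
   when c2 = 0. *)
Definition gen_caputo_defined (c2 : R) (nu w : R -> R) (t : R) : Prop :=
  [/\ abs_cont 0 t w,
      c2 != 0 -> derivable w t 1 &
      lebesgue_measure.-integrable `]0, t[ (EFin \o caputo_integrand nu w t)].

End caputo.

(* Main.v *)
Require Import Defs.
From HB Require Import structures.
From mathcomp Require Import all_boot all_order all_algebra.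
From mathcomp Require Import all_classical all_reals all_analysis.
From mathcomp Require Import measurable_realfun.
From mathcomp Require Import lra ring zify.
Set Implicit Arguments.
Unset Strict Implicit.
Unset Printing Implicit Defensive.
Import Order.TTheory GRing.Theory Num.Theory.
Import numFieldNormedType.Exports.
Local Open Scope classical_set_scope.
Local Open Scope ring_scope.

(* Let g_n(x) = P(S(x) = n), H the inverse subordinator, U(t) = E H(t), K = Lam + Mu,
   p_n(t) = P(S(H(t)) = n), and r the right-hand side of the equation for p_n. Since
   |g_n'| <= K, p_n(t) - g_n(0) is the integral of g_n'(x) P(H(t) > x), and both
   K U + (p_n - g_n(0)) and K U - (p_n - g_n(0)) are nondecreasing. The Laplace transform
   of P(H(t) > x) in t is exp(-x f(s)) / s, and f(s) = s (c2 + L nu(s)); hence these two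
   functions Y solve c2 Y + nu * Y = B, where B is the primitive of K + r or of K - r,
   while c2 U + nu * U = t. It remains to differentiate under the convolution.

   If c2 > 0, then U, hence Y, is Lipschitz, and dominated convergence applies.

   If c2 = 0, the renewal equation nu * U = t is discretized: U is a limit of solutions of
   discrete renewal equations, for which absolute continuity is controlled by comparing nu
   with its truncation max(nu, nu(eta)). So U and the functions Y have densities. For every
   t > 0, monotone convergence shows that the convolution of nu with the density of Y is
   at most B'(t). Conversely, the values of nu above a large level contribute little to the
   increments of nu * U away from 0, again by a discrete renewal argument, so that the
   convolution of nu with the density of U is at least 1. The two upper bounds, K + r and
   K - r, add up to the lower bound 2 K, so equality holds at every t > 0. *)


(** The equation is wanted at every t, whereas for [c2 = 0] the functions involved have derivatives
    only almost everywhere, and no integrable bound on their difference quotients is at hand. Limits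
    of these quotients are therefore replaced by one-sided inequalities between nondecreasing
    functions, which is why [p_n] is always handled through [K U + p_n] and [K U - p_n].
    Monotonicity also yields uniqueness for Laplace transforms without an inversion formula: values
    at two distinct points are compared through a kernel that concentrates between them. In the
    discrete renewal equation [a * u = 1], [a] is the tail of a step law and [u] its renewal
    sequence. Truncating [a] kills the walk at its first long step, and absolute continuity of nu
    says that the law of long steps puts little mass on small sets. Two probabilistic inputs remain.
    The law of S(H(t)) is obtained by approaching H(t) from the right by discrete times, the paths
    being right-continuous with integer values. For a process with unit jumps, the state equations
    come from transition estimates uniform in t, so that right difference quotients control the left
    ones too. *)

Definition dconv (R : pzRingType) (f g : nat -> R) (n : nat) : R :=
  \sum_(i < n.+1) f i * g (n - i)%N.

(** * Algebra of convolutions of sequences *)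

Section conv_algebra.
Context {R : comNzRingType}.
Implicit Types f g h : nat -> R.

(** Truncated generating polynomial. The coefficients of a product up to rank [n] only involve those
    of its factors up to rank [n], so commutativity and associativity are inherited from
    [{poly R}]. *)
Let pol f (n : nat) : {poly R} := \poly_(i < n.+1) f i.

Let conv_pol f g n k : (k <= n)%N -> dconv f g k = (pol f n * pol g n)`_k.
Proof.
move=> kn; rewrite coefM /dconv; apply: eq_bigr => i _.
rewrite !coef_poly !ifT//; first by rewrite ltnS (leq_trans (leq_subr _ _)).
by rewrite ltnS (leq_trans _ kn)// -ltnS.
Qed.

Let conv_coef f g n : dconv f g n = (pol f n * pol g n)`_n.
Proof. exact: conv_pol. Qed.

Lemma dconvC f g n : dconv f g n = dconv g f n.
Proof. by rewrite !conv_coef mulrC. Qed.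

Lemma dconvA f g h n : dconv f (dconv g h) n = dconv (dconv f g) h n.
Proof.
have -> : dconv (dconv f g) h n = (pol f n * pol g n * pol h n)`_n.
  rewrite coefM; apply: eq_bigr => i _; rewrite (@conv_pol f g n)//; last first.
    by rewrite -ltnS.
  by rewrite coef_poly ifT// ltnS leq_subr.
rewrite -mulrA coefM; apply: eq_bigr => i _.
rewrite (@conv_pol g h n) ?leq_subr//; congr (_ * _).
by rewrite coef_poly ifT.
Qed.

Lemma dconvDr f g h n : dconv f (fun i => g i + h i) n = dconv f g n + dconv f h n.
Proof. by rewrite /dconv -big_split/=; apply: eq_bigr => i _; rewrite mulrDr. Qed.

Lemma dconvDl f g h n : dconv (fun i => f i + g i) h n = dconv f h n + dconv g h n.
Proof. by rewrite /dconv -big_split/=; apply: eq_bigr => i _; rewrite mulrDl. Qed.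

Lemma eq_dconvr f g h n : (forall i, (i <= n)%N -> g i = h i) -> dconv f g n = dconv f h n.
Proof. by move=> gh; apply: eq_bigr => i _; rewrite gh// leq_subr. Qed.

Lemma eq_dconvl f g h n : (forall i, (i <= n)%N -> f i = g i) -> dconv f h n = dconv g h n.
Proof. by move=> fg; apply: eq_bigr => i _; rewrite fg// -ltnS. Qed.

Lemma dconv1 f n : dconv (fun=> 1) f n = \sum_(i < n.+1) f i.
Proof.
by rewrite dconvC; apply: eq_bigr => i _; rewrite mulr1.
Qed.

(** Partial summation is convolution with the constant sequence 1, so this is associativity and
    commutativity. *)
Lemma sum_dconv f g n :
  \sum_(k < n.+1) dconv f g k = dconv f (fun m => \sum_(i < m.+1) g i) n.
Proof.
rewrite -dconv1 dconvA.
rewrite (@eq_dconvl _ (dconv f (fun=> 1))); last by move=> i _; exact: dconvC.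
by rewrite -dconvA; apply: eq_dconvr => i _; rewrite dconv1.
Qed.

End conv_algebra.

(** * Estimates and inverses for convolutions of sequences *)

Section conv_order.
Context {R : realFieldType}.
Implicit Types f g h : nat -> R.

Lemma ler_dconv f f' g g' n :
  (forall i, (i <= n)%N -> 0 <= f i <= f' i) ->
  (forall i, (i <= n)%N -> 0 <= g i <= g' i) -> dconv f g n <= dconv f' g' n.
Proof.
move=> ff gg; apply: ler_sum => i _.
have /andP[f0 f1] := ff i (ltn_ord i).
have /andP[g0 g1] := gg (n - i)%N (leq_subr _ _).
exact: ler_pM.
Qed.

Lemma dconv_ge0 f g n : (forall i, (i <= n)%N -> 0 <= f i) ->
  (forall i, (i <= n)%N -> 0 <= g i) -> 0 <= dconv f g n.
Proof.
move=> f0 g0; apply: sumr_ge0 => i _; apply: mulr_ge0; first exact: (f0 i (ltn_ord i)).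
exact/g0/leq_subr.
Qed.

Lemma ler_sum_ord f m n : (m <= n)%N -> (forall i, (i < n)%N -> 0 <= f i) ->
  \sum_(i < m) f i <= \sum_(i < n) f i.
Proof.
move=> mn f0; rewrite (big_ord_widen n f mn) big_mkcond; apply: ler_sum => i _.
by case: ifP => // _; exact/f0/ltn_ord.
Qed.

Lemma sum_dconv_le f g n : (forall i, 0 <= f i) -> (forall i, 0 <= g i) ->
  \sum_(k < n.+1) dconv f g k <= (\sum_(i < n.+1) f i) * \sum_(i < n.+1) g i.
Proof.
move=> f0 g0; rewrite sum_dconv /dconv mulr_suml; apply: ler_sum => i _.
by rewrite ler_wpM2l// ler_sum_ord// ltnS leq_subr.
Qed.

Lemma sum_dconv_cond (E : pred nat) f g n :
  \sum_(k < n.+1 | E k) dconv f g k =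
  \sum_(i < n.+1) f i * \sum_(j < (n - i).+1 | E (i + j)%N) g j.
Proof.
transitivity (\sum_(k < n.+1) dconv f g k *+ E k).
  by rewrite big_mkcond/=; apply: eq_bigr => k _; case: (E k).
transitivity (dconv f (fun=> 1) n *+ 0 +
   \sum_(i < n.+1) f i * \sum_(j < (n - i).+1) g j *+ E (i + j)%N); last first.
  rewrite mulr0n add0r; apply: eq_bigr => i _; congr (_ * _).
  by rewrite [RHS]big_mkcond/=; apply: eq_bigr => k _; case: (E _).
rewrite mulr0n add0r.
elim: n => [|n ih].
  have sum1 (F : nat -> R) : \sum_(i < 1) F i = F 0%N by rewrite big_ord1.
  rewrite (sum1 (fun k => dconv f g k *+ E k)) /dconv (sum1 (fun k => f k * g (0 - k)%N)).
  rewrite (sum1 (fun i => f i * \sum_(j < (0 - i).+1) g j *+ E (i + j)%N)).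
  by rewrite (sum1 (fun j => g j *+ E (0 + j)%N)) mulrnAr.
rewrite big_ord_recr/= ih [RHS]big_ord_recr/= subnn big_ord1 addn0.
have -> : dconv f g n.+1 = \sum_(i < n.+1) f i * g (n.+1 - i)%N + f n.+1 * g 0%N.
  by rewrite /dconv big_ord_recr/= subnn.
rewrite mulrnDl addrA -[f n.+1 * _ *+ _]mulrnAr; congr (_ + _).
rewrite -sumrMnl -big_split/=; apply: eq_bigr => i _.
rewrite subSn; last by rewrite -ltnS.
rewrite [in RHS]big_ord_recr/= mulrDr; congr (_ + _).
rewrite mulrnAr; congr (_ *+ E _); have := ltn_ord i; lia.
Qed.

(** Each index of [f] translates the set [E] seen by [g]; this is why the bound on [g] is asked for
    every translate of [E]. *)
Lemma sum_dconv_cond_le (E : pred nat) f g n D : (forall i, 0 <= f i) ->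
  (forall i, (i <= n)%N -> \sum_(j < (n - i).+1 | E (i + j)%N) g j <= D) ->
  \sum_(k < n.+1 | E k) dconv f g k <= (\sum_(i < n.+1) f i) * D.
Proof.
move=> f0 gD; rewrite sum_dconv_cond mulr_suml; apply: ler_sum => i _.
by rewrite ler_wpM2l// gD// -ltnS.
Qed.

Lemma dconv_inv f : f 0%N != 0 -> exists u, forall n, dconv f u n = 1.
Proof.
move=> f0.
(* The equation at rank [size s], solved for its last unknown, which has coefficient [f 0]. *)
pose next (s : seq R) := (1 - \sum_(i < size s) f (size s - i)%N * s`_i) / f 0%N.
pose S := fix S n := if n is m.+1 then rcons (S m) (next (S m)) else [::].
have sS n : size (S n) = n by elim: n => //= n; rewrite size_rcons => ->.
pose u n := (S n.+1)`_n.
have Su n i : (i < n)%N -> (S n)`_i = u i.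
  elim: n => // n ih; rewrite ltnS leq_eqVlt => /orP[/eqP -> //|lt_in].
  by rewrite /= nth_rcons sS lt_in ih.
exists u => n; rewrite dconvC /dconv big_ord_recr/= subnn.
have -> : u n = next (S n) by rewrite /u /= nth_rcons sS ltnn eqxx.
rewrite /next sS divfK// addrC -addrA -sumrN -big_split/= big1 ?addr0// => i _.
by rewrite Su// mulrC addNr.
Qed.

Lemma dconv_inj f u v : f 0%N != 0 ->
  (forall n, dconv f u n = dconv f v n) -> forall n, u n = v n.
Proof.
move=> f0 uv; elim/ltn_ind => n ih.
have := uv n; rewrite /dconv !big_ord_recl/= !subn0.
rewrite (eq_bigr (fun i : 'I_n => f (bump 0 i) * v (n - bump 0 i)%N)); last first.
  by move=> i _; rewrite ih// /bump/=; have := ltn_ord i; lia.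
by move=> /addIr /(mulfI f0).
Qed.

(* Subtracting the equations at [n] and [n - 1] expresses [f 0 * u n] as a
   combination of the [u k], [k < n], with the coefficients [f (n-1-k) - f (n-k)]. *)
Lemma dconv_inv_ge0 f u : 0 < f 0%N -> {homo f : m n / (m <= n)%N >-> n <= m} ->
  (forall n, dconv f u n = 1) -> forall n, 0 <= u n.
Proof.
move=> f0 fdec fu; elim/ltn_ind => -[_|n ih].
  by move: (fu 0%N); rewrite /dconv big_ord1 => fu0; rewrite -(pmulr_rge0 _ f0) fu0.
rewrite -(pmulr_rge0 _ f0).
have := fu n.+1; rewrite dconvC /dconv big_ord_recr/= subnn mulrC => /eqP.
rewrite addrC eq_sym -subr_eq => /eqP <-.
rewrite -(fu n) dconvC /dconv -sumrB; apply: sumr_ge0 => i _.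
rewrite -mulrBr mulr_ge0//; first exact: ih.
by rewrite subr_ge0; apply: fdec; lia.
Qed.

End conv_order.

(** * Discrete renewal equation and truncation of long steps *)

Section truncation.
Context {R : realFieldType} (a u : nat -> R) (K : nat).
Hypotheses (aK : 0 < a K) (adec : {homo a : m n / (m <= n)%N >-> n <= m}).
Hypotheses (a_ge0 : forall n, 0 <= a n) (au : forall n, dconv a u n = 1).

(** If [a n] is the probability, up to normalization, that a step is longer than [n], this is the
    law of the step restricted to finite lengths above [K]. *)
Definition tail_incr (n : nat) : R := if (n <= K)%N then 0 else a n.-1 - a n.

Let a0 : 0 < a 0%N. Proof. exact: lt_le_trans (adec (leq0n K)). Qed.

Lemma renewal_ge0 n : 0 <= u n. Proof. exact: dconv_inv_ge0 au n. Qed.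
Let u0 := renewal_ge0.

(** Tail of the step law once the steps longer than [K] are made infinite. The solution [v] of
    [b * v = 1] is then the renewal sequence of a walk killed at its first long step; its total mass
    is at most [1 / a K]. *)
Let b n := Num.max (a n) (a K).
Let g n := b n - a n.

Let d := tail_incr.

Let bE n : b n = if (n <= K)%N then a n else a K.
Proof.
rewrite /b; case: leqP => nK; first by apply/max_idPl/adec.
by apply/max_idPr/adec/ltnW.
Qed.

Let d0 n : 0 <= d n.
Proof.
rewrite /d /tail_incr; case: leqP => // _; rewrite subr_ge0; apply: adec; exact: leq_pred.
Qed.

Let gd n : g n = dconv d (fun=> 1) n.
Proof.
rewrite dconvC dconv1 /g bE; elim: n => [|n ih].
  by rewrite big_ord1 /d /tail_incr !leq0n subrr.
rewrite big_ord_recr/= -ih /d /tail_incr.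
case: (ltngtP n K) => nK.
- by lra.
- by rewrite /=; lra.
- by rewrite nK /=; lra.
Qed.

Let g_le n : g n <= a K.
Proof.
rewrite /g bE; case: leqP => nK; first by rewrite subrr a_ge0.
by rewrite gerBl.
Qed.

Let d_sum n : \sum_(i < n.+1) d i <= a K.
Proof. by rewrite -dconv1 dconvC -gd g_le. Qed.

Let bdec : {homo b : m n / (m <= n)%N >-> n <= m}.
Proof. by move=> m n mn; rewrite /b le_max2 ?lexx ?adec. Qed.

Let b0 : 0 < b 0%N. Proof. by rewrite /b lt_max a0. Qed.

Let b_ge n : a K <= b n. Proof. by rewrite /b le_max lexx orbT. Qed.

Let vex : exists v, (forall n, dconv b v n = 1) /\ (forall n, 0 <= v n).
Proof.
have [v bv] := dconv_inv (lt0r_neq0 b0).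
by exists v; split => //; exact: dconv_inv_ge0 bv.
Qed.

Let v_sum v : (forall n, dconv b v n = 1) -> (forall n, 0 <= v n) ->
  forall n, a K * \sum_(i < n.+1) v i <= 1.
Proof.
move=> bv v0 n; rewrite -(bv n) mulr_sumr dconvC.
by apply: ler_sum => i _; rewrite mulrC ler_wpM2l.
Qed.

(* At the first jump beyond level [K], the process starts afresh. *)
Let u_split v : (forall n, dconv b v n = 1) ->
  forall n, u n = v n + dconv (dconv v d) u n.
Proof.
move=> bv; apply: (@dconv_inj _ b); first exact: lt0r_neq0.
move=> n; rewrite dconvDr bv.
have -> : dconv b u n = dconv a u n + dconv g u n.
  by rewrite -dconvDl; apply: eq_dconvl => i _; rewrite /g; ring.
rewrite au; congr (_ + _).
rewrite dconvA.
rewrite (@eq_dconvl _ (dconv b (dconv v d)) (dconv (fun=> 1) d)); last first.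
  by move=> i _; rewrite dconvA; apply: eq_dconvl.
by apply: eq_dconvl => i _; rewrite gd dconvC.
Qed.

Variables (n m : nat) (D : R).
Hypothesis dD : forall E : pred nat,
  (\sum_(i < n.+1 | E i) 1 <= m)%N -> \sum_(i < n.+1 | E i) d i <= D.

Let D0 : 0 <= D.
Proof. by apply: le_trans (dD (E := pred0) _); rewrite big_pred0. Qed.

(** Translating [E] by [i] and cutting at [n] does not increase its number of points, so the
    hypothesis on [d] applies to every translate. *)
Let dD_shift (E : pred nat) i : (i <= n)%N -> (\sum_(j < n.+1 | E j) 1 <= m)%N ->
  \sum_(j < (n - i).+1 | E (i + j)%N) d j <= D.
Proof.
move=> le_in Em.
have -> : \sum_(j < (n - i).+1 | E (i + j)%N) d j =
    \sum_(j < n.+1 | (i + j <= n)%N && E (i + j)%N) d j.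
  rewrite (big_ord_widen_cond n.+1 (fun j => E (i + j)%N) d) ?ltnS ?leq_subr//.
  by apply: eq_bigl => j; lia.
apply: (dD (E := fun j => (i + j <= n)%N && E (i + j)%N)); apply: leq_trans Em.
rewrite -(big_mkord (fun j => (i + j <= n)%N && E (i + j)%N) (fun=> 1%N)).
rewrite -[leqRHS](big_mkord E (fun=> 1%N)).
rewrite (big_cat_nat (n := (n.+1 - i)%N))//=; last by rewrite leq_subr.
rewrite [X in (_ + X <= _)%N]big_nat_cond [X in (_ + X <= _)%N]big_pred0 ?addn0; last by move=> j; lia.
rewrite [leqRHS](big_cat_nat (n := i))//=; last lia.
apply: leq_trans (leq_addl _ _).
have -> : (\sum_(i <= j < n.+1 | E j) 1 = \sum_(0 <= j < n.+1 - i | E (j + i)) 1)%N.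
  by rewrite -{1}[i]add0n big_addn.
rewrite big_nat_cond [leqRHS]big_nat_cond.
by apply: eq_leq; apply: eq_bigl => j; rewrite (addnC i); lia.
Qed.

Let conv_vd_sum v (E : pred nat) k : (forall n, 0 <= v n) -> (k <= n)%N ->
  (\sum_(i < n.+1 | E i) 1 <= m)%N ->
  \sum_(i < (n - k).+1 | E (k + i)%N) dconv v d i <= (\sum_(i < n.+1) v i) * D.
Proof.
move=> v0 kn Em.
apply: (@le_trans _ _ ((\sum_(i < (n - k).+1) v i) * D)); last first.
  by rewrite ler_wpM2r// ler_sum_ord// ltnS leq_subr.
apply: (sum_dconv_cond_le (E := fun i => E (k + i)%N)) => // i ik.
rewrite -subnDA; have := @dD_shift E (k + i)%N; rewrite -(leq_subRL i kn) => /(_ ik Em).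
by under eq_bigl do rewrite -addnA.
Qed.

(** By [u_split], the mass of [u] on [E] is at most the total mass of [v], itself at most [1 / a K],
    plus the mass on [E] of the convolution of [u] with [v * d]. The latter carries a factor [D],
    because [d] has mass at most [D] on each translate of [E]. *)
Lemma renewal_sum_le (E : pred nat) : (\sum_(i < n.+1 | E i) 1 <= m)%N ->
  \sum_(k < n.+1 | E k) u k <= (1 + D * \sum_(k < n.+1) u k) / a K.
Proof.
move=> Em; have [v [bv v0]] := vex.
rewrite ler_pdivlMr// (eq_bigr _ (fun (k : 'I_n.+1) _ => u_split bv k)) big_split/=.
rewrite mulrDl lerD//.
  rewrite mulrC; apply: le_trans (v_sum bv v0 n).
  rewrite ler_pM2l// [leRHS](bigID (fun i : 'I_n.+1 => E i))/= lerDl.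
  exact: sumr_ge0.
under eq_bigr do rewrite dconvC.
apply: (@le_trans _ _ ((\sum_(i < n.+1) u i) * ((\sum_(i < n.+1) v i) * D) * a K)).
  rewrite ler_pM2r//; apply: sum_dconv_cond_le => // k kn.
  exact: conv_vd_sum.
rewrite -[leRHS]mulr1 [D * _]mulrC -!mulrA ler_wpM2l ?sumr_ge0//.
by rewrite mulrA mulrAC mulrC ler_wpM2l// mulrC v_sum.
Qed.

(** For [t = x * u] one has [t <= 1] and, by [u_split], [t = x * v + (v * d) * t]. The first term is
    bounded by the probability that no long step has started early, which is small by averaging. In
    the second term, [t] exceeds [e] at no more than [m] indices, on whose translates [d] has mass
    at most [D]. *)
Lemma renewal_concentration (x : nat -> R) (J : nat) (e : R) :
  (forall i, 0 <= x i <= a i) -> (forall i, (J < i)%N -> x i = 0) ->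
  (J <= K)%N -> (J < n)%N -> 0 < e ->
  (\sum_(i < n.+1) x i) * (\sum_(i < n.+1) u i) <= e * m%:R ->
  dconv x u n <= (\sum_(i < K.+1) a i) / (a K * (n - J)%:R) + e + D / a K.
Proof.
move=> xa xJ JK Jn e0 xue; have [v [bv v0]] := vex.
have x0 i : 0 <= x i by have /andP[] := xa i.
have vd0 i : 0 <= dconv v d i by apply: dconv_ge0.
pose t := dconv x u.
have t0 i : 0 <= t i by apply: dconv_ge0.
have t1 i : t i <= 1.
  rewrite -(au i); apply: ler_dconv => j _; first exact: xa.
  by rewrite u0 lexx.
have t_split : t n = dconv x v n + dconv (dconv v d) t n.
  rewrite /t (@eq_dconvr _ x u (fun k => v k + dconv (dconv v d) u k)); last first.
    by move=> i _; exact: u_split.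
  rewrite dconvDr; congr (_ + _); rewrite dconvA [RHS]dconvA.
  by apply: eq_dconvl => i _; rewrite dconvC.
rewrite -/t -/(t n) t_split -addrA lerD//.
(* [a K * v i] is the probability that the killing step starts at time [i], so [Q k] is the
   probability that it starts after time [k]. *)
- pose Q k := 1 - a K * \sum_(i < k.+1) v i.
  have Qdec i k : (i <= k)%N -> Q k <= Q i.
    by move=> ik; rewrite /Q lerD2l lerN2 ler_pM2l// ler_sum_ord.
  (* In [1 = b * v], the terms of index at most [J] dominate [x * v], since [x <= b] and [x]
     vanishes beyond [J]; in the others [b] is at least [a K]. *)
  have xvQ : dconv x v n <= Q (n - J).-1.
    rewrite /Q -(bv n) lerBrDr.
    have -> : dconv b v n = \sum_(i < n.+1) (if (i <= J)%N then b i else 0) * v (n - i)%N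
       + \sum_(i < n.+1) (if (i <= J)%N then 0 else b i) * v (n - i)%N.
      rewrite -big_split/=; apply: eq_bigr => i _; rewrite -mulrDl; congr (_ * _).
      by case: ifP; rewrite ?addr0 ?add0r.
    apply: lerD.
      apply: ler_sum => i _; rewrite ler_wpM2r//; case: leqP => iJ; last by rewrite xJ.
      have /andP[_ /le_trans] := xa i; apply.
      by rewrite /b le_max lexx.
    rewrite mulr_sumr.
    rewrite -(big_mkord xpredT (fun i => (if (i <= J)%N then 0 else b i) * v (n - i)%N)).
    rewrite (big_cat_nat (n := J.+1))//=; last lia.
    rewrite -[leLHS]add0r lerD//; first by apply: sumr_ge0 => i _; case: ifP; rewrite ?mul0r// mulr_ge0// (le_trans _ (b_ge _))// ltW.
    rewrite big_nat_rev/=.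
    pose F i := (if (J.+1 + n.+1 - i.+1 <= J)%N then 0 else b (J.+1 + n.+1 - i.+1)%N)
      * v (n - (J.+1 + n.+1 - i.+1))%N.
    have -> : \sum_(J.+1 <= i < n.+1) F i = \sum_(0 <= i < n.+1 - J.+1) F (i + J.+1)%N.
      by rewrite -{1}[J.+1]add0n big_addn.
    rewrite big_mkord (_ : (n - J).-1.+1 = (n.+1 - J.+1)%N); last lia.
    apply: ler_sum => i _; rewrite /F ifF; last by have := ltn_ord i; lia.
    have -> : (n - (J.+1 + n.+1 - (i + J.+1).+1))%N = i by have := ltn_ord i; lia.
    by rewrite ler_wpM2r.
  apply: (le_trans xvQ).
  rewrite ler_pdivlMr; last by rewrite mulr_gt0// ltr0n subn_gt0.
  rewrite mulrCA mulrC.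
  have n' : (n - J)%N = (n - J).-1.+1 by lia.
  set k := (n - J).-1 in n' *; rewrite n'.
  (* [Q] is nonincreasing: [k.+1] times its last value is at most its sum. *)
  apply: (@le_trans _ _ (a K * \sum_(i < k.+1) Q i)).
    rewrite mulrC ler_pM2l// mulr_natr -[X in _ *+ X]card_ord -sumr_const.
    by apply: ler_sum => i _; apply: Qdec; rewrite -ltnS.
  (* Since [b * v = 1], [Q] is the convolution of [v] with [b - a K], which vanishes from [K] on.
     Its sum is thus at most the sum of [a] up to [K] times that of [v]. *)
  have -> : \sum_(i < k.+1) Q i = \sum_(i < k.+1) dconv (fun i => b i - a K) v i.
    apply: eq_bigr => i _; rewrite /Q -(bv i) /dconv.
    rewrite -[\sum_(j < i.+1) v j]dconv1 /dconv mulr_sumr -sumrB.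
    by apply: eq_bigr => j _; ring.
  apply: (@le_trans _ _ (a K * ((\sum_(i < K.+1) a i) * \sum_(i < k.+1) v i))); last first.
    rewrite mulrCA -[leRHS]mulr1 ler_wpM2l ?sumr_ge0//; exact: v_sum.
  rewrite ler_pM2l//; apply: (le_trans (sum_dconv_le _ _ _)) => //.
    by move=> i; rewrite subr_ge0.
  rewrite ler_wpM2r ?sumr_ge0//.
  apply: (@le_trans _ _ (\sum_(i < maxn k.+1 K.+1) (if (i <= K)%N then a i else 0))).
    apply: (@le_trans _ _ (\sum_(i < k.+1) (if (i <= K)%N then a i else 0))).
      apply: ler_sum => i _; rewrite bE; case: ifP => _; last by rewrite subrr.
      by rewrite gerBl ltW.
    apply: (ler_sum_ord (f := fun i => if (i <= K)%N then a i else 0)) => [|i _].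
      exact: leq_maxl.
    by case: ifP.
  rewrite -(big_mkord xpredT (fun i => if (i <= K)%N then a i else 0)).
  rewrite (big_cat_nat (n := K.+1))//=; last by rewrite leq_maxr.
  rewrite [X in _ + X]big_nat_cond [X in _ + X]big1 ?addr0 ?big_mkord; last by move=> i; case: ifP => //; lia.
  by apply: ler_sum => i _; rewrite -ltnS ltn_ord.
- pose E i := e < t i.
  rewrite -[dconv _ t n]/(\sum_(i < n.+1) dconv v d i * t (n - i)%N).
  rewrite (bigID (fun i : 'I_n.+1 => E (n - i)%N))/= addrC lerD//.
    apply: (@le_trans _ _ (\sum_(i < n.+1) dconv v d i * e)).
      rewrite [leRHS](bigID (fun i : 'I_n.+1 => E (n - i)%N))/= addrC -[leLHS]addr0 lerD//.
        by apply: ler_sum => i Ei; rewrite ler_wpM2l// leNgt.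
      by apply: sumr_ge0 => i _; rewrite mulr_ge0// ltW.
    rewrite -mulr_suml -[leRHS]mul1r ler_pM2r//.
    apply: (le_trans (sum_dconv_le _ v0 d0)); apply: le_trans (v_sum bv v0 n).
    by rewrite mulrC ler_wpM2r ?sumr_ge0.
  apply: (@le_trans _ _ (\sum_(i < n.+1 | E (n - i)%N) dconv v d i)).
    by apply: ler_sum => i _; rewrite -[leRHS]mulr1 ler_wpM2l.
  rewrite ler_pdivlMr//.
  apply: (@le_trans _ _ ((\sum_(i < n.+1) v i) * D * a K)); last first.
    by rewrite -[leRHS]mulr1 mulrAC mulrC ler_wpM2l// mulrC v_sum.
  rewrite ler_pM2r//.
  (* Markov's inequality: the sum of [t] is at most the product of the sums of [x] and [u], hence at
     most [e * m]. *)
  have Em : (\sum_(i < n.+1 | E i) 1 <= m)%N.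
    rewrite -(ler_nat R) -(ler_pM2l e0) natr_sum mulr_sumr.
    apply: le_trans xue; apply: le_trans (sum_dconv_le n x0 u0).
    rewrite [leRHS](bigID (fun i : 'I_n.+1 => E i))/= -[leLHS]addr0 lerD//.
      by apply: ler_sum => i Ei; rewrite mulr1 ltW.
    by apply: sumr_ge0 => i _; exact: t0.
  have := @conv_vd_sum v (fun i => E (n - i)%N) 0 v0 isT; rewrite subn0; apply.
  rewrite (reindex_inj rev_ord_inj)/=; apply: leq_trans Em; apply: eq_leq.
  by apply: eq_bigl => i /=; rewrite subSS subKn// -ltnS.
Qed.

End truncation.

(** * Nonnegative integrals, translations and Laplace transforms *)

Section nonneg_integral.
Context d (T : measurableType d) (R : realType) (m : {measure set T -> \bar R}).
Local Open Scope ereal_scope.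
Implicit Types f g : T -> R.

Lemma integral_nnZl f (c : R) : measurable_fun setT f -> (forall x, 0 <= f x)%R ->
  (0 <= c)%R -> \int[m]_x (c * f x)%:E = c%:E * \int[m]_x (f x)%:E.
Proof.
move=> mf f0 c0; rewrite -ge0_integralZl//; try exact/measurable_EFinP.
by move=> x _; rewrite lee_fin.
Qed.

Lemma integral_nnD f g : measurable_fun setT f -> measurable_fun setT g ->
  (forall x, 0 <= f x)%R -> (forall x, 0 <= g x)%R ->
  \int[m]_x (f x + g x)%:E = \int[m]_x (f x)%:E + \int[m]_x (g x)%:E.
Proof.
move=> mf mg f0 g0.
rewrite -ge0_integralD//; try exact/measurable_EFinP.
all: by move=> x _; rewrite lee_fin.
Qed.

Lemma le_integral_nn f g : measurable_fun setT f -> measurable_fun setT g ->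
  (forall x, 0 <= f x)%R -> (forall x, f x <= g x)%R ->
  \int[m]_x (f x)%:E <= \int[m]_x (g x)%:E.
Proof.
move=> mf mg f0 fg; apply: ge0_le_integral => //; try exact/measurable_EFinP.
all: by move=> x _; rewrite lee_fin.
Qed.

End nonneg_integral.

Section translation.
Context {R : realType}.
Notation mu := (@lebesgue_measure R).
Local Open Scope ereal_scope.

Lemma ge0_integral_shift (f : R -> \bar R) (r : R) : measurable_fun setT f ->
  (forall x, 0 <= f x) -> \int[mu]_x f (x - r)%R = \int[mu]_x f x.
Proof.
move=> mf f0.
have mphi : measurable_fun setT ((fun x => x - r)%R : measurableTypeR R -> measurableTypeR R).
  exact: measurable_funB.
pose phi : {mfun measurableTypeR R >-> measurableTypeR R} := HB.pack (fun x => x - r)%R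
  (isMeasurableFun.Build _ _ _ _ _ mphi).
have := @ge0_integral_pushforward _ _ _ _ R phi mphi mu setT f measurableT mf (fun x _ => f0 x).
rewrite preimage_setT => <-.
apply: eq_measure_integral => A mA _; apply/esym.
apply: (@lebesgue_measure_unique R (pushforward mu phi)) => //= _ [[a b]] _ <-.
rewrite /pushforward /=.
have -> : (fun x => x - r)%R @^-1` `]a, b] = `](a + r)%R, (b + r)%R]%classic.
  by apply/seteqP; split => x /=; rewrite !in_itv/= ltrBrDr lerBlDr.
by rewrite !lebesgue_measure_itv/= !lte_fin ltrD2r -!EFinD; case: ifP => // _; congr EFin; ring.
Qed.

End translation.

Section laplace.
Context {R : realType}.
Notation mu := (@lebesgue_measure R).
Local Open Scope ereal_scope.
Implicit Types (k f g W : R -> R) (s t : R).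

(** For functions that vanish on the negative half-line this is the usual one-sided transform.
    Values in [\bar R] let Tonelli's theorem be used without finiteness hypotheses. *)
Definition laplace W s : \bar R := \int[mu]_t (expR (- (s * t)) * W t)%:E.

Definition convolution k W t : \bar R := \int[mu]_x (k x * W (t - x))%:E.

Lemma measurable_expRN s : measurable_fun setT (fun t : R => expR (- (s * t))).
Proof.
by apply: measurableT_comp => //; apply: measurableT_comp => //; exact: measurable_funM.
Qed.

Lemma laplace_ge0 W s : (forall x, (0 <= W x)%R) -> 0 <= laplace W s.
Proof. by move=> W0; apply: integral_ge0 => x _; rewrite lee_fin mulr_ge0// ?expR_ge0. Qed.

Lemma convolution_ge0 k W t : (forall x, (0 <= k x)%R) -> (forall x, (0 <= W x)%R) ->
  0 <= convolution k W t.
Proof. by move=> k0 W0; apply: integral_ge0 => x _; rewrite lee_fin mulr_ge0. Qed.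

Let measurable_conv_fun k W : measurable_fun setT k -> measurable_fun setT W ->
  measurable_fun setT (fun z : R * R => k z.2 * W (z.1 - z.2))%R.
Proof.
move=> mk mW; apply: measurable_funM; first exact: measurableT_comp.
apply: (measurableT_comp mW); exact: measurable_funB.
Qed.

Lemma laplace_convolution k W s : measurable_fun setT k -> measurable_fun setT W ->
  (forall x, (0 <= k x)%R) -> (forall x, (0 <= W x)%R) ->
  \int[mu]_t ((expR (- (s * t)))%:E * convolution k W t) = laplace k s * laplace W s.
Proof.
move=> mk mW k0 W0.
have mkW (c : R) : measurable_fun setT (fun x => k x * W (c - x))%R.
  exact: (measurableT_comp (measurable_conv_fun mk mW) (pair1_measurable c)).
have m3 : measurable_fun setT
    (fun z : R * R => (expR (- (s * z.1)) * (k z.2 * W (z.1 - z.2)))%:E).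
  apply/measurable_EFinP; apply: measurable_funM; last exact: measurable_conv_fun.
  exact: (measurableT_comp (measurable_expRN s)).
have e0 (x : R) : (0 <= expR x)%R by exact: expR_ge0.
have p0 (z : R * R) : 0 <= (expR (- (s * z.1)) * (k z.2 * W (z.1 - z.2)))%:E.
  by rewrite lee_fin !mulr_ge0.
transitivity (\int[mu]_t \int[mu]_x (expR (- (s * t)) * (k x * W (t - x)))%:E).
  apply: eq_integral => t _; rewrite -integral_nnZl//; first exact: mkW.
  by move=> x; exact: mulr_ge0.
rewrite (fubini_tonelli (m1 := mu) (m2 := mu) _ m3 p0)/=.
rewrite muleC -[RHS]ge0_integralZl//; first last.
- exact: laplace_ge0.
- by move=> x _; rewrite lee_fin mulr_ge0.
- by apply/measurable_EFinP/measurable_funM => //; exact: measurable_expRN.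
apply: eq_integral => x _; rewrite muleC /laplace.
rewrite -(@ge0_integral_shift R (fun t => (expR (- (s * t)) * W t)%:E) x); last 2 first.
- by apply/measurable_EFinP/measurable_funM => //; exact: measurable_expRN.
- by move=> t; rewrite lee_fin mulr_ge0.
have mW' : measurable_fun setT (fun t => W (t - x)%R).
  by apply: (measurableT_comp mW); exact: measurable_funB.
rewrite -integral_nnZl.
- apply: eq_integral => t _; congr EFin.
  have -> : expR (- (s * t)) = (expR (- (s * x)) * expR (- (s * (t - x))))%R.
    by rewrite -expRD; congr expR; ring.
  by ring.
- apply: measurable_funM => //.
  by apply: (measurableT_comp (measurable_expRN s)); exact: measurable_funB.
- by move=> t; exact: mulr_ge0.
- by rewrite mulr_ge0.
Qed.

End laplace.

(** * Elementary inequalities and limits of powers *)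

Section elementary_limits.
Context {R : realType}.

Lemma bernoulli_ineq (x : R) n : 0 <= x -> 1 + n%:R * x <= (1 + x) ^+ n.
Proof.
move=> x0; elim: n => [|n ih]; first by rewrite mul0r addr0.
rewrite exprS; apply: (@le_trans _ _ ((1 + x) * (1 + n%:R * x))).
  rewrite -natr1; have : 0 <= n%:R * x * x by rewrite !mulr_ge0.
  by lra.
by rewrite ler_wpM2l// addr_ge0.
Qed.

Lemma expr_onem_le (z : R) n : 0 <= z <= 1 -> (1 - z) ^+ n <= (1 + n%:R * z)^-1.
Proof.
move=> /andP[z0 z1]; rewrite -[leRHS]mul1r ler_pdivlMr; last first.
  by rewrite ltr_pwDl// mulr_ge0.
apply: (@le_trans _ _ ((1 - z) ^+ n * (1 + z) ^+ n)).
  by rewrite ler_wpM2l ?exprn_ge0 ?subr_ge0// bernoulli_ineq.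
rewrite -exprMn exprn_ile1//.
  by rewrite mulr_ge0 ?subr_ge0// addr_ge0.
by nra.
Qed.

Lemma cvg_mul_geometric (r : R) : 0 < r < 1 -> (n%:R * r ^+ n) @[n --> \oo] --> (0 : R).
Proof.
move=> /andP[r0 r1].
pose q := (1 + r) / 2.
have rq : r < q by rewrite /q; lra.
have q1 : `|q| < 1 by rewrite ger0_norm /q; lra.
pose del := q / r - 1.
have d0 : 0 < del by rewrite subr_gt0 ltr_pdivlMr// mul1r.
apply: (@squeeze_cvgr _ _ _ _ (cst 0) (geometric del^-1 q)).
- apply: nearW => n; rewrite /= mulr_ge0 ?exprn_ge0 ?(ltW r0)//=.
  have := bernoulli_ineq n (ltW d0).
  rewrite (_ : 1 + del = q / r); last by rewrite /del; lra.
  rewrite expr_div_n => h.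
  have rn0 : 0 < r ^+ n by rewrite exprn_gt0.
  have : n%:R * del <= q ^+ n / r ^+ n by apply: le_trans h; rewrite lerDr.
  rewrite ler_pdivlMr// => nd; rewrite -[leRHS]/(del^-1 * q ^+ n).
  by rewrite ler_pdivlMl// mulrCA mulrA.
- exact: cvg_cst.
- exact: cvg_geometric.
Qed.

Lemma cvgy_expr (q : R) : 1 < q -> q ^+ n @[n --> \oo] --> +oo.
Proof.
move=> q1; have q0 : 0 < q by rewrite (lt_trans _ q1).
apply/cvgryPge => A.
near=> n.
rewrite (_ : q = 1 + (q - 1)); last by lra.
apply: le_trans (bernoulli_ineq n _); last by rewrite subr_ge0 ltW.
rewrite -lerBlDl -ler_pdivrMr ?subr_gt0//.
near: n; exact: nbhs_infty_ger.
Unshelve. all: by end_near. Qed.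

End elementary_limits.

(** * Kernels that extract point values from a Laplace transform *)

Section bump_kernel_sec.
Context {R : realType}.
Notation mu := (@lebesgue_measure R).
Implicit Types (V : R -> R) (s t : R).

(* [bump_kernel a M] is a probability density on [0, +oo[, and a linear combination of
   exponentials; [M * expR (- (a * y))] is 1 near the point where it concentrates. *)
Definition bump_kernel (a : R) (M : nat) (y : R) : R :=
  a * M%:R * expR (- (a * y)) * (1 - expR (- (a * y))) ^+ M.-1.

Lemma is_derive_expRN (s x : R) :
  is_derive x 1 (fun y => expR (- (s * y))) (- s * expR (- (s * x))).
Proof.
have h : is_derive x 1 (fun y : R => - (s * y)) (- s).
  have : is_derive x 1 (- (s \*: (@id R))) (- s).
    apply: is_derive_eq; by rewrite /GRing.scale/= mulr1.
  by [].
have := @is_derive1_comp R _ _ x _ _ (is_derive_expR (- (s * x))) h.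
by rewrite mulrC.
Qed.

Lemma cvg_expRN_y (s : R) : 0 < s -> expR (- (s * x)) @[x --> +oo] --> (0 : R).
Proof.
move=> s0; have h : s * x @[x --> +oo] --> +oo by apply: gt0_cvgMry => //; exact: cvg_id.
by have := cvg_comp _ _ h (@cvgr_expR R).
Qed.

Lemma measurable_kernel (a : R) M : measurable_fun setT (bump_kernel a M).
Proof.
apply: measurable_funM.
  by apply: measurable_funM => //; exact: measurable_expRN.
apply: measurable_funX; apply: measurable_funB => //; exact: measurable_expRN.
Qed.

Lemma kernel_ge0 (a : R) M (y : R) : 0 <= a -> 0 <= y -> 0 <= bump_kernel a M y.
Proof.
move=> a0 y0; rewrite /bump_kernel !mulr_ge0 ?expR_ge0// exprn_ge0// subr_ge0.
by rewrite -expR0 ler_expR oppr_le0 mulr_ge0.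
Qed.

(** The kernel is the density of the maximum of [M] independent exponential variables of rate [a],
    with distribution function [(1 - expR (- (a * y))) ^+ M]. [F] is this function minus 1, so that
    it vanishes at infinity. *)
Lemma integral_kernel (a : R) M (b : R) : 0 < a -> (0 < M)%N -> 0 <= b ->
  (\int[mu]_(y in `[b, +oo[) (bump_kernel a M y)%:E = (1 - (1 - expR (- (a * b))) ^+ M)%:E)%E.
Proof.
move=> a0 M0 b0.
pose F (y : R) : R := (1 - expR (- (a * y))) ^+ M - 1.
have dF (x : R) : is_derive x 1 F (bump_kernel a M x).
  have h := is_derive_expRN a x.
  have h1 : is_derive x 1 (fun y : R => 1 - expR (- (a * y))) (a * expR (- (a * x))).
    have : is_derive x 1 (cst 1 - (fun y => expR (- (a * y)))) (0 - - a * expR (- (a * x))).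
      exact: is_deriveB.
    by rewrite sub0r mulNr opprK.
  have := is_deriveB (is_deriveX M h1) (is_derive_cst (1 : R) x (1 : R)).
  have -> : (fun y => 1 - expR (- (a * y))) ^+ M - cst 1 = F.
    by apply/funext => y; rewrite /F !fctE.
  by move=> h2; apply: (is_derive_eq h2); rewrite /GRing.scale/= /bump_kernel subr0; ring.
have cF (x : R) : {for x, continuous F}.
  apply: differentiable_continuous; apply/derivable1_diffP.
  by have [] := dF x.
have -> : (\int[mu]_(y in `[b, +oo[) (bump_kernel a M y)%:E = 0%:E - (F b)%:E)%E.
  apply: (@ge0_continuous_FTC2y _ (bump_kernel a M) F b 0).
  - by move=> x bx; apply: kernel_ge0; [exact: ltW|exact: le_trans bx].
  - apply: continuous_subspaceT => x.
    have ce : {for x, continuous (fun y => expR (- (a * y)))}.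
      apply: differentiable_continuous; apply/derivable1_diffP.
      by have [] := is_derive_expRN a x.
    apply: cvgM; first by apply: cvgM => //; exact: cvg_cst.
    have cg : {for x, continuous (fun y => 1 - expR (- (a * y)))}.
      by apply: cvgB => //; exact: cvg_cst.
    by have := cvg_comp _ _ cg (@exprn_continuous _ M.-1 (1 - expR (- (a * x)))).
  - have : F x @[x --> +oo] --> (1 - 0) ^+ M - (1 : R).
      apply: cvgB; last exact: cvg_cst.
      have h : 1 - expR (- (a * x)) @[x --> +oo] --> (1 - 0 : R).
        by apply: cvgB; [exact: cvg_cst|exact: cvg_expRN_y].
      by have := cvg_comp _ _ h (@exprn_continuous _ M (1 - 0 : R)).
    by rewrite subr0 expr1n subrr.
  - by move=> x _; have [] := dF x.
  - by apply: cvg_at_right_filter; exact: cF.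
  - by move=> x _; rewrite derive1E; have [_ ->] := dF x.
by rewrite sub0e -EFinN /F opprB.
Qed.

Let tail (a : R) M (b y : R) : R := (bump_kernel a M \_ `[b, +oo[) y.

Let measurable_tail a M b : measurable_fun setT (tail a M b).
Proof.
by apply/(measurable_restrictT _ _).1 => //; apply: measurable_funTS; exact: measurable_kernel.
Qed.

Let tailE a M b y : b <= y -> tail a M b y = bump_kernel a M y.
Proof. by move=> by_; rewrite /tail patchE mem_set//= in_itv/= by_. Qed.

Let tail0 a M b y : y < b -> tail a M b y = 0.
Proof. by move=> yb; rewrite /tail patchE memNset//= in_itv/= andbT leNgt yb. Qed.

Let tail_ge0 a M b y : 0 <= a -> 0 <= b -> 0 <= tail a M b y.
Proof.
move=> a0 b0; have [yb|yb] := ltP y b; first by rewrite tail0.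
by rewrite tailE// kernel_ge0//; exact: le_trans yb.
Qed.

Let integral_tail (a : R) M (b : R) : 0 < a -> (0 < M)%N -> 0 <= b ->
  (\int[mu]_y (tail a M b y)%:E = (1 - (1 - expR (- (a * b))) ^+ M)%:E)%E.
Proof. by move=> a0 M0 b0; rewrite -integral_kernel// [RHS]integral_mkcond restrict_EFin. Qed.

Variables (V : R -> R).
Hypotheses (Vnd : {homo V : x y / x <= y}) (V0 : forall x, 0 <= V x).
Hypothesis VN : forall x, x < 0 -> V x = 0.

Let mV : measurable_fun setT V.
Proof. exact: nondecreasing_measurable. Qed.

Let kV0 a M y : 0 <= a -> 0 <= bump_kernel a M y * V y.
Proof.
move=> a0; have [y0|y0] := ltP y 0; first by rewrite VN// mulr0.
by rewrite mulr_ge0// kernel_ge0.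
Qed.

Lemma integral_kernel_ge (a : R) M (t : R) : 0 < a -> (0 < M)%N -> 0 <= t ->
  ((V t * (1 - (1 - expR (- (a * t))) ^+ M))%:E <= \int[mu]_y (bump_kernel a M y * V y)%:E)%E.
Proof.
move=> a0 M0 t0.
rewrite EFinM -integral_tail// -integral_nnZl//; last 2 first.
- exact: measurable_tail.
- by move=> y; rewrite tail_ge0// ltW.
apply: le_integral_nn.
- by apply: measurable_funM => //; exact: measurable_tail.
- by apply: measurable_funM => //; exact: measurable_kernel.
- by move=> y; rewrite mulr_ge0// tail_ge0// ltW.
- move=> y; have [yt|ty] := ltP y t; first by rewrite tail0// mulr0 kV0// ltW.
  rewrite tailE// mulrC ler_wpM2l ?Vnd//.
  by rewrite kernel_ge0 ?(ltW a0)//; exact: le_trans ty.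
Qed.

(** Up to [t], [V] is at most [V t] and the kernel has mass 1. Beyond [t], the last factor of the
    kernel is at most 1, and [expR (- (a * y))] is at most [expR (- ((a - s) * t))] times
    [expR (- (s * y))]. *)
Lemma integral_kernel_le (a s : R) M (t : R) : 0 < s -> s <= a -> (0 < M)%N -> 0 <= t ->
  (\int[mu]_y (bump_kernel a M y * V y)%:E <=
    (V t)%:E + (a * M%:R * expR (- ((a - s) * t)))%:E * laplace V s)%E.
Proof.
move=> s0 sa M0 t0; have a0 : 0 < a by exact: lt_le_trans sa.
have mk := measurable_kernel a M.
have me := measurable_expRN s.
pose k1 := tail a M 0.
have mk1 : measurable_fun setT k1 by exact: measurable_tail.
have k10 (y : R) : 0 <= k1 y by rewrite tail_ge0// ltW.
set c := a * M%:R * _.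
have c0 : 0 <= c by rewrite /c !mulr_ge0 ?expR_ge0// ltW.
apply: (@le_trans _ _ (\int[mu]_y (V t * k1 y + c * (expR (- (s * y)) * V y))%:E)%E).
  apply: le_integral_nn => //.
  - by apply: measurable_funM.
  - by apply: measurable_funD; apply: measurable_funM => //; apply: measurable_funM.
  - by move=> y; rewrite kV0// ltW.
  - move=> y.
    have [y0|y0] := ltP y 0.
      by rewrite VN// !mulr0 addr0 mulr_ge0.
    have k1E : k1 y = bump_kernel a M y by exact: tailE.
    have [yt|ty] := leP y t.
      rewrite k1E mulrC; apply: ler_wpDr; first by rewrite !mulr_ge0// ltW.
      by rewrite ler_wpM2r ?Vnd// kernel_ge0// ltW.
    apply: ler_wpDl; first by rewrite mulr_ge0.
    rewrite mulrA ler_wpM2r// /c /bump_kernel.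
    rewrite -[leRHS]mulrA -expRD.
    apply: (@le_trans _ _ (a * M%:R * expR (- (a * y)))).
      rewrite -[leRHS]mulr1 ler_wpM2l//.
        by rewrite !mulr_ge0 ?expR_ge0// ltW.
      rewrite exprn_ile1 ?gerBl ?expR_ge0// subr_ge0.
      by rewrite -expR0 ler_expR oppr_le0 mulr_ge0// ltW.
    rewrite ler_wpM2l//; first by rewrite mulr_ge0// ltW.
    rewrite ler_expR.
    have : (a - s) * t <= (a - s) * y by rewrite ler_wpM2l ?subr_ge0// ltW.
    lra.
have meV : measurable_fun setT (fun y => expR (- (s * y)) * V y) by exact: measurable_funM.
have eV0 y : 0 <= expR (- (s * y)) * V y by rewrite mulr_ge0 ?expR_ge0.
have m1 : measurable_fun setT (fun y => V t * k1 y) by exact: measurable_funM.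
have m2 : measurable_fun setT (fun y => c * (expR (- (s * y)) * V y)) by exact: measurable_funM.
have p1 y : 0 <= V t * k1 y by exact: mulr_ge0.
have p2 y : 0 <= c * (expR (- (s * y)) * V y) by exact: mulr_ge0.
rewrite (integral_nnD mu m1 m2 p1 p2).
rewrite (integral_nnZl mu mk1 k10 (V0 t)) (integral_nnZl mu meV eV0 c0).
apply: leeD => //.
rewrite -[leRHS]mule1 lee_wpmul2l// ?lee_fin//.
by rewrite integral_tail// mulr0 oppr0 expR0 subrr expr0n gtn_eqF//= subr0.
Qed.

(** The binomial formula writes the integral as a finite combination of values of the transform at
    multiples of [a]; convergence of transforms therefore gives convergence of these integrals. *)
Lemma integral_kernel_expand (a : R) M : 0 < a -> (0 < M)%N ->
  (forall s, 0 < s -> laplace V s \is a fin_num) ->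
  (\int[mu]_y (bump_kernel a M y * V y)%:E =
   (\sum_(i < M) (a * M%:R * (-1) ^+ i * 'C(M.-1, i)%:R) *
     fine (laplace V (a * i.+1%:R)))%:E)%E.
Proof.
move=> a0 M0 LV.
have intV s : 0 < s -> mu.-integrable setT (fun y => (expR (- (s * y)) * V y)%:E).
  move=> s0; apply/integrableP; split.
    by apply/measurable_EFinP/measurable_funM => //; exact: measurable_expRN.
  under eq_integral => y _ do rewrite gee0_abs ?lee_fin ?mulr_ge0 ?expR_ge0//.
  by have := LV _ s0; rewrite ge0_fin_numE// laplace_ge0.
have ai (i : nat) : 0 < a * i.+1%:R by rewrite mulr_gt0.
transitivity (\int[mu]_y (\sum_(i < M) ((a * M%:R * (-1) ^+ i * 'C(M.-1, i)%:R)%:E *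
   (expR (- (a * i.+1%:R * y)) * V y)%:E)))%E.
  apply: eq_integral.
  move=> y _; rewrite sumEFin; congr EFin; rewrite /bump_kernel exprBn prednK// mulr_sumr mulr_suml.
  apply: eq_bigr => i _; rewrite expr1n mulr1.
  rewrite (_ : expR (- (a * i.+1%:R * y)) = expR (- (a * y)) ^+ i.+1); last first.
    by rewrite -expRM_natr; congr expR; ring.
  by rewrite exprS -(mulr_natr ((-1) ^+ i * _)); ring.
rewrite integral_sum//; last by move=> i; apply: integrableZl => //; exact: intV.
rewrite -sumEFin; apply: eq_bigr => i _.
rewrite integralZl//; last exact: intV.
by rewrite [RHS]EFinM fineK//; exact: LV.
Qed.

End bump_kernel_sec.

Lemma cvg_sum_seq {R : realType} I (r : seq I) (f : I -> nat -> R) (l : I -> R) :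
  (forall i, f i n @[n --> \oo] --> l i) ->
  \sum_(i <- r) f i n @[n --> \oo] --> \sum_(i <- r) l i.
Proof.
move=> fl; elim: r => [|i r ih].
  by rewrite big_nil; under eq_fun do rewrite big_nil; exact: cvg_cst.
rewrite big_cons; under eq_fun do rewrite big_cons.
exact: cvgD.
Qed.

(** * Continuity and uniqueness for Laplace transforms of nondecreasing functions *)

Section laplace_continuity.
Context {R : realType}.
Notation mu := (@lebesgue_measure R).

(** Distribution functions of measures on the half-line whose transform is finite. Right-continuity
    is not imposed, so a transform determines them only up to comparisons between distinct
    points. *)
Definition cdf_like (V : R -> R) :=
  [/\ {homo V : x y / x <= y}, forall x, 0 <= V x, forall x, x < 0 -> V x = 0 &
      forall s, 0 < s -> laplace V s \is a fin_num].

(** The maximum of [M] exponentials of rate [a] concentrates near [ln M / a]; for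
    [a = m.+1%:R * s_ tau] and [M = 2 ^ m.+1] this is [tau], whatever [m]. *)
Let s_ (tau : R) : R := ln 2 / tau.
Let I (tau : R) (V : R -> R) (m : nat) : R := fine (\int[mu]_y (bump_kernel (m.+1%:R * s_ tau) (2 ^ m.+1) y * V y)%:E)%E.
Let p (tau t : R) (m : nat) : R := 1 - (1 - expR (- (m.+1%:R * s_ tau * t))) ^+ (2 ^ m.+1).
Let c (tau t : R) (m : nat) : R :=
  m.+1%:R * s_ tau * (2 ^ m.+1)%:R * expR (- ((m.+1%:R * s_ tau - s_ tau) * t)).

Let s_gt0 tau : 0 < tau -> 0 < s_ tau.
Proof. by move=> tau0; rewrite /s_ divr_gt0// ln_gt0// ltr1n. Qed.

Let a_gt0 tau m : 0 < tau -> 0 < m.+1%:R * s_ tau.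
Proof. by move=> tau0; rewrite mulr_gt0 ?ltr0n// s_gt0. Qed.

(** Mean number, among [2 ^ m] exponentials of rate [m%:R * s_ tau], of those beyond [t]. It is
    geometric in [m], with ratio above 1 for [t < tau] and below 1 for [t > tau], which gives the
    limits of [p] and [c]. *)
Let exp2s (tau t : R) m : 0 < tau ->
  (2 ^ m)%:R * expR (- (m%:R * s_ tau * t)) = expR (ln 2 * (1 - t / tau)) ^+ m.
Proof.
move=> tau0; rewrite natrX -[in 2%:R ^+ m](@lnK R 2) ?posrE// -!expRM_natr -expRD.
by congr expR; rewrite /s_; field; rewrite gt_eqF.
Qed.

Let kernel_int tau V m : 0 < tau -> cdf_like V ->
  (I tau V m)%:E = (\int[mu]_y (bump_kernel (m.+1%:R * s_ tau) (2 ^ m.+1) y * V y)%:E)%E.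
Proof.
move=> tau0 [Vnd V0 VN LV].
by rewrite /I integral_kernel_expand ?a_gt0 ?expn_gt0.
Qed.

Let I_ge tau V m t : 0 < tau -> 0 <= t -> cdf_like V -> V t * p tau t m <= I tau V m.
Proof.
move=> tau0 t0 cV; rewrite -lee_fin kernel_int//; case: cV => [Vnd V0 VN LV].
by rewrite integral_kernel_ge ?a_gt0 ?expn_gt0.
Qed.

Let I_le tau V m t : 0 < tau -> 0 <= t -> cdf_like V ->
  I tau V m <= V t + c tau t m * fine (laplace V (s_ tau)).
Proof.
move=> tau0 t0 cV; rewrite -lee_fin kernel_int//; case: cV => [Vnd V0 VN LV].
rewrite EFinD EFinM fineK; last exact/LV/s_gt0.
apply: integral_kernel_le => //; first exact: s_gt0.
- by rewrite ler_peMl ?ler1n// ltW// s_gt0.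
- by rewrite expn_gt0.
Qed.

Let cvg_I tau (V_ : nat -> R -> R) V m : 0 < tau -> (forall n, cdf_like (V_ n)) -> cdf_like V ->
  (forall s, 0 < s -> laplace (V_ n) s @[n --> \oo] --> laplace V s) ->
  I tau (V_ n) m @[n --> \oo] --> I tau V m.
Proof.
move=> tau0 cV_ cV VV.
have a0 : 0 < m.+1%:R * s_ tau by rewrite mulr_gt0 ?s_gt0.
pose C (i : nat) : R := m.+1%:R * s_ tau * (2 ^ m.+1)%:R * (-1) ^+ i * 'C((2 ^ m.+1).-1, i)%:R.
have IE W : cdf_like W -> I tau W m =
    \sum_(i < 2 ^ m.+1) C i * fine (laplace W (m.+1%:R * s_ tau * i.+1%:R)).
  by case=> Wnd W0 WN LW; rewrite /I integral_kernel_expand ?expn_gt0.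
rewrite IE//; under eq_fun do rewrite IE//.
apply: cvg_sum_seq => i; apply: cvgM; first exact: cvg_cst.
have ai : 0 < m.+1%:R * s_ tau * i.+1%:R by rewrite mulr_gt0.
have := VV _ ai; have [_ _ _ /(_ _ ai) LV] := cV.
by rewrite -[X in _ --> X -> _]fineK// => /fine_cvgP[_].
Qed.

Let cvg_p tau t : 0 < tau -> 0 <= t -> t < tau -> p tau t m @[m --> \oo] --> (1 : R).
Proof.
move=> tau0 t0 ttau; rewrite -[X in _ --> X]subr0; apply: cvgB; first exact: cvg_cst.
pose q : R := expR (ln 2 * (1 - t / tau)).
have q1 : 1 < q.
  rewrite /q -[ltLHS]expR0 ltr_expR mulr_gt0 ?ln_gt0 ?ltr1n// subr_gt0.
  by rewrite ltr_pdivrMr// mul1r.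
apply: (@squeeze_cvgr _ _ _ _ (cst 0) (fun m => (1 + q ^+ m.+1)^-1)).
- apply: nearW => m /=.
  have e01 : 0 <= expR (- (m.+1%:R * s_ tau * t)) <= 1.
    by rewrite expR_ge0/= -[leRHS]expR0 ler_expR oppr_le0 (mulr_ge0 (ltW (a_gt0 m tau0)) t0).
  rewrite exprn_ge0 ?subr_ge0/=; last by case/andP: e01.
  by apply: le_trans (expr_onem_le _ e01) _; rewrite exp2s.
- exact: cvg_cst.
- have qy : 1 + q ^+ m.+1 @[m --> \oo] --> +oo.
    have := cvgy_expr q1; rewrite -(cvg_shiftS (fun m => q ^+ m)) => /cvgryPge h.
    apply/cvgryPge => A; apply: filterS (h A) => m.
    by move=> Aq; rewrite ler_wpDl.
  have qg : \forall m \near \oo, 0 < 1 + q ^+ m.+1.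
    by apply: nearW => m; rewrite addr_gt0// exprn_gt0// (lt_trans _ q1).
  by have /(gtr0_cvgV0 qg) := qy.
Qed.

Let cvg_c tau t : 0 < tau -> tau < t -> c tau t m @[m --> \oo] --> (0 : R).
Proof.
move=> tau0 ttau.
pose r : R := expR (ln 2 * (1 - t / tau)).
have r01 : 0 < r < 1.
  rewrite expR_gt0/= -[ltRHS]expR0 ltr_expR nmulr_llt0 ?ln_gt0 ?ltr1n// subr_lt0.
  by rewrite ltr_pdivlMr// mul1r.
have cE m : c tau t m = s_ tau * expR (s_ tau * t) * (m.+1%:R * r ^+ m.+1).
  rewrite /c /r -exp2s// (_ : - ((m.+1%:R * s_ tau - s_ tau) * t) = s_ tau * t + - (m.+1%:R * s_ tau * t)); last by ring.
  by rewrite expRD; ring.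
rewrite (_ : c tau t = fun m => s_ tau * expR (s_ tau * t) * (m.+1%:R * r ^+ m.+1)); last exact/funext.
have h : m.+1%:R * r ^+ m.+1 @[m --> \oo] --> (0 : R).
  by have := cvg_mul_geometric r01; rewrite -(cvg_shiftS (fun m => m%:R * r ^+ m)).
by have := cvgM (cvg_cst (s_ tau * expR (s_ tau * t)) : _ --> _) h; rewrite mulr0; apply.
Qed.

(** With [tau] the midpoint of [t'] and [t], the kernel integral lies between [p] times the value at
    [t'] and the value at [t] plus a multiple of [c]. First [m] is fixed so that [p] is close to 1
    and [c] to 0; only then is [n] taken large, since the kernel integral converges for fixed
    [m]. *)
Lemma laplace_cvg_le (V_ : nat -> R -> R) V t t' e :
  (forall n, cdf_like (V_ n)) -> cdf_like V ->
  (forall s, 0 < s -> laplace (V_ n) s @[n --> \oo] --> laplace V s) ->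
  t' < t -> 0 < e ->
  (\forall n \near \oo, V_ n t' <= V t + e) /\ (\forall n \near \oo, V t' <= V_ n t + e).
Proof.
move=> cV_ cV VV tt e0; have [Vnd V0 VN LV] := cV.
have [t'0|t'0] := ltP t' 0.
  split; apply: nearW => n; last by have [_ W0 _ _] := cV_ n; rewrite VN// addr_ge0// ltW.
  by have [_ _ WN _] := cV_ n; rewrite WN// addr_ge0// ltW.
pose tau := (t' + t) / 2.
have tau0 : 0 < tau by rewrite /tau; lra.
have t'tau : t' < tau by rewrite /tau; lra.
have taut : tau < t by rewrite /tau; lra.
have t0 : 0 <= t by lra.
set L := fine (laplace V (s_ tau)).
have L0 : 0 <= L by rewrite fine_ge0// laplace_ge0.
have hp := cvg_p tau0 t'0 t'tau.
have hc := cvg_c tau0 taut.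
split.
- have : \forall m \near \oo, (V t + c tau t m * L + e / 2) < (V t + e) * p tau t' m.
    have h1 : V t + c tau t m * L + e / 2 @[m --> \oo] --> V t + 0 * L + e / 2.
      apply: cvgD; last exact: cvg_cst.
      by apply: cvgD; [exact: cvg_cst|apply: cvgM => //; exact: cvg_cst].
    have h2 : (V t + e) * p tau t' m @[m --> \oo] --> (V t + e) * 1.
      by apply: cvgM => //; exact: cvg_cst.
    pose b := V t + e * (3 / 4).
    near=> m; apply: (@lt_trans _ _ b).
      near: m; apply: (cvgr_lt _ h1); rewrite mul0r addr0 ltrD2l; lra.
    by near: m; apply: (cvgr_gt _ h2); rewrite mulr1 ltrD2l; lra.
  have hp1 : \forall m \near \oo, 0 < p tau t' m by apply: (cvgr_gt _ hp).
  move=> h; have [m [h1 pm]] := filter_ex (filterI h hp1).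
  have hI := @cvg_I tau V_ V m tau0 cV_ cV VV.
  near=> n.
  rewrite -(ler_pM2r pm); apply: le_trans (@I_ge tau (V_ n) m t' tau0 t'0 (cV_ n)) _.
  apply: le_trans (ltW h1); apply: (@le_trans _ _ (I tau V m + e / 2)).
    by near: n; apply: (cvgr_le _ hI); rewrite ltrDl divr_gt0.
  by rewrite lerD2r; exact: I_le.
- have : \forall m \near \oo, V t' * (1 - p tau t' m) + c tau t m * (L + 1) < e / 2.
    apply: (@cvgr_lt _ _ _ _ _ (V t' * (1 - 1) + 0 * (L + 1))).
      apply: cvgD; apply: cvgM => //; try exact: cvg_cst.
      by apply: cvgB => //; exact: cvg_cst.
    by rewrite subrr mulr0 mul0r addr0 divr_gt0.
  move=> /filter_ex[m hm].
  have hI := @cvg_I tau V_ V m tau0 cV_ cV VV.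
  have hL : fine (laplace (V_ n) (s_ tau)) @[n --> \oo] --> L.
    have := VV _ (s_gt0 tau0); rewrite -[X in _ --> X -> _]fineK; last exact/LV/s_gt0.
    by move=> /fine_cvgP[_].
  have cm0 : 0 <= c tau t m.
    by rewrite /c mulr_ge0 ?expR_ge0// mulr_ge0// (ltW (a_gt0 m tau0)).
  near=> n.
  have h1 : I tau V m <= I tau (V_ n) m + e / 2.
    rewrite -lerBlDr; near: n; apply: (cvgr_ge _ hI).
    by rewrite ltrBlDr ltrDl divr_gt0.
  have h2 := @I_le tau (V_ n) m t tau0 t0 (cV_ n).
  have h3 := @I_ge tau V m t' tau0 t'0 cV.
  have h4 : fine (laplace (V_ n) (s_ tau)) <= L + 1.
    by near: n; apply: (cvgr_le _ hL); rewrite ltrDl.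
  have h5 : c tau t m * fine (laplace (V_ n) (s_ tau)) <= c tau t m * (L + 1) by rewrite ler_wpM2l.
  lra.
Unshelve. all: by end_near. Qed.

Lemma laplace_le V W t t' : cdf_like V -> cdf_like W ->
  (forall s, 0 < s -> laplace V s = laplace W s) -> t' < t -> V t' <= W t.
Proof.
move=> cV cW VW tt; apply/ler_addgt0Pr => e e0.
have [|h _] := @laplace_cvg_le (fun=> V) W t t' e (fun=> cV) cW _ tt e0.
  by move=> s s0; rewrite VW//; exact: cvg_cst.
by have [n] := filter_ex h.
Qed.

End laplace_continuity.

(** * Convolution equations on the half-line *)

Section real_convolution.
Context {R : realType}.
Notation mu := (@lebesgue_measure R).

Implicit Types (q V W B : R -> R) (s t : R).

Definition is_kernel (q : R -> R) :=
  [/\ measurable_fun setT q, forall x, 0 <= q x, forall x, x <= 0 -> q x = 0 &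
      forall s, 0 < s -> laplace q s \is a fin_num].

Definition rconv (q W : R -> R) (t : R) : R := fine (convolution q W t).

Definition heaviside (x : R) : R := ((0 <= x)%R)%:R.

Definition ramp (x : R) : R := Num.max x 0.

Lemma cdf_like_measurable (W : R -> R) : cdf_like W -> measurable_fun setT W.
Proof. by case=> Wnd _ _ _; exact: nondecreasing_measurable. Qed.

Lemma measurable_conv_integrand (q W : R -> R) t : measurable_fun setT q ->
  measurable_fun setT W -> measurable_fun setT (fun x : R => q x * W (t - x)).
Proof.
move=> mq mW; apply: measurable_funM => //; apply: (measurableT_comp mW).
exact: measurable_funB.
Qed.

(** Where the integrand is nonzero, [0 < x <= t], so that [W (t - x)] is at most [W t] and the
    factor [expR (t - x)] is at least 1: the convolution is at most [W t * expR t] times the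
    transform of [q] at 1. *)
Lemma convolution_fin_num q W t : is_kernel q -> cdf_like W ->
  convolution q W t \is a fin_num.
Proof.
move=> [mq q0 qN Lq] cW; have mW := cdf_like_measurable cW; have [Wnd W0 WN LW] := cW.
rewrite ge0_fin_numE; last exact: convolution_ge0.
have me := @measurable_expRN R 1.
apply: (@le_lt_trans _ _ (\int[mu]_x (W t * expR t * (expR (- (1 * x)) * q x))%:E)%E).
  apply: le_integral_nn.
  - exact: measurable_conv_integrand.
  - by apply: measurable_funM => //; exact: measurable_funM.
  - by move=> x; exact: mulr_ge0.
  - move=> x; have [x0|x0] := leP x 0; first by rewrite qN// mul0r !mulr0.
    have [xt|tx] := leP x t; last first.
      by rewrite WN ?subr_lt0// mulr0 !mulr_ge0// expR_ge0.
    rewrite [leRHS]mulrACA -!mulrA mulrC !mulrA ler_wpM2r//.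
    rewrite -[leLHS]mulr1 -mulrA ler_pM ?W0//.
      by apply: Wnd; rewrite gerBl ltW.
    by rewrite -expRD -[leLHS]expR0 ler_expR; lra.
have mq1 : measurable_fun setT (fun x : R => expR (- (1 * x)) * q x) by exact: measurable_funM.
have q10 x : 0 <= expR (- (1 * x)) * q x by rewrite mulr_ge0 ?expR_ge0.
rewrite (integral_nnZl mu mq1 q10); last by rewrite mulr_ge0 ?expR_ge0.
rewrite lte_mul_pinfty ?lee_fin ?mulr_ge0 ?expR_ge0//.
by have := Lq _ ltr01; rewrite ge0_fin_numE// laplace_ge0.
Qed.

Lemma rconvE q W t : is_kernel q -> cdf_like W -> (rconv q W t)%:E = convolution q W t.
Proof. by move=> kq cW; rewrite fineK// convolution_fin_num. Qed.

Lemma rconv_ge0 q W t : is_kernel q -> cdf_like W -> 0 <= rconv q W t.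
Proof. by move=> [? ? ? ?] [? ? ? ?]; rewrite fine_ge0// convolution_ge0. Qed.

Lemma le_rconv q q' W t t' : is_kernel q -> is_kernel q' -> cdf_like W ->
  (forall x, 0 < x -> q x * W (t - x) <= q' x * W (t' - x)) -> rconv q W t <= rconv q' W t'.
Proof.
move=> kq kq' cW h; rewrite -lee_fin !rconvE//.
have mW := cdf_like_measurable cW.
have [mq q0 qN _] := kq; have [mq' q0' qN' _] := kq'; have [_ W0 _ _] := cW.
apply: le_integral_nn.
- exact: measurable_conv_integrand.
- exact: measurable_conv_integrand.
- by move=> x; exact: mulr_ge0.
- move=> x; have [x0|x0] := leP x 0; first by rewrite qN// qN'// !mul0r.
  exact: h.
Qed.

Lemma rconv_nd q W : is_kernel q -> cdf_like W -> {homo rconv q W : x y / x <= y}.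
Proof.
move=> kq cW x y xy; apply: le_rconv => // z _; have [_ q0 _ _] := kq; have [Wnd _ _ _] := cW.
by rewrite ler_wpM2l// Wnd// lerD2r.
Qed.

Lemma rconvN q W t : is_kernel q -> cdf_like W -> t < 0 -> rconv q W t = 0.
Proof.
move=> [mq q0 qN _] [_ _ WN _] t0; rewrite /rconv /convolution integral0_eq// => x _.
have [x0|x0] := leP x 0; first by rewrite qN// mul0r.
by rewrite WN ?mulr0// subr_lt0 (lt_trans t0).
Qed.

Lemma laplace_rconv q W s : is_kernel q -> cdf_like W ->
  laplace (rconv q W) s = (laplace q s * laplace W s)%E.
Proof.
move=> kq cW; have mW := cdf_like_measurable cW; have [mq q0 qN Lq] := kq; have [_ W0 _ _] := cW.
by rewrite -laplace_convolution//; apply: eq_integral => t _; rewrite EFinM rconvE.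
Qed.

Lemma cdf_like_rconv q W : is_kernel q -> cdf_like W -> cdf_like (rconv q W).
Proof.
move=> kq cW; split.
- exact: rconv_nd.
- by move=> x; exact: rconv_ge0.
- by move=> x; exact: rconvN.
- move=> s s0; rewrite laplace_rconv//; have [_ _ _ Lq] := kq; have [_ _ _ LW] := cW.
  by rewrite fin_numM// ?Lq ?LW.
Qed.

Lemma laplaceD V W s : measurable_fun setT V -> measurable_fun setT W ->
  (forall x, 0 <= V x) -> (forall x, 0 <= W x) ->
  laplace (fun t => V t + W t) s = (laplace V s + laplace W s)%E.
Proof.
move=> mV mW V0 W0; rewrite /laplace.
have me := @measurable_expRN R s.
have m1 : measurable_fun setT (fun x : R => expR (- (s * x)) * V x) by exact: measurable_funM.
have m2 : measurable_fun setT (fun x : R => expR (- (s * x)) * W x) by exact: measurable_funM.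
have p1 x : 0 <= expR (- (s * x)) * V x by rewrite mulr_ge0 ?expR_ge0.
have p2 x : 0 <= expR (- (s * x)) * W x by rewrite mulr_ge0 ?expR_ge0.
rewrite -(integral_nnD mu m1 m2 p1 p2).
by apply: eq_integral => x _; rewrite mulrDr.
Qed.

Lemma laplaceZ (c : R) V s : measurable_fun setT V -> (forall x, 0 <= V x) -> 0 <= c ->
  laplace (fun t => c * V t) s = (c%:E * laplace V s)%E.
Proof.
move=> mV V0 c0; rewrite /laplace.
have m1 : measurable_fun setT (fun x : R => expR (- (s * x)) * V x).
  by apply: measurable_funM => //; exact: measurable_expRN.
have p1 x : 0 <= expR (- (s * x)) * V x by rewrite mulr_ge0 ?expR_ge0.
rewrite -(integral_nnZl mu m1 p1 c0).
by apply: eq_integral => x _; rewrite mulrCA.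
Qed.

Lemma le_laplace V W s : measurable_fun setT V -> measurable_fun setT W ->
  (forall x, 0 <= V x <= W x) -> (laplace V s <= laplace W s)%E.
Proof.
move=> mV mW VW; have me := @measurable_expRN R s.
apply: le_integral_nn.
- exact: measurable_funM.
- exact: measurable_funM.
- by move=> x; rewrite mulr_ge0 ?expR_ge0//; have /andP[] := VW x.
- by move=> x; rewrite ler_wpM2l ?expR_ge0//; have /andP[] := VW x.
Qed.

Lemma cdf_likeD V W : cdf_like V -> cdf_like W -> cdf_like (fun t => V t + W t).
Proof.
move=> cV cW; have mV := cdf_like_measurable cV; have mW := cdf_like_measurable cW.
have [Vnd V0 VN LV] := cV; have [Wnd W0 WN LW] := cW; split.
- by move=> x y xy; rewrite lerD ?Vnd ?Wnd.
- by move=> x; rewrite addr_ge0.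
- by move=> x x0; rewrite VN// WN// addr0.
- by move=> s s0; rewrite laplaceD// fin_numD LV ?LW.
Qed.

Lemma cdf_likeZ (c : R) V : 0 <= c -> cdf_like V -> cdf_like (fun t => c * V t).
Proof.
move=> c0 cV; have mV := cdf_like_measurable cV.
have [Vnd V0 VN LV] := cV; split.
- by move=> x y xy; rewrite ler_wpM2l// Vnd.
- by move=> x; rewrite mulr_ge0.
- by move=> x x0; rewrite VN// mulr0.
- by move=> s s0; rewrite laplaceZ// fin_numM// LV.
Qed.

Let heaviside_nd : {homo heaviside : x y / x <= y}.
Proof.
by move=> x y xy; rewrite /heaviside ler_nat; case: leP => // x0; rewrite (le_trans x0 xy).
Qed.

Lemma laplace_heaviside s : 0 < s -> laplace heaviside s = (s^-1)%:E.
Proof.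
move=> s0; have := @integral_kernel R s 1 0 s0 isT (lexx _).
rewrite mulr0 oppr0 expR0 subrr expr1 subr0 => h.
have mh : measurable_fun setT heaviside by apply: nondecreasing_measurable => //; exact: heaviside_nd.
have h0 (x : R) : 0 <= heaviside x by rewrite ler0n.
have : (s%:E * laplace heaviside s = 1)%E.
  rewrite -(laplaceZ s mh h0 (ltW s0)).
  rewrite /laplace -h [RHS]integral_mkcond; apply: eq_integral => y _.
  rewrite patchE /heaviside; have [y0|y0] := leP 0 y.
    rewrite mem_set/= ?in_itv/= ?y0// mulr1 /bump_kernel expr0 !mulr1.
    by rewrite mulrC.
  by rewrite memNset/= ?in_itv/= ?andbT ?leNgt ?y0// !mulr0.
move=> h1; rewrite -[LHS]mul1e -[X in (X * _)%E](_ : ((s^-1)%:E * s%:E = 1)%E); last first.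
  by rewrite -EFinM mulVf// gt_eqF.
by rewrite -muleA h1 mule1.
Qed.

Lemma heaviside_cdf_like : cdf_like heaviside.
Proof.
split.
- exact: heaviside_nd.
- by move=> x; rewrite ler0n.
- by move=> x x0; rewrite /heaviside leNgt x0.
- by move=> s s0; rewrite laplace_heaviside.
Qed.

Lemma laplace_ae (V W : R -> R) s : measurable_fun setT V -> measurable_fun setT W ->
  (forall x, x != 0 -> V x = W x) -> laplace V s = laplace W s.
Proof.
move=> mV mW VW; have me := @measurable_expRN R s.
apply: ae_eq_integral => //.
- by apply/measurable_EFinP; exact: measurable_funM.
- by apply/measurable_EFinP; exact: measurable_funM.
- exists [set 0]; split => //; first exact: lebesgue_measure_set1.
  move=> x /=; apply: contra_notP => /eqP x0 _; by rewrite VW.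
Qed.

(** The Heaviside function with value 0 at 0, as [is_kernel] demands. It makes [ramp] a convolution,
    which provides both its monotonicity package and its transform. *)
Let step (x : R) : R := ((0 < x)%R)%:R.

Let step_nd : {homo step : x y / x <= y}.
Proof.
by move=> x y xy; rewrite /step ler_nat; case: ltP => // x0; rewrite (lt_le_trans x0 xy).
Qed.

Let laplace_step s : laplace step s = laplace heaviside s.
Proof.
apply: laplace_ae; try by apply: nondecreasing_measurable => //; (exact: heaviside_nd || exact: step_nd).
by move=> x x0; rewrite /step /heaviside lt_neqAle eq_sym x0.
Qed.

Let step_kernel : is_kernel step.
Proof.
split.
- by apply: nondecreasing_measurable => //; exact: step_nd.
- by move=> x; rewrite ler0n.
- by move=> x x0; rewrite /step ltNge x0.
- by move=> s s0; rewrite laplace_step laplace_heaviside.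
Qed.

Let rampE : ramp = rconv step heaviside.
Proof.
apply/funext => t; rewrite /rconv /convolution.
transitivity (fine (\int[mu]_(x in `]0%R, t]) (cst 1%:E x))%E).
  rewrite integral_cst//= mul1e /ramp; have [t0|t0] := leP t 0.
    by rewrite set_itv_ge ?measure0//= bnd_simp -leNgt.
  by rewrite lebesgue_measure_itv/= lte_fin t0/= subr0.
rewrite integral_mkcond; congr fine; apply: eq_integral => x _.
rewrite patchE /step /heaviside subr_ge0.
have [x0|x0] := ltP 0 x; have [xt|xt] := leP x t.
- by rewrite mem_set/= ?in_itv/= ?x0// mulr1.
- by rewrite memNset/= ?in_itv/= ?x0 ?leNgt ?xt// mulr0.
- by rewrite memNset/= ?in_itv/= ?ltNge ?x0// mul0r.
- by rewrite memNset/= ?in_itv/= ?ltNge ?x0// mul0r.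
Qed.

Lemma ramp_cdf_like : cdf_like ramp.
Proof. by rewrite rampE; exact/cdf_like_rconv/heaviside_cdf_like. Qed.

Lemma laplace_ramp s : 0 < s -> laplace ramp s = (s^-1 * s^-1)%:E.
Proof.
move=> s0; rewrite rampE laplace_rconv//; last exact: heaviside_cdf_like.
by rewrite laplace_step laplace_heaviside.
Qed.

Lemma continuous_ramp : continuous ramp.
Proof. by move=> x; apply: continuous_max; [exact: cvg_id|exact: cvg_cst]. Qed.

(* Two nondecreasing functions with the same Laplace transform agree at the continuity points. *)
Lemma laplace_inj V W : cdf_like V -> cdf_like W -> continuous W ->
  (forall s, 0 < s -> laplace V s = laplace W s) -> V =1 W.
Proof.
move=> cV cW ctW VW t; apply/eqP; rewrite eq_le; apply/andP; split; apply/ler_addgt0Pr => e e0.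
- have [t' [tt' h]] : exists t', t < t' /\ W t' <= W t + e.
    have /cvgr_le/(_ (W t + e)) : W x @[x --> t^'+] --> W t by exact/cvg_at_right_filter/ctW.
    rewrite ltrDl e0 => /(_ isT) h.
    by have [x [? ?]] := filter_ex (filterI (nbhs_right_gt t) h); exists x.
  exact: le_trans (laplace_le cV cW VW tt') h.
- have [t' [tt' h]] : exists t', t' < t /\ W t - e <= W t'.
    have /cvgr_ge/(_ (W t - e)) : W x @[x --> t^'-] --> W t by exact/cvg_at_left_filter/ctW.
    rewrite ltrBlDr ltrDl e0 => /(_ isT) h.
    by have [x [? ?]] := filter_ex (filterI (nbhs_left_lt t) h); exists x.
  rewrite -lerBlDr; apply: le_trans h _.
  by apply: laplace_le tt' => // s s0; rewrite VW.
Qed.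

(* The convolution equation [c W + q * W = B], from its Laplace transform. *)
Lemma convolution_equation (c : R) q W B : 0 <= c -> is_kernel q -> cdf_like W ->
  cdf_like B -> continuous B ->
  (forall s, 0 < s -> ((c%:E + laplace q s) * laplace W s = laplace B s)%E) ->
  forall t, c * W t + rconv q W t = B t.
Proof.
move=> c0 kq cW cB ctB h.
have c1 := cdf_likeZ c0 cW; have c2 := cdf_like_rconv kq cW.
apply: (laplace_inj (V := fun t => c * W t + rconv q W t)) => //; first exact: cdf_likeD.
move=> s s0; have [_ cW0 _ LW] := cW; have [mq q0 _ Lq] := kq.
have mW := cdf_like_measurable cW; have m1 := cdf_like_measurable c1.
have m2 := cdf_like_measurable c2; have [_ p1 _ _] := c1; have [_ p2 _ _] := c2.
rewrite (laplaceD s m1 m2 p1 p2) (laplaceZ s mW cW0 c0) laplace_rconv// -h//.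
have lq := laplace_ge0 s q0; have lc : (0 <= c%:E)%E by rewrite lee_fin.
by rewrite [RHS]ge0_muleDl.
Qed.

End real_convolution.

(** * Continuity and growth of the renewal function *)

Section renewal_function.
Context {R : realType} (c : R) (k U : R -> R).
Notation mu := (@lebesgue_measure R).
Hypotheses (c0 : 0 <= c) (kk : is_kernel k) (cU : cdf_like U).
Hypothesis kdec : forall x y, 0 < x -> x <= y -> k y <= k x.
Hypothesis kU : forall t, c * U t + rconv k U t = ramp t.

Let Und : {homo U : x y / x <= y}. Proof. by case: cU. Qed.

(** For x in ]0, e], [U (y + 2 * e - x)] is at least [U (y + e)], [U (y - x)] is at most [U y], and
    [k x] is at least [k e]. So [k * U] grows by at least [e * k e] times the increment of [U]
    between [y] and [y + 2 * e], while the equation lets it grow by at most [2 * e]. *)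
Lemma renewal_modulus y e : 0 < e -> (U (y + e) - U y) * k e <= 2.
Proof.
move=> e0.
have k0 x : 0 <= k x by case: kk.
set D := U (y + e) - U y.
have D0 : 0 <= D by rewrite subr_ge0 Und// lerDl ltW.
have h1 : rconv k U (y + 2 * e) - rconv k U y <= 2 * e.
  have := kU (y + 2 * e); have := kU y.
  have : c * U y <= c * U (y + 2 * e) by rewrite ler_wpM2l// Und// lerDl mulr_ge0// ltW.
  have : ramp (y + 2 * e) <= ramp y + 2 * e.
    rewrite /ramp ge_max; apply/andP; split; first by rewrite lerD2r le_max lexx.
    by rewrite addr_ge0 ?mulr_ge0 ?(ltW e0)// le_max lexx orbT.
  lra.
pose w (x : R) : R := k e * D * \1_`]0, e]%classic x.
have [mk _ kN _] := kk; have mU := cdf_like_measurable cU; have [_ U0 _ _] := cU.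
have mi : measurable_fun setT (\1_`]0, e]%classic : R -> R) by exact: measurable_indic.
have mw : measurable_fun setT w by exact: measurable_funM.
have w0 (x : R) : 0 <= w x by rewrite /w mulr_ge0// mulr_ge0.
have wE : (\int[mu]_x (w x)%:E = (k e * D * e)%:E)%E.
  have i0 (x : R) : 0 <= (\1_`]0, e]%classic x : R) by [].
  rewrite (integral_nnZl mu mi i0); last by rewrite mulr_ge0.
  by rewrite integral_indic// setIT [X in (_ * X)%E](lebesgue_measure_itv `]0, e])/= lte_fin e0 -EFinB subr0 -EFinM.
have h2 : rconv k U y + k e * D * e <= rconv k U (y + 2 * e).
  rewrite -lee_fin EFinD !rconvE// -wE.
  have m1 := measurable_conv_integrand y mk mU.
  have p1 (x : R) : 0 <= k x * U (y - x) by exact: mulr_ge0.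
  rewrite /convolution -(integral_nnD mu m1 mw p1 w0).
  apply: le_integral_nn.
  - exact: measurable_funD.
  - exact: measurable_conv_integrand.
  - by move=> x; rewrite addr_ge0.
  - move=> x; rewrite /w indicE; have [x0|x0] := leP x 0.
      by rewrite kN// !mul0r add0r memNset ?mulr0//= in_itv/= ltNge x0.
    have [xe|xe] := leP x e.
      rewrite mem_set/= ?in_itv/= ?x0// mulr1.
      have h3 : U (y + e) <= U (y + 2 * e - x) by apply: Und; lra.
      have h4 : U (y - x) <= U y by apply: Und; lra.
      apply: (@le_trans _ _ (k x * U (y - x) + k x * D)).
        by rewrite lerD2l ler_wpM2r// kdec.
      by rewrite -mulrDr ler_wpM2l// /D; lra.
    rewrite (_ : (x \in `]0, e]%classic) = false) ?mulr0 ?addr0; last first.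
      by apply: memNset; rewrite /= in_itv/= x0/= leNgt xe.
    by rewrite ler_wpM2l// Und//; lra.
rewrite -(ler_pM2r e0) (mulrC D); lra.
Qed.

Hypothesis kinf : forall A, exists2 x, 0 < x & A <= k x.

(** The increments over a length [x] are at most [2 / k x], which is small because [k] is unbounded
    near 0: this is where the infinite mass of the Lévy measure enters. *)
Lemma renewal_continuous : continuous U.
Proof.
move=> y; apply/cvgrPdist_le => e e0.
have [x x0 kx] := kinf (2 / e).
have k0 : 0 < k x by apply: lt_le_trans kx; rewrite divr_gt0.
have h z : U (z + x) - U z <= e.
  have := renewal_modulus z x0; rewrite -ler_pdivlMr// => /le_trans; apply.
  by rewrite ler_pdivrMr// mulrC -ler_pdivrMr.
near=> z.
have : `|y - z| <= x by near: z; apply: cvgr_dist_le => //; exact: cvg_id.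
rewrite ler_norml => /andP[z1 z2].
have := h y; have := h z.
have : U y <= U (z + x) by apply: Und; lra.
have : U z <= U (y + x) by apply: Und; lra.
by move=> h1 h2 h3 h4; rewrite ler_norml; lra.
Unshelve. all: by end_near. Qed.

Lemma renewal_at0 t : t <= 0 -> U t = 0.
Proof.
move=> t0; have [_ U0 UN _] := cU.
have h : U x @[x --> (0 : R)^'-] --> U 0 by apply: cvg_at_left_filter; exact: renewal_continuous.
have h' : U x @[x --> (0 : R)^'-] --> (0 : R).
  apply: cvg_near_cst; near=> x; apply/UN; near: x; exact: nbhs_left_lt.
have U00 : U 0 = 0 by rewrite -(cvg_lim _ h)// (cvg_lim _ h').
by apply/eqP; rewrite eq_le U0 andbT -U00 Und.
Unshelve. all: by end_near. Qed.

Lemma renewal_lipschitz a b : a <= b -> c * (U b - U a) <= b - a.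
Proof.
move=> ab; have := kU a; have := kU b.
have : rconv k U a <= rconv k U b by apply: rconv_nd.
have : ramp b <= ramp a + (b - a).
  by rewrite /ramp; case: (leP a 0) => h; case: (leP b 0) => h'; lra.
lra.
Qed.

End renewal_function.

(** * Primitives of kernels *)

Section primitive.
Context {R : realType}.
Notation mu := (@lebesgue_measure R).
Implicit Types (q : R -> R) (a b t : R).

(** The convolution form gives monotonicity, sign and Laplace transform from the facts on
    [rconv]. *)
Definition primitive q t : R := rconv q heaviside t.

Lemma primitive_nd q : is_kernel q -> {homo primitive q : x y / x <= y}.
Proof. by move=> kq; apply: rconv_nd => //; exact: heaviside_cdf_like. Qed.

Lemma primitive_ge0 q t : is_kernel q -> 0 <= primitive q t.
Proof. by move=> kq; apply: rconv_ge0 => //; exact: heaviside_cdf_like. Qed.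

Lemma primitiveE q t : is_kernel q -> (primitive q t)%:E = (\int[mu]_x (q x * heaviside (t - x))%:E)%E.
Proof. by move=> kq; rewrite rconvE//; exact: heaviside_cdf_like. Qed.

Lemma primitive_le0 q t : is_kernel q -> t <= 0 -> primitive q t = 0.
Proof.
move=> [_ _ qN _] t0; rewrite /primitive /rconv /convolution integral0_eq// => x _.
have [x0|x0] := leP x 0; first by rewrite qN// mul0r.
by rewrite /heaviside leNgt subr_lt0 (le_lt_trans t0 x0)/= mulr0.
Qed.

Lemma measurable_heaviside_sub t : measurable_fun setT (fun x : R => heaviside (t - x)).
Proof.
apply: (measurableT_comp (cdf_like_measurable heaviside_cdf_like)).
exact: measurable_funB.
Qed.

Lemma primitiveB q a b : is_kernel q -> a <= b ->
  (primitive q b)%:E = ((primitive q a)%:E + \int[mu]_x (q x * \1_(`]a, b]%classic) x)%:E)%E.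
Proof.
move=> kq ab; have [mq q0 _ _] := kq; rewrite !primitiveE//.
have m1 : measurable_fun setT (fun x : R => q x * heaviside (a - x)).
  by apply: measurable_funM => //; exact: measurable_heaviside_sub.
have m2 : measurable_fun setT (fun x : R => q x * \1_(`]a, b]%classic) x).
  by apply: measurable_funM => //; exact: measurable_indic.
have p1 (x : R) : 0 <= q x * heaviside (a - x) by rewrite mulr_ge0// ler0n.
have p2 (x : R) : 0 <= q x * \1_(`]a, b]%classic) x by rewrite mulr_ge0// ler0n.
rewrite -(integral_nnD mu m1 m2 p1 p2); apply: eq_integral => x _; congr EFin.
rewrite -mulrDr; congr (_ * _); rewrite /heaviside !subr_ge0 indicE.
have [xa|xa] := leP x a.
  rewrite (le_trans xa ab) (_ : (x \in `]a, b]%classic) = false) ?addr0//.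
  by apply: memNset; rewrite /= in_itv/= ltNge xa.
have [xb|xb] := leP x b.
  by rewrite (_ : (x \in `]a, b]%classic) = true) ?add0r// mem_set//= in_itv/= xa.
rewrite (_ : (x \in `]a, b]%classic) = false) ?addr0//.
by apply: memNset; rewrite /= in_itv/= leNgt xb andbF.
Qed.

Lemma integral_cst_itv (r a b : R) : 0 <= r -> a <= b ->
  (\int[mu]_x (r * \1_(`]a, b]%classic) x)%:E = (r * (b - a))%:E)%E.
Proof.
move=> r0 ab.
have mi : measurable_fun setT (\1_(`]a, b]%classic) : R -> R) by exact: measurable_indic.
have i0 (x : R) : 0 <= (\1_(`]a, b]%classic) x : R) by [].
rewrite (integral_nnZl mu mi i0 r0) integral_indic// setIT.
rewrite [X in (_ * X)%E](lebesgue_measure_itv `]a, b])/= lte_fin.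
have [ab'|ba] := ltP a b; first by rewrite -EFinB -EFinM.
by rewrite mule0 (_ : b = a) ?subrr ?mulr0//; apply/eqP; rewrite eq_le ba.
Qed.

Let le_itv q q' a b : measurable_fun setT q -> measurable_fun setT q' ->
  (forall x, 0 <= q x) -> (forall x, 0 <= q' x) -> (forall x, a < x -> x <= b -> q x <= q' x) ->
  (\int[mu]_x (q x * \1_(`]a, b]%classic) x)%:E <= \int[mu]_x (q' x * \1_(`]a, b]%classic) x)%:E)%E.
Proof.
move=> mq mq' q0 q0' qq.
have mi : measurable_fun setT (\1_(`]a, b]%classic) : R -> R) by exact: measurable_indic.
apply: le_integral_nn.
- exact: measurable_funM.
- exact: measurable_funM.
- by move=> x; rewrite mulr_ge0// ler0n.
- move=> x; rewrite indicE; have [/[!inE]/=|_] := boolP (x \in _); last by rewrite !mulr0.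
  by rewrite in_itv/= => /andP[ax xb]; rewrite !mulr1 qq.
Qed.

Lemma primitiveB_le q q' a b : is_kernel q -> is_kernel q' -> a <= b ->
  (forall x, q x <= q' x) -> primitive q b - primitive q a <= primitive q' b - primitive q' a.
Proof.
move=> kq kq' ab qq; rewrite lerBlDr -lee_fin EFinD EFinB.
rewrite (primitiveB kq ab) (primitiveB kq' ab) [X in (_ <= X - _ + _)%E]addeC addeK// addeC leeD2r//.
have [mq q0 _ _] := kq; have [mq' q0' _ _] := kq'.
by apply: le_itv => // x _ _; exact: qq.
Qed.

Variable k : R -> R.
Hypotheses (kk : is_kernel k) (kdec : forall x y, 0 < x -> x <= y -> k y <= k x).

Lemma primitiveB_ub a b : 0 < a -> a <= b -> primitive k b - primitive k a <= k a * (b - a).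
Proof.
move=> a0 ab; have [mk k0 _ _] := kk.
rewrite lerBlDl -lee_fin EFinD (primitiveB kk ab) leeD2l// -integral_cst_itv//.
apply: le_itv => //; by move=> x ax _; apply: kdec => //; exact: ltW.
Qed.

Lemma primitiveB_lb a b : 0 <= a -> a <= b -> k b * (b - a) <= primitive k b - primitive k a.
Proof.
move=> a0 ab; have [mk k0 _ _] := kk.
rewrite lerBrDl -lee_fin EFinD (primitiveB kk ab) leeD2l// -integral_cst_itv//.
by apply: le_itv => // x ax xb; apply: kdec => //; exact: le_lt_trans ax.
Qed.

Lemma primitive_cvg0 e : 0 < e -> exists2 x, 0 < x & primitive k x <= e.
Proof.
move=> e0; have [mk k0 kN Lk] := kk.
have h : (\int[mu]_x (k x * heaviside (n.+1%:R^-1 - x))%:E @[n --> \oo] --> \int[mu]_x (cst 0 x)%:E)%E.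
  apply: (@dominated_cvg _ _ _ mu setT measurableT _ _ (fun x => (k x * heaviside (1 - x))%:E)).
  - move=> n; apply/measurable_EFinP; apply: measurable_funM => //.
    exact: measurable_heaviside_sub.
  - move=> x _; have [x0|x0] := leP x 0.
      by rewrite kN//; apply: cvg_near_cst; apply: nearW => n; rewrite mul0r.
    apply: cvg_near_cst; near=> n; rewrite /heaviside subr_ge0 leNgt.
    suff -> : n.+1%:R^-1 < x by rewrite mulr0.
    by near: n; exact: near_infty_natSinv_lt (PosNum x0).
  - by [].
  - apply/integrableP; split.
      apply/measurable_EFinP; apply: measurable_funM => //; exact: measurable_heaviside_sub.
    under eq_integral => x _ do rewrite gee0_abs ?lee_fin ?mulr_ge0 ?ler0n//.
    by rewrite -primitiveE// ltry.
  - move=> n x _; rewrite gee0_abs ?lee_fin ?mulr_ge0 ?ler0n//.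
    rewrite ler_wpM2l// /heaviside ler_nat !subr_ge0; case: leP => // h.
    by rewrite (le_trans h)// invf_le1// ler1n.
have : primitive k n.+1%:R^-1 @[n --> \oo] --> (0 : R).
  move: h; rewrite integral0; under eq_fun do rewrite -primitiveE//.
  by move=> /fine_cvgP[_].
move=> /cvgr_le/(_ _ e0) /filter_ex[n hn]; exists n.+1%:R^-1 => //.
Unshelve. all: by end_near. Qed.

End primitive.

(** * Measures carried by a grid *)

Section grid.
Context {R : realType}.
Notation mu := (@lebesgue_measure R).
Variables (h : R) (u : nat -> R).
Hypotheses (h0 : 0 < h) (u0 : forall n, 0 <= u n).

(* Distribution function of the measure giving mass [h * u j] to the point [h * j]. *)
Definition grid_cdf (y : R) : R :=
  h * \sum_(j < if y < 0 then 0%N else (Num.truncn (y / h)).+1) u j.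

Lemma grid_cdfE y m : y < h * m%:R ->
  grid_cdf y = h * \sum_(j < m | h * j%:R <= y) u j.
Proof.
move=> ym; rewrite /grid_cdf; congr (_ * _); have [y0|y0] := ltP y 0.
  rewrite big_ord0 big_pred0// => j; apply/negbTE; rewrite -ltNge.
  by apply: lt_le_trans y0 _; rewrite mulr_ge0// ltW.
have yh0 : 0 <= y / h by rewrite divr_ge0// ltW.
have jE (j : nat) : (j <= Num.truncn (y / h))%N = (h * j%:R <= y).
  by rewrite truncn_ge_nat// ler_pdivlMr// mulrC.
have hm : ((Num.truncn (y / h)).+1 <= m)%N.
  rewrite ltnNge jE -ltNge//.
rewrite (big_ord_widen m u hm); apply: eq_bigl => j.
by rewrite ltnS jE.
Qed.

Lemma grid_cdf_nd : {homo grid_cdf : x y / x <= y}.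
Proof.
move=> x y xy.
have [m hm] : exists m : nat, y < h * m%:R.
  exists (Num.truncn (y / h)).+1; rewrite mulrC -ltr_pdivrMr//; exact: truncnS_gt.
rewrite (grid_cdfE hm) (grid_cdfE (le_lt_trans xy hm)) ler_pM2l//.
rewrite big_mkcond [leRHS]big_mkcond; apply: ler_sum => j _.
by case: ifP => // hx; [rewrite (le_trans hx xy)|case: ifP].
Qed.

Lemma grid_cdf_ge0 y : 0 <= grid_cdf y.
Proof. by rewrite /grid_cdf mulr_ge0 ?(ltW h0)// sumr_ge0. Qed.

Lemma grid_cdfN y : y < 0 -> grid_cdf y = 0.
Proof. by move=> y0; rewrite /grid_cdf y0 big_ord0 mulr0. Qed.

Lemma grid_cdf_cdf_like C : (forall n, u n <= C) -> cdf_like grid_cdf.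
Proof.
move=> uC; have C0 : 0 <= C by exact: le_trans (uC 0%N).
split; [exact: grid_cdf_nd|exact: grid_cdf_ge0|exact: grid_cdfN|move=> s s0].
rewrite ge0_fin_numE; last exact/laplace_ge0/grid_cdf_ge0.
have c1 := cdf_likeZ C0 (@ramp_cdf_like R).
have c2 := cdf_likeZ (mulr_ge0 C0 (ltW h0)) (@heaviside_cdf_like R).
have c3 := cdf_likeD c1 c2.
apply: (@le_lt_trans _ _ (laplace (fun t => C * ramp t + C * h * heaviside t) s)); last first.
  by have [_ W0 _ L3] := c3; have := L3 _ s0; rewrite ge0_fin_numE// laplace_ge0.
apply: le_laplace.
- by apply: nondecreasing_measurable => //; exact: grid_cdf_nd.
- exact: cdf_like_measurable.
- move=> y; rewrite grid_cdf_ge0/=; have [y0|y0] := ltP y 0.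
    by rewrite grid_cdfN//; have [_ W0 _ _] := c3.
  rewrite /grid_cdf ltNge y0/= /ramp (max_idPl y0) /heaviside y0 mulr1.
  apply: (@le_trans _ _ (h * \sum_(j < (Num.truncn (y / h)).+1) C)).
    by rewrite ler_pM2l// ler_sum.
  rewrite sumr_const card_ord -mulr_natr mulrA (mulrC h) -mulrA -mulrDr ler_wpM2l//.
  rewrite -natr1 mulrDr mulr1 lerD2r mulrC -ler_pdivlMr//.
  by rewrite truncn_le// divr_ge0// ltW.
Qed.

(** At a grid point the mass at [h * j] is weighted by the primitive of [q] at the remaining
    distance. Writing this primitive as a telescoping sum over cells turns the convolution into a
    partial sum of a discrete one. *)
Lemma rconv_grid q m : is_kernel q -> cdf_like grid_cdf ->
  rconv q grid_cdf (h * m%:R) =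
  h * \sum_(l < m) dconv (fun i => primitive q (h * i.+1%:R) - primitive q (h * i%:R)) u l.
Proof.
move=> kq cW; have [mq q0 qN _] := kq.
transitivity (\sum_(j < m) h * u j * primitive q (h * (m - j)%:R)).
  apply/EFin_inj; rewrite rconvE// -sumEFin.
  transitivity (\int[mu]_x (\sum_(j < m) (h * u j * (q x * heaviside (h * (m - j)%:R - x)))%:E))%E.
    apply: eq_integral => x _; rewrite sumEFin; congr EFin.
    have [x0|x0] := leP x 0.
      by rewrite qN// mul0r big1// => j _; rewrite mul0r mulr0.
    rewrite (@grid_cdfE _ m) ?ltrBlDr ?ltrDl// mulr_sumr mulr_sumr big_mkcond/=.
    apply: eq_bigr => j _; rewrite /heaviside natrB 1?ltnW// mulrBr.
    rewrite (_ : (0 <= h * m%:R - h * j%:R - x) = (h * j%:R <= h * m%:R - x)); last first.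
      by apply/idP/idP; lra.
    by case: ifP => _; rewrite ?mulr1 ?mulr0//; ring.
  rewrite ge0_integral_sum//; last 2 first.
  - move=> j; apply/measurable_EFinP; apply: measurable_funM => //.
    by apply: measurable_funM => //; exact: measurable_heaviside_sub.
  - by move=> j x _; rewrite lee_fin !mulr_ge0// ?ler0n// ltW.
  apply: eq_bigr => j _; rewrite EFinM primitiveE//.
  have m1 : measurable_fun setT (fun x : R => q x * heaviside (h * (m - j)%:R - x)).
    by apply: measurable_funM => //; exact: measurable_heaviside_sub.
  have p1 (x : R) : 0 <= q x * heaviside (h * (m - j)%:R - x) by rewrite mulr_ge0// ler0n.
  by rewrite -(integral_nnZl mu m1 p1)// mulr_ge0// ltW.
under eq_bigr do rewrite -mulrA; rewrite -mulr_sumr; congr (_ * _).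
case: m => [|m]; first by rewrite !big_ord0.
have telescope i : primitive q (h * i%:R) = \sum_(l < i) (primitive q (h * l.+1%:R) - primitive q (h * l%:R)).
  elim: i => [|i ih]; first by rewrite mulr0 primitive_le0// big_ord0.
  by rewrite big_ord_recr/= -ih addrC subrK.
under [RHS]eq_bigr do rewrite dconvC.
rewrite sum_dconv; apply: eq_bigr => j _; rewrite telescope subSn//.
by rewrite -ltnS.
Qed.

End grid.

(** * Discrete approximation of the renewal function *)

Section approximation.
Context {R : realType} (k U : R -> R) (T : R).
Notation mu := (@lebesgue_measure R).
Hypotheses (kk : is_kernel k) (cU : cdf_like U).
Hypothesis kdec : forall x y, 0 < x -> x <= y -> k y <= k x.
Hypothesis kinf : forall A, exists2 x, 0 < x & A <= k x.
Hypothesis kU : forall t, rconv k U t = ramp t.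
Hypothesis T0 : 0 < T.

Definition mesh (n : nat) : R := T / n.+1%:R.

Definition cell_mass (n i : nat) : R :=
  primitive k (mesh n * i.+1%:R) - primitive k (mesh n * i%:R).

Lemma mesh_gt0 n : 0 < mesh n. Proof. by rewrite divr_gt0. Qed.

Lemma mesh_cvg0 : mesh n @[n --> \oo] --> (0 : R).
Proof.
rewrite /mesh -[X in _ --> X](mulr0 T); apply: cvgM; first exact: cvg_cst.
exact: cvg_harmonic.
Qed.

Let hi_ge0 n i : 0 <= mesh n * i%:R. Proof. by rewrite mulr_ge0// ltW// mesh_gt0. Qed.
Let hi_le n i j : (i <= j)%N -> mesh n * i%:R <= mesh n * j%:R.
Proof. by move=> ij; rewrite ler_wpM2l ?ler_nat// ltW// mesh_gt0. Qed.
Let hiS n i : mesh n * i.+1%:R - mesh n * i%:R = mesh n.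
Proof. by rewrite -mulrBr -natr1 addrAC subrr add0r mulr1. Qed.

Lemma cell_mass_ge0 n i : 0 <= cell_mass n i.
Proof. by rewrite subr_ge0 primitive_nd// hi_le. Qed.

Lemma cell_mass_lb n i : k (mesh n * i.+1%:R) * mesh n <= cell_mass n i.
Proof. by rewrite -{2}(hiS n i) primitiveB_lb// hi_le. Qed.

(** The cell at 0 is excluded because [k] is unbounded near 0. *)
Lemma cell_mass_ub n i : (0 < i)%N -> cell_mass n i <= k (mesh n * i%:R) * mesh n.
Proof.
by move=> i0; rewrite -{2}(hiS n i) primitiveB_ub// ?hi_le// mulr_gt0 ?mesh_gt0// ltr0n.
Qed.

Lemma cell_mass_dec n : {homo cell_mass n : i j / (i <= j)%N >-> j <= i}.
Proof.
apply: homo_leq => [//|x y z xy yz|i]; first exact: le_trans yz xy.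
exact: le_trans (cell_mass_ub n (ltn0Sn i)) (cell_mass_lb n i).
Qed.

Lemma cell_mass_gt0 n : 0 < cell_mass n 0%N.
Proof.
have [x x0 kx] := kinf 1; rewrite /cell_mass mulr0 (@primitive_le0 _ k 0)// subr0 mulr1.
pose y := Num.min x (mesh n).
have y0 : 0 < y by rewrite lt_min x0 mesh_gt0.
have := primitiveB_lb kk kdec (lexx 0) (ltW y0).
rewrite (@primitive_le0 _ k 0)// !subr0 => h.
apply: lt_le_trans (primitive_nd kk (_ : y <= _)); last by rewrite ge_min lexx orbT.
have ky : k x <= k y by apply: kdec => //; rewrite ge_min lexx.
apply: lt_le_trans h; rewrite mulr_gt0//; apply: lt_le_trans ky; exact: lt_le_trans kx.
Qed.

(** The masses are chosen so that [k * renewal_approx] is exactly the identity at the grid points,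
    as [rconv_approx] shows. *)
Definition renewal_mass (n : nat) : nat -> R :=
  projT1 (cid (dconv_inv (lt0r_neq0 (cell_mass_gt0 n)))).

Lemma renewal_massE n m : dconv (cell_mass n) (renewal_mass n) m = 1.
Proof. by rewrite /renewal_mass; case: cid => u /= ->. Qed.

Lemma renewal_mass_ge0 n m : 0 <= renewal_mass n m.
Proof.
apply: (dconv_inv_ge0 (cell_mass_gt0 n) (cell_mass_dec n)); exact: renewal_massE.
Qed.

Definition renewal_approx (n : nat) : R -> R := grid_cdf (mesh n) (renewal_mass n).

Lemma renewal_approx_cdf_like n : cdf_like (renewal_approx n).
Proof.
apply: (grid_cdf_cdf_like (mesh_gt0 n) (renewal_mass_ge0 n) (C := (cell_mass n 0%N)^-1)) => m.
rewrite -[leRHS]mul1r ler_pdivlMr ?cell_mass_gt0// -(renewal_massE n m) mulrC.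
rewrite /dconv big_ord_recl/= subn0 lerDl sumr_ge0// => i _.
by rewrite mulr_ge0 ?cell_mass_ge0 ?renewal_mass_ge0.
Qed.

Lemma rconv_approx n m : rconv k (renewal_approx n) (mesh n * m%:R) = mesh n * m%:R.
Proof.
rewrite (rconv_grid (mesh_gt0 n) (renewal_mass_ge0 n))//; last exact: renewal_approx_cdf_like.
congr (_ * _); rewrite (eq_bigr (fun=> 1)) ?sumr_const ?card_ord// => l _.
exact: renewal_massE.
Qed.

(** Between consecutive grid points, monotonicity leaves an uncertainty of one mesh. *)
Let approx_bounds n t : ramp t <= rconv k (renewal_approx n) t + mesh n * heaviside t /\
  rconv k (renewal_approx n) t <= ramp t + mesh n * heaviside t.
Proof.
have cA := renewal_approx_cdf_like n; have h0 := mesh_gt0 n.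
rewrite /ramp /heaviside; have [t0|t0] := ltP t 0.
  by rewrite rconvN// mulr0 !addr0.
rewrite mulr1.
pose m := Num.truncn (t / mesh n).
have th0 : 0 <= t / mesh n by rewrite divr_ge0// ltW.
have h1 : mesh n * m%:R <= t by rewrite mulrC -ler_pdivlMr// truncn_le.
have h2 : t <= mesh n * m.+1%:R by rewrite mulrC -ler_pdivrMr// ltW// truncnS_gt.
have := rconv_nd kk cA h1; have := rconv_nd kk cA h2; rewrite !rconv_approx.
by have := hiS n m; lra.
Qed.

(** The convolution of [k] with the approximation is within one mesh of the ramp, so the product of
    the transforms is within [mesh n / s] of its limit. It remains to divide by the transform of
    [k], which is nonzero since its product with that of [U] is. *)
Lemma laplace_approx s : 0 < s -> laplace (renewal_approx n) s @[n --> \oo] --> laplace U s.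
Proof.
move=> s0; have [mk k0 kN Lk] := kk.
have LU : (laplace k s * laplace U s = (s^-1 * s^-1)%:E)%E.
  by rewrite -laplace_rconv// -laplace_ramp//; congr laplace; exact/funext.
have fLA n : laplace (renewal_approx n) s \is a fin_num by have [_ _ _] := renewal_approx_cdf_like n; apply.
have fLU : laplace U s \is a fin_num by have [_ _ _] := cU; apply.
set lk := fine (laplace k s); set lU := fine (laplace U s).
have lkU : lk * lU = s^-1 * s^-1.
  by apply/EFin_inj; rewrite EFinM !fineK ?Lk.
have lk0 : 0 < lk.
  rewrite lt_neqAle fine_ge0 ?laplace_ge0// andbT eq_sym; apply/negP => /eqP lk0.
  move: lkU; rewrite lk0 mul0r => /esym/eqP; rewrite mulf_eq0 invr_eq0 orbb.
  by rewrite gt_eqF.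
pose lA n := fine (laplace (renewal_approx n) s).
have hb n : s^-1 * s^-1 - mesh n * s^-1 <= lk * lA n /\ lk * lA n <= s^-1 * s^-1 + mesh n * s^-1.
  have cA := renewal_approx_cdf_like n.
  have cC := cdf_like_rconv kk cA; have cR := @ramp_cdf_like R.
  have cH := cdf_likeZ (ltW (mesh_gt0 n)) (@heaviside_cdf_like R).
  have mC := cdf_like_measurable cC; have mR := cdf_like_measurable cR; have mH := cdf_like_measurable cH.
  have [_ C0 _ _] := cC; have [_ R0 _ _] := cR; have [_ H0 _ _] := cH.
  have LC : laplace (rconv k (renewal_approx n)) s = (lk * lA n)%:E.
    by rewrite laplace_rconv// EFinM !fineK ?Lk.
  have LH : laplace (fun t => mesh n * heaviside t) s = (mesh n * s^-1)%:E.
    have mh := cdf_like_measurable (@heaviside_cdf_like R); have [_ hh _ _] := @heaviside_cdf_like R.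
    by rewrite (laplaceZ s mh hh (ltW (mesh_gt0 n))) laplace_heaviside.
  split.
    rewrite lerBlDr -lee_fin EFinD -LC -LH -laplace_ramp// -laplaceD//.
    apply: le_laplace => //; first exact: measurable_funD.
    by move=> t; rewrite R0/=; have [] := approx_bounds n t.
  rewrite -lee_fin EFinD -LC -LH -laplace_ramp// -laplaceD//.
  apply: le_laplace => //; first exact: measurable_funD.
  by move=> t; rewrite C0/=; have [] := approx_bounds n t.
have : lA n @[n --> \oo] --> lU.
  have hs : mesh n * s^-1 @[n --> \oo] --> (0 : R).
    by have := cvgM mesh_cvg0 (cvg_cst s^-1 : _ --> _); rewrite mul0r; apply.
  rewrite (_ : lU = lk^-1 * (s^-1 * s^-1)); last first.
    by rewrite -lkU mulKf// gt_eqF.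
  apply: (@squeeze_cvgr _ _ _ _ (fun n => lk^-1 * (s^-1 * s^-1 - mesh n * s^-1))
    (fun n => lk^-1 * (s^-1 * s^-1 + mesh n * s^-1))).
  - by apply: nearW => n; rewrite ler_pdivrMl// ler_pdivlMl//; have [-> ->] := hb n.
  - have := cvgM (cvg_cst lk^-1 : _ --> _) (cvgB (cvg_cst (s^-1 * s^-1) : _ --> _) hs).
    by rewrite subr0; apply.
  - have := cvgM (cvg_cst lk^-1 : _ --> _) (cvgD (cvg_cst (s^-1 * s^-1) : _ --> _) hs).
    by rewrite addr0; apply.
move=> hl; rewrite -(fineK fLU); apply/fine_cvgP; split => //.
by apply: nearW => n; exact: fLA.
Qed.

Let ctU : continuous U.
Proof.
apply: (@renewal_continuous R 0 k U) => //.
by move=> t; rewrite mul0r add0r.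
Qed.

Lemma cvg_approx_fun t : renewal_approx n t @[n --> \oo] --> U t.
Proof.
have cA := renewal_approx_cdf_like.
apply/cvgrPdist_le => e e0.
have e20 : 0 < e / 2 by rewrite divr_gt0.
have [t1 [tt1 h1]] : exists t1, t < t1 /\ U t1 <= U t + e / 2.
  have /cvgr_le/(_ (U t + e / 2)) : U x @[x --> t^'+] --> U t by exact/cvg_at_right_filter/ctU.
  rewrite ltrDl e20 => /(_ isT) h.
  by have [x [? ?]] := filter_ex (filterI (nbhs_right_gt t) h); exists x.
have [t2 [tt2 h2]] : exists t2, t2 < t /\ U t - e / 2 <= U t2.
  have /cvgr_ge/(_ (U t - e / 2)) : U x @[x --> t^'-] --> U t by exact/cvg_at_left_filter/ctU.
  rewrite ltrBlDr ltrDl e20 => /(_ isT) h.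
  by have [x [? ?]] := filter_ex (filterI (nbhs_left_lt t) h); exists x.
have [g1 _] := laplace_cvg_le cA cU laplace_approx tt1 e20.
have [_ g2] := laplace_cvg_le cA cU laplace_approx tt2 e20.
near=> n.
have : renewal_approx n t <= U t1 + e / 2 by near: n.
have : U t2 <= renewal_approx n t + e / 2 by near: n.
move=> a1 a2; rewrite ler_norml; apply/andP; split; lra.
Unshelve. all: by end_near. Qed.

End approximation.

(** * Absolute continuity of the renewal function and small jumps *)

Lemma count_interval (a b m : nat) :
  (\sum_(j < m | (a < j <= b)%N) 1 = minn m b.+1 - a.+1)%N.
Proof.
elim: m => [|m ih]; first by rewrite big_ord0 min0n sub0n.
rewrite big_mkcond big_ord_recr/= -big_mkcond/= ih /minn.
by case: ifP; case: ifP; case: ifP; lia.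
Qed.

Section concentration.
Context {R : realType} (k U : R -> R) (T : R).
Notation mu := (@lebesgue_measure R).
Hypotheses (kk : is_kernel k) (cU : cdf_like U).
Hypothesis kdec : forall x y, 0 < x -> x <= y -> k y <= k x.
Hypothesis kinf : forall A, exists2 x, 0 < x & A <= k x.
Hypothesis kU : forall t, rconv k U t = ramp t.
Hypothesis kac : forall a b, 0 < a -> a <= b -> abs_cont a b k.
Hypothesis T0 : 0 < T.

Let h (n : nat) := mesh T n.
Let al n i := cell_mass k T n i.
Let u n := renewal_mass kk kdec kinf T0 n.
Let A n := renewal_approx kk kdec kinf T0 n.
Let h0 n : 0 < h n. Proof. exact: mesh_gt0. Qed.
Let hcvg : h n @[n --> \oo] --> (0 : R). Proof. exact: mesh_cvg0. Qed.
Let hT n : h n * n.+1%:R = T. Proof. by rewrite /h /mesh divfK// pnatr_eq0. Qed.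
Let k0 x : 0 <= k x. Proof. by case: kk. Qed.
Let ctA t : A n t @[n --> \oo] --> U t. Proof. exact: cvg_approx_fun. Qed.
Let near_h e : 0 < e -> \forall n \near \oo, h n <= e.
Proof. by move=> e0; apply: (cvgr_le _ hcvg). Qed.
Let u0 n i : 0 <= u n i. Proof. exact: renewal_mass_ge0. Qed.

(** Absolute continuity of [k] for the grid cells selected by [E] beyond [K]; an unselected index
    receives a degenerate interval at [eta / 2]. The shift [s], 0 or 1, is there because a
    difference of consecutive cell masses spans two adjacent cells. The right end [T + 1] leaves
    room for the last of them. *)
Let sel (n : nat) (E : pred nat) (K s : nat) (eta e del : R) : 0 < eta -> eta <= T ->
  (forall (m : nat) (x y : 'I_m -> R),
    (forall i, eta / 2 <= x i /\ x i <= y i /\ y i <= T + 1) ->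
    trivIset setT (fun i => `]x i, y i[%classic) ->
    \sum_i (y i - x i) < del -> \sum_i `|k (y i) - k (x i)| < e) ->
  (s <= 1)%N -> h n <= 1 -> eta / 2 <= h n * K%:R ->
  h n * (\sum_(i < n.+2 | E i) 1)%N%:R < del ->
  \sum_(i < n.+2 | E i && (K < i)%N) (k (h n * (i.-1 + s)%:R) - k (h n * (i + s)%:R)) <= e.
Proof.
move=> eta0 etaT ac s1 hn1 etaK Edel.
pose S (i : nat) := E i && (K < i)%N.
pose x (i : 'I_n.+2) := if S i then h n * (i.-1 + s)%:R else eta / 2.
pose y (i : 'I_n.+2) := if S i then h n * (i + s)%:R else eta / 2.
have eT : eta / 2 <= T + 1 by lra.
have hle (i j : nat) : (i <= j)%N -> h n * i%:R <= h n * j%:R by move=> ij; rewrite ler_pM2l// ler_nat.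
have H1 i : eta / 2 <= x i /\ x i <= y i /\ y i <= T + 1.
  rewrite /x /y; case: ifP => [/andP[_ Ki]|_]; last by [].
  split; first by apply: le_trans etaK _; apply: hle; lia.
  split; first by apply: hle; lia.
  apply: (@le_trans _ _ (h n * n.+2%:R)); first by apply: hle; have := ltn_ord i; lia.
  by rewrite -natr1 mulrDr hT mulr1 lerD2l.
have H2 : trivIset setT (fun i => `]x i, y i[%classic).
  apply/trivIsetP => i j _ _ ij; rewrite -subset0 => z [] /=.
  rewrite !in_itv/= /x /y; case: ifP => Si; last by move=> /andP[z1 z2]; move: (lt_trans z1 z2); rewrite ltxx.
  case: ifP => Sj; last by move=> _ /andP[z1 z2]; move: (lt_trans z1 z2); rewrite ltxx.
  move=> /andP[z1 z2] /andP[z3 z4].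
  have /orP[lij|lij] : (i < j)%N || (j < i)%N by rewrite -neq_ltn.
    have hij : h n * (i + s)%:R <= h n * (j.-1 + s)%:R.
      by apply: hle; rewrite leq_add2r -ltnS prednK// (leq_ltn_trans _ lij).
    by move: (lt_trans (lt_le_trans z2 hij) z3); rewrite ltxx.
  have hji : h n * (j + s)%:R <= h n * (i.-1 + s)%:R.
    by apply: hle; rewrite leq_add2r -ltnS prednK// (leq_ltn_trans _ lij).
  by move: (lt_trans (lt_le_trans z4 hji) z1); rewrite ltxx.
have H3 : \sum_i (y i - x i) < del.
  apply: le_lt_trans Edel; rewrite natr_sum mulr_sumr big_mkcond/= [leRHS]big_mkcond/=.
  apply: ler_sum => i _; rewrite /y /x; case: ifP => [/andP[-> Ki]|_].
    rewrite -mulrBr ler_pM2l// -natrB; last lia.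
    by rewrite ler_nat; lia.
  by rewrite subrr; case: ifP => // _; rewrite mulr1 ltW.
have := ac _ _ _ H1 H2 H3; move=> /ltW; apply: le_trans.
rewrite big_mkcond/=; apply: ler_sum => i _; rewrite /x /y /S; case: ifP => _.
  by rewrite distrC ler_norm.
by rewrite subrr normr0.
Qed.

Let K n (eta : R) := Num.truncn (eta / h n).

Let hK n eta : 0 < eta -> h n * (K n eta)%:R <= eta /\ eta < h n * (K n eta).+1%:R.
Proof.
move=> eta0; have e0 : 0 <= eta / h n by rewrite divr_ge0// ltW.
split; first by rewrite mulrC -ler_pdivlMr// truncn_le.
by rewrite mulrC -ltr_pdivrMr// truncnS_gt.
Qed.

Let hS n (i : nat) : h n * i.+1%:R = h n * i%:R + h n.
Proof. by rewrite -natr1 mulrDr mulr1. Qed.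

(** A difference of consecutive cell masses is at most [h n] times the drop of [k] over two cells,
    whence the factor 2. For a fixed [eta] the level [K n eta] is eventually positive, so the
    singular cell at 0 does not occur. *)
Lemma tail_incr_sum_le (eta e : R) : 0 < eta -> eta <= T -> 0 < e -> exists2 del, 0 < del &
  \forall n \near \oo, forall E : pred nat, h n * (\sum_(i < n.+2 | E i) 1)%N%:R <= del ->
    \sum_(i < n.+2 | E i) tail_incr (al n) (K n eta) i <= 2 * e * h n.
Proof.
move=> eta0 etaT e0.
have eta2 : 0 < eta / 2 by rewrite divr_gt0.
have eT : eta / 2 <= T + 1 by lra.
have [del del0 ac] := kac eta2 eT e0.
exists (del / 2); first by rewrite divr_gt0.
near=> n => E hE.
have hn1 : h n <= 1 by near: n; exact: near_h.
have hneta : h n <= eta / 2 by near: n; apply: near_h; rewrite divr_gt0.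
have [hK1 hK2] := hK n eta0.
have etaK : eta / 2 <= h n * (K n eta)%:R by move: hK2; rewrite hS; lra.
have Edel : h n * (\sum_(i < n.+2 | E i) 1)%N%:R < del by lra.
have K1 : (0 < K n eta)%N.
  by rewrite lt0n; apply/eqP => K0; move: etaK; rewrite K0 mulr0; lra.
have s0 := sel eta0 etaT ac (leq0n 1) hn1 etaK Edel.
have s1 := sel eta0 etaT ac (leqnn 1) hn1 etaK Edel.
apply: (@le_trans _ _ (h n * (\sum_(i < n.+2 | E i && (K n eta < i)%N) (k (h n * (i.-1 + 0)%:R) - k (h n * (i + 0)%:R)) +
  \sum_(i < n.+2 | E i && (K n eta < i)%N) (k (h n * (i.-1 + 1)%:R) - k (h n * (i + 1)%:R))))).
  rewrite -big_split/= mulr_sumr big_mkcond/= [leRHS]big_mkcond/=.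
  apply: ler_sum => i _; case: (E i) => //=; rewrite /tail_incr.
  case: leqP => Ki //.
  rewrite !addn0 addn1 prednK ?(leq_trans _ Ki)// addrA subrK addn1.
  have i1 : (0 < i.-1)%N by rewrite -subn1 subn_gt0 (leq_ltn_trans K1 Ki).
  rewrite mulrBr lerB//; rewrite mulrC.
    exact: (cell_mass_ub kk kdec T0 n i1).
  exact: (cell_mass_lb kk kdec T0 n i).
rewrite mulrC ler_pM2r//; lra.
Unshelve. all: by end_near. Qed.

Let AE n y : y <= T -> A n y = h n * \sum_(j < n.+2 | h n * j%:R <= y) u n j.
Proof.
move=> yT; apply: (@grid_cdfE _ _ (u n) (h0 n)).
by rewrite -/(h n) hS hT (le_lt_trans yT)// ltrDl.
Qed.

Let count_le n (x y : R) : 0 <= x -> x <= y ->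
  h n * (\sum_(j < n.+2 | ((x < h n * j%:R) && (h n * j%:R <= y))%R) 1)%N%:R <= y - x + h n.
Proof.
move=> x0 xy; have y0 : 0 <= y by exact: le_trans xy.
have hx : 0 <= x / h n by rewrite divr_ge0// ltW.
have hy : 0 <= y / h n by rewrite divr_ge0// ltW.
pose a := Num.truncn (x / h n); pose b := Num.truncn (y / h n).
have E (j : nat) : (x < h n * j%:R) && (h n * j%:R <= y) = (a < j <= b)%N.
  rewrite /a /b truncn_ge_nat// (ltnNge a) truncn_ge_nat//.
  by rewrite !ler_pdivlMr// !(mulrC j%:R) -ltNge.
have -> : (\sum_(j < n.+2 | ((x < h n * j%:R) && (h n * j%:R <= y))%R) 1 = \sum_(j < n.+2 | (a < j <= b)) 1)%N.
  by apply: eq_bigl => j; exact: E.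
rewrite count_interval.
have ab : (a <= b)%N.
  by rewrite /b truncn_ge_nat// (le_trans (_ : _ <= x / h n)) ?truncn_le// ler_pM2r ?invr_gt0.
apply: (@le_trans _ _ (h n * (b - a)%N%:R)).
  by rewrite ler_pM2l// ler_nat; apply: leq_trans (leq_sub2r _ (geq_minr _ _)) _; rewrite subSS.
rewrite natrB// mulrBr.
have h1 : h n * b%:R <= y by rewrite mulrC -ler_pdivlMr// truncn_le.
have h2 : x < h n * a.+1%:R by rewrite mulrC -ltr_pdivrMr// truncnS_gt.
by rewrite hS in h2; rewrite -addrA (_ : - x + h n = - (x - h n)) ?lerB ?lerBlDr ?(ltW h2)// opprB addrC.
Qed.

Let sum_u n : h n * \sum_(j < n.+2) u n j = A n T.
Proof.
rewrite AE//; congr (_ * _); apply/esym/eq_bigl => j.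
by rewrite -(hT n) ler_pM2l// ler_nat -ltnS ltn_ord.
Qed.

Let aK n eta : 0 < eta -> eta <= T -> h n <= eta -> 0 < k (2 * eta) ->
  k (2 * eta) * h n <= al n (K n eta).
Proof.
move=> eta0 etaT hn k2; have [h1 _] := hK n eta0.
apply: le_trans (cell_mass_lb kk kdec T0 n (K n eta)).
rewrite ler_pM2r//; apply: kdec; first by rewrite mulr_gt0// ltr0n.
by rewrite -/(h n) hS; lra.
Qed.

Let kbig c : exists2 eta, 0 < eta & eta <= T /\ c <= k (2 * eta).
Proof.
have [x x0 kx] := kinf c; exists (Num.min (x / 2) T); first by rewrite lt_min divr_gt0.
split; first by rewrite ge_min lexx orbT.
apply: le_trans kx _; apply: kdec; first by rewrite mulr_gt0 ?ltr0n// lt_min divr_gt0.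
have : Num.min (x / 2) T <= x / 2 by rewrite ge_min lexx.
by lra.
Qed.

Let u_sum_le n eta D (m : nat) (E : pred nat) : 0 < eta -> eta <= T -> h n <= eta -> 0 < k (2 * eta) ->
  (forall E : pred nat, (\sum_(i < n.+2 | E i) 1 <= m)%N ->
     \sum_(i < n.+2 | E i) tail_incr (al n) (K n eta) i <= D * h n) ->
  (\sum_(i < n.+2 | E i) 1 <= m)%N ->
  h n * \sum_(i < n.+2 | E i) u n i <= (1 + D * A n T) / k (2 * eta).
Proof.
move=> eta0 etaT hn k2 HD Em.
have ak := aK eta0 etaT hn k2.
have aK0 : 0 < al n (K n eta) by apply: lt_le_trans ak; rewrite mulr_gt0.
have D0 : 0 <= D.
  have := HD pred0; rewrite !big_pred0// => /(_ isT); by rewrite pmulr_lge0.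
have := renewal_sum_le aK0 (@cell_mass_dec _ _ _ kk kdec T0 n)
  (renewal_massE kk kdec kinf T0 n) HD Em.
rewrite -/(u n) -(ler_pM2l (h0 n)) => /le_trans; apply.
have -> : D * h n * \sum_(j < n.+2) u n j = D * A n T by rewrite -mulrA sum_u.
rewrite mulrCA; apply: ler_wpM2l.
  rewrite addr_ge0// mulr_ge0//.
  by have [_ A0 _ _] := renewal_approx_cdf_like kk kdec kinf T0 n; exact: A0.
by rewrite ler_pdivrMr// ler_pdivlMl.
Qed.

(** The grid points lying in the given intervals form a small set, to which [renewal_sum_le] applies
    with constants that do not depend on the mesh; the bound then passes to the limit. *)
Lemma renewal_abs_cont : abs_cont 0 T U.
Proof.
move=> e e0.
(* With [C] an eventual bound of [A n T], the constant [D] will be [1 / C]; then [1 + D * A n T] is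
   at most 2, and dividing by [k (2 * eta)] gives at most [e / 2]. *)
have [eta eta0 [etaT keta]] := kbig (4 / e).
have k2 : 0 < k (2 * eta) by apply: lt_le_trans keta; rewrite divr_gt0.
pose C := U T + 1.
have UT0 : 0 <= U T by have [_ ? _ _] := cU.
have C0 : 0 < C by rewrite ltr_wpDl.
have e'0 : 0 < (2 * C)^-1 by rewrite invr_gt0 mulr_gt0.
have [del del0 HD] := tail_incr_sum_le eta0 etaT e'0.
(* Counting grid points adds up to one mesh per interval, which costs a second [del / 4] once the
   mesh is small compared with the number of intervals. *)
exists (del / 4); first by rewrite divr_gt0.
move=> N x y H1 H2 H3.
have Und : {homo U : x y / x <= y} by case: cU.
rewrite (eq_bigr (fun i => U (y i) - U (x i))); last first.
  by move=> i _; rewrite ger0_norm// subr_ge0 Und//; have [_ []] := H1 i.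
have cv : \sum_(i < N) (A n (y i) - A n (x i)) @[n --> \oo] --> \sum_(i < N) (U (y i) - U (x i)).
  by apply: cvg_sum_seq => i; apply: cvgB; exact: ctA.
apply: (@le_lt_trans _ _ (e / 2)); last by lra.
have hAC : \forall n \near \oo, A n T <= C.
  by have /cvgr_le/(_ C) := @ctA T; apply; rewrite ltrDl.
apply: (ler_cvg_to cv (cvg_cst (e / 2) : _ --> _)).
near=> n.
have hHD : forall E : pred nat, h n * (\sum_(i < n.+2 | E i) 1)%N%:R <= del ->
    \sum_(i < n.+2 | E i) tail_incr (al n) (K n eta) i <= 2 * (2 * C)^-1 * h n.
  by near: n.
have hn : h n <= eta by near: n; exact: near_h.
have hn4 : h n <= del / 4 by near: n; apply: near_h; rewrite divr_gt0.
have hnN : h n <= del / 4 / N.+1%:R by near: n; apply: near_h; rewrite !divr_gt0.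
have AC : A n T <= C by near: n.
pose m := Num.truncn (del / h n).
have dh0 : 0 <= del / h n by rewrite divr_ge0// ltW.
have mE (i : nat) : (i <= m)%N = (h n * i%:R <= del).
  by rewrite truncn_ge_nat// ler_pdivlMr// mulrC.
pose E (j : nat) := [exists i : 'I_N, (x i < h n * j%:R) && (h n * j%:R <= y i)].
have Em : (\sum_(j < n.+2 | E j) 1 <= m)%N.
  rewrite mE.
  apply: (@le_trans _ _ (\sum_(i < N) h n * (\sum_(j < n.+2 | ((x i < h n * j%:R) && (h n * j%:R <= y i))%R) 1)%N%:R)).
    rewrite -mulr_sumr ler_pM2l// -natr_sum ler_nat.
    under [leqRHS]eq_bigr do rewrite big_mkcond/=.
    rewrite exchange_big/= big_mkcond/=; apply: leq_sum => j _.
    case: ifP => // /existsP[i hi]; rewrite (bigD1 i)//= hi.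
    exact: leq_addr.
  apply: (@le_trans _ _ (\sum_(i < N) (y i - x i + h n))).
    by apply: ler_sum => i _; have [x0 [xy _]] := H1 i; exact: count_le.
  rewrite big_split/= sumr_const card_ord -mulr_natr.
  have : h n * N%:R <= del / 4.
    apply: (@le_trans _ _ (h n * N.+1%:R)); first by rewrite ler_pM2l// ler_nat.
    by rewrite -ler_pdivlMr.
  by move=> hN; apply: le_trans (lerD (ltW H3) hN) _; lra.
have HD' : forall E : pred nat, (\sum_(i < n.+2 | E i) 1 <= m)%N ->
     \sum_(i < n.+2 | E i) tail_incr (al n) (K n eta) i <= (2 * (2 * C)^-1) * h n.
  by move=> F Fm; apply: hHD; rewrite -mE.
apply: (@le_trans _ _ (h n * \sum_(j < n.+2 | E j) u n j)).
  have Ai i : A n (y i) - A n (x i) = h n * \sum_(j < n.+2 | (x i < h n * j%:R) && (h n * j%:R <= y i)) u n j.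
    have [x0 [xy yT]] := H1 i.
    rewrite !AE//; last exact: le_trans yT.
    rewrite -mulrBr; congr (_ * _); rewrite (bigID (fun j : 'I_n.+2 => h n * j%:R <= x i))/=.
    rewrite [X in X + _ - _](_ : _ = \sum_(j < n.+2 | h n * j%:R <= x i) u n j); last first.
      apply: eq_bigl => j; case: (leP (h n * j%:R) (x i)) => hj; last by rewrite andbF.
      by rewrite (le_trans hj xy).
    by rewrite addrAC subrr add0r; apply: eq_bigl => j; rewrite -ltNge andbC.
  under eq_bigr do rewrite Ai.
  rewrite -mulr_sumr ler_pM2l//.
  under eq_bigr do rewrite big_mkcond/=.
  rewrite exchange_big/= [leRHS]big_mkcond/=; apply: ler_sum => j _.
  case: ifPn => [/existsP[i hi]|]; last first.
    rewrite negb_exists => /forallP nE; rewrite big1// => i _.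
    by rewrite (negbTE (nE i)).
  rewrite (bigD1 i)//= hi big1 ?addr0// => l li.
  case: ifP => // hl.
  have /trivIsetP/(_ l i Logic.I Logic.I li) := H2.
  move: hi hl => /andP[i1 i2] /andP[l1 l2].
  set z := h n * j%:R in i1 i2 l1 l2.
  (* The grid point [z] may be the right end of both intervals, whereas disjointness is known for
     open ones; a point slightly to the left of [z] gives the contradiction. *)
  pose w := (Num.max (x i) (x l) + z) / 2.
  have mz : Num.max (x i) (x l) < z by rewrite gt_max i1.
  have m1 : x i <= Num.max (x i) (x l) by rewrite le_max lexx.
  have m2 : x l <= Num.max (x i) (x l) by rewrite le_max lexx orbT.
  move=> /seteqP[/(_ w) + _] => h3; exfalso; apply: h3 => /=.
  rewrite !in_itv/= /w.
  by split; apply/andP; split; lra.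
apply: le_trans (u_sum_le eta0 etaT hn k2 HD' Em) _.
rewrite ler_pdivrMr//.
have c1 : 2 * (2 * C)^-1 * A n T <= 1.
  by rewrite (_ : 2 * (2 * C)^-1 = C^-1) ?(mulrC C^-1) ?ler_pdivrMr ?mul1r//; field; rewrite gt_eqF.
have : e / 2 * (4 / e) <= e / 2 * k (2 * eta) by rewrite ler_pM2l// divr_gt0.
rewrite (_ : e / 2 * (4 / e) = 2); last by field; rewrite gt_eqF.
by lra.
Unshelve. all: by end_near. Qed.

Let cA n : cdf_like (A n). Proof. exact: renewal_approx_cdf_like. Qed.

Let cvg_rconv q t : is_kernel q -> rconv q (A n) t @[n --> \oo] --> rconv q U t.
Proof.
move=> kq; have [mq q0 qN Lq] := kq.
have [N _ hN] : \forall n \near \oo, A n t <= U t + 1.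
  by have /cvgr_le/(_ (U t + 1)) := @ctA t; apply; rewrite ltrDl.
have UT0 : 0 <= U t + 1 by have [_ V0 _ _] := cU; rewrite addr_ge0.
rewrite -(cvg_shiftn N).
have hI : (\int[mu]_x (q x * A (n + N)%N (t - x))%:E @[n --> \oo] -->
    \int[mu]_x (q x * U (t - x))%:E)%E.
  apply: (@dominated_cvg _ _ _ mu setT measurableT _ _ (fun x => (q x * ((U t + 1) * heaviside (t - x)))%:E)).
  - move=> n; apply/measurable_EFinP; apply: measurable_conv_integrand => //.
    exact: cdf_like_measurable.
  - move=> x _; apply/fine_cvgP; split; first exact: nearW.
    rewrite /comp /=; apply: cvgM; first exact: cvg_cst.
    by have := @ctA (t - x); rewrite -(cvg_shiftn N).
  - by [].
  - apply/integrableP; split.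
      apply/measurable_EFinP; apply: measurable_funM => //; apply: measurable_funM => //.
      exact: measurable_heaviside_sub.
    have cH := cdf_likeZ UT0 (@heaviside_cdf_like R).
    have := convolution_fin_num t kq cH; have [_ H0 _ _] := cH.
    rewrite ge0_fin_numE; last exact: convolution_ge0.
    by under eq_integral => x _ do rewrite gee0_abs ?lee_fin ?mulr_ge0 ?ler0n//.
  - move=> n x _; have [_ An0 AnN _] := cA (n + N)%N.
    rewrite gee0_abs lee_fin ?(mulr_ge0 (q0 x) (An0 _))// /heaviside subr_ge0.
    have [x0|x0] := leP x 0; first by rewrite qN// !mul0r.
    have [xt|xt] := leP x t; last by rewrite AnN ?subr_lt0// !mulr0.
    rewrite mulr1 ler_wpM2l//; apply: le_trans (hN (n + N)%N _); last exact: leq_addl.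
    by have [And _ _ _] := cA (n + N)%N; apply: And; rewrite gerBl ltW.
move: hI; rewrite -[X in _ --> X -> _]/(convolution q U t) -(rconvE t kq cU).
rewrite (_ : (fun n => _) = (fun n => (rconv q (A (n + N)%N) t)%:E)); last first.
  by apply/funext => n; rewrite rconvE.
by move=> /fine_cvgP[_].
Qed.

(** What a truncation of [k] at level [k del] cuts off. As [k] is nonincreasing it is supported in
    ]0, del[; its cell masses are the sequence [x] of [renewal_concentration]. *)
Definition excess (del x : R) : R := Num.max (k x - k del) 0.

Lemma excess_kernel del : is_kernel (excess del).
Proof.
have [mk _ kN Lk] := kk.
have me : measurable_fun setT (excess del).
  by apply: measurable_maxr => //; exact: measurable_funB.
have e0 (x : R) : 0 <= excess del x by rewrite le_max lexx orbT.
split => //.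
- by move=> x x0; rewrite /excess kN// sub0r max_r// oppr_le0.
- move=> s s0; have := Lk s s0; rewrite !ge0_fin_numE ?laplace_ge0//.
  apply: le_lt_trans; apply: le_laplace => // x.
  by rewrite e0 /excess ge_max k0 andbT gerBl k0.
Qed.

Let excess_le del x : excess del x <= k x.
Proof. by rewrite /excess ge_max k0 andbT gerBl k0. Qed.

Let excess0 del x : 0 < del -> del <= x -> excess del x = 0.
Proof. by move=> d0 dx; rewrite /excess max_r// subr_le0 kdec. Qed.

Let excess_total del t : 0 < del -> primitive (excess del) t <= primitive k del.
Proof.
move=> d0; have ke := excess_kernel del; have [me e0 _ _] := ke; have [mk _ _ _] := kk.
rewrite -lee_fin !primitiveE//; apply: le_integral_nn.
- by apply: measurable_funM => //; exact: measurable_heaviside_sub.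
- by apply: measurable_funM => //; exact: measurable_heaviside_sub.
- by move=> x; rewrite mulr_ge0// ler0n.
- move=> x; have [dx|xd] := leP del x; first by rewrite excess0// mul0r mulr_ge0// ler0n.
  apply: ler_pM; rewrite ?e0 ?excess_le ?ler0n//.
  by rewrite /heaviside ler_nat (subr_ge0 x del) (ltW xd); case: (0 <= t - x).
Qed.

Let excess_cst del a b : 0 < del -> del <= a -> a <= b ->
  primitive (excess del) b = primitive (excess del) a.
Proof.
move=> d0 da ab; have ke := excess_kernel del; apply/EFin_inj; rewrite (primitiveB ke ab).
rewrite integral0_eq ?adde0// => x _; rewrite indicE.
have [/[!inE]/=|_] := boolP (x \in _); last by rewrite mulr0.
by rewrite in_itv/= => /andP[ax _]; rewrite excess0 ?mul0r// (le_trans da)// ltW.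
Qed.

(* Uniformly on [t1, T], the small jumps contribute little to [k * U = id]. *)
Lemma renewal_concentrated t1 e : 0 < t1 -> t1 <= T -> 0 < e -> exists2 del, 0 < del &
  forall a b, t1 <= a -> a <= b -> b <= T ->
    rconv (excess del) U b - rconv (excess del) U a <= e * (b - a).
Proof.
move=> t10 t1T e0.
pose C := U T + 1.
have UT0 : 0 <= U T by have [_ ? _ _] := cU.
have C0 : 0 < C by rewrite ltr_wpDl.
(* Each of the three terms of [renewal_concentration] has to be at most [e / 3]. The first is at
   most the primitive of [k] at [2 * eta] over [t1 / 4], whence this constant. The last is at most
   [2 / k (2 * eta)], whence [6 / e] below, where the added 1 ensures [1 <= k (2 * eta)]. The Markov
   condition for the middle one dictates the bound [e * del' / (12 * C)]. *)
have e1 : 0 < e * t1 / 12 by rewrite divr_gt0 ?mulr_gt0.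
have [x1 x10 Mx1] := primitive_cvg0 kk e1.
have [eta' eta'0 [eta'T keta']] := kbig (6 / e + 1).
pose eta := Num.min eta' (x1 / 2).
have eta0 : 0 < eta by rewrite lt_min eta'0 divr_gt0.
have etaT : eta <= T by rewrite (le_trans _ eta'T)// ge_min lexx.
have etax1 : 2 * eta <= x1.
  have : eta <= x1 / 2 by rewrite ge_min lexx orbT.
  by rewrite ler_pdivlMr// mulrC.
have keta : 6 / e + 1 <= k (2 * eta).
  apply: le_trans keta' _; apply: kdec; first by rewrite mulr_gt0.
  by rewrite ler_pM2l// ge_min lexx.
have k1 : 1 <= k (2 * eta) by apply: le_trans keta; rewrite lerDr divr_ge0// ltW.
have k2 : 0 < k (2 * eta) by apply: lt_le_trans k1.
have k6 : 6 / e <= k (2 * eta) by apply: le_trans keta; rewrite lerDl.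
have [del' del'0 HD] := tail_incr_sum_le eta0 etaT ltr01.
have e2 : 0 < e * del' / (12 * C) by rewrite divr_gt0 ?mulr_gt0.
have [x2 x20 Mx2] := primitive_cvg0 kk e2.
pose del := Num.min x2 (Num.min eta (t1 / 8)).
have d0 : 0 < del by rewrite lt_min x20/= lt_min eta0 divr_gt0.
have dx2 : del <= x2 by rewrite ge_min lexx.
have deta : del <= eta by rewrite ge_min (ge_min eta) lexx/= orbT.
have dt1 : del <= t1 / 8 by rewrite ge_min (ge_min (t1 / 8)) lexx/= !orbT.
have Mdel : primitive k del * C <= e * del' / 12.
  apply: (@le_trans _ _ (e * del' / (12 * C) * C)).
    by rewrite ler_pM2r// (le_trans _ Mx2)// primitive_nd.
  by rewrite le_eqVlt; apply/orP; left; apply/eqP; field; rewrite gt_eqF.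
have ke := excess_kernel del; have [me ex0 _ _] := ke.
have Meta : primitive k (2 * eta) <= e * t1 / 12 by apply: le_trans Mx1; exact: primitive_nd.
exists del => // a b ta ab bT.
(* The term [e * (2 * h n)] pays for rounding [a] down and [b] up to the grid; it vanishes in the
   limit. *)
have cv : rconv (excess del) (A n) b - rconv (excess del) (A n) a - e * (2 * h n) @[n --> \oo] -->
    rconv (excess del) U b - rconv (excess del) U a - e * (2 * 0).
  apply: cvgB; first by apply: cvgB; exact: cvg_rconv.
  by apply: cvgM; [exact: cvg_cst|apply: cvgM => //; exact: cvg_cst].
rewrite !mulr0 subr0 in cv.
have hAC : \forall n \near \oo, A n T <= C.
  by have /cvgr_le/(_ C) := @ctA T; apply; rewrite ltrDl.
apply: (ler_cvg_to cv (cvg_cst (e * (b - a)) : _ --> _)).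
near=> n.
have hHD : forall E : pred nat, h n * (\sum_(i < n.+2 | E i) 1)%N%:R <= del' ->
    \sum_(i < n.+2 | E i) tail_incr (al n) (K n eta) i <= 2 * 1 * h n.
  by near: n.
have hn : h n <= eta by near: n; exact: near_h.
have hnd : h n <= del' / 2 by near: n; apply: near_h; rewrite divr_gt0.
have hnt : h n <= t1 / 8 by near: n; apply: near_h; rewrite divr_gt0.
have AC : A n T <= C by near: n.
pose m := Num.truncn (del' / h n).
have dh0 : 0 <= del' / h n by rewrite divr_ge0// ltW.
have mE (i : nat) : (i <= m)%N = (h n * i%:R <= del').
  by rewrite truncn_ge_nat// ler_pdivlMr// mulrC.
have mh : del' / 2 <= h n * m%:R.
  have : del' < h n * m.+1%:R by rewrite mulrC -ltr_pdivrMr// truncnS_gt.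
  by rewrite hS; lra.
pose J := Num.truncn (del / h n).
have dd0 : 0 <= del / h n by rewrite divr_ge0// ltW.
have JE (i : nat) : (i <= J)%N = (h n * i%:R <= del).
  by rewrite truncn_ge_nat// ler_pdivlMr// mulrC.
pose xx (i : nat) := primitive (excess del) (h n * i.+1%:R) - primitive (excess del) (h n * i%:R).
have hle (i j : nat) : (i <= j)%N -> h n * i%:R <= h n * j%:R by move=> ij; rewrite ler_pM2l// ler_nat.
have ak := aK eta0 etaT hn k2.
have aK0 : 0 < al n (K n eta) by apply: lt_le_trans ak; rewrite mulr_gt0.
have xx0 i : 0 <= xx i <= al n i.
  rewrite subr_ge0 (primitive_nd ke (hle _ _ (leqnSn i)))/=.
  by apply: (primitiveB_le ke kk (hle _ _ (leqnSn i))); exact: excess_le.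
have xxJ i : (J < i)%N -> xx i = 0.
  by rewrite ltnNge JE -ltNge => Ji; rewrite /xx (excess_cst d0 (ltW Ji) (hle _ _ (leqnSn i))) subrr.
have hJ : h n * J%:R <= del by rewrite -JE.
have JK : (J <= K n eta)%N.
  rewrite /K truncn_ge_nat ?(divr_ge0 (ltW eta0) (ltW (h0 n)))//.
  by rewrite ler_pdivlMr// mulrC (le_trans hJ).
have step l : t1 - h n <= h n * l%:R -> (l <= n.+1)%N -> dconv xx (u n) l <= e.
  move=> lt1 ln.
  have tl : t1 / 2 <= h n * l%:R by lra.
  have Jl : (J < l)%N.
    rewrite ltnNge; apply/negP => lJ; have := hle _ _ lJ; lra.
  have HDl : forall E : pred nat, (\sum_(i < l.+1 | E i) 1 <= m)%N ->
      \sum_(i < l.+1 | E i) tail_incr (al n) (K n eta) i <= 2 * 1 * h n.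
    move=> E Em.
    rewrite (big_ord_widen_cond n.+2 E (tail_incr (al n) (K n eta)))//.
    apply: (hHD (fun i => E i && (i < l.+1)%N)).
    by rewrite -mE -(big_ord_widen_cond n.+2 E (fun=> 1%N)).
  have sum_xx : \sum_(i < l.+1) xx i = primitive (excess del) (h n * l.+1%:R).
    elim: (l.+1) => [|i ih]; first by rewrite big_ord0 mulr0 primitive_le0.
    by rewrite big_ord_recr/= ih /xx addrC subrK.
  have sum_al : \sum_(i < (K n eta).+1) al n i = primitive k (h n * (K n eta).+1%:R).
    elim: ((K n eta).+1) => [|i ih]; first by rewrite big_ord0 mulr0 primitive_le0.
    by rewrite big_ord_recr/= ih /al /cell_mass -/(h n) addrC subrK.
  have uS : h n * \sum_(i < l.+1) u n i <= C.
    apply: le_trans AC; rewrite -sum_u ler_pM2l//; exact: ler_sum_ord.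
  have cond : (\sum_(i < l.+1) xx i) * (\sum_(i < l.+1) u n i) <= e / 3 * m%:R.
    rewrite -(ler_pM2l (h0 n)) mulrCA.
    apply: (@le_trans _ _ (primitive k del * C)).
      rewrite ler_pM//; first by rewrite sumr_ge0// => i _; case/andP: (xx0 i).
        by rewrite mulr_ge0 ?(ltW (h0 n))// sumr_ge0.
      by rewrite sum_xx excess_total.
    apply: le_trans Mdel _; rewrite mulrCA.
    apply: (@le_trans _ _ (e / 3 * (del' / 2))); last by rewrite ler_pM2l// divr_gt0.
    rewrite (_ : e * del' / 12 = e / 3 * (del' / 4)); last by field.
    by rewrite ler_pM2l ?divr_gt0//; lra.
  have e30 : 0 < e / 3 by rewrite divr_gt0.
  have := renewal_concentration aK0 (@cell_mass_dec _ _ _ kk kdec T0 n) (cell_mass_ge0 kk T0 n)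
    (renewal_massE kk kdec kinf T0 n) HDl xx0 xxJ JK Jl e30 cond.
  move=> /le_trans; apply.
  have b1 : (\sum_(i < (K n eta).+1) al n i) / (al n (K n eta) * (l - J)%:R) <= e / 3.
    have lJ0 : 0 < (l - J)%:R :> R by rewrite ltr0n subn_gt0.
    rewrite ler_pdivrMr ?mulr_gt0//.
    apply: (@le_trans _ _ (e * t1 / 12)).
      rewrite sum_al; apply: le_trans Meta; apply: primitive_nd => //.
      have [hK1 _] := hK n eta0; rewrite hS.
      by apply: (le_trans (lerD hK1 hn)); rewrite mulr_natl mulr2n.
    rewrite (_ : e * t1 / 12 = e / 3 * (t1 / 4)); last by field.
    rewrite ler_pM2l//.
    apply: (@le_trans _ _ (h n * (l - J)%:R)).
      rewrite natrB 1?ltnW// mulrBr; lra.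
    by rewrite ler_pM2r// (le_trans _ ak)// ler_peMl// ltW.
  have b2 : 2 * 1 * h n / al n (K n eta) <= e / 3.
    rewrite ler_pdivrMr// mulr1.
    apply: (@le_trans _ _ (e / 3 * (k (2 * eta) * h n))); last by rewrite ler_pM2l.
    rewrite (mulrA (e / 3)) ler_pM2r//.
    have : e / 3 * (6 / e) <= e / 3 * k (2 * eta) by rewrite ler_pM2l.
    by rewrite (_ : e / 3 * (6 / e) = 2)//; field; rewrite gt_eqF.
  apply: (@le_trans _ _ (e / 3 + e / 3 + e / 3)); first by rewrite !lerD.
    by rewrite le_eqVlt; apply/orP; left; apply/eqP; field.
pose ma := Num.truncn (a / h n); pose mb := (Num.truncn (b / h n)).+1.
have a0 : 0 <= a by rewrite (le_trans _ ta)// ltW.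
have b0 : 0 <= b by exact: le_trans ab.
have ah0 : 0 <= a / h n by rewrite divr_ge0// ltW.
have bh0 : 0 <= b / h n by rewrite divr_ge0// ltW.
have ma1 : h n * ma%:R <= a by rewrite mulrC -ler_pdivlMr// truncn_le.
have ma2 : a < h n * ma.+1%:R by rewrite mulrC -ltr_pdivrMr// truncnS_gt.
have mb1 : b <= h n * mb%:R by rewrite mulrC -ler_pdivrMr// ltW// truncnS_gt.
have mb2 : h n * mb.-1%:R <= b by rewrite mulrC -ler_pdivlMr// truncn_le.
have mab : (ma <= mb)%N.
  rewrite -(ler_nat R) -(ler_pM2l (h0 n)); exact: le_trans ma1 (le_trans ab mb1).
have grid j : rconv (excess del) (A n) (h n * j%:R) = h n * \sum_(l < j) dconv xx (u n) l.
  exact: (rconv_grid (h0 n) (u0 n) j ke (cA n)).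
have d1 : rconv (excess del) (A n) b <= rconv (excess del) (A n) (h n * mb%:R) by exact: rconv_nd.
have d2 : rconv (excess del) (A n) (h n * ma%:R) <= rconv (excess del) (A n) a by exact: rconv_nd.
have d3 : rconv (excess del) (A n) (h n * mb%:R) - rconv (excess del) (A n) (h n * ma%:R)
    <= e * (h n * mb%:R - h n * ma%:R).
  rewrite !grid -mulrBr -!(big_mkord xpredT (dconv xx (u n))).
  rewrite (big_cat_nat (n := ma))//= addrAC subrr add0r.
  rewrite -mulrBr mulrCA ler_pM2l// -natrB// mulr_natr -sumr_const_nat big_nat_cond [leRHS]big_nat_cond.
  apply: ler_sum => l /andP[/andP[al1 lb] _]; apply: step.
    by apply: (@le_trans _ _ (h n * ma%:R)); [rewrite hS in ma2; lra|exact: hle].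
  rewrite -(ler_nat R) -(ler_pM2l (h0 n)) hT.
  by apply: le_trans bT; apply: le_trans mb2; apply: hle.
have d4 : h n * mb%:R - h n * ma%:R <= b - a + 2 * h n.
  by move: mb2 ma2; rewrite -[mb]/(mb.-1.+1) !hS; lra.
have d5 : e * (h n * mb%:R - h n * ma%:R) <= e * (b - a + 2 * h n) by rewrite ler_pM2l.
by rewrite lerBlDr -mulrDr; lra.
Unshelve. all: by end_near. Qed.

End concentration.

(** * Densities of absolutely continuous functions *)

Section density.
Context {R : realType} (X : R -> R) (T : R).
Notation mu := (@lebesgue_measure R).
Hypotheses (T0 : 0 < T) (Xnd : {homo X : x y / x <= y}) (XN : forall x, x <= 0 -> X x = 0).
Hypothesis Xac : abs_cont 0 T X.

(** Freezing [X] beyond [T] makes its Stieltjes measure finite. *)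
Let F (y : R) : R := X (Num.min y T).

Let Fnd : nondecreasing F.
Proof. by move=> x y xy; apply: Xnd; rewrite le_min !ge_min xy lexx orbT. Qed.

(** Projection onto [0, T]. It does not increase lengths and keeps disjoint intervals disjoint, so
    absolute continuity on [0, T] transfers to [F] on the whole line. *)
Let clip (z : R) := Num.max 0 (Num.min z T).

Let FE z : F z = X (clip z).
Proof. by rewrite /F /clip; case: leP => // z0; rewrite !XN// ltW. Qed.

Let clip_nd x y : x <= y -> clip x <= clip y.
Proof. by move=> xy; rewrite /clip ge_max !le_max lexx/= le_min !ge_min xy lexx !orbT. Qed.

Let clip_le x y : x <= y -> clip y - clip x <= y - x.
Proof.
by move=> xy; rewrite /clip; case: (leP x T) => xT; case: (leP y T) => yT;
  case: (leP 0 y) => y0; case: (leP 0 x) => x0; case: (leP 0 T) => T'; move: T0; lra.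
Qed.

Let clip_gt x z : clip x < z -> z <= T -> x < z.
Proof.
rewrite /clip gt_max gt_min => /andP[_ /orP[//|Tz]] zT.
by have := lt_le_trans Tz zT; rewrite ltxx.
Qed.

Let clip_lt y z : z < clip y -> 0 <= z -> z < y.
Proof.
rewrite /clip lt_max lt_min => /orP[z0 z1|/andP[]//].
by have := lt_le_trans z0 z1; rewrite ltxx.
Qed.

Let clip0 x : 0 <= clip x. Proof. by rewrite /clip le_max lexx. Qed.

Let clipT x : clip x <= T. Proof. by rewrite /clip ge_max (ltW T0) ge_min lexx orbT. Qed.

Let F_ac e : 0 < e -> exists2 del, 0 < del &
  forall n (x y : nat -> R), (forall i, x i <= y i) ->
  trivIset setT (fun i => `]x i, y i[%classic) ->
  \sum_(i < n) (y i - x i) < del -> \sum_(i < n) (F (y i) - F (x i)) < e.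
Proof.
move=> e0; have [del del0 h] := Xac e0; exists del => // n x y xy tr sd.
apply: (@le_lt_trans _ _ (\sum_(i < n) `|X (clip (y i)) - X (clip (x i))|)).
  by apply: ler_sum => i _; rewrite !FE; exact: ler_norm.
apply: (h n (fun i : 'I_n => clip (x i)) (fun i : 'I_n => clip (y i))).
- by move=> i; rewrite clip0 clipT clip_nd.
- move=> i j _ _ [z [/=]]; rewrite !in_itv/= => /andP[a1 a2] /andP[b1 b2].
  have z0 : 0 <= z by apply/ltW/(le_lt_trans (clip0 _) a1).
  have zT : z <= T by apply/ltW/(lt_le_trans a2 (clipT _)).
  apply/val_inj; apply: (tr (val i) (val j) Logic.I Logic.I); exists z; split; rewrite /= in_itv/=.
    by apply/andP; split; [exact: clip_gt a1 zT|exact: clip_lt a2 z0].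
  by apply/andP; split; [exact: clip_gt b1 zT|exact: clip_lt b2 z0].
- by apply: le_lt_trans sd; apply: ler_sum => i _; exact: clip_le.
Qed.

Let F_small e : 0 < e -> exists2 del, 0 < del &
  forall x y, x <= y -> y - x < del -> F y - F x < e.
Proof.
move=> e0; have [del del0 h] := F_ac e0; exists del => // x y xy yx.
pose y' (i : nat) := if i is 0%N then y else x.
have := h 1%N (fun=> x) y'; rewrite !big_ord1 /y'; apply => //.
  by case.
move=> [|i] [|j] _ _ //= [z [/=]]; rewrite !in_itv/=.
- by move=> _ /andP[/lt_trans h1 /h1]; rewrite ltxx.
- by move=> /andP[/lt_trans h1 /h1]; rewrite ltxx.
- by move=> /andP[/lt_trans h1 /h1]; rewrite ltxx.
Qed.

Let Frc : right_continuous F.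
Proof.
move=> x; apply/cvgrPdist_lt => e e0; have [del del0 h] := F_small e0.
near=> y; rewrite distrC ger0_norm ?subr_ge0; last by apply: Fnd; near: y; exact: nbhs_right_ge.
apply: h; first by near: y; exact: nbhs_right_ge.
by rewrite ltrBlDl; near: y; apply: nbhs_right_lt; rewrite ltrDl.
Unshelve. all: by end_near. Qed.

Let FC : cumulative R R := HB.pack F (isCumulative.Build R _ R F Fnd Frc).
Notation m := (lebesgue_stieltjes_measure FC).

Let mitv a b : a <= b -> m `]a, b]%classic = (F b - F a)%:E.
Proof.
move=> ab; rewrite -(@wlength_itv_bnd R FC a b false false ab).
rewrite /lebesgue_stieltjes_measure /measure_extension.
by rewrite measurable_mu_extE//; exact: is_ocitv.
Qed.

Let m_bigcup (A : (set (measurableTypeR R))^nat) c : (forall n, measurable (A n)) ->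
  nondecreasing_seq A -> (forall n, (m (A n) <= c)%E) -> (m (\bigcup_n A n) <= c)%E.
Proof.
move=> mA ndA Ac.
have cv := nondecreasing_cvg_mu (mu := m) mA (bigcupT_measurable _ mA) ndA.
have hl : limn (fun n => m (A n)) = m (\bigcup_n A n) by exact: (cvg_lim _ cv).
by rewrite -hl; apply: lime_le; [exact: cvgP cv|exact: nearW].
Qed.

Let m_setT : (m setT <= (X T)%:E)%E.
Proof.
rewrite (_ : setT = \bigcup_(n : nat) `]- n%:R, n%:R]%classic :> set (measurableTypeR R)); last first.
  apply/seteqP; split => // x _; exists (Num.truncn `|x|).+1 => //=.
  have := truncnS_gt `|x|; rewrite ltr_norml in_itv/= => /andP[-> h]; exact: ltW.
apply: m_bigcup.
- by move=> n; exact: measurable_itv.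
- move=> a b ab; apply/subsetPset => x /=; rewrite !in_itv/= => /andP[x1 x2].
  rewrite (le_trans x2) ?ler_nat// andbT; apply: le_lt_trans x1.
  by rewrite lerN2 ler_nat.
- move=> n; rewrite mitv; last by rewrite ge0_cp.
  have nN : - n%:R <= 0 :> R by rewrite oppr_le0.
  rewrite lee_fin /F (XN (x := Num.min (- n%:R) _)) ?subr0; last by rewrite ge_min nN.
  by apply: Xnd; rewrite ge_min lexx orbT.
Qed.

Let m_fin : fin_num_fun m.
Proof.
move=> A mA; rewrite ge0_fin_numE//; apply: (@le_lt_trans _ _ (m setT)).
  by rewrite le_measure ?inE.
by apply: le_lt_trans m_setT _; exact: ltry.
Qed.

Let mf : {finite_measure set (measurableTypeR R) -> \bar R} :=
  HB.pack m (Measure_isFinite.Build _ _ _ m m_fin).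

(** Absolute continuity speaks of finitely many intervals: the connected components of the open set
    are summed finitely, then to the limit. The window keeps every component bounded, so that it is
    the interval between its infimum and its supremum. *)
Let m_open (U : set R) e del : open U -> U `<=` `]-1, T + 1[%classic ->
  (forall n (x y : nat -> R), (forall i, x i <= y i) ->
    trivIset setT (fun i => `]x i, y i[%classic) ->
    \sum_(i < n) (y i - x i) < del -> \sum_(i < n) (F (y i) - F (x i)) < e) ->
  (mu U < del%:E -> m U <= e%:E)%E.
Proof.
move=> oU UT h Udel.
pose J := open_disjoint_itv oU.
have JU i : J i `<=` U by rewrite (open_disjoint_itv_bigcup oU) => x Jx; exists i.
pose x i := inf (J i); pose y i := sup (J i).
have lJ i : has_lbound (J i).
  by exists (-1) => z /JU/UT/=; rewrite in_itv/= => /andP[/ltW].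
have uJ i : has_ubound (J i).
  by exists (T + 1) => z /JU/UT/=; rewrite in_itv/= => /andP[_ /ltW].
have JE i : J i = `]x i, y i[%classic.
  transitivity ((interior (J i))); first exact/esym/((interior_id _).1 (@open_disjoint_itv_open _ _ oU i)).
  rewrite (interval_bounded_interior (@open_disjoint_itv_is_interval _ _ oU i) (lJ i) (uJ i)).
  by apply/seteqP; split => z /=; rewrite in_itv.
have xy i : x i <= y i.
  have [J0|/set0P[z Jz]] := eqVneq (J i) set0; first by rewrite /x /y J0 inf0 sup0.
  apply: (@le_trans _ _ z); first exact: ge_inf.
  by apply: sup_upper_bound => //; split => //; exists z.
have trJ : trivIset setT J by exact: open_disjoint_itv_trivIset.
have trJ' : trivIset setT (fun i => `]x i, y i[%classic).
  by rewrite (_ : (fun i => _) = J)//; apply/funext => i; rewrite JE.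
have mJ i : measurable (J i : set (measurableTypeR R)) by rewrite JE; exact: measurable_itv.
have UE : U = \bigcup_i J i by exact: open_disjoint_itv_bigcup.
have sumdel n : \sum_(i < n) (y i - x i) < del.
  rewrite -lte_fin; apply: le_lt_trans Udel.
  rewrite UE (measure_bigcup mu)// -sumEFin.
  apply: le_trans (nneseries_lim_ge (m := 0) n _); last by move=> *; exact: measure_ge0.
  rewrite big_mkord [leRHS](eq_bigl xpredT); last by move=> i; rewrite mem_set.
  apply: lee_sum => i _; rewrite JE.
  have [<-|xyi] := eqVneq (x i) (y i); first by rewrite subrr measure_ge0.
  rewrite [leRHS](lebesgue_measure_itv `]x i, y i[)/= lte_fin.
  by rewrite lt_neqAle xyi xy/=.
rewrite UE (measure_bigcup m)//.
apply: lime_le.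
  by apply: is_cvg_nneseries => *; exact: measure_ge0.
apply: nearW => n /=.
rewrite big_mkord [leLHS](eq_bigl xpredT); last by move=> i; rewrite mem_set.
apply: (@le_trans _ _ (\sum_(i < n) (F (y i) - F (x i)))%:E).
  rewrite -sumEFin; apply: lee_sum => i _.
  rewrite -(mitv (xy i)) JE; apply: le_measure; rewrite ?inE; [exact: measurable_itv| |].
  - exact: measurable_itv.
  - by move=> z /=; rewrite !in_itv/= => /andP[-> /ltW].
by rewrite lee_fin ltW// h.
Qed.

(** Outer regularity encloses a null set in an open set of small length. The window [V] carries all
    of [m], so restricting to it loses no mass. *)
Let m_dom : m `<< mu.
Proof.
apply/null_content_dominatesP => A mA A0.
apply/eqP; rewrite eq_le measure_ge0 andbT.
apply/lee_addgt0Pr => e e0; rewrite add0e.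
have [del del0 h] := F_ac e0.
pose V : set (measurableTypeR R) := `]-1, T]%classic.
have mV : measurable V by exact: measurable_itv.
have mVC : m (~` V) = 0%E.
  apply/eqP; rewrite eq_le measure_ge0 andbT.
  have : (m V + m (~` V) <= (X T)%:E)%E.
    rewrite -measureU//; first by rewrite setUv.
    - exact: measurableC.
    - exact: setICr.
  have N1 : -1 <= 0 :> R by rewrite oppr_le0.
  have N1T : -1 <= T := le_trans N1 (ltW T0).
  rewrite /V (mitv N1T) /F (min_l N1T) minxx (XN N1) subr0 -[leRHS]adde0.
  by rewrite leeD2lE.
have [U [oU AU dU]] := lebesgue_regularity_outer (D := A) mA (ltac:(by rewrite A0 ltry)) del0.
have mU : measurable (U : set (measurableTypeR R)) by exact: open_measurable.
have mAV : measurable (A `&` V) by exact: measurableI.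
apply: (@le_trans _ _ (m (A `&` V))).
  have AE : A = (A `&` V) `|` (A `&` ~` V) by rewrite -setIUr setUv setIT.
  rewrite {1}AE; apply: (le_trans (measureU2 _ _ _)) => //.
    by apply: measurableI => //; exact: measurableC.
  rewrite -[leRHS]adde0 leeD2l// -mVC le_measure ?inE//.
  - by apply: measurableI => //; exact: measurableC.
  - exact: measurableC.
apply: (@le_trans _ _ (m (U `&` `]-1, T + 1[%classic))).
  rewrite le_measure ?inE//; first exact: measurableI.
  move=> x [/AU Ux]; rewrite /V/= !in_itv/= => /andP[x1 x2]; split => //=.
  by rewrite x1/= (le_lt_trans x2)// ltrDl.
apply: (m_open (del := del)) => //.
- by apply: openI => //; exact: interval_open.
apply: le_lt_trans dU.
have mUA : measurable (U `\` A : set (measurableTypeR R)) by exact: measurableD.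
apply: (@le_trans _ _ (mu (U `\` A) + mu A)%E); last by rewrite [X in (_ + X <= _)%E]A0 adde0.
apply: le_trans (measureU2 mu mUA mA).
rewrite le_measure ?inE//.
- by apply: measurableI => //; exact: measurable_itv.
- exact: measurableU.
- by move=> x [Ux _]; have [Ax|Ax] := pselect (A x); [right|left].
Qed.

(** Radon-Nikodym provides the density, and Lebesgue's differentiation theorem its equality with the
    derivative. The indicator of ]0, T] in [phi] gives the vanishing on the negative side. *)
Lemma abs_cont_density : exists phi : R -> R, [/\ measurable_fun setT phi,
  forall x, 0 <= phi x, forall x, x <= 0 -> phi x = 0,
  forall t, t <= T -> (X t)%:E = (\int[mu]_x (phi x * heaviside (t - x))%:E)%E &
  {ae mu, forall x, x < T -> derivable X x 1 /\ derive1 X x = phi x}].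
Proof.
have [f [f0 ffin fint fE]] := @radon_nikodym_sigma_finite _ _ R mu mf m_dom.
pose A : set (measurableTypeR R) := `]0, T]%classic.
have mA : measurable A by exact: measurable_itv.
pose phi x := fine (f x) * \1_A x.
have mf' : measurable_fun setT (fine \o f).
  by apply: measurableT_comp => //; exact: measurable_int fint.
have mphi : measurable_fun setT phi by apply: measurable_funM => //; exact: measurable_indic.
have phi0 x : 0 <= phi x by rewrite mulr_ge0 ?fine_ge0// indicE.
have phiN x : x <= 0 -> phi x = 0.
  move=> x0; rewrite /phi indicE memNset ?mulr0// /A/= in_itv/= => /andP[].
  by rewrite ltNge x0.
have XE t : t <= T -> (X t)%:E = (\int[mu]_x (phi x * heaviside (t - x))%:E)%E.
  move=> tT; have [t0|t0] := leP t 0.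
    rewrite XN// integral0_eq// => x _; have [x0|x0] := leP x 0; first by rewrite phiN// mul0r.
    by rewrite /heaviside subr_ge0 leNgt (le_lt_trans t0 x0) mulr0.
  transitivity (mf `]0, t]%classic).
    rewrite -[RHS]/(m `]0, t]%classic) (mitv (ltW t0)) /F (min_l tT) (min_l (ltW T0)).
    by rewrite (XN (lexx 0)) subr0.
  rewrite (fE _ (measurable_itv _)).
  rewrite integral_mkcond; apply: eq_integral => x _; rewrite patchE /phi indicE /A /heaviside subr_ge0.
  rewrite -[X in if X then _ else _]/(x \in [set` `]0, t]]) !mem_setE !in_itv/=.
  have [x0|x0] := leP x 0; first by rewrite /= !mulr0 ?mul0r.
  have [xt|xt] := leP x t; last by rewrite mulr0.
  by rewrite (le_trans xt tT) /= !mulr1 fineK.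
exists phi; split => //.
have ip : mu.-integrable setT (EFin \o phi).
  apply: (le_integrable measurableT _ _ fint); first exact/measurable_EFinP.
  move=> x _; rewrite /phi /= !ger0_norm ?mulr_ge0 ?fine_ge0 ?indicE//.
  rewrite gee0_abs// -[leRHS](fineK (ffin x)) lee_fin ler_piMr ?fine_ge0//.
  by case: (x \in A).
have lp : locally_integrable setT phi.
  have := integrable_locally measurableT ip; by rewrite patch_setT.
have ip' (y : R) : mu.-integrable `]-oo, y] (EFin \o phi).
  by apply: integrableS ip => //; exact: measurable_itv.
have := FTC1Ny ip' lp; apply: filterS; first exact: (ae_filter_ringOfSetsType mu).
move=> x /= [dx dE] xT.
pose G (x : R) := (\int[mu]_(t in `]-oo, x]) phi t)%R.
have GE z : z <= T -> G z = X z.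
  move=> zT; apply: EFin_inj; rewrite XE// /G /Rintegral fineK; last first.
    by apply: integral_fune_fin_num => //; exact: measurable_itv.
  rewrite integral_mkcond; apply: eq_integral => u _; rewrite patchE mem_setE in_itv/= /heaviside subr_ge0.
  by case: ifP => _; rewrite ?mulr1 ?mulr0.
have nG : \forall z \near x, G z = X z.
  by near=> z; apply: GE; apply: ltW; near: z; exact: lt_nbhsl.
have := near_eq_is_derive nG (derivableP dx) => hd.
split; first exact: ex_derive.
by rewrite derive1E (@derive_val _ _ _ _ _ _ _ hd) -dE derive1E.
Unshelve. all: by end_near. Qed.

End density.

(** * Measurability of the derivative of a continuous function *)

Section measurable_derivative.
Context {R : realType} (w : R -> R).
Hypothesis cw : continuous w.

Let Q (h x : R) : R := h^-1 * (w (h + x) - w x).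

Let cQ h : continuous (Q h).
Proof.
move=> x; apply: cvgM; first exact: cvg_cst.
apply: cvgB; last exact: cw.
have h1 : {for x, continuous (fun y => h + y)} by apply: cvgD; [exact: cvg_cst|exact: cvg_id].
by have := cvg_comp _ _ h1 (@cw (h + x)).
Qed.

Let cQh x h : h != 0 -> {for h, continuous (Q ^~ x)}.
Proof.
move=> h0; apply: cvgM; first exact: cvgV.
apply: cvgB; last exact: cvg_cst.
have h1 : {for h, continuous (fun y => y + x)} by apply: cvgD; [exact: cvg_id|exact: cvg_cst].
by have := cvg_comp _ _ h1 (@cw (h + x)).
Qed.

Let mQ h : measurable_fun setT (Q h). Proof. exact: continuous_measurable_fun. Qed.

Let q (n : nat) : R := ratr (odflt 0 (unpickle n : option rat)).
(** A reference increment lying strictly inside the radius [m.+1%:R^-1], hence [m.+2]. *)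
Let hm (m : nat) : R := m.+2%:R^-1.

(** Cauchy's criterion at 0 for the difference quotient, tested on rational increments against one
    reference increment. Rationals suffice because the quotient is continuous in a nonzero
    increment, and they make [D] a countable combination of measurable sets. *)
Let B (e m n : nat) : set R :=
  [set x | 0 < `|q n| < m.+1%:R^-1 -> `|Q (q n) x - Q (hm m) x| <= e.+1%:R^-1].

Let mB e m n : measurable (B e m n).
Proof.
have [c|c] := boolP (0 < `|q n| < m.+1%:R^-1); last first.
  by rewrite (_ : B e m n = setT)//; apply/seteqP; split => // x _ /= h; case/negP: c.
pose f (x : R) : R := `|Q (q n) x - Q (hm m) x|.
have mf : measurable_fun setT f.
  by apply: measurableT_comp => //; exact: measurable_funB.
have -> : B e m n = setT `&` f @^-1` `]-oo, e.+1%:R^-1]%classic.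
  apply/seteqP; split => x /=; rewrite /B/= in_itv/=; first by move=> /(_ c).
  by move=> [].
by apply: mf => //; exact: measurable_itv.
Qed.

Let D : set R := \bigcap_e \bigcup_m \bigcap_n B e m n.

Let mD : measurable D.
Proof.
apply: bigcapT_measurable => e; apply: bigcupT_measurable => m.
exact: bigcapT_measurable.
Qed.

Let DE x : D x <-> cvg (Q h x @[h --> 0^']).
Proof.
split.
- move=> Dx; apply/cauchy_cvgP; apply: cauchy_exP => e e0.
  have [N hN] : exists N : nat, N.+1%:R^-1 < e.
    by have [N _ hN] := near_infty_natSinv_lt (PosNum e0); exists N; exact: (hN N (leqnn N)).
  have [m _ hmn] := Dx N I.
  exists (Q (hm m) x).
  have m0 : 0 < m.+1%:R^-1 :> R by [].
  exists m.+1%:R^-1 => //= h; rewrite /ball_/= sub0r normrN => hlt h0.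
  rewrite -ball_normE/= distrC; apply: le_lt_trans hN.
  rewrite leNgt; apply/negP => habs.
  have cg : {for h, continuous (fun z => `|Q z x - Q (hm m) x|)}.
    by apply: cvg_norm; apply: cvgB; [exact: cQh|exact: cvg_cst].
  have n1 : \forall z \near h, N.+1%:R^-1 < `|Q z x - Q (hm m) x|.
    by apply: (cvgr_gt _ cg).
  have cn : {for h, continuous (fun z : R => `|z|)} by exact: norm_continuous.
  have n2 : \forall z \near h, `|z| < m.+1%:R^-1 by exact: (cvgr_lt _ cn).
  have n3 : \forall z \near h, 0 < `|z|.
    by apply: (cvgr_gt _ cn); rewrite normr_gt0.
  have [d /= d0 hd] := (nbhs_ballP _ _).1 (filterI n1 (filterI n2 n3)).
  have hd2 : h - d / 2 < h + d / 2 by move: d0; lra.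
  have [r] := rat_in_itvoo hd2; rewrite in_itv/= => /andP[r1 r2].
  have : ball h d (ratr r).
    by rewrite -ball_normE/= ltr_norml; apply/andP; split; move: d0; lra.
  move=> /hd[g1 [g2 g3]].
  have qr : q (pickle r) = ratr r by rewrite /q pickleK.
  have := hmn (pickle r) I; rewrite /B/= qr g2 g3 => /(_ isT).
  by rewrite leNgt g1.
- move=> /cvg_ex[l hl] e _.
  have e2 : 0 < e.+1%:R^-1 / 2 :> R by rewrite divr_gt0.
  have /cvgrPdist_le/(_ _ e2)[d /= d0 hd] := hl.
  have [m _ hm'] := near_infty_natSinv_lt (PosNum d0).
  exists m => // n _ /andP[n0 nm].
  have b (h : R) : h != 0 -> `|h| < m.+1%:R^-1 -> `|l - Q h x| <= e.+1%:R^-1 / 2.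
    move=> h0 hh; apply: hd => //=; rewrite /ball_/= sub0r normrN.
    by apply: (lt_trans hh); exact: (hm' m (leqnn m)).
  have b1 := b (q n); have b2 := b (hm m).
  have qn0 : q n != 0 by rewrite -normr_gt0.
  have hm0 : hm m != 0 by rewrite /hm invr_eq0.
  have hml : `|hm m| < m.+1%:R^-1 by rewrite /hm gtr0_norm// ltf_pV2 ?posrE// ltr_nat.
  have {}b1 := b1 qn0 nm; have {}b2 := b2 hm0 hml.
  rewrite (_ : Q (q n) x - Q (hm m) x = (l - Q (hm m) x) - (l - Q (q n) x)); last by ring.
  apply: (le_trans (ler_normB _ _)).
  by apply: (le_trans (lerD b2 b1)); rewrite -splitr.
Qed.

Lemma measurable_derive1 : measurable_fun setT (derive1 w).
Proof.
have d1 x : derive1 w x = lim (Q h x @[h --> 0^']) by [].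
pose g (n : nat) (x : R) : R := Q n.+1%:R^-1 x * \1_D x.
apply: (@measurable_fun_cvg _ _ _ _ g).
- by move=> n; apply: measurable_funM => //; exact: measurable_indic.
- move=> x _; rewrite /g indicE; have [xD|xD] := boolP (x \in D).
    have /DE cq : D x by rewrite inE in xD.
    rewrite d1; under eq_fun do rewrite mulr1.
    have h : (n.+1%:R^-1 : R) @[n --> \oo] --> (0 : R)^'.
      move=> A [e /= e0 hA]; have [m _ hm'] := near_infty_natSinv_lt (PosNum e0).
      exists m => // n mn; apply: hA => //=; rewrite /ball_/= sub0r normrN gtr0_norm//; exact: hm'.
    exact: (cvg_comp _ _ h cq).
  (* Where the quotient diverges, [lim] takes the default value 0, the value produced by the
     indicator of [D] in [g]. *)
  rewrite (_ : derive1 w x = 0); last first.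
    by rewrite d1 dvgP//; apply/DE => Dx; move/negP: xD; apply; rewrite inE.
  by under eq_fun do rewrite mulr0; exact: cvg_cst.
Qed.

End measurable_derivative.

Lemma le_heaviside {R : realType} : {homo @heaviside R : x y / x <= y}.
Proof. by have [] := @heaviside_cdf_like R. Qed.

(** * Reflections of the line and difference quotients *)

Section reflection.
Context {R : realType}.
Notation mu := (@lebesgue_measure R).

Let measurable_reflect (r : R) :
  measurable_fun setT ((fun x => r - x) : measurableTypeR R -> measurableTypeR R).
Proof. by apply: measurable_funB. Qed.

Lemma ge0_integral_reflect (f : R -> \bar R) (r : R) : measurable_fun setT f ->
  (forall x, 0 <= f x)%E -> (\int[mu]_x f (r - x)%R = \int[mu]_x f x)%E.
Proof.
move=> mf f0.
pose phi : {mfun measurableTypeR R >-> measurableTypeR R} := HB.pack (fun x => r - x)%R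
  (isMeasurableFun.Build _ _ _ _ _ (measurable_reflect r)).
have := @ge0_integral_pushforward _ _ _ _ R phi (measurable_reflect r) mu setT f measurableT mf (fun x _ => f0 x).
rewrite preimage_setT => <-.
apply: eq_measure_integral => A mA _; apply/esym.
apply: (@lebesgue_measure_unique R (pushforward mu phi)) => //= _ [[a b]] _ <-.
rewrite /pushforward /=.
have -> : (fun x => r - x)%R @^-1` `]a, b] = `[(r - b)%R, (r - a)%R[%classic.
  apply/seteqP; split => x /=; rewrite !in_itv/=.
    by move=> /andP[h1 h2]; apply/andP; split; move: h1 h2; lra.
  by move=> /andP[h1 h2]; apply/andP; split; move: h1 h2; lra.
rewrite !lebesgue_measure_itv/= !lte_fin (_ : (r - b < r - a) = (a < b)); last first.
  by rewrite ltrD2l ltrN2.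
by rewrite -!EFinD; case: ifP => // _; congr EFin; ring.
Qed.

Lemma ae_reflect (A : R -> Prop) (r : R) :
  {ae mu, forall x, A x} -> {ae mu, forall x, A (r - x)}.
Proof.
move=> [B [mB B0 AB]]; pose C := (fun x => r - x) @^-1` B.
have mC : measurable (C : set (measurableTypeR R)).
  by rewrite -[X in measurable X]setTI; exact: measurable_reflect.
have mI : measurable_fun setT (fun x : R => (\1_B x : R)%:E).
  by apply/measurable_EFinP; exact: measurable_indic.
exists C; split => //; last by move=> x /= nA; apply: AB => /= h; apply: nA.
have h := @ge0_integral_reflect (fun x : R => (\1_B x : R)%:E) r mI (fun x => ltac:(by rewrite lee_fin)).
rewrite -[X in mu X]setIT -integral_indic//.
transitivity (\int[mu]_x (\1_B (r - x)%R : R)%:E)%E; first by apply: eq_integral => x _; rewrite !indicE.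
by rewrite h integral_indic// setIT.
Qed.

End reflection.

Section derivative_quotient.
Context {R : realType}.

Lemma is_derive_quotient (B : R -> R) (t b : R) : is_derive t 1 B b -> forall e, 0 < e ->
  exists2 del, 0 < del & forall h, h != 0 -> `|h| < del -> `|h^-1 * (B (t + h) - B t) - b| <= e.
Proof.
move=> hB e e0; have dB : derivable B t 1 by exact: ex_derive.
have vB : 'D_1 B t = b by exact: derive_val.
have : (fun h => h^-1 *: (B (h *: (1 : R) + t) - B t)) @ 0^' --> b by rewrite -vB; exact: dB.
move=> /cvgrPdist_le/(_ _ e0)[del /= del0 hd]; exists del => // h h0 hdel.
have := hd h; rewrite /= sub0r normrN => /(_ hdel h0).
by rewrite /GRing.scale/= mulr1 (addrC h) distrC.
Qed.

End derivative_quotient.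

(** * Upper bound for the convolution of a kernel with a density *)

Section density_convolution.
Context {R : realType} (q X phi : R -> R) (T : R).
Notation mu := (@lebesgue_measure R).
Hypotheses (kq : is_kernel q) (cX : cdf_like X).
Hypotheses (mphi : measurable_fun setT phi) (phi0 : forall x, 0 <= phi x).
Hypothesis Xphi : forall t, t <= T -> (X t)%:E = (\int[mu]_x (phi x * heaviside (t - x))%:E)%E.

Let mprim : measurable_fun setT (primitive q).
Proof. by apply: nondecreasing_measurable => //; exact: primitive_nd. Qed.

(** By Tonelli, the dependence on [t] moves from [X] to the primitive of [q], whose increments are
    controlled by the monotonicity of [q]. *)
Lemma density_rconv t : t <= T ->
  (rconv q X t)%:E = (\int[mu]_y (phi y * primitive q (t - y))%:E)%E.
Proof.
have [mq q0 qN _] := kq; move=> tT; rewrite rconvE//.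
have mh : measurable_fun setT (heaviside : R -> R) := cdf_like_measurable heaviside_cdf_like.
have h0 (x : R) : 0 <= heaviside x :> R by rewrite ler0n.
have m3 : measurable_fun setT
    (fun z : R * R => (q z.1 * (phi z.2 * heaviside (t - z.1 - z.2)))%:E).
  apply/measurable_EFinP; apply: measurable_funM; first exact: (measurableT_comp mq).
  apply: measurable_funM; first exact: (measurableT_comp mphi).
  by apply: (measurableT_comp mh); do 2 apply: measurable_funB => //.
have p3 (z : R * R) : (0 <= (q z.1 * (phi z.2 * heaviside (t - z.1 - z.2)))%:E)%E.
  by rewrite lee_fin !mulr_ge0.
transitivity (\int[mu]_s \int[mu]_y (q s * (phi y * heaviside (t - s - y)))%:E)%E.
  apply: eq_integral => s _; have [s0|s0] := leP s 0.
    by rewrite qN// mul0r integral0_eq// => y _; rewrite mul0r.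
  have mi : measurable_fun setT (fun y : R => phi y * heaviside (t - s - y)).
    by apply: measurable_funM => //; exact: measurable_heaviside_sub.
  have pi (y : R) : 0 <= phi y * heaviside (t - s - y) by rewrite mulr_ge0.
  rewrite (integral_nnZl mu mi pi (q0 s)) EFinM Xphi//.
  by rewrite (le_trans _ tT)// lerBlDr lerDl ltW.
rewrite (fubini_tonelli (m1 := mu) (m2 := mu) _ m3 p3)/=.
apply: eq_integral => y _; rewrite EFinM primitiveE//.
have mi : measurable_fun setT (fun s : R => q s * heaviside (t - y - s)).
  by apply: measurable_funM => //; exact: measurable_heaviside_sub.
have pi (s : R) : 0 <= q s * heaviside (t - y - s) by rewrite mulr_ge0.
rewrite -(integral_nnZl mu mi pi (phi0 y)); apply: eq_integral => s _; congr EFin.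
by rewrite mulrCA (_ : t - s - y = t - y - s)//; ring.
Qed.

Hypothesis qdec : forall x y, 0 < x -> x <= y -> q y <= q x.
Variables (t0 b : R) (B : R -> R).
Hypotheses (t00 : 0 < t0) (t0T : t0 <= T) (XB : forall t, rconv q X t = B t).
Hypothesis Bb : is_derive t0 1 B b.

Let mprim_sub (t : R) : measurable_fun setT (fun y : R => phi y * primitive q (t - y)).
Proof.
by apply: measurable_funM => //; apply: (measurableT_comp mprim); exact: measurable_funB.
Qed.

Let mq_sub (r : R) : measurable_fun setT (fun y : R => phi y * (q (t0 - y) * heaviside (t0 - r - y))).
Proof.
have [mq _ _ _] := kq.
apply: measurable_funM => //; apply: measurable_funM; last exact: measurable_heaviside_sub.
by apply: (measurableT_comp mq); exact: measurable_funB.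
Qed.

Let q_sub0 r y : 0 <= phi y * (q (t0 - y) * heaviside (t0 - r - y)).
Proof. by have [_ q0 _ _] := kq; rewrite !mulr_ge0// ler0n. Qed.

(** A backward increment is taken because [q] is nonincreasing: its mean over an interval ending at
    [t0 - y] is at least [q (t0 - y)]. The remaining [y] contribute nonnegatively and are
    dropped. *)
Let upper_step r r' : 0 < r -> r <= r' ->
  (r%:E * \int[mu]_y (phi y * (q (t0 - y) * heaviside (t0 - r' - y)))%:E <=
   (B t0 - B (t0 - r))%:E)%E.
Proof.
move=> r0 rr'; have [mq q0 qN _] := kq.
rewrite EFinB leeBrDl// -!XB.
have tr : t0 - r <= T by rewrite (le_trans _ t0T)// lerBlDr lerDl ltW.
rewrite (density_rconv t0T) (density_rconv tr).
rewrite -(integral_nnZl mu (mq_sub r') (q_sub0 r') (ltW r0)).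
have m1 : measurable_fun setT (fun y : R => r * (phi y * (q (t0 - y) * heaviside (t0 - r' - y)))).
  exact: measurable_funM.
have p1 (y : R) : 0 <= r * (phi y * (q (t0 - y) * heaviside (t0 - r' - y))).
  by rewrite mulr_ge0// ltW.
have p2 (y : R) : 0 <= phi y * primitive q (t0 - r - y) by rewrite mulr_ge0// primitive_ge0.
rewrite -(integral_nnD mu (mprim_sub _) m1 p2 p1); apply: le_integral_nn => [||y|y].
- by apply: measurable_funD; [exact: mprim_sub|exact: m1].
- exact: mprim_sub.
- by apply: addr_ge0.
- rewrite -[leLHS]/(phi y * primitive q (t0 - r - y) + r * (phi y * (q (t0 - y) * heaviside (t0 - r' - y)))).
  rewrite (_ : r * _ = phi y * (r * (q (t0 - y) * heaviside (t0 - r' - y)))); last by ring.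
  rewrite -mulrDr ler_wpM2l// /heaviside.
  have [h|h] := leP 0 (t0 - r' - y); last first.
    by rewrite !mulr0 addr0 primitive_nd// lerD2r lerBlDr lerDl ltW.
  have a0 : 0 <= t0 - r - y by move: h rr'; lra.
  have ab : t0 - r - y <= t0 - y by move: r0; lra.
  have := primitiveB_lb kq qdec a0 ab; rewrite mulr1.
  rewrite (_ : t0 - y - (t0 - r - y) = r); last by ring.
  by rewrite lerBrDl mulrC.
Qed.

(** First [r] tends to 0 with [r'] fixed, which keeps the integrand independent of the increment and
    yields [b]; then [r'] tends to 0 by monotone convergence. *)
Lemma density_upper : (\int[mu]_y (phi y * q (t0 - y))%:E <= b%:E)%E.
Proof.
have [mq q0 qN _] := kq.
have step r' : 0 < r' -> (\int[mu]_y (phi y * (q (t0 - y) * heaviside (t0 - r' - y)))%:E <= b%:E)%E.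
  move=> r'0; apply/lee_addgt0Pr => e e0.
  have [del del0 hd] := is_derive_quotient Bb e0.
  pose r := Num.min (del / 2) r'.
  have r0 : 0 < r by rewrite lt_min r'0 divr_gt0.
  have rr' : r <= r' by rewrite ge_min lexx orbT.
  have rdel : r < del.
    by apply: (@le_lt_trans _ _ (del / 2)); rewrite ?ge_min ?lexx// ltr_pdivrMr// ltr_pMr// ltr1n.
  have us := upper_step r0 rr'.
  apply: (@le_trans _ _ ((B t0 - B (t0 - r))%:E * (r^-1)%:E)%E).
    by rewrite (lee_pdivlMr _ _ r0) (muleC _ r%:E).
  rewrite -EFinM -EFinD lee_fin.
  have := hd (- r); rewrite oppr_eq0 gt_eqF// normrN gtr0_norm// => /(_ isT rdel).
  rewrite ler_norml => /andP[_]; rewrite lerBlDr => h; rewrite (addrC b e); apply: le_trans h.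
  by rewrite invrN mulNr -mulrN opprB mulrC.
pose f (n : nat) (y : R) : \bar R := (phi y * (q (t0 - y) * heaviside (t0 - n.+1%:R^-1 - y)))%:E.
have cv : ((\int[mu]_y f n y) @[n --> \oo] --> \int[mu]_y (phi y * q (t0 - y))%:E)%E.
  rewrite (_ : (\int[mu]_y (phi y * q (t0 - y))%:E = \int[mu]_y (limn (f^~ y)))%E).
    apply: cvg_monotone_convergence => //.
    - by move=> n; apply/measurable_EFinP; exact: mq_sub.
    - by move=> n y _; rewrite lee_fin.
    - move=> y _ m n mn; rewrite lee_fin ler_wpM2l// ler_wpM2l//.
      apply: le_heaviside; rewrite lerD2r lerD2l lerN2 lef_pV2 ?posrE//.
      by rewrite ler_nat.
  apply: eq_integral => y _; apply/esym/cvg_lim => //.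
  have [y0|y0] := leP t0 y.
    rewrite /f qN ?subr_le0//; under eq_fun do rewrite mul0r; exact: cvg_cst.
  apply: cvg_near_cst; near=> n; rewrite /f /heaviside.
  rewrite (_ : 0 <= t0 - n.+1%:R^-1 - y) ?mulr1//.
  have : n.+1%:R^-1 < t0 - y.
    by near: n; apply: near_infty_natSinv_lt (PosNum _); rewrite subr_gt0.
  by move: (n.+1%:R^-1 : R) => z; lra.
rewrite -(cvg_lim _ cv)//; apply: lime_le; first exact: cvgP cv.
by apply: nearW => n; exact: step.
Unshelve. all: by end_near. Qed.

End density_convolution.

(** * Lower bound for the convolution with the density of the renewal function *)

Section density_lower.
Context {R : realType} (k U psi : R -> R) (T t0 : R).
Notation mu := (@lebesgue_measure R).
Hypotheses (kk : is_kernel k) (cU : cdf_like U).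
Hypothesis kdec : forall x y, 0 < x -> x <= y -> k y <= k x.
Hypothesis kinf : forall A, exists2 x, 0 < x & A <= k x.
Hypothesis kU : forall t, rconv k U t = ramp t.
Hypothesis kac : forall a b, 0 < a -> a <= b -> abs_cont a b k.
Hypotheses (mpsi : measurable_fun setT psi) (psi0 : forall x, 0 <= psi x).
Hypothesis Upsi : forall t, t <= T -> (U t)%:E = (\int[mu]_x (psi x * heaviside (t - x))%:E)%E.
Hypotheses (t00 : 0 < t0) (t0T : t0 < T).

Let truncated del (x : R) : R := k x - excess k del x.

Let truncatedE del x : truncated del x = Num.min (k x) (k del).
Proof.
by rewrite /truncated /excess /Num.max /Num.min; case: ltP => h1; case: ltP => h2; move: h1 h2; lra.
Qed.

Let truncated_kernel del : is_kernel (truncated del).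
Proof.
have [mk k0 kN Lk] := kk.
have mt : measurable_fun setT (truncated del).
  by apply: measurable_funB => //; have [] := excess_kernel kk del.
have t0' (x : R) : 0 <= truncated del x by rewrite truncatedE le_min !k0.
split => //.
- by move=> x x0; rewrite truncatedE kN// min_l.
- move=> s s0; have := Lk s s0; rewrite !ge0_fin_numE ?laplace_ge0//.
  apply: le_lt_trans; apply: le_laplace => // x.
  by rewrite t0'/= truncatedE ge_min lexx.
Qed.

Let truncated_dec del x y : 0 < x -> x <= y -> truncated del y <= truncated del x.
Proof.
by move=> x0 xy; rewrite !truncatedE le_min !ge_min lexx orbT (kdec x0 xy).
Qed.

Let primitive_truncated del z : 0 <= z -> primitive (truncated del) z <= k del * z.
Proof.
move=> z0; have [mk k0 kN Lk] := kk.
have kt := truncated_kernel del; have [mt pt _ _] := kt.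
rewrite -lee_fin (primitiveB kt z0) primitive_le0// add0e -[X in k del * X]subr0 -integral_cst_itv//.
apply: le_integral_nn.
- by apply: measurable_funM => //; exact: measurable_indic.
- by apply: measurable_funM => //; exact: measurable_indic.
- by move=> x; rewrite mulr_ge0.
- by move=> x; rewrite ler_wpM2r// truncatedE ge_min lexx orbT.
Qed.

Let rconv_split del t : rconv k U t = rconv (truncated del) U t + rconv (excess k del) U t.
Proof.
have [mk k0 kN Lk] := kk; have mU := cdf_like_measurable cU; have [_ U0 _ _] := cU.
have kt := truncated_kernel del; have [mt pt _ _] := kt.
have ke := excess_kernel kk del; have [me pe _ _] := ke.
apply: EFin_inj; rewrite EFinD !rconvE// /convolution.
rewrite -integral_nnD.
- by apply: eq_integral => x _; congr EFin; rewrite -mulrDl /truncated subrK.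
- exact: measurable_conv_integrand.
- exact: measurable_conv_integrand.
- by move=> x; rewrite mulr_ge0.
- by move=> x; rewrite mulr_ge0.
Qed.

(** Forward increments now bound the convolution from above: for [y < t0] the primitive grows by at
    most [r * truncated del (t0 - y)]. For [y] between [t0] and [t0 + r] only the bound [k del] of
    the truncated kernel is available; the mass of [U] around [t0] absorbs it. *)
Let lower_step del r : 0 < r -> t0 + r <= T ->
  ((rconv (truncated del) U (t0 + r) + r * k del * U (t0 - r))%:E <=
   (rconv (truncated del) U t0 + r * k del * U (t0 + r))%:E +
   r%:E * \int[mu]_y (psi y * truncated del (t0 - y))%:E)%E.
Proof.
move=> r0 rT; have [mk k0 kN Lk] := kk.
have kt := truncated_kernel del; have [mt pt _ _] := kt.
have tr : t0 - r <= T by move: r0 rT; lra.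
have rk0 : 0 <= r * k del by rewrite mulr_ge0// ltW.
have mh (t : R) : measurable_fun setT (fun y : R => psi y * heaviside (t - y)).
  by apply: measurable_funM => //; exact: measurable_heaviside_sub.
have ph (t y : R) : 0 <= psi y * heaviside (t - y) by rewrite mulr_ge0// ler0n.
have mp (t : R) : measurable_fun setT (fun y : R => psi y * primitive (truncated del) (t - y)).
  apply: measurable_funM => //; apply: (@measurableT_comp _ _ _ _ _ _ (primitive (truncated del))).
    by apply: nondecreasing_measurable => //; exact: primitive_nd.
  exact: measurable_funB.
have pp (t y : R) : 0 <= psi y * primitive (truncated del) (t - y).
  by rewrite mulr_ge0// primitive_ge0.
have mq : measurable_fun setT (fun y : R => psi y * truncated del (t0 - y)).
  by apply: measurable_funM => //; apply: (measurableT_comp mt); exact: measurable_funB.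
have pq (y : R) : 0 <= psi y * truncated del (t0 - y) by rewrite mulr_ge0.
rewrite !EFinD (EFinM (r * k del) (U (t0 - r))) (EFinM (r * k del) (U (t0 + r))) !Upsi//.
rewrite !(density_rconv kt cU mpsi psi0 Upsi)//; last exact: ltW.
rewrite -(integral_nnZl mu (mh (t0 - r)) (ph (t0 - r)) rk0).
rewrite -(integral_nnZl mu (mh (t0 + r)) (ph (t0 + r)) rk0).
rewrite -(integral_nnZl mu mq pq (ltW r0)).
have mh' t : measurable_fun setT (fun y : R => r * k del * (psi y * heaviside (t - y))).
  exact: measurable_funM.
have ph' t (y : R) : 0 <= r * k del * (psi y * heaviside (t - y)) by rewrite mulr_ge0.
have mq' : measurable_fun setT (fun y : R => r * (psi y * truncated del (t0 - y))).
  exact: measurable_funM.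
have pq' (y : R) : 0 <= r * (psi y * truncated del (t0 - y)) by rewrite mulr_ge0// ltW.
rewrite -(integral_nnD mu (mp (t0 + r)) (mh' _) (pp _) (ph' _)).
rewrite -(integral_nnD mu (mp t0) (mh' _) (pp _) (ph' _)).
have m4 : measurable_fun setT (fun y : R => psi y * primitive (truncated del) (t0 - y) +
    r * k del * (psi y * heaviside (t0 + r - y))) by exact: measurable_funD.
have p4 (y : R) : 0 <= psi y * primitive (truncated del) (t0 - y) +
    r * k del * (psi y * heaviside (t0 + r - y)) by rewrite addr_ge0.
rewrite -(integral_nnD mu m4 mq' p4 pq'); apply: le_integral_nn.
- by apply: measurable_funD; [exact: mp|exact: mh'].
- by apply: measurable_funD; [exact: m4|exact: mq'].
- by move=> y; apply: addr_ge0.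
- move=> y.
  have -> : psi y * primitive (truncated del) (t0 + r - y) + r * k del * (psi y * heaviside (t0 - r - y)) =
    psi y * (primitive (truncated del) (t0 + r - y) + r * k del * heaviside (t0 - r - y)) by ring.
  have -> : psi y * primitive (truncated del) (t0 - y) + r * k del * (psi y * heaviside (t0 + r - y)) +
    r * (psi y * truncated del (t0 - y)) =
    psi y * (primitive (truncated del) (t0 - y) + r * truncated del (t0 - y) + r * k del * heaviside (t0 + r - y)).
    by ring.
  apply: ler_wpM2l => //; have [yt|yt] := ltP y t0.
    apply: lerD.
      have a0 : 0 < t0 - y by rewrite subr_gt0.
      have ab : t0 - y <= t0 + r - y by move: r0; lra.
      have := primitiveB_ub kt (@truncated_dec del) a0 ab.
      rewrite (_ : t0 + r - y - (t0 - y) = r); last by ring.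
      by rewrite lerBlDl mulrC.
    by apply: ler_wpM2l => //; apply: le_heaviside; move: r0; lra.
  have -> : heaviside (t0 - r - y) = 0 :> R.
    by rewrite /heaviside (_ : (0 <= t0 - r - y) = false)//; apply/negbTE; rewrite -ltNge; move: r0 yt; lra.
  rewrite mulr0 addr0; apply: ler_wpDl.
    by rewrite addr_ge0 ?primitive_ge0// mulr_ge0// ltW.
  rewrite /heaviside; have [h|h] := leP 0 (t0 + r - y).
    apply: (le_trans (primitive_truncated del h)); rewrite mulr1 mulrC.
    by apply: ler_wpM2r => //; move: yt; lra.
  by rewrite primitive_le0 ?mulr0// ltW.
Qed.

(* The truncation [min k (k del)] is bounded, so its primitive has difference quotients
   controlled by its values; what is cut off is small by [renewal_concentrated]. *)
Lemma density_lower : (1 <= \int[mu]_y (psi y * k (t0 - y))%:E)%E.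
Proof.
apply/lee_addgt0Pr => e e0; have [mk k0 kN Lk] := kk.
have e2 : 0 < e / 2 by rewrite divr_gt0.
have T0 : 0 < T := lt_trans t00 t0T.
have [del del0 hd] := renewal_concentrated kk cU kdec kinf kU kac T0 t00 (ltW t0T) e2.
have kt := truncated_kernel del; have [mt pt _ _] := kt.
have mq : measurable_fun setT (fun y : R => psi y * truncated del (t0 - y)).
  by apply: measurable_funM => //; apply: (measurableT_comp mt); exact: measurable_funB.
have mq' : measurable_fun setT (fun y : R => psi y * k (t0 - y)).
  by apply: measurable_funM => //; apply: (measurableT_comp mk); exact: measurable_funB.
have le1 : (\int[mu]_y (psi y * truncated del (t0 - y))%:E <= \int[mu]_y (psi y * k (t0 - y))%:E)%E.
  apply: le_integral_nn => //; first by move=> y; rewrite mulr_ge0.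
  by move=> y; rewrite ler_wpM2l// truncatedE ge_min lexx.
apply: (@le_trans _ _ (\int[mu]_y (psi y * truncated del (t0 - y))%:E + e%:E)%E); last exact: leeD2r.
(* By continuity of [U], the boundary term of [lower_step] can be made at most [r * (e / 2)]. The
   other half of [e] pays for the excess part. *)
have [r r0 [rT hr]] : exists2 r, 0 < r & t0 + r <= T /\ k del * (U (t0 + r) - U (t0 - r)) <= e / 2.
  have cU0 : U (t0 + r) - U (t0 - r) @[r --> (0 : R)^'+] --> (0 : R).
    have kU' t : 0 * U t + rconv k U t = ramp t by rewrite mul0r add0r.
    have ctU : continuous U by exact: (renewal_continuous (lexx 0) kk cU kdec kU' kinf).
    rewrite -[X in _ --> X](subrr (U t0)); apply: cvgB.
      have c1 : t0 + r @[r --> (0 : R)^'+] --> t0 + 0 by apply: cvgD; [exact: cvg_cst|exact/cvg_at_right_filter/cvg_id].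
      by rewrite addr0 in c1; exact: (cvg_comp _ _ c1 (ctU t0)).
    have c1 : t0 - r @[r --> (0 : R)^'+] --> t0 - 0 by apply: cvgB; [exact: cvg_cst|exact/cvg_at_right_filter/cvg_id].
    by rewrite subr0 in c1; exact: (cvg_comp _ _ c1 (ctU t0)).
  have c2 : k del * (U (t0 + r) - U (t0 - r)) @[r --> (0 : R)^'+] --> k del * 0.
    by apply: cvgM => //; exact: cvg_cst.
  rewrite mulr0 in c2; have /cvgr_le/(_ (e / 2) e2) c3 := c2.
  near (0 : R)^'+ => r; exists r; first by near: r; exact: nbhs_right_gt.
  split; last by near: r; exact: c3.
  by rewrite -lerBrDl; near: r; apply: nbhs_right_le; rewrite subr_gt0.
have := lower_step del r0 rT.
set J := (\int[mu]_y _)%E.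
have J0 : (0 <= J)%E by apply: integral_ge0 => y _; rewrite lee_fin mulr_ge0.
case: J J0 => [J| |] // J0; last by rewrite addye// leey.
rewrite -EFinM -!EFinD !lee_fin => hJ.
have hex := hd t0 (t0 + r) (lexx _) (ltac:(by rewrite lerDl ltW)) rT.
have s1 := rconv_split del t0; have s2 := rconv_split del (t0 + r).
have t0r : 0 <= t0 + r by rewrite addr_ge0 ?ltW.
rewrite kU /ramp max_l ?(ltW t00)// in s1; rewrite kU /ramp max_l// in s2.
rewrite (_ : t0 + r - t0 = r) in hex; last by ring.
have h1 : r * (k del * (U (t0 + r) - U (t0 - r))) <= r * (e / 2) by rewrite ler_wpM2l// ltW.
have h2 : r * 1 <= r * (J + e).
  rewrite mulrDr; move: h1; rewrite mulrA mulrBr mulr1 => h1.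
  move: (rconv (truncated del) U (t0 + r)) (rconv (truncated del) U t0) (rconv (excess k del) U (t0 + r))
    (rconv (excess k del) U t0) (r * k del * U (t0 + r)) (r * k del * U (t0 - r)) s1 s2 hJ hex h1.
  by move=> a1 a2 a3 a4 a5 a6; lra.
by rewrite ler_pM2l in h2.
Unshelve. all: by end_near. Qed.

End density_lower.

Lemma nn_integrable {R : realType} (h : R -> R) : measurable_fun setT h -> (forall x, 0 <= h x) ->
  (\int[@lebesgue_measure R]_x (h x)%:E < +oo)%E -> (@lebesgue_measure R).-integrable setT (EFin \o h).
Proof.
move=> mh h0 hoo; apply/integrableP; split; first exact/measurable_EFinP.
suff <- : (\int[@lebesgue_measure R]_x (h x)%:E = \int[@lebesgue_measure R]_x `|(EFin \o h) x|)%E by [].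
by apply: eq_integral => x _; rewrite gee0_abs// lee_fin.
Qed.

(** * Differentiation of the convolution by domination *)

Section lipschitz_convolution.
Context {R : realType} (q X phi : R -> R) (T L t0 : R).
Notation mu := (@lebesgue_measure R).
Hypotheses (kq : is_kernel q) (cX : cdf_like X) (X0 : X 0 = 0).
Hypotheses (mphi : measurable_fun setT phi).
Hypothesis XL : forall a b, a <= b -> X b - X a <= L * (b - a).
Hypotheses (t0T : t0 < T).
Hypothesis Xd : {ae mu, forall s, t0 - s < T ->
  derivable X (t0 - s) 1 /\ derive1 X (t0 - s) = phi (t0 - s)}.

Let XN x : x <= 0 -> X x = 0.
Proof.
have [_ _ XN _] := cX; rewrite le_eqVlt => /predU1P[->//|]; exact: XN.
Qed.

Let Xnorm a b : `|X b - X a| <= L * `|b - a|.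
Proof.
have [Xnd _ _ _] := cX.
wlog ab : a b / a <= b.
  move=> h; have [/h//|/ltW/h] := leP a b.
  by rewrite distrC (distrC a).
by rewrite !ger0_norm ?subr_ge0 ?XL// Xnd.
Qed.

Let L0 : 0 <= L.
Proof. by have := Xnorm 0 1; rewrite subr0 normr1 mulr1; exact: le_trans. Qed.

Let integrable_conv t : mu.-integrable setT (fun s => (q s * X (t - s))%:E).
Proof.
have [mq q0 qN _] := kq; have [_ X0' _ _] := cX; have mX := cdf_like_measurable cX.
apply: (@nn_integrable _ (fun s => q s * X (t - s))).
- exact: measurable_conv_integrand.
- by move=> s; rewrite mulr_ge0.
- by have := convolution_fin_num t kq cX; rewrite /convolution fin_numElt => /andP[].
Qed.

Let dconvq (h s : R) := q s * (h^-1 * (X (t0 + h - s) - X (t0 - s))).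

Let rconv_quotient (h : R) : (h^-1 * (rconv q X (t0 + h) - rconv q X t0))%:E =
  (\int[mu]_s (dconvq h s)%:E)%E.
Proof.
rewrite EFinM EFinB !rconvE// /convolution.
have i1 := integrable_conv (t0 + h); have i2 := integrable_conv t0.
rewrite -[X in (_ * X)%E](integralB measurableT i1 i2).
rewrite -(integralZl measurableT (integrableB measurableT i1 i2)).
by apply: eq_integral => s _; rewrite -EFinB -EFinM /dconvq; congr EFin; ring.
Qed.

(** The Lipschitz bound, cut off where both values of [X] vanish, since [q] need not be integrable
    at infinity. *)
Let dom (M s : R) := L * (q s * heaviside (t0 + M - s)).

Let dom_bound (h M s : R) : h != 0 -> `|h| <= M -> `|dconvq h s| <= dom M s.
Proof.
move=> h0 hM; have [mq q0 qN _] := kq.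
rewrite /dconvq /dom normrM (ger0_norm (q0 s)) mulrCA ler_wpM2l// /heaviside.
have hpos : 0 < `|h| by rewrite normr_gt0.
have [st|st] := leP 0 (t0 + M - s).
  rewrite mulr1 normrM normfV mulrC ler_pdivrMr//.
  by apply: (le_trans (Xnorm _ _)); rewrite (_ : t0 + h - s - (t0 - s) = h)//; ring.
have hle : h <= `|h| by exact: ler_norm.
rewrite !XN; first by rewrite subrr mulr0 normr0 mulr0.
- by move: st hM hpos; lra.
- by move: st hM hle; lra.
Qed.

Let dom_integrable M : mu.-integrable setT (EFin \o dom M).
Proof.
have [mq q0 qN _] := kq.
have m1 : measurable_fun setT (fun s : R => q s * heaviside (t0 + M - s)).
  by apply: measurable_funM => //; exact: measurable_heaviside_sub.
have p1 (s : R) : 0 <= q s * heaviside (t0 + M - s) by rewrite mulr_ge0// ler0n.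
apply: nn_integrable.
- exact: measurable_funM.
- by move=> s; rewrite mulr_ge0.
- by rewrite /dom (integral_nnZl mu m1 p1 L0) -primitiveE// -EFinM ltry.
Qed.

Lemma lipschitz_rconv_cvg (h : nat -> R) : (forall n, h n != 0) -> h n @[n --> \oo] --> (0 : R) ->
  ((h n)^-1 * (rconv q X (t0 + h n) - rconv q X t0))%:E @[n --> \oo] -->
  (\int[mu]_s (q s * phi (t0 - s))%:E)%E /\
  (\int[mu]_s (q s * phi (t0 - s))%:E)%E \is a fin_num.
Proof.
move=> hn0 hcv; have [mq q0 qN _] := kq; have mX := cdf_like_measurable cX.
have [M hM] : exists M, forall n, `|h n| <= M.
  have /cvg_seq_bounded : cvgn h by apply: cvgP hcv.
  move=> [M [_ hM]]; exists (M + 1) => n; apply: (hM (M + 1)) => //.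
  by rewrite ltrDl.
pose D := [set s : R | dconvq (h n) s @[n --> \oo] --> q s * phi (t0 - s)].
have aeD : {ae mu, forall s, D s}.
  have [B [mB B0 AB]] := Xd; exists B; split => // s /= nD; apply: AB => /= hs; apply: nD.
  rewrite /D/=; have [s0|s0] := leP s 0.
    rewrite qN// mul0r; rewrite /dconvq; under eq_fun do rewrite qN// mul0r.
    exact: cvg_cst.
  have [dX dphi] : derivable X (t0 - s) 1 /\ derive1 X (t0 - s) = phi (t0 - s).
    by apply: hs; rewrite (lt_trans _ t0T)// ltrBlDr ltrDl.
  apply: cvgM; first exact: cvg_cst.
  rewrite -dphi derive1E.
  have hd : (h n) @[n --> \oo] --> (0 : R)^'.
    move=> A [e /= e0 hA]; have /cvgrPdist_lt/(_ _ e0)[N _ hN] := hcv.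
    by exists N => // n Nn; apply: hA; [exact: hN|exact: hn0].
  have := cvg_comp _ _ hd dX; apply: cvg_trans; apply: near_eq_cvg; near=> n => /=.
  by rewrite /GRing.scale/= mulr1; congr (_ * (X _ - _)); ring.
have mf n : measurable_fun setT (EFin \o dconvq (h n)).
  apply/measurable_EFinP; apply: measurable_funM => //; apply: measurable_funM => //.
  by apply: measurable_funB; apply: (measurableT_comp mX); exact: measurable_funB.
have mg : measurable_fun setT (fun s : R => (q s * phi (t0 - s))%:E).
  apply/measurable_EFinP; apply: measurable_funM => //.
  by apply: (measurableT_comp mphi); exact: measurable_funB.
have := @dominated_convergence _ _ R mu setT measurableT (fun n => EFin \o dconvq (h n))
  (fun s => (q s * phi (t0 - s))%:E) (EFin \o dom M) mf mg.
case.
- have [B [mB B0 AB]] := aeD; exists B; split => // s /= nD; apply: AB => /= hs; apply: nD => _.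
  exact/(cvg_comp _ _ hs).
- exact: dom_integrable.
- by apply: nearW => s n _ /=; rewrite lee_fin; exact: dom_bound.
- move=> ig _ cv; split; last by apply: integral_fune_fin_num ig.
  apply: cvg_trans cv; apply: near_eq_cvg; near=> n.
  by rewrite rconv_quotient.
Unshelve. all: by end_near. Qed.

End lipschitz_convolution.

(** * From densities to the generalized Caputo derivative *)

Section caputo_of_densities.
Context {R : realType} (nu q V f g : R -> R) (t c a b : R).
Notation mu := (@lebesgue_measure R).

Lemma derive1_shift (w : R -> R) (s u : R) : derive1 (fun z => w (z - s)) u = derive1 w (u - s).
Proof.
pose F h := h^-1 *: (w (h + u - s) - w (u - s)).
pose G h := h^-1 *: (w (h + (u - s)) - w (u - s)).
rewrite -[LHS]/(lim (F h @[h --> 0^'])) -[RHS]/(lim (G h @[h --> 0^'])).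
suff -> : F = G by [].
by apply/funext => h; rewrite /F /G addrA.
Qed.

(** The integrand agrees only almost everywhere with [f - g], so its measurability rests on that of
    [derive1 V]. Keeping [f] and [g] as separate nonnegative functions with finite integrals gives
    integrability and the value [a - b] together. *)
Lemma gen_caputo_of_densities : (forall x, 0 < x -> nu x = q x) -> 0 < t ->
  measurable_fun setT q ->
  measurable_fun setT (derive1 V) ->
  measurable_fun setT f -> measurable_fun setT g ->
  (forall s, 0 <= f s) -> (forall s, 0 <= g s) ->
  (forall s, ~~ (0 < s < t) -> f s = 0) -> (forall s, ~~ (0 < s < t) -> g s = 0) ->
  (\int[mu]_s (f s)%:E = a%:E)%E -> (\int[mu]_s (g s)%:E = b%:E)%E ->
  {ae mu, forall s, 0 < s < t -> derive1 V (t - s) * q s = f s - g s} ->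
  abs_cont 0 t V -> (c != 0 -> derivable V t 1) ->
  gen_caputo_defined c nu V t /\ gen_caputo c nu V t = c * derive1 V t + (a - b).
Proof.
move=> nuq t0 mq mdV mf mg f0 g0 fN gN fa gb hae acV dV.
have mI : measurable (`]0, t[%classic : set (measurableTypeR R)) by exact: measurable_itv.
have fint : mu.-integrable setT (EFin \o f) by apply: nn_integrable => //; rewrite fa ltry.
have gint : mu.-integrable setT (EFin \o g) by apply: nn_integrable => //; rewrite gb ltry.
have dint : mu.-integrable setT (EFin \o (f \- g)) by exact: (integrableB measurableT fint gint).
have dintI : mu.-integrable `]0, t[ (EFin \o (f \- g)) by apply: integrableS dint.
have mE : measurable_fun (`]0, t[%classic : set (measurableTypeR R)) (EFin \o (caputo_integrand nu V t)).
  apply: (eq_measurable_fun (fun s : R => (derive1 V (t - s) * q s)%:E)).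
    move=> s; rewrite inE/= in_itv/= => /andP[s0 _].
    by rewrite /caputo_integrand derive1_shift nuq.
  apply: (@measurable_funS _ _ _ _ setT) => //.
  apply/measurable_EFinP; apply: measurable_funM => //.
  by apply: (measurableT_comp mdV); exact: measurable_funB.
have aeE : ae_eq mu `]0, t[%classic (EFin \o (f \- g)) (EFin \o caputo_integrand nu V t).
  have [B [mB B0 AB]] := hae; exists B; split => // s /= nD; apply: AB => /= hs; apply: nD.
  rewrite in_itv/= => hst; have /andP[s0 _] := hst.
  by rewrite /caputo_integrand derive1_shift nuq// hs.
split.
  split => //.
  apply/integrableP; split => //.
  have /integrableP[md doo] := dintI.
  have hE : (\int[mu]_(x in `]0%R, t[) `|(EFin \o (f \- g)%R) x| =
      \int[mu]_(x in `]0%R, t[) `|(EFin \o caputo_integrand nu V t) x|)%E.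
    apply: ae_eq_integral => //.
    - exact: measurableT_comp.
    - exact: measurableT_comp.
    - have [B [mB B0 AB]] := aeE; exists B; split => // s /= nD; apply: AB => /= hs; apply: nD.
      by move=> /hs /(congr1 abse).
  by rewrite -hE.
rewrite /gen_caputo; congr (_ + _); rewrite /Rintegral.
have /integrableP[md _] := dintI.
transitivity (fine (\int[mu]_(x in `]0%R, t[) (EFin \o (f \- g)%R) x)%E).
  by congr fine; apply/esym/ae_eq_integral.
rewrite (_ : (\int[mu]_(x in `]0%R, t[) (EFin \o (f \- g)%R) x = a%:E - b%:E)%E)//.
have h := integralB measurableT fint gint.
rewrite -fa -gb -[RHS]h [LHS]integral_mkcond; apply: eq_integral => s _.
rewrite patchE mem_setE in_itv/=; case: ifPn => // hs.
by rewrite /= fN// gN// sube0.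
Qed.

End caputo_of_densities.

(** * Regularity inherited from a dominating function *)

Section domination.
Context {R : realType} (f g : R -> R) (L : R).
Hypotheses (L0 : 0 <= L) (fg : forall a b, a <= b -> `|f b - f a| <= L * (g b - g a)).

Lemma abs_cont_dominated s t : abs_cont s t g -> abs_cont s t f.
Proof.
(* [L + 1] replaces [L], which may be 0, as a divisor. *)
move=> ac e e0; have L1 : 0 < L + 1 by rewrite ltr_wpDl.
have [del del0 hd] := ac (e / (L + 1)) (divr_gt0 e0 L1); exists del => // n x y hxy tr sd.
apply: (@le_lt_trans _ _ ((L + 1) * \sum_i `|g (y i) - g (x i)|)).
  rewrite mulr_sumr; apply: ler_sum => i _; have [_ [xy _]] := hxy i.
  apply: (le_trans (fg xy)); apply: (@le_trans _ _ (L * `|g (y i) - g (x i)|)).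
    by rewrite ler_wpM2l// ler_norm.
  by rewrite ler_wpM2r// lerDl.
by rewrite mulrC -ltr_pdivlMr//; exact: hd.
Qed.

Lemma continuous_dominated : continuous g -> continuous f.
Proof.
move=> cg x; apply/cvgrPdist_le => e e0; have L1 : 0 < L + 1 by rewrite ltr_wpDl.
have /cvgrPdist_le/(_ _ (divr_gt0 e0 L1)) := cg x; apply: filterS => y.
rewrite ler_pdivlMr// => h; apply: le_trans h.
wlog xy : x y / x <= y.
  by move=> h; have [/h//|/ltW/h] := leP x y; rewrite distrC (distrC (g y)).
rewrite distrC; apply: (le_trans (fg xy)); rewrite (distrC (g x)) [leRHS]mulrC.
apply: (@le_trans _ _ (L * `|g y - g x|)); first by rewrite ler_wpM2l// ler_norm.
by rewrite ler_wpM2r// lerDl.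
Qed.

End domination.

Lemma abs_cont_id {R : realType} (s t : R) : abs_cont s t id.
Proof.
move=> e e0; exists e => // n x y hxy tr; apply: le_lt_trans; apply: ler_sum => i _.
by have [_ [xy _]] := hxy i; rewrite ger0_norm// subr_ge0.
Qed.

(** * The Caputo equation at a fixed time *)

Section main_analysis.
Context {R : realType} (c K w0 : R) (q nu U w r BY BZ : R -> R).
Notation mu := (@lebesgue_measure R).
Hypotheses (c0 : 0 <= c) (K0 : 0 < K) (kq : is_kernel q) (cU : cdf_like U).
Hypothesis nuq : forall x, 0 < x -> nu x = q x.
Hypothesis qdec : forall x y, 0 < x -> x <= y -> q y <= q x.
Hypothesis qinf : forall A, exists2 x, 0 < x & A <= q x.
Hypothesis qac : forall a b, 0 < a -> a <= b -> abs_cont a b q.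
Hypothesis qU : forall t, c * U t + rconv q U t = ramp t.
Let Y t := K * U t + (w t - w0).
Let Z t := K * U t - (w t - w0).
Hypotheses (cY : cdf_like Y) (cZ : cdf_like Z).
Hypothesis qY : forall t, c * Y t + rconv q Y t = BY t.
Hypothesis qZ : forall t, c * Z t + rconv q Z t = BZ t.
Hypothesis dBY : forall t : R, 0 < t -> is_derive t 1 BY (K + r t).
Hypothesis dBZ : forall t : R, 0 < t -> is_derive t 1 BZ (K - r t).

Let ctU : continuous U. Proof. exact: (renewal_continuous c0 kq cU qdec qU qinf). Qed.

Let U0 t : t <= 0 -> U t = 0. Proof. exact: (renewal_at0 c0 kq cU qdec qU qinf). Qed.

Let YZ t : Y t + Z t = 2 * K * U t. Proof. by rewrite /Y /Z; ring. Qed.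

(** [Y] and [Z] are nonnegative with sum [2 * K * U], and [U] vanishes there. *)
Let YN t : t <= 0 -> Y t = 0.
Proof.
have [_ Y0 _ _] := cY; have [_ Z0 _ _] := cZ => t0.
by have := YZ t; have := Y0 t; have := Z0 t; rewrite U0// mulr0; lra.
Qed.

Let ZN t : t <= 0 -> Z t = 0.
Proof. by move=> t0; have := YZ t; rewrite U0// mulr0 YN// add0r. Qed.

Let KK0 : 0 <= 2 * K. Proof. by rewrite mulr_ge0// ltW. Qed.

Let Ydom a b : a <= b -> `|Y b - Y a| <= 2 * K * (U b - U a).
Proof.
have [Ynd _ _ _] := cY; have [Znd _ _ _] := cZ => ab.
rewrite ger0_norm ?subr_ge0 ?Ynd// mulrBr -!YZ.
by have := Znd _ _ ab; lra.
Qed.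

Let Zdom a b : a <= b -> `|Z b - Z a| <= 2 * K * (U b - U a).
Proof.
have [Ynd _ _ _] := cY; have [Znd _ _ _] := cZ => ab.
rewrite ger0_norm ?subr_ge0 ?Znd// mulrBr -!YZ.
by have := Ynd _ _ ab; lra.
Qed.

Let wdom a b : a <= b -> `|w b - w a| <= K * (U b - U a).
Proof.
have [Ynd _ _ _] := cY; have [Znd _ _ _] := cZ => ab.
have := Znd _ _ ab; have := Ynd _ _ ab; rewrite /Y /Z mulrBr => h1 h2.
by rewrite ler_norml; apply/andP; split; move: h1 h2; lra.
Qed.

Let Uac T : 0 < T -> abs_cont 0 T U.
Proof.
move=> T0; have := c0; rewrite le_eqVlt => /predU1P[cE|cpos].
  apply: (renewal_abs_cont kq cU qdec qinf _ qac T0) => t.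
  by rewrite -qU -cE mul0r add0r.
have ci : 0 <= c^-1 by rewrite invr_ge0.
apply: (abs_cont_dominated ci _ (@abs_cont_id R 0 T)) => a b ab.
have [Und _ _ _] := cU; rewrite ger0_norm ?subr_ge0 ?Und//.
by rewrite mulrC ler_pdivlMr// mulrC; exact: (renewal_lipschitz kq cU qU ab).
Qed.

Section at_point.
Variable t0 : R.
Hypothesis t00 : 0 < t0.
(** The horizon only has to exceed [t0], to leave room for forward increments at [t0]. *)
Let T := t0 + 1.

Let T0 : 0 < T. Proof. by rewrite addr_gt0. Qed.
Let t0T : t0 < T. Proof. by rewrite ltrDl. Qed.

Let conv_phi (phi : R -> R) := (\int[mu]_s (q s * phi (t0 - s))%:E)%E.

Let conv_phiE (phi : R -> R) : measurable_fun setT phi -> (forall x, 0 <= phi x) ->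
  conv_phi phi = (\int[mu]_y (phi y * q (t0 - y))%:E)%E.
Proof.
move=> mphi phi0; have [mq q0 _ _] := kq.
rewrite -(@ge0_integral_reflect _ (fun y => (phi y * q (t0 - y))%:E) t0).
- by apply: eq_integral => s _; rewrite mulrC (_ : t0 - (t0 - s) = s)//; ring.
- apply/measurable_EFinP; apply: measurable_funM => //.
  by apply: (measurableT_comp mq); exact: measurable_funB.
- by move=> y; rewrite lee_fin mulr_ge0.
Qed.

(** Domination makes the convolution differentiable at [t0] itself; the equation [c X = B - q * X]
    passes this on to [X], whose derivative was known almost everywhere only. *)
Let lipschitz_case (X B phi : R -> R) (b : R) : 0 < c -> cdf_like X -> X 0 = 0 ->
  (forall a b, a <= b -> `|X b - X a| <= 2 * K * (U b - U a)) ->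
  (forall t, c * X t + rconv q X t = B t) -> is_derive t0 1 B b ->
  measurable_fun setT phi ->
  {ae mu, forall x, x < T -> derivable X x 1 /\ derive1 X x = phi x} ->
  conv_phi phi \is a fin_num /\ is_derive t0 1 X (c^-1 * (b - fine (conv_phi phi))).
Proof.
move=> cpos cX X0 Xdom XB Bb mphi aeX.
have [Xnd _ _ _] := cX.
have XL a b' : a <= b' -> X b' - X a <= (2 * K * c^-1) * (b' - a).
  move=> ab; apply: (le_trans (ler_norm _)); apply: (le_trans (Xdom _ _ ab)).
  rewrite -[leRHS]mulrA ler_wpM2l// [leRHS]mulrC ler_pdivlMr// mulrC.
  exact: (renewal_lipschitz kq cU qU ab).
have aeX' := ae_reflect t0 aeX.
have lc := lipschitz_rconv_cvg kq cX X0 mphi XL t0T aeX'.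
have fin : conv_phi phi \is a fin_num.
  have h1 n : (n.+1%:R^-1 : R) != 0 by rewrite invr_eq0.
  have h2 : (n.+1%:R^-1 : R) @[n --> \oo] --> (0 : R).
    apply/cvgrPdist_lt => e e0; have [N _ hN] := near_infty_natSinv_lt (PosNum e0).
    by exists N => // n Nn; rewrite /= sub0r normrN gtr0_norm//; exact: hN.
  by have [] := lc _ h1 h2.
split => //.
have dconv : h^-1 *: (rconv q X (h *: (1 : R) + t0) - rconv q X t0) @[h --> 0^'] --> fine (conv_phi phi).
  apply/cvgr_dnbhsP => h [h0 hcv].
  have [+ _] := lc h h0 hcv.
  rewrite -/(conv_phi phi) -(fineK fin) => /fine_cvg; apply: cvg_trans; apply: near_eq_cvg.
  by near=> n; rewrite /GRing.scale/= mulr1 (addrC t0).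
have dr : is_derive t0 1 (rconv q X) (fine (conv_phi phi)).
  split; first exact: (cvgP _ dconv).
  exact: (cvg_lim _ dconv).
have XE : X = (fun t => c^-1 * (B t - rconv q X t)).
  by apply/funext => t; rewrite -XB addrK mulKf// gt_eqF.
have : is_derive t0 1 (fun t => c^-1 * (B t - rconv q X t)) (c^-1 * (b - fine (conv_phi phi))).
  by have := is_deriveZ c^-1 (is_deriveB Bb dr).
by rewrite -XE.
Unshelve. all: by end_near. Qed.

Lemma caputo_equation : gen_caputo_defined c nu w t0 /\ gen_caputo c nu w t0 = r t0.
Proof.
have [mq q0 qN _] := kq.
have [Ynd _ _ _] := cY; have [Znd _ _ _] := cZ.
have [phY [mY pY NY EY aeY]] := abs_cont_density T0 Ynd YN (abs_cont_dominated KK0 Ydom (Uac T0)).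
have [phZ [mZ pZ NZ EZ aeZ]] := abs_cont_density T0 Znd ZN (abs_cont_dominated KK0 Zdom (Uac T0)).
have wE t : w t = w0 + 2^-1 * (Y t - Z t) by rewrite /Y /Z; field.
have [aY [aZ [hY hZ hw]]] : exists aY aZ, [/\ conv_phi phY = aY%:E, conv_phi phZ = aZ%:E &
    (c != 0 -> derivable w t0 1) /\ c * derive1 w t0 + (aY / 2 - aZ / 2) = r t0].
  have := c0; rewrite le_eqVlt => /predU1P[cE|cpos].
    have qY' t : rconv q Y t = BY t by rewrite -qY -cE mul0r add0r.
    have qZ' t : rconv q Z t = BZ t by rewrite -qZ -cE mul0r add0r.
    have qU' t : rconv q U t = ramp t by rewrite -qU -cE mul0r add0r.
    have uY := density_upper kq cY mY pY EY qdec (ltW t0T) qY' (dBY t00).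
    have uZ := density_upper kq cZ mZ pZ EZ qdec (ltW t0T) qZ' (dBZ t00).
    rewrite -conv_phiE// in uY; rewrite -conv_phiE// in uZ.
    (* A density of [U], because [Y + Z = 2 * K * U]. *)
    pose psi x := (2 * K)^-1 * (phY x + phZ x).
    have mYZ : measurable_fun setT (fun x : R => phY x + phZ x) by exact: measurable_funD.
    have mpsi : measurable_fun setT psi by exact: measurable_funM.
    have KKi : 0 <= (2 * K)^-1 by rewrite invr_ge0.
    have pYZ x : 0 <= phY x + phZ x by rewrite addr_ge0.
    have psi0 x : 0 <= psi x by rewrite mulr_ge0.
    have mh (phi : R -> R) t : measurable_fun setT phi -> measurable_fun setT (fun x : R => phi x * heaviside (t - x)).
      by move=> mp; apply: measurable_funM => //; exact: measurable_heaviside_sub.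
    have Upsi t : t <= T -> (U t)%:E = (\int[mu]_x (psi x * heaviside (t - x))%:E)%E.
      move=> tT; transitivity ((2 * K)^-1%:E * ((Y t)%:E + (Z t)%:E))%E.
        by rewrite -EFinD -EFinM YZ mulKf// mulf_neq0 ?gt_eqF.
      rewrite (EY _ tT) (EZ _ tT).
      have p1 (phi : R -> R) : (forall x, 0 <= phi x) -> forall x, 0 <= phi x * heaviside (t - x).
        by move=> h x; rewrite mulr_ge0// ler0n.
      rewrite -(integral_nnD mu (mh _ t mY) (mh _ t mZ) (p1 _ pY) (p1 _ pZ)).
      have m2 : measurable_fun setT (fun x : R => phY x * heaviside (t - x) + phZ x * heaviside (t - x)).
        by apply: measurable_funD; exact: mh.
      have p2 (x : R) : 0 <= phY x * heaviside (t - x) + phZ x * heaviside (t - x).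
        by apply: addr_ge0; exact: p1.
      rewrite -(integral_nnZl mu m2 p2 KKi); apply: eq_integral => x _; congr EFin.
      by rewrite /psi; ring.
    have low := density_lower kq cU qdec qinf qU' qac mpsi psi0 Upsi t00 t0T.
    rewrite -conv_phiE// in low.
    have lowE : conv_phi psi = ((2 * K)^-1%:E * (conv_phi phY + conv_phi phZ))%E.
      have mc (phi : R -> R) : measurable_fun setT phi -> measurable_fun setT (fun s : R => q s * phi (t0 - s)).
        move=> mp; apply: measurable_funM => //.
        by apply: (measurableT_comp mp); exact: measurable_funB.
      have pc (phi : R -> R) : (forall x, 0 <= phi x) -> forall s, 0 <= q s * phi (t0 - s).
        by move=> h s; rewrite mulr_ge0.
      rewrite /conv_phi -(integral_nnD mu (mc _ mY) (mc _ mZ) (pc _ pY) (pc _ pZ)).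
      have m2 : measurable_fun setT (fun s : R => q s * phY (t0 - s) + q s * phZ (t0 - s)).
        by apply: measurable_funD; exact: mc.
      have p2 (s : R) : 0 <= q s * phY (t0 - s) + q s * phZ (t0 - s).
        by apply: addr_ge0; exact: pc.
      rewrite -(integral_nnZl mu m2 p2 KKi); apply: eq_integral => x _; congr EFin.
      by rewrite /psi; ring.
    have Y0 : (0 <= conv_phi phY)%E by apply: integral_ge0 => s _; rewrite lee_fin mulr_ge0.
    have Z0 : (0 <= conv_phi phZ)%E by apply: integral_ge0 => s _; rewrite lee_fin mulr_ge0.
    rewrite lowE in low.
    (* The upper bounds exclude infinite values, so the three inequalities can be compared in
       [R]. *)
    case: (conv_phi phY) uY Y0 low => [aY| |] // uY _ low.
    case: (conv_phi phZ) uZ Z0 low => [aZ| |] // uZ _ low.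
    exists aY, aZ; split => //; split; first by rewrite -cE eqxx.
    rewrite -cE mul0r add0r; move: uY uZ low; rewrite -EFinD -EFinM !lee_fin mulrC ler_pdivlMr ?mulr_gt0//.
    by rewrite mul1r => u1 u2 l1; lra.
  have YL := lipschitz_case cpos cY (YN (lexx 0)) Ydom qY (dBY t00) mY aeY.
  have ZL := lipschitz_case cpos cZ (ZN (lexx 0)) Zdom qZ (dBZ t00) mZ aeZ.
  have [fY dY] := YL; have [fZ dZ] := ZL.
  exists (fine (conv_phi phY)), (fine (conv_phi phZ)); split; rewrite ?fineK//.
  have dw : is_derive t0 1 w (2^-1 * (c^-1 * (K + r t0 - fine (conv_phi phY)) -
      c^-1 * (K - r t0 - fine (conv_phi phZ)))).
    have -> : w = (fun t => w0 + 2^-1 * (Y t - Z t)) by apply/funext => t; exact: wE.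
    have := is_deriveD (is_derive_cst w0 t0 1) (is_deriveZ 2^-1 (is_deriveB dY dZ)).
    by rewrite add0r.
  split; first by move=> _; exact: ex_derive.
  rewrite derive1E (@derive_val _ _ _ _ _ _ _ dw); field.
  by rewrite gt_eqF.
have [dw wr] := hw.
have mdw : measurable_fun setT (derive1 w).
  by apply: measurable_derive1; exact: (continuous_dominated (ltW K0) wdom ctU).
have acw : abs_cont 0 t0 w := abs_cont_dominated (ltW K0) wdom (Uac t00).
pose f s := 2^-1 * (q s * phY (t0 - s)); pose g s := 2^-1 * (q s * phZ (t0 - s)).
have i2 : 0 <= 2^-1 :> R by [].
have mc (phi : R -> R) : measurable_fun setT phi -> measurable_fun setT (fun s : R => q s * phi (t0 - s)).
  move=> mp; apply: measurable_funM => //.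
  by apply: (measurableT_comp mp); exact: measurable_funB.
have pc (phi : R -> R) : (forall x, 0 <= phi x) -> forall s, 0 <= q s * phi (t0 - s).
  by move=> h s; rewrite mulr_ge0.
have oN (phi : R -> R) : (forall x, x <= 0 -> phi x = 0) -> forall s, ~~ (0 < s < t0) ->
    2^-1 * (q s * phi (t0 - s)) = 0.
  move=> h s; rewrite negb_and -!leNgt => /orP[s0|s0]; first by rewrite qN// mul0r mulr0.
  by rewrite h ?mulr0// subr_le0.
rewrite -wr; apply: (gen_caputo_of_densities (q := q) (f := f) (g := g)) => //.
- by apply: measurable_funM => //; exact: mc.
- by apply: measurable_funM => //; exact: mc.
- by move=> s; rewrite mulr_ge0// pc.
- by move=> s; rewrite mulr_ge0// pc.
- exact: oN.
- exact: oN.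
- by rewrite /f (integral_nnZl mu (mc _ mY) (pc _ pY) i2) -/(conv_phi phY) hY -EFinM mulrC.
- by rewrite /g (integral_nnZl mu (mc _ mZ) (pc _ pZ) i2) -/(conv_phi phZ) hZ -EFinM mulrC.
- have aeYr := ae_reflect t0 aeY; have aeZr := ae_reflect t0 aeZ.
  apply: (@filterS2 _ _ (ae_filter_ringOfSetsType mu) _ _ _ _ aeYr aeZr).
  move=> s /= hs1 hs2 /andP[s0 st].
  have sT : t0 - s < T by rewrite (lt_trans _ t0T)// ltrBlDr ltrDl.
  have [dY dYE] := hs1 sT; have [dZ dZE] := hs2 sT.
  have dw' : is_derive (t0 - s) 1 w (2^-1 * (phY (t0 - s) - phZ (t0 - s))).
    have -> : w = (fun t => w0 + 2^-1 * (Y t - Z t)) by apply/funext => t; exact: wE.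
    have hY' := derivableP dY; have hZ' := derivableP dZ.
    rewrite -dYE -dZE !derive1E.
    have := is_deriveD (is_derive_cst w0 (t0 - s) 1) (is_deriveZ 2^-1 (is_deriveB hY' hZ')).
    by rewrite add0r.
  rewrite derive1E (@derive_val _ _ _ _ _ _ _ dw') /f /g; ring.
Qed.

End at_point.

End main_analysis.

(** * Events of processes and rates of counting processes *)

Section process_sigma.
Context d (T : measurableType d) (R : realType) d' (U : measurableType d').

Lemma process_sigma_preimage (X : R -> T -> U) (I : set R) t (B : set U) : I t -> measurable B ->
  process_sigma X I (X t @^-1` B).
Proof. by move=> It mB; apply: sub_gen_smallest; exists t => //; exists B. Qed.

Lemma process_sigmaI (X : R -> T -> U) (I : set R) A B :
  process_sigma X I A -> process_sigma X I B -> process_sigma X I (A `&` B).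
Proof.
have [c0 cC cU] := smallest_sigma_algebra [set: T] [set X t @^-1` B | t in I & B in measurable].
have hC E : process_sigma X I E -> process_sigma X I (~` E) by move=> h; rewrite -setTD; exact: cC.
move=> hA hB; rewrite -[A `&` B]setCK setCI.
apply: (hC (~` A `|` ~` B)); rewrite -bigcup2E; apply: cU => -[|[|n]] /=.
- exact: (hC A hA).
- exact: (hC B hB).
- exact: c0.
Qed.

End process_sigma.

Section gcp_facts.
Context d (T : measurableType d) (R : realType) (P : probability T R).

Lemma measurable_int_level (X : T -> int) (n : int) : measurable_fun setT X ->
  measurable [set w | X w = n].
Proof. by move=> mX; rewrite -[X in measurable X]setTI; apply: (mX measurableT [set n]). Qed.

Lemma gcp1_jump (rate : 'I_1 -> R) (M : R -> T -> int) : gcp P rate M ->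
  h^-1 * state_prob P M 1 h @[h --> 0^'+] --> rate ord0 /\
  h^-1 * (1 - state_prob P M 0 h) @[h --> 0^'+] --> rate ord0.
Proof. by move=> [_ h1 h2]; split; [exact: (h1 ord0)|rewrite big_ord1 in h2]. Qed.

Lemma rate_ge0 (rate : 'I_1 -> R) (M : R -> T -> int) : gcp P rate M -> 0 <= rate ord0.
Proof.
move=> /gcp1_jump[h _]; rewrite -(cvg_lim _ h)//; apply: limr_ge; first exact: cvgP h.
near=> x; rewrite mulr_ge0 ?fine_ge0// invr_ge0 ltW//; near: x; exact: nbhs_right_gt.
Unshelve. all: by end_near. Qed.

End gcp_facts.

(** * Transition estimates for differences of unit-jump processes *)

Section skellam_transition.
Context d (T : measurableType d) (R : realType) (P : probability T R).
Variables (lam mu : 'I_1 -> R) (M1 M2 : R -> T -> int) (S : R -> T -> int).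
Hypotheses (g1 : gcp P lam M1) (g2 : gcp P mu M2) (ind : independent_processes P M1 M2).
Hypothesis SE : forall t w, S t w = M1 t w - M2 t w.

Let l1 := let: And3 h _ _ := g1 in h.
Let l2 := let: And3 h _ _ := g2 in h.

Let mM1 t : 0 <= t -> measurable_fun setT (M1 t). Proof. by have [[h _] _ _ _] := l1; exact: h. Qed.
Let mM2 t : 0 <= t -> measurable_fun setT (M2 t). Proof. by have [[h _] _ _ _] := l2; exact: h. Qed.

Lemma measurable_skellam t : 0 <= t -> measurable_fun setT (S t).
Proof.
move=> t0 _ B _; rewrite setTI.
rewrite (_ : S t @^-1` B = \bigcup_(k : nat) \bigcup_(l in [set l : nat | B ((odflt 0 (unpickle k) : int) - (odflt 0 (unpickle l) : int))])
   ([set w | M1 t w = odflt 0 (unpickle k)] `&` [set w | M2 t w = odflt 0 (unpickle l)])).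
  apply: bigcupT_measurable => k; apply: bigcup_measurable => l _.
  by apply: measurableI; apply: measurable_int_level; [exact: mM1|exact: mM2].
apply/seteqP; split => w /=.
  move=> BS; exists (pickle (M1 t w)) => //; exists (pickle (M2 t w)); last by split; rewrite /= pickleK.
  by move: BS; rewrite /= !pickleK SE.
by move=> [k _ [l /= Bkl [e1 e2]]]; rewrite SE e1 e2.
Qed.

Let p1 (j : int) h := state_prob P M1 j h.
Let p2 (j : int) h := state_prob P M2 j h.
Let g (n : int) t := state_prob P S n t.

Let fin1 j h : 0 <= h -> P [set w | M1 h w = j] = (p1 j h)%:E.
Proof. by move=> h0; rewrite /p1 /state_prob fineK// fin_num_measure//; exact/measurable_int_level/mM1. Qed.

Let fin2 j h : 0 <= h -> P [set w | M2 h w = j] = (p2 j h)%:E.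
Proof. by move=> h0; rewrite /p2 /state_prob fineK// fin_num_measure//; exact/measurable_int_level/mM2. Qed.

Let fing n t : 0 <= t -> P [set w | S t w = n] = (g n t)%:E.
Proof. by move=> h0; rewrite /g /state_prob fineK// fin_num_measure//; exact/measurable_int_level/measurable_skellam. Qed.

Let joint t h (i j i' j' : int) : 0 <= t -> 0 <= h ->
  P ([set w | M1 t w = i /\ M1 (t + h) w - M1 t w = j] `&`
     [set w | M2 t w = i' /\ M2 (t + h) w - M2 t w = j']) =
  (P [set w | M1 t w = i] * P [set w | M1 h w = j] *
   (P [set w | M2 t w = i'] * P [set w | M2 h w = j']))%E.
Proof.
move=> t0 h0; have th0 : 0 <= t + h by rewrite addr_ge0.
have E (M : R -> T -> int) (a b : int) : [set w | M t w = a /\ M (t + h) w - M t w = b] =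
    M t @^-1` [set a] `&` M (t + h) @^-1` [set a + b].
  apply/seteqP; split => w /= [e1 e2]; split => //; first by rewrite /= -e1 -e2 [RHS]addrC subrK.
  by rewrite e1 e2 addrAC subrr add0r.
have ps (M : R -> T -> int) (a b : int) : process_sigma M [set t | 0 <= t]
    [set w | M t w = a /\ M (t + h) w - M t w = b].
  by rewrite E; apply: process_sigmaI; apply: process_sigma_preimage.
rewrite (ind (ps M1 i j) (ps M2 i' j')).
have one (M : R -> T -> int) (a b : int) : levy_int P M ->
    P [set w | M t w = a /\ M (t + h) w - M t w = b] = (P [set w | M t w = a] * P [set w | M h w = b])%E.
  move=> [_ _ st inc]; have pa : process_sigma M `[0, t]%classic [set w | M t w = a].
    by apply: (@process_sigma_preimage _ _ _ _ _ M _ t [set a]) => //=; rewrite in_itv/= t0 lexx.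
  by have := inc t h t0 h0 b _ pa; rewrite st.
by rewrite !one.
Qed.

Let A t h (n j j' : int) := [set w | S t w = n /\ (M1 (t + h) w - M1 t w = j /\ M2 (t + h) w - M2 t w = j')].

Let mA t h n j j' : 0 <= t -> 0 <= h -> measurable (A t h n j j').
Proof.
move=> t0 h0; have th0 : 0 <= t + h by rewrite addr_ge0.
have mD (M : R -> T -> int) (b : int) : (forall t, 0 <= t -> measurable_fun setT (M t)) ->
    measurable [set w | M (t + h) w - M t w = b].
  move=> mM; rewrite (_ : [set w | _] = \bigcup_(k : nat) ([set w | M t w = odflt 0 (unpickle k)] `&`
      [set w | M (t + h) w = odflt 0 (unpickle k) + b])).
    by apply: bigcupT_measurable => k; apply: measurableI; apply: measurable_int_level; exact: mM.
  apply/seteqP; split => w /=.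
    by move=> <-; exists (pickle (M t w)) => //; rewrite pickleK/=; split => //=; rewrite [RHS]addrC subrK.
  by move=> [k _ [-> ->]]; rewrite addrAC subrr add0r.
rewrite (_ : A t h n j j' = [set w | S t w = n] `&` ([set w | M1 (t + h) w - M1 t w = j] `&` [set w | M2 (t + h) w - M2 t w = j'])).
  apply: measurableI; first exact: measurable_int_level (measurable_skellam t0).
  by apply: measurableI; [exact: (mD M1 j mM1)|exact: (mD M2 j' mM2)].
by apply/seteqP; split => w /=.
Qed.

Let partition_int (E : set T) (X : T -> int) : measurable E -> measurable_fun setT X ->
  P E = (\sum_(0 <= k <oo) P (E `&` [set w | pickle (X w) = k]))%E.
Proof.
move=> mE mX; have mk k : measurable [set w | pickle (X w) = k].
  rewrite -[X in measurable X]setTI; exact: (mX measurableT [set i | pickle i = k]).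
rewrite [in LHS](_ : E = \bigcup_k (E `&` [set w | pickle (X w) = k])).
  rewrite measure_bigcup; last 2 first.
  - by move=> k _; exact: measurableI.
  - by move=> k l _ _ [w [[_ /= <-] [_ /= <-]]].
  by apply: eq_eseriesl => k; rewrite in_setT.
by apply/seteqP; split => [w Ew|w [k _ []]//]; exists (pickle (X w)).
Qed.

(** A level set of [S t] belongs to neither process alone. Splitting over the value of [M2 t] gives
    intersections of one event of each process, to which independence and the Lévy property apply;
    the pieces are then summed back. *)
Let PA t h (n j j' : int) : 0 <= t -> 0 <= h ->
  P (A t h n j j') = ((p1 j h * p2 j' h)%:E * P [set w | S t w = n])%E.
Proof.
move=> t0 h0; rewrite (partition_int (mA n j j' t0 h0) (mM2 t0)).
have mS := measurable_int_level n (measurable_skellam t0).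
rewrite (partition_int mS (mM2 t0)) -nneseriesZl; last by move=> k _; exact: measure_ge0.
apply: eq_eseriesr => k _.
have [[i ik]|ne] := pselect (exists i : int, pickle i = k); last first.
  have e0 (E : set T) : E `&` [set w | pickle (M2 t w) = k] = set0.
    by apply/seteqP; split => // w [_ /= hw]; apply: ne; exists (M2 t w).
  by rewrite !e0 !measure0 mule0.
have -> : A t h n j j' `&` [set w | pickle (M2 t w) = k] =
    [set w | M1 t w = n + i /\ M1 (t + h) w - M1 t w = j] `&`
    [set w | M2 t w = i /\ M2 (t + h) w - M2 t w = j'].
  apply/seteqP; split => w /=.
    move=> [[Sn [I1 I2]]]; rewrite -ik => /(pcan_inj (@pickleK int)) Mi.
    by split; split => //; rewrite -Sn SE Mi subrK.
  move=> [[e1 e2] [e3 e4]]; split; last by rewrite e3 ik.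
  by split; [rewrite SE e1 e3 addrK|split].
have -> : [set w | S t w = n] `&` [set w | pickle (M2 t w) = k] =
    M1 t @^-1` [set n + i] `&` M2 t @^-1` [set i].
  apply/seteqP; split => w /=.
    by move=> [Sn]; rewrite -ik => /(pcan_inj (@pickleK int)) Mi; rewrite -Sn SE Mi subrK.
  by move=> [e1 e2]; rewrite SE e1 e2 addrK ik.
rewrite joint// ind; last 2 first.
- exact: process_sigma_preimage.
- exact: process_sigma_preimage.
have -> : P (M1 t @^-1` [set n + i]) = (p1 (n + i) t)%:E by exact: fin1.
have -> : P (M2 t @^-1` [set i]) = (p2 i t)%:E by exact: fin2.
by rewrite !fin1// !fin2// -!EFinM; congr EFin; ring.
Qed.

Let J t h (j j' : int) := [set w | M1 (t + h) w - M1 t w = j /\ M2 (t + h) w - M2 t w = j'].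

Let mJ t h j j' : 0 <= t -> 0 <= h -> measurable (J t h j j').
Proof.
move=> t0 h0; rewrite (_ : J t h j j' = \bigcup_(k : nat) A t h (odflt 0 (unpickle k)) j j').
  by apply: bigcupT_measurable => k; exact: mA.
apply/seteqP; split => w /=; last by move=> [k _ []].
by move=> hJ; exists (pickle (S t w)) => //; rewrite /A/= pickleK.
Qed.

Let PJ t h (j j' : int) : 0 <= t -> 0 <= h ->
  P (J t h j j') = (p1 j h * p2 j' h)%:E.
Proof.
move=> t0 h0; rewrite (partition_int (mJ j j' t0 h0) (measurable_skellam t0)).
rewrite -[RHS]mule1 -(probability_setT P) (partition_int measurableT (measurable_skellam t0)) -nneseriesZl; last by move=> k _; exact: measure_ge0.
apply: eq_eseriesr => k _; rewrite setTI.
have [[i ik]|ne] := pselect (exists i : int, pickle i = k); last first.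
  have e0 : [set w | pickle (S t w) = k] = set0.
    by apply/seteqP; split => // w /= hw; apply: ne; exists (S t w).
  by rewrite e0 setI0 !measure0 mule0.
have -> : [set w | pickle (S t w) = k] = [set w | S t w = i].
  by apply/seteqP; split => w /=; rewrite -ik; [move=> /(pcan_inj (@pickleK int))|move=> ->].
by rewrite -PA//; congr (P _); apply/seteqP; split => w /= [].
Qed.

Let main_part n t h := p1 0 h * p2 0 h * g n t + (p1 1 h * p2 0 h * g (n - 1) t + p1 0 h * p2 1 h * g (n + 1) t).

Let union n t h := A t h n 0 0 `|` (A t h (n - 1) 1 0 `|` A t h (n + 1) 0 1).

Let munion n t h : 0 <= t -> 0 <= h -> measurable (union n t h).
Proof. by move=> t0 h0; apply: measurableU; [exact: mA|apply: measurableU; exact: mA]. Qed.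

Let P3U (A1 A2 A3 : set T) : measurable A1 -> measurable A2 -> measurable A3 ->
  A1 `&` A2 = set0 -> A1 `&` A3 = set0 -> A2 `&` A3 = set0 ->
  P (A1 `|` (A2 `|` A3)) = (P A1 + (P A2 + P A3))%E.
Proof.
move=> m1 m2 m3 d12 d13 d23; rewrite measureU//; first by rewrite measureU.
  exact: measurableU.
by rewrite setIUr d12 d13 setU0.
Qed.

Let Punion n t h : 0 <= t -> 0 <= h -> P (union n t h) = (main_part n t h)%:E.
Proof.
move=> t0 h0; rewrite P3U; try exact: mA.
- by rewrite !PA// !fing// -!EFinM -!EFinD.
- by apply/seteqP; split => // w [/= [_ [e1 _]] [_ [e2 _]]]; rewrite e1 in e2.
- by apply/seteqP; split => // w [/= [_ [_ e1]] [_ [_ e2]]]; rewrite e1 in e2.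
- by apply/seteqP; split => // w [/= [_ [e1 _]] [_ [e2 _]]]; rewrite e1 in e2.
Qed.

Let good t h := J t h 0 0 `|` (J t h 1 0 `|` J t h 0 1).

Let Pgood t h : 0 <= t -> 0 <= h ->
  P (good t h) = (p1 0 h * p2 0 h + (p1 1 h * p2 0 h + p1 0 h * p2 1 h))%:E.
Proof.
move=> t0 h0; rewrite P3U; try exact: mJ.
- by rewrite !PJ// -!EFinD.
- by apply/seteqP; split => // w [/= [e1 _] [e2 _]]; rewrite e1 in e2.
- by apply/seteqP; split => // w [/= [_ e1] [_ e2]]; rewrite e1 in e2.
- by apply/seteqP; split => // w [/= [e1 _] [e2 _]]; rewrite e1 in e2.
Qed.

Let mgood t h : 0 <= t -> 0 <= h -> measurable (good t h).
Proof. by move=> t0 h0; apply: measurableU; [exact: mJ|apply: measurableU; exact: mJ]. Qed.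

Let SI t h w : S (t + h) w = S t w + ((M1 (t + h) w - M1 t w) - (M2 (t + h) w - M2 t w)).
Proof. by rewrite !SE; ring. Qed.

(** Either no process moves, or exactly one moves, by one unit, or [good] fails. The probability of
    the last case depends neither on [n] nor on [t], so the error is uniform. *)
Lemma transition_bounds n t h : 0 <= t -> 0 <= h ->
  main_part n t h <= g n (t + h) <=
  main_part n t h + (1 - (p1 0 h * p2 0 h + (p1 1 h * p2 0 h + p1 0 h * p2 1 h))).
Proof.
move=> t0 h0; have th0 : 0 <= t + h by rewrite addr_ge0.
have mS := measurable_int_level n (measurable_skellam th0).
have mU := munion n t0 h0; have mg := mgood t0 h0.
apply/andP; split; rewrite -lee_fin -fing//.
  rewrite -Punion//; apply: le_measure; rewrite ?inE//.
  move=> w [[/= Sn [e1 e2]]|[[/= Sn [e1 e2]]|[/= Sn [e1 e2]]]]; rewrite SI Sn e1 e2.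
  - by rewrite subrr addr0.
  - by rewrite subr0 subrK.
  - by rewrite sub0r addrK.
rewrite EFinD -(Punion n t0 h0) EFinB -(Pgood t0 h0) -probability_setC//.
apply: (@le_trans _ _ (P (union n t h `|` ~` good t h))).
  apply: le_measure; rewrite ?inE//; first by apply: measurableU => //; exact: measurableC.
  move=> w /= Sn; have [[hJ|[hJ|hJ]]|ng] := pselect (good t h w); last by right.
  - by left; left; move: Sn; rewrite /A/= SI; case: hJ => -> ->; rewrite subrr addr0.
  - by left; right; left; move: Sn; rewrite /A/= SI; case: hJ => -> -> <-; rewrite subr0 addrK.
  - by left; right; right; move: Sn; rewrite /A/= SI; case: hJ => -> -> <-; rewrite sub0r subrK.
by apply: measureU2 => //; exact: measurableC.
Qed.

End skellam_transition.

(** * From uniform forward estimates to derivatives *)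

Section one_sided_derivative.
Context {R : realType} (g : int -> R -> R) (l m : R) (eps : R -> R).
Hypotheses (l0 : 0 <= l) (m0 : 0 <= m) (g01 : forall n t, 0 <= g n t <= 1).
Hypothesis est : forall n t h, 0 <= t -> 0 < h ->
  `|g n (t + h) - g n t - h * skellam_rhs l m g n t| <= h * eps h.
Hypothesis eps0 : eps h @[h --> 0^'+] --> (0 : R).

Let C := l + m.

Let rhs_le n t : `|skellam_rhs l m g n t| <= C.
Proof.
rewrite /skellam_rhs /C; have /andP[a1 a2] := g01 n t; have /andP[b1 b2] := g01 (n - 1) t.
have /andP[c1 c2] := g01 (n + 1) t.
apply: (le_trans (ler_normB _ _)); apply: lerD; rewrite normrM (ger0_norm l0, ger0_norm m0) ler_piMr// ler_norml.
  by apply/andP; split; move: a1 a2 b1 b2; lra.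
by apply/andP; split; move: a1 a2 c1 c2; lra.
Qed.

Let inc n t h : 0 <= t -> 0 < h -> `|g n (t + h) - g n t| <= h * (eps h + C).
Proof.
move=> t0 h0; rewrite mulrDr.
rewrite -[X in `|X|](subrK (h * skellam_rhs l m g n t)); apply: (le_trans (ler_normD _ _)).
apply: lerD; first exact: est.
by rewrite normrM (gtr0_norm h0) ler_wpM2l// ltW.
Qed.

Let rhs_inc n t h : 0 <= t -> 0 < h ->
  `|skellam_rhs l m g n (t + h) - skellam_rhs l m g n t| <= 2 * C * (h * (eps h + C)).
Proof.
move=> t0 h0; have i1 := inc n t0 h0; have i2 := inc (n - 1) t0 h0; have i3 := inc (n + 1) t0 h0.
set e := h * (eps h + C) in i1 i2 i3 *.
have -> : skellam_rhs l m g n (t + h) - skellam_rhs l m g n t =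
    l * ((g (n - 1) (t + h) - g (n - 1) t) - (g n (t + h) - g n t)) -
    m * ((g n (t + h) - g n t) - (g (n + 1) (t + h) - g (n + 1) t)) by rewrite /skellam_rhs; ring.
apply: (le_trans (ler_normB _ _)); rewrite !normrM (ger0_norm l0) (ger0_norm m0).
have -> : 2 * C * e = l * (e + e) + m * (e + e) by rewrite /C; ring.
by apply: lerD; apply: ler_wpM2l => //; apply: (le_trans (ler_normB _ _)); exact: lerD.
Qed.

Let eta h := 2 * C * (h * (eps h + C)) + eps h.

Let eta0 : eta h @[h --> 0^'+] --> (0 : R).
Proof.
have c1 : h * (eps h + C) @[h --> 0^'+] --> 0 * (0 + C).
  apply: cvgM; first exact: (cvg_at_right_filter cvg_id).
  by apply: cvgD; [exact: eps0|exact: cvg_cst].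
have c2 : eta h @[h --> 0^'+] --> 2 * C * (0 * (0 + C)) + 0.
  by apply: cvgD; [apply: cvgM; [exact: cvg_cst|exact: c1]|exact: eps0].
by rewrite mul0r mulr0 addr0 in c2.
Qed.

(** Since [est] is uniform in the base point, a negative increment [h] is treated as the step [- h]
    from [t + h]; the right-hand side at [t + h] differs from that at [t] by a quantity that
    [rhs_inc] controls. *)
Lemma skellam_derive n (t : R) : 0 < t -> is_derive t 1 (g n) (skellam_rhs l m g n t).
Proof.
move=> t0.
have C0 : 0 <= C by rewrite addr_ge0.
have key : h^-1 *: (g n (h *: (1 : R) + t) - g n t) @[h --> 0^'] --> skellam_rhs l m g n t.
  apply/cvgrPdist_le => e e0.
  have /cvgr_le/(_ e e0) := eta0; move=> [del /= del0 hd].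
  have near0 : \forall h \near (0 : R)^', `|h| < Num.min del t.
    exists (Num.min del t) => /=; first by rewrite lt_min del0 t0.
    by move=> h /=; rewrite sub0r normrN.
  have near1 : \forall h \near (0 : R)^', h != 0 by exists 1 => //=.
  move: near0 near1; apply: filterS2 => h; rewrite lt_min => /andP[hdel ht] h0.
  have he k : 0 < k -> k < del -> eta k <= e.
    by move=> k0 kd; apply: hd => //=; rewrite sub0r normrN gtr0_norm.
  rewrite /GRing.scale/= mulr1 distrC.
  have [hpos|hneg] := ltP 0 h.
    have eh := est n (ltW t0) hpos.
    rewrite gtr0_norm// in hdel; apply: le_trans (he _ hpos hdel).
    have -> : h^-1 * (g n (h + t) - g n t) - skellam_rhs l m g n t =
      h^-1 * (g n (t + h) - g n t - h * skellam_rhs l m g n t).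
      by rewrite [RHS]mulrBr mulKf// (addrC h).
    rewrite normrM normfV (gtr0_norm hpos) ler_pdivrMl//; apply: (le_trans eh).
    apply: ler_wpM2l; first exact: ltW.
    rewrite /eta lerDr; apply: mulr_ge0; first by rewrite mulr_ge0.
    have e1 : 0 <= h * eps h := le_trans (normr_ge0 _) eh.
    by rewrite mulrDr addr_ge0// mulr_ge0// ltW.
  have kpos : 0 < - h by rewrite oppr_gt0 lt_neqAle h0.
  have hn : h < 0 by rewrite lt_neqAle h0.
  rewrite (ltr0_norm hn) in hdel ht.
  have t1 : 0 <= t + h by move: ht; lra.
  have eh := est n t1 kpos; have rh := rhs_inc n t1 kpos; rewrite addrK in eh rh.
  apply: le_trans (he _ kpos hdel); rewrite /eta [leRHS]addrC.
  have -> : h^-1 * (g n (h + t) - g n t) - skellam_rhs l m g n t =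
    (- h)^-1 * (g n t - g n (t + h) - (- h) * skellam_rhs l m g n (t + h)) -
    (skellam_rhs l m g n t - skellam_rhs l m g n (t + h)).
    by rewrite (addrC h t); field.
  apply: (le_trans (ler_normB _ _)); apply: lerD => //.
  by rewrite normrM normfV (gtr0_norm kpos) ler_pdivrMl.
by split; [exact: (cvgP _ key)|exact: (cvg_lim _ key)].
Qed.

End one_sided_derivative.

(** * State equations for unit jumps *)

Section unit_jumps.
Context d (T : measurableType d) (R : realType) (P : probability T R).
Variables (lam mu : 'I_1 -> R) (M1 M2 : R -> T -> int) (S : R -> T -> int).
Hypotheses (g1 : gcp P lam M1) (g2 : gcp P mu M2) (ind : independent_processes P M1 M2).
Hypothesis SE : forall t w, S t w = M1 t w - M2 t w.

Let a1 h := state_prob P M1 1 h.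
Let b1 h := state_prob P M1 0 h.
Let a2 h := state_prob P M2 1 h.
Let b2 h := state_prob P M2 0 h.
Let l := lam ord0.
Let m := mu ord0.

Let cvg_id0 : h @[h --> (0 : R)^'+] --> (0 : R).
Proof. exact: (cvg_at_right_filter cvg_id). Qed.

Let b_cvg1 (b : R -> R) (c : R) : h^-1 * (1 - b h) @[h --> 0^'+] --> c -> b h @[h --> (0 : R)^'+] --> (1 : R).
Proof.
move=> hb; have h1 : 1 - h * (h^-1 * (1 - b h)) @[h --> (0 : R)^'+] --> 1 - 0 * c.
  by apply: cvgB; [exact: cvg_cst|apply: cvgM].
rewrite mul0r subr0 in h1; apply: cvg_trans h1; apply: near_eq_cvg; near=> h.
rewrite mulVKf ?subKr//; apply: lt0r_neq0; near: h; exact: nbhs_right_gt.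
Unshelve. all: by end_near. Qed.

(** Errors on the rate of leaving a state, on the rates of upward and of downward unit moves, and on
    all other moves. The last one vanishes because, with a single jump size, the exit rate is the
    rate of the unit jumps. *)
Let e0 h := `|h^-1 * (1 - b1 h * b2 h) - (l + m)|.
Let e1 h := `|h^-1 * (a1 h * b2 h) - l|.
Let e2 h := `|h^-1 * (b1 h * a2 h) - m|.
Let e3 h := `|h^-1 * (1 - (b1 h * b2 h + (a1 h * b2 h + b1 h * a2 h)))|.
Let eps h := e0 h + e1 h + e2 h + e3 h.

Let eps_cvg : eps h @[h --> 0^'+] --> (0 : R).
Proof.
have [ha1 hb1] := gcp1_jump g1; have [ha2 hb2] := gcp1_jump g2.
have cb1 := b_cvg1 hb1; have cb2 := b_cvg1 hb2.
have cvg_ext (u v : R -> R) (c : R) : u =1 v -> u h @[h --> (0 : R)^'+] --> c ->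
    v h @[h --> (0 : R)^'+] --> c by move=> /funext ->.
have c0 : h^-1 * (1 - b1 h * b2 h) @[h --> 0^'+] --> l + m.
  have -> : l + m = l + 1 * m by rewrite mul1r.
  apply: (cvg_ext (fun h => h^-1 * (1 - b1 h) + b1 h * (h^-1 * (1 - b2 h)))); first by move=> h; ring.
  by apply: cvgD; [exact: hb1|apply: cvgM; [exact: cb1|exact: hb2]].
have c1 : h^-1 * (a1 h * b2 h) @[h --> 0^'+] --> l.
  rewrite -[X in _ --> X]mulr1; apply: (cvg_ext (fun h => h^-1 * a1 h * b2 h)); first by move=> h; ring.
  by apply: cvgM; [exact: ha1|exact: cb2].
have c2 : h^-1 * (b1 h * a2 h) @[h --> 0^'+] --> m.
  rewrite -[X in _ --> X]mul1r; apply: (cvg_ext (fun h => b1 h * (h^-1 * a2 h))); first by move=> h; ring.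
  by apply: cvgM; [exact: cb1|exact: ha2].
have c3 : h^-1 * (1 - (b1 h * b2 h + (a1 h * b2 h + b1 h * a2 h))) @[h --> 0^'+] --> (0 : R).
  rewrite -[X in _ --> X](subrr (l + m)).
  apply: (cvg_ext (fun h => h^-1 * (1 - b1 h * b2 h) - (h^-1 * (a1 h * b2 h) + h^-1 * (b1 h * a2 h)))).
    by move=> h; ring.
  by apply: cvgB; [exact: c0|apply: cvgD; [exact: c1|exact: c2]].
have n0 (u : R -> R) (c : R) : u h @[h --> 0^'+] --> c -> `|u h - c| @[h --> 0^'+] --> (0 : R).
  move=> hu; apply/cvgrPdist_lt => r r0; have /cvgrPdist_lt/(_ r r0) := hu.
  by apply: filterS => h; rewrite sub0r normrN normr_id distrC.
have h3 : e3 h @[h --> 0^'+] --> (0 : R).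
  apply: (cvg_ext (fun h => `|h^-1 * (1 - (b1 h * b2 h + (a1 h * b2 h + b1 h * a2 h))) - 0|)).
    by move=> h; rewrite subr0.
  exact: n0.
have z : (0 : R) = 0 + 0 + 0 + 0 by rewrite !addr0.
have h := cvgD (cvgD (cvgD (n0 _ _ c0) (n0 _ _ c1)) (n0 _ _ c2)) h3.
rewrite -z in h; exact: h.
Qed.

Let intS : int_process S.
Proof.
have [[[m1 cad1] _ _ _] _ _] := g1; have [[[m2 cad2] _ _ _] _ _] := g2.
split; first by move=> t t0; exact: (measurable_skellam g1 g2 SE t0).
move=> w; have [r1 l1] := cad1 w; have [r2 l2] := cad2 w; split.
  move=> t t0; rewrite SE rmorphB/=; under eq_fun do rewrite SE rmorphB/=.
  by apply: cvgB; [exact: r1|exact: r2].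
move=> t t0; have [x hx] := l1 t t0; have [y hy] := l2 t t0; exists (x - y).
by under eq_fun do rewrite SE rmorphB/=; exact: cvgB.
Qed.

(** State probabilities are extended evenly in time: [skellam_derive] asks for bounds at all real
    times, and [S t] is known to be measurable for [0 <= t] only. *)
Let g01 n (t : R) : 0 <= state_prob P S n `|t| <= 1.
Proof.
rewrite fine_ge0//= -lee_fin fineK ?probability_le1// ?fin_num_measure//.
all: by apply: measurable_int_level; case: intS => h _; exact: h.
Qed.

Let est n (t h : R) : 0 <= t -> 0 < h ->
  `|state_prob P S n `|t + h| - state_prob P S n `|t| -
    h * skellam_rhs l m (fun n (t : R) => state_prob P S n `|t|) n t| <= h * eps h.
Proof.
move=> t0 h0; have := transition_bounds g1 g2 ind SE n t0 (ltW h0).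
have th : `|t + h| = t + h by rewrite ger0_norm// addr_ge0// ltW.
rewrite /skellam_rhs th (ger0_norm t0).
rewrite -/(a1 h) -/(b1 h) -/(a2 h) -/(b2 h).
have := g01 n t; have := g01 (n - 1) t; have := g01 (n + 1) t; rewrite (ger0_norm t0).
move: (state_prob P S (n + 1) t) (state_prob P S (n - 1) t) (state_prob P S n t) (state_prob P S n (t + h)).
move=> x y z z' /andP[x0 x1] /andP[y0 y1] /andP[z0 z1] /andP[lo up].
have hn : h != 0 by rewrite gt_eqF.
have hE (a c : R) : `|a - h * c| = h * `|h^-1 * a - c|.
  transitivity (`|h| * `|h^-1 * a - c|); last by rewrite gtr0_norm.
  by rewrite -normrM mulrBr mulVKf.
have E0 : `|1 - b1 h * b2 h - h * (l + m)| = h * e0 h := hE _ _.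
have E1 : `|a1 h * b2 h - h * l| = h * e1 h := hE _ _.
have E2 : `|b1 h * a2 h - h * m| = h * e2 h := hE _ _.
have E3 : `|1 - (b1 h * b2 h + (a1 h * b2 h + b1 h * a2 h))| = h * e3 h.
  by have := hE (1 - (b1 h * b2 h + (a1 h * b2 h + b1 h * a2 h))) 0; rewrite mulr0 !subr0.
pose L := b1 h * b2 h * z + (a1 h * b2 h * y + b1 h * a2 h * x).
have -> : z' - z - h * (l * (y - z) - m * (z - x)) =
  (z' - L) + (- (z * (1 - b1 h * b2 h - h * (l + m))) + (y * (a1 h * b2 h - h * l) + x * (b1 h * a2 h - h * m))).
  by rewrite /L; ring.
have nz (u v : R) : 0 <= u -> u <= 1 -> `|u * v| <= `|v|.
  by move=> u0 u1; rewrite normrM (ger0_norm u0) ler_piMl.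
have k1 : `|z' - L| <= h * e3 h.
  rewrite -E3; apply: le_trans (ler_norm _); rewrite ger0_norm; last by rewrite subr_ge0.
  by rewrite lerBlDl.
apply: (le_trans (ler_normD _ _)).
have k2 := nz z (1 - b1 h * b2 h - h * (l + m)) z0 z1; rewrite E0 in k2.
have k3 := nz y (a1 h * b2 h - h * l) y0 y1; rewrite E1 in k3.
have k4 := nz x (b1 h * a2 h - h * m) x0 x1; rewrite E2 in k4.
have -> : h * eps h = h * e3 h + (h * e0 h + (h * e1 h + h * e2 h)) by rewrite /eps; ring.
apply: lerD => //; apply: (le_trans (ler_normD _ _)); rewrite normrN; apply: lerD => //.
by apply: (le_trans (ler_normD _ _)); apply: lerD.
Qed.

Lemma gsp1_state_equations : skellam_state_equations P l m S.
Proof.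
have [[_ z1 _ _] _ _] := g1; have [[_ z2 _ _] _ _] := g2.
have [mS _] := intS.
have z0 : {ae P, forall w, S 0 w = 0}.
  apply: (@filterS2 _ _ (ae_filter_ringOfSetsType P) _ _ _ _ z1 z2) => w e1' e2'.
  by rewrite SE e1' e2' subrr.
have [N [mN PN hN]] := z0.
have m0 n : measurable [set w | S 0 w = n] by exact/measurable_int_level/mS.
split => //.
- have UT : [set w | S 0 w = 0] `|` N = setT.
    apply/seteqP; split => // w _; have [h|h] := pselect (S 0 w = 0); [by left|by right; apply: hN].
  have P1 : P setT = 1%E by exact: probability_setT.
  rewrite /state_prob -(measureU0 (m0 0) mN PN) UT; exact: (congr1 fine P1).
- move=> n n0; rewrite /state_prob (_ : P _ = 0%E)//; apply/eqP; rewrite eq_le measure_ge0 andbT.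
  apply: (@le_trans _ _ (P N)); last by rewrite PN.
  apply: le_measure; rewrite ?inE// => w /= Sn; apply: hN => /= S0.
  by move: n0; rewrite -Sn S0 eqxx.
- move=> n t t0.
  have l0 : 0 <= l by exact: rate_ge0 g1.
  have m0' : 0 <= m by exact: rate_ge0 g2.
  have hd := skellam_derive l0 m0' g01 est eps_cvg n t0.
  rewrite /skellam_rhs (ger0_norm (ltW t0)) in hd.
  apply: (near_eq_is_derive _ hd); near=> u; rewrite ger0_norm// ltW//.
  near: u; exact: lt_nbhsr.
Unshelve. all: by end_near. Qed.

End unit_jumps.

Lemma gsp_unit_state_equations d (T : measurableType d) (R : realType) (P : probability T R)
    (lam mu : 'I_1 -> R) (S : R -> T -> int) :
  gsp P lam mu S -> skellam_state_equations P (\sum_i lam i) (\sum_i mu i) S.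
Proof.
move=> [M1 [M2 [g1 g2 ind SE]]]; rewrite !big_ord1.
exact: (gsp1_state_equations g1 g2 ind SE).
Qed.

(** * The tail of the Lévy measure and its Laplace transform *)

Section levy_kernel.
Context {R : realType} (c1 c2 : R) (nubar : {measure set R -> \bar R}).
Notation mu := (@lebesgue_measure R).
Hypothesis hf : bernstein_triplet c1 c2 nubar.
Hypothesis hinf : nubar `]0, +oo[%classic = +oo%E.

Let D : set R := `]0, +oo[%classic.
Let mD : measurable D. Proof. exact: measurable_itv. Qed.
Let ray (x : R) : set R := `]x, +oo[%classic.
Let mray x : measurable (ray x). Proof. exact: measurable_itv. Qed.

Let le_ray x y : x <= y -> (nubar (ray y) <= nubar (ray x))%E.
Proof.
move=> xy; apply: le_measure; rewrite ?inE; [exact: mray|exact: mray|].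
by move=> z; rewrite /ray /= !in_itv/= !andbT; exact: le_lt_trans.
Qed.

Let mmin : measurable_fun setT (fun x : R => (Num.min x 1)%:E).
Proof. by apply/measurable_EFinP; exact: measurable_minr. Qed.

Lemma levy_tail_fin_num (x : R) : 0 < x -> nubar (ray x) \is a fin_num.
Proof.
move=> x0; have [_ _ hmin] := hf.
have m0 : 0 < Num.min x 1 by rewrite lt_min x0 ltr01.
rewrite ge0_fin_numE; last exact: measure_ge0.
have h : ((Num.min x 1)%:E * nubar (ray x) < +oo)%E.
  apply: le_lt_trans hmin; rewrite -integral_cst; last exact: mray.
  apply: (@le_trans _ _ (\int[nubar]_(y in ray x) (Num.min y 1)%:E)%E).
    apply: ge0_le_integral; [exact: mray| | | |].
    - by move=> y _; rewrite lee_fin ltW.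
    - exact: measurable_cst.
    - exact: measurable_funS mmin.
    - move=> y; rewrite /ray/= in_itv/= andbT => xy.
      by rewrite lee_fin le_min !ge_min lexx orbT (ltW xy).
  apply: ge0_subset_integral; [exact: mray|exact: mD|exact: measurable_funS mmin| |].
    by move=> y; rewrite /= in_itv/= andbT => y0; rewrite lee_fin le_min (ltW y0) ler01.
  by move=> y; rewrite /ray /= !in_itv/= !andbT; exact: lt_trans.
rewrite ltNge; apply/negP; rewrite leye_eq => /eqP E.
by move: h; rewrite E gt0_muley ?lte_fin// ltxx.
Qed.

(** For [x <= 0] the tail of [nubar] is infinite and [fine] would give a default value; 0 is what
    [is_kernel] demands there. *)
Definition levy_kernel (x : R) : R := if 0 < x then levy_tail c1 nubar x else 0.

Lemma levy_kernel_dec x y : 0 < x -> x <= y -> levy_kernel y <= levy_kernel x.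
Proof.
move=> x0 xy; rewrite /levy_kernel x0 (lt_le_trans x0 xy) /levy_tail lerD2l.
by apply: fine_le; [exact/levy_tail_fin_num/(lt_le_trans x0)|exact: levy_tail_fin_num|exact: le_ray].
Qed.

Let levy_kernel_ge0 x : 0 <= levy_kernel x.
Proof.
have [c10 _ _] := hf; rewrite /levy_kernel; case: ifP => // _.
by rewrite /levy_tail addr_ge0// fine_ge0.
Qed.

(** Monotonicity holds on the positive half-line only, hence the approximation by
    [levy_kernel (m n x)], nonincreasing on the whole line. *)
Let measurable_levy_kernel : measurable_fun setT levy_kernel.
Proof.
pose m (n : nat) (x : R) : R := Num.max x n.+1%:R^-1.
have m0 n x : 0 < m n x by rewrite lt_max invr_gt0 ltr0n orbT.
pose g n (x : R) : R := - (- levy_kernel (m n x)) * \1_D x.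
apply: (@measurable_fun_cvg _ _ _ _ g).
- move=> n; apply: measurable_funM; last exact: measurable_indic.
  apply: measurableT_comp => //; apply: nondecreasing_measurable => //.
  move=> x y xy; rewrite lerN2; apply: levy_kernel_dec => //.
  by rewrite /m ge_max !le_max xy lexx orbT.
- move=> x _; have [x0|x0] := ltP 0 x; last first.
    rewrite /levy_kernel ltNge x0/= /g indicE (_ : (x \in D) = false).
      by under eq_fun do rewrite mulr0; exact: cvg_cst.
    by apply: memNset; rewrite /D/= in_itv/= andbT; apply/negP; rewrite -leNgt.
  apply: cvg_near_cst; near=> n; rewrite /g indicE mem_set ?mulr1 ?opprK.
    rewrite /m max_l//; apply: ltW; near: n; exact: near_infty_natSinv_lt (PosNum x0).
  by rewrite /D/= in_itv/= andbT.
Unshelve. all: by end_near. Qed.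

Lemma levy_kernel_inf (A : R) : exists2 x, 0 < x & A <= levy_kernel x.
Proof.
pose E (n : nat) := ray n.+1%:R^-1.
have i0 n : (0 : R) < n.+1%:R^-1 by rewrite invr_gt0.
have UE : \bigcup_n E n = D.
  apply/seteqP; split => x /=.
    by move=> [n _]; rewrite /E /ray /D/= !in_itv/= !andbT; exact: lt_trans.
  rewrite /D/= in_itv/= andbT => x0.
  have [N _ hN] := near_infty_natSinv_lt (PosNum x0).
  by exists N => //; rewrite /E /ray/= in_itv/= andbT; exact: (hN N (leqnn N)).
have cv : (nubar \o E) n @[n --> \oo] --> nubar (\bigcup_n E n).
  apply: nondecreasing_cvg_mu; [by move=> n; exact: mray|rewrite UE; exact: mD|].
  move=> a b ab; apply/subsetPset => x; rewrite /E /ray/= !in_itv/= !andbT; apply: le_lt_trans.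
  by rewrite lef_pV2 ?posrE// ler_nat.
rewrite UE [nubar D]hinf in cv.
have [N _ hN] := (cvgeyPge _).1 cv A.
exists N.+1%:R^-1 => //; rewrite /levy_kernel i0 /levy_tail.
have [c10 _ _] := hf; apply: ler_wpDl => //.
by rewrite -lee_fin fineK; [exact: (hN N (leqnn N))|exact: levy_tail_fin_num].
Qed.

Notation m := (mrestr nubar mD).

(** Tonelli's theorem requires sigma-finiteness. It holds on the positive half-line, which is
    exhausted by rays of finite mass; nothing is known of [nubar] elsewhere, whence the
    restriction. *)
Let m_sigma_finite : sigma_finite setT m.
Proof.
exists (fun n : nat => (~` D) `|` ray n.+1%:R^-1).
  apply/esym/seteqP; split => // x _; have [x0|x0] := ltP 0 x; last first.
    by exists 0%N => //; left; rewrite /D/= in_itv/= andbT; apply/negP; rewrite -leNgt.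
  have [N _ hN] := near_infty_natSinv_lt (PosNum x0).
  by exists N => //; right; rewrite /ray/= in_itv/= andbT; exact: (hN N (leqnn N)).
move=> n; split; first by apply: measurableU; [exact: measurableC|exact: mray].
rewrite /mrestr setIUl setICl set0U.
have i0 : (0 : R) < n.+1%:R^-1 by rewrite invr_gt0.
rewrite setIidl; last by move=> x; rewrite /ray /D/= !in_itv/= !andbT; exact: lt_trans.
by have := levy_tail_fin_num i0; rewrite ge0_fin_numE.
Qed.

Let ms : {sigma_finite_measure set R -> \bar R} :=
  HB.pack m (Measure_isSigmaFinite.Build _ _ _ m m_sigma_finite).

Let integral_ms (f : R -> \bar R) : measurable_fun setT f -> (forall x, 0 <= f x)%E ->
  (\int[ms]_x (f x * (\1_D x)%:E) = \int[nubar]_(x in D) f x)%E.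
Proof.
move=> mf f0; transitivity (\int[ms]_(x in D) f x)%E.
  rewrite [RHS]integral_mkcond; apply: eq_integral => x _; rewrite patchE indicE.
  by case: ifP => _; rewrite ?mule1 ?mule0.
apply: eq_measure_integral => A mA AD.
by rewrite /= /mrestr setIidl.
Qed.

(** The tail at [x] is the integral of [between y x] in [y], and the transform of [between y] at [s]
    is [(1 - expR (- (s * y))) / s]: exchanging the two integrals makes the Bernstein integrand
    appear. *)
Let between (y x : R) : R := (0 < x < y)%R%:R.

Let heaviside_cts_sub (y : R) : measurable_fun setT (fun x : R => heaviside (x - y)).
Proof.
apply: (measurableT_comp (cdf_like_measurable heaviside_cdf_like)).
exact: measurable_funB.
Qed.

Let mE : measurable [set z : R * R | 0 < z.1 < z.2].
Proof.
have h1 := @measurable_lee _ (R * R)%type R setT measurableT (fun z => (z.1)%:E) (cst 0%E)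
  (ltac:(by apply/measurable_EFinP)) (ltac:(by [])).
have h2 := @measurable_lee _ (R * R)%type R setT measurableT (fun z => (z.2)%:E) (fun z => (z.1)%:E)
  (ltac:(by apply/measurable_EFinP)) (ltac:(by apply/measurable_EFinP)).
rewrite (_ : [set z : R * R | _] = ~` (setT `&` [set z : R * R | ((z.1)%:E <= cst 0 z)%E]) `&`
  ~` (setT `&` [set z : R * R | ((z.2)%:E <= (z.1)%:E)%E])).
  by apply: measurableI; exact: measurableC.
apply/seteqP; split => z /=; rewrite !lee_fin.
  by move=> /andP[h1' h2']; split => -[_]; rewrite leNgt ?h1' ?h2'.
move=> [h1' h2']; apply/andP; split; rewrite ltNge; apply/negP => h.
  exact: h1'.
exact: h2'.
Qed.

Let measurable_between y : measurable_fun setT (between y).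
Proof.
rewrite (_ : between y = (\1_[set z : R * R | 0 < z.1 < z.2] : R * R -> R) \o (fun x => (x, y))).
  by apply: measurableT_comp; [exact: measurable_indic|exact: pair2_measurable].
by apply/funext => x; rewrite /comp indicE /between; congr ((nat_of_bool _)%:R); apply/idP/idP; rewrite inE.
Qed.

Let laplace_between y s : 0 < s -> 0 < y -> laplace (between y) s = ((1 - expR (- (s * y))) / s)%:E.
Proof.
move=> s0 y0; have me := @measurable_expRN R s.
have mh : measurable_fun setT (heaviside : R -> R) := cdf_like_measurable heaviside_cdf_like.
have m1 : measurable_fun setT (fun x : R => between y x + heaviside (x - y)).
  by apply: measurable_funD; [exact: measurable_between|exact: heaviside_cts_sub].
have b0 (x : R) : 0 <= between y x by rewrite ler0n.
have h0 (x : R) : 0 <= heaviside x :> R by rewrite ler0n.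
have e1 : laplace (fun x => between y x + heaviside (x - y)) s = (s^-1)%:E.
  rewrite -(laplace_heaviside s0); apply: laplace_ae => // x x0.
  rewrite /between /heaviside subr_ge0 (le_eqVlt 0 x) (eq_sym 0 x) (negbTE x0)/= -natrD.
  by congr (_%:R); case: (ltP 0 x) => hx; case: (ltP x y) => hy //; exfalso; move: hx hy y0; lra.
have e2 : laplace (fun x => heaviside (x - y)) s = (expR (- (s * y)) / s)%:E.
  rewrite EFinM -(laplace_heaviside s0) /laplace.
  rewrite -(integral_nnZl mu _ _ (expR_ge0 _)); last 2 first.
  - exact: measurable_funM.
  - by move=> x; rewrite mulr_ge0 ?expR_ge0.
  rewrite -(@ge0_integral_shift R (fun x => (expR (- (s * y)) * (expR (- (s * x)) * heaviside x))%:E) y).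
  - apply: eq_integral => x _; rewrite mulrA -expRD; congr (expR _ * _)%:E; ring.
  - apply/measurable_EFinP; apply: measurable_funM => //; exact: measurable_funM.
  - by move=> x; rewrite lee_fin !mulr_ge0 ?expR_ge0.
move: e1; rewrite (laplaceD s (measurable_between y) (heaviside_cts_sub y) b0 (fun x => h0 _)) e2 => e1.
have : (laplace (between y) s = (s^-1)%:E - (expR (- (s * y)) / s)%:E)%E by rewrite -e1 addeK.
by move=> ->; rewrite -EFinB mulrBl mul1r.
Qed.

Let tail (x : R) : R := if 0 < x then fine (nubar (ray x)) else 0.

Let tail_between x : (tail x)%:E = (\int[ms]_y (between y x)%:E)%E.
Proof.
rewrite /tail; case: ifPn => x0; last first.
  by rewrite integral0_eq// => y _; rewrite /between (negbTE x0).
rewrite fineK ?levy_tail_fin_num//.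
transitivity (ms (ray x)).
  rewrite /= /mrestr setIidl// => z; rewrite /ray /D/= !in_itv/= !andbT; exact: lt_trans.
rewrite -[X in ms X]setIT -integral_indic//; apply: eq_integral => y _.
rewrite indicE /between x0/=; congr ((nat_of_bool _)%:R%:E); apply/idP/idP; rewrite inE /ray/= in_itv/= andbT//.
Qed.

Lemma laplace_levy_kernel s : 0 < s ->
  (c2%:E + laplace levy_kernel s)%E = (bernstein c1 c2 nubar s / s)%:E.
Proof.
move=> s0; have [c10 c20 hmin] := hf; have me := @measurable_expRN R s.
have tail0 x : 0 <= tail x by rewrite /tail; case: ifP => // _; rewrite fine_ge0.
have mh : measurable_fun setT (heaviside : R -> R) := cdf_like_measurable heaviside_cdf_like.
have h0 (x : R) : 0 <= heaviside x :> R by rewrite ler0n.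
have mb : measurable_fun setT (fun z : R * R => (expR (- (s * z.1)) * between z.2 z.1)%:E).
  apply/measurable_EFinP; apply: measurable_funM; first exact: (measurableT_comp me).
  rewrite (_ : (fun z : R * R => between z.2 z.1) = \1_[set z : R * R | 0 < z.1 < z.2]).
    exact: measurable_indic.
  by apply/funext => z; rewrite indicE /between; congr ((nat_of_bool _)%:R); apply/idP/idP; rewrite inE.
have mb2 x : measurable_fun setT (fun y : R => between y x).
  rewrite (_ : (fun y : R => between y x) = (\1_[set z : R * R | 0 < z.1 < z.2] : R * R -> R) \o (fun y => (x, y))).
    by apply: measurableT_comp; [exact: measurable_indic|exact: pair1_measurable].
  by apply/funext => y; rewrite /comp indicE /between; congr ((nat_of_bool _)%:R); apply/idP/idP; rewrite inE.
have bb (y x : R) : 0 <= between y x by rewrite ler0n.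
have pb (z : R * R) : (0 <= (expR (- (s * z.1)) * between z.2 z.1)%:E)%E.
  by rewrite lee_fin mulr_ge0 ?expR_ge0.
have mexp : measurable_fun setT (fun y : R => (1 - expR (- (s * y)))).
  by apply: measurable_funB => //; exact: me.
pose I := (\int[nubar]_(y in D) (1 - expR (- (s * y)))%:E)%E.
have lt : laplace tail s = ((s^-1)%:E * I)%E.
  transitivity (\int[mu]_x \int[ms]_y (expR (- (s * x)) * between y x)%:E)%E.
    apply: eq_integral => x _; rewrite EFinM tail_between.
    by rewrite -(integral_nnZl ms (mb2 x) (bb^~ x) (expR_ge0 _)).
  rewrite (fubini_tonelli (m1 := mu) (m2 := ms) _ mb pb)/=.
  (* The maximum only makes the integrand nonnegative on the whole line, as [integral_ms] asks. *)
  pose f (y : R) : R := Num.max ((1 - expR (- (s * y))) / s) 0.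
  have mf : measurable_fun setT (fun y : R => (f y)%:E).
    by apply/measurable_EFinP; apply: measurable_maxr => //; exact: measurable_funM.
  have fpos y : 0 < y -> f y = (1 - expR (- (s * y))) / s.
    move=> y0; rewrite /f max_l// divr_ge0 ?(ltW s0)// subr_ge0.
    by rewrite -[leRHS]expR0 ler_expR oppr_le0 mulr_ge0 ?ltW.
  transitivity (\int[ms]_y ((f y)%:E * (\1_D y)%:E))%E.
    apply: eq_integral => y _; rewrite indicE; have [y0|y0] := ltP 0 y.
      rewrite mem_set ?mule1 ?fpos//; last by rewrite /D/= in_itv/= andbT.
      by rewrite -(laplace_between s0 y0).
    rewrite (_ : (y \in D) = false) ?mule0; last first.
      by apply: memNset; rewrite /D/= in_itv/= andbT; apply/negP; rewrite -leNgt.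
    rewrite integral0_eq// => x _; rewrite /between (_ : (0 < x < y) = false) ?mulr0//.
    by apply/negbTE/negP => /andP[/lt_trans h /h]; rewrite ltNge y0.
  rewrite integral_ms//; last by move=> y; rewrite lee_fin le_max lexx orbT.
  rewrite /I -ge0_integralZl//; last first.
  - by rewrite lee_fin invr_ge0 ltW.
  - move=> y; rewrite /D/= in_itv/= andbT => y0; rewrite lee_fin subr_ge0.
    by rewrite -[leRHS]expR0 ler_expR oppr_le0 mulr_ge0 ?ltW.
  - by apply/measurable_EFinP; exact: measurable_funTS.
  apply: eq_integral => y; rewrite inE /D/= in_itv/= andbT => y0.
  by rewrite fpos// -EFinM mulrC.
have Ifin : I \is a fin_num.
  rewrite ge0_fin_numE; last first.
    apply: integral_ge0 => y; rewrite /D/= in_itv/= andbT => y0; rewrite lee_fin subr_ge0.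
    by rewrite -[leRHS]expR0 ler_expR oppr_le0 mulr_ge0 ?ltW.
  (* [1 - expR (- (s * y))] is at most [s * y] and at most 1, hence at most [(1 + s) * min y 1]. *)
  apply: (@le_lt_trans _ _ ((1 + s)%:E * \int[nubar]_(y in D) (Num.min y 1)%:E)%E).
    rewrite -ge0_integralZl//.
    - apply: ge0_le_integral => //.
      + move=> y; rewrite /D/= in_itv/= andbT => y0; rewrite lee_fin subr_ge0.
        by rewrite -[leRHS]expR0 ler_expR oppr_le0 mulr_ge0 ?ltW.
      + by apply/measurable_EFinP; exact: measurable_funTS.
      + by apply: (measurable_funS measurableT) => //; apply: measurable_funeM; exact: mmin.
      + move=> y; rewrite /D/= in_itv/= andbT => y0; rewrite -EFinM lee_fin.
        have e1 := expR_ge1Dx (- (s * y)); have e2 := expR_ge0 (- (s * y)).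
        rewrite /Num.min; case: ifP => _; last by move: e2 s0; rewrite mulr1; lra.
        by rewrite mulrDl mul1r; move: e1 y0; lra.
    - exact: (measurable_funS measurableT).
    - move=> y; rewrite /D/= in_itv/= andbT => y0; rewrite lee_fin le_min (ltW y0)/=.
      exact: ler01.
    - by rewrite lee_fin addr_ge0// ltW.
  by apply: lte_mul_pinfty => //; rewrite ?lee_fin ?addr_ge0// ltW.
have mt : measurable_fun setT tail.
  rewrite (_ : tail = (fun x : R => levy_kernel x - c1 * \1_D x)).
    by apply: measurable_funB => //; apply: measurable_funM => //; exact: measurable_indic.
  apply/funext => x; rewrite /levy_kernel /tail /levy_tail indicE.
  case: ifP => x0.
    have -> : (x \in D) = true by rewrite mem_set// /D/= in_itv/= x0.
    by rewrite mulr1 addrAC subrr add0r.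
  have -> : (x \in D) = false by apply: memNset; rewrite /D/= in_itv/= x0.
  by rewrite mulr0 subr0.
have -> : laplace levy_kernel s = (laplace (fun x => c1 * heaviside x)%R s + laplace tail s)%E.
  rewrite -laplaceD//; [|exact: measurable_funM|by move=> x; rewrite mulr_ge0].
  apply: laplace_ae => //; first by apply: measurable_funD => //; exact: measurable_funM.
  move=> x x0; rewrite /levy_kernel /heaviside /levy_tail /tail (le_eqVlt 0 x) (eq_sym 0 x) (negbTE x0)/=.
  by case: ifP => _; rewrite ?mulr1 ?mulr0 ?addr0.
rewrite laplaceZ// laplace_heaviside// lt /bernstein /Rintegral.
rewrite -/D -/I -(fineK Ifin)/= -!EFinM -!EFinD; congr EFin; field.
by rewrite gt_eqF.
Qed.

Lemma levy_kernel_is_kernel : is_kernel levy_kernel.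
Proof.
split => //.
- by move=> x x0; rewrite /levy_kernel ltNge x0.
- move=> s s0; have := laplace_levy_kernel s0.
  by case: (laplace levy_kernel s).
Qed.

(** The ratio of the Bernstein function to [s] is [c2] plus the transform of a kernel that is at
    least 1 near 0. Positivity permits evaluating transforms at this function and dividing by it. *)
Lemma bernstein_gt0 s : 0 < s -> 0 < bernstein c1 c2 nubar s.
Proof.
move=> s0; have [c10 c20 hmin] := hf.
have [x0 x00 kx] := levy_kernel_inf 1.
have me := @measurable_expRN R s.
have : (0 < laplace levy_kernel s)%E.
  apply: (@lt_le_trans _ _ (laplace (between x0) s)).
    rewrite (laplace_between s0 x00) lte_fin divr_gt0// subr_gt0 -[ltRHS]expR0 ltr_expR.
    by rewrite oppr_lt0 mulr_gt0.
  apply: le_laplace => //.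
  move=> x; rewrite ler0n/= /between; case: (boolP (0 < x < x0)) => [/andP[hx1 hx2]|_] //=.
  by apply: (le_trans kx); apply: levy_kernel_dec => //; exact: ltW.
have c2e : (0 <= c2%:E)%E by rewrite lee_fin.
move=> h; have := lt_le_trans h (leeDr (laplace levy_kernel s) c2e).
by rewrite laplace_levy_kernel// lte_fin pmulr_lgt0// invr_gt0.
Qed.

End levy_kernel.

(** * Law of the inverse subordinator *)

Section inverse_of_subordinator.
Context d (T : measurableType d) (R : realType) (P : probability T R).
Context (D : R -> T -> \bar R) (f : R -> R).
Notation mu := (@lebesgue_measure R).
Hypothesis mD : forall t, 0 <= t -> measurable_fun setT (D t).
Hypothesis D0 : {ae P, forall w, D 0 w = 0%E}.
Hypothesis Dnd : forall w s t, 0 <= s -> s <= t -> (D s w <= D t w)%E.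
Hypothesis LD : forall t s : R, 0 <= t -> 0 < s ->
  (\int[P]_w expeR (- (s%:E * D t w)) = (expR (- (t * f s)))%:E)%E.
Hypothesis f0 : forall s, 0 < s -> 0 < f s.

Notation H := (inverse_subordinator D).

Notation passage t w := [set x : R | 0 <= x /\ (t%:E < D x w)%E].

Lemma inverse_subordinator_ge0 t w : 0 <= H t w.
Proof.
rewrite /inverse_subordinator; have [->|/set0P ne] := eqVneq (passage t w) set0.
  by rewrite inf0.
by apply: lb_le_inf => // x [].
Qed.

Let H_gt_le x t w : 0 <= x -> x < H t w -> (D x w <= t%:E)%E.
Proof.
move=> x0 xH; rewrite leNgt; apply/negP => h; move: xH; rewrite ltNge => /negP; apply.
by apply: ge_inf => //; exists 0 => y [].
Qed.

Let D_le_lt x y t w : passage t w !=set0 -> 0 <= x -> x < y -> (D y w <= t%:E)%E -> x < H t w.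
Proof.
move=> ne x0 xy Dy; apply: (lt_le_trans xy); apply: lb_le_inf => // z [z0 tz].
rewrite leNgt; apply/negP => zy.
by have := lt_le_trans tz (le_trans (Dnd w z0 (ltW zy)) Dy); rewrite ltxx.
Qed.

(** The event that level [t] is never passed. There [inf] takes its default value 0 and the duality
    between [D] and its inverse breaks down; [PN] shows that it is null. *)
Let N t := \bigcap_(n : nat) [set w | (D n%:R w <= t%:E)%E].

Let N_empty t w : passage t w = set0 -> N t w.
Proof.
move=> e n _ /=; rewrite leNgt; apply/negP => h.
by have : passage t w n%:R by []; rewrite e.
Qed.

Let empty_N t w : N t w -> passage t w = set0.
Proof.
move=> h; apply/seteqP; split => // x [x0 tx].
have [n xn] : exists n : nat, x <= n%:R.
  by exists (Num.truncn x).+1; apply/ltW; exact: truncnS_gt.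
have := lt_le_trans tx (le_trans (Dnd w x0 xn) (h n I)); by rewrite ltxx.
Qed.

Let mDle x t : 0 <= x -> measurable [set w | (D x w <= t%:E)%E].
Proof.
by move=> x0; rewrite -[X in measurable X]setTI; exact: measurable_realfun.emeasurable_fun_infty_c measurableT (mD x0) _.
Qed.

Let mN t : measurable (N t).
Proof. by apply: bigcapT_measurable => n; exact: mDle. Qed.

(** For [x > 0], the inverse is below [x] exactly when the level is never passed or is passed before
    [x]; by monotonicity of [D], rational times are enough. *)
Lemma measurable_inverse_subordinator t : measurable_fun setT (H t).
Proof.
move=> _; apply: (measurability _ (RGenCInfty.measurableE R)) => // _ [_ [x ->] <-].
rewrite setTI; have [x0|x0] := leP x 0.
  rewrite (_ : _ @^-1` _ = setT)//; apply/seteqP; split => // w _ /=.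
  by rewrite in_itv/= andbT (le_trans x0)// inverse_subordinator_ge0.
have -> : H t @^-1` `[x, +oo[%classic =
    ~` (N t `|` \bigcup_(q in [set q : rat | (0 <= (ratr q : R)) && ((ratr q : R) < x)]) [set w | (t%:E < D (ratr q) w)%E]).
  apply/seteqP; split => w /=; rewrite in_itv/= andbT.
    move=> xH [Nw|[q /= /andP[q0 qx] tq]].
      by move: xH; rewrite /inverse_subordinator (empty_N Nw) inf0 leNgt x0.
    have : H t w <= ratr q by apply: ge_inf => //; exists 0 => y [].
    by move=> /le_lt_trans/(_ qx); rewrite ltNge xH.
  move=> h; have ne : passage t w !=set0.
    by apply/set0P/eqP => e; apply: h; left; exact: N_empty.
  apply: lb_le_inf => // z [z0 tz]; rewrite leNgt; apply/negP => zx; apply: h; right.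
  have [q /=] := rat_in_itvoo zx; rewrite in_itv/= => /andP[zq qx].
  exists q => /=; first by rewrite qx (le_trans z0 (ltW zq)).
  by apply: (lt_le_trans tz); apply: Dnd => //; exact: ltW.
apply: measurableC; apply: measurableU; first exact: mN.
rewrite bigcup_mkcond; apply: bigcupT_measurable_rat => q.
case: ifPn => [|_]; last exact: measurable0.
rewrite inE/= => /andP[q0 _].
rewrite -[X in measurable X]setTI; exact: measurable_realfun.emeasurable_fun_o_infty measurableT (mD q0) _.
Qed.

Let G (x t : R) : R := fine (P [set w | (D x w <= t%:E)%E]).

Let GE x t : 0 <= x -> (G x t)%:E = P [set w | (D x w <= t%:E)%E].
Proof. by move=> x0; rewrite fineK// fin_num_measure//; exact: mDle. Qed.

Let step (r : \bar R) (t : R) : R := (r <= t%:E)%E%:R.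

Let laplace_step_at (r : \bar R) s : 0 < s ->
  laplace (step r) s = ((s^-1)%:E * expeR (- (s%:E * r)))%E.
Proof.
move=> s0; have me := @measurable_expRN R s.
have mh : measurable_fun setT (heaviside : R -> R) := cdf_like_measurable heaviside_cdf_like.
have fin (a : R) : laplace (step a%:E) s = (s^-1 * expR (- (s * a)))%:E.
  rewrite mulrC EFinM -(laplace_heaviside s0) /laplace.
  rewrite -(integral_nnZl mu _ _ (expR_ge0 _)); last 2 first.
  - exact: measurable_funM.
  - by move=> x; rewrite mulr_ge0 ?expR_ge0// ler0n.
  rewrite -(@ge0_integral_shift R (fun x => (expR (- (s * a)) * (expR (- (s * x)) * heaviside x))%:E) a).
  - apply: eq_integral => x _; rewrite mulrA -expRD /step /heaviside lee_fin subr_ge0.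
    by congr (expR _ * _)%:E; ring.
  - by apply/measurable_EFinP; apply: measurable_funM => //; exact: measurable_funM.
  - by move=> x; rewrite lee_fin !mulr_ge0 ?expR_ge0// ler0n.
case: r => [a| |]; first by rewrite fin -EFinM.
- rewrite /laplace integral0_eq; first by rewrite gt0_muley ?lte_fin//= mule0.
  by move=> x _; rewrite /step leye_eq/= mulr0.
- rewrite gt0_muleNy ?lte_fin//= gt0_muley ?lte_fin ?invr_gt0//.
  apply/eqyP => A A0; apply: (@le_trans _ _ (laplace (step (- A)%:E) s)).
    rewrite fin lee_fin mulrN opprK mulrC ler_pdivlMr//.
    by have := expR_ge1Dx (s * A); rewrite mulrC; lra.
  apply: le_laplace.
  + by apply: nondecreasing_measurable => // x y xy; rewrite /step !lee_fin ler_nat; case: leP => //= h; rewrite (le_trans h xy).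
  + by apply: nondecreasing_measurable => // x y xy; rewrite /step !leNye.
  + by move=> x; rewrite /step leNye ler0n/= lern1 leq_b1.
Qed.

Let mstep x : 0 <= x -> measurable_fun setT (fun z : T * R => step (D x z.1) z.2).
Proof.
move=> x0.
have mE : measurable [set z : T * R | (D x z.1 <= z.2%:E)%E].
  have := @measurable_lee _ (T * R)%type R setT measurableT (fun z => D x z.1) (fun z => (z.2)%:E)
    (measurableT_comp (mD x0) measurable_fst) (ltac:(by apply/measurable_EFinP)).
  by rewrite setTI.
rewrite (_ : (fun z : T * R => step (D x z.1) z.2) = \1_[set z : T * R | (D x z.1 <= z.2%:E)%E]).
  exact: measurable_indic.
by apply/funext => z; rewrite indicE /step; congr ((nat_of_bool _)%:R); apply/idP/idP; rewrite inE.
Qed.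

Let laplace_G x s : 0 <= x -> 0 < s -> laplace (G x) s = (s^-1 * expR (- (x * f s)))%:E.
Proof.
move=> x0 s0; have me := @measurable_expRN R s.
have m3 : measurable_fun setT (fun z : T * R => (expR (- (s * z.2)) * step (D x z.1) z.2)%:E).
  apply/measurable_EFinP; apply: measurable_funM; last exact: mstep.
  exact: (measurableT_comp me).
have p3 (z : T * R) : (0 <= (expR (- (s * z.2)) * step (D x z.1) z.2)%:E)%E.
  by rewrite lee_fin mulr_ge0 ?expR_ge0// ler0n.
transitivity (\int[mu]_t \int[P]_w (expR (- (s * t)) * step (D x w) t)%:E)%E.
  apply: eq_integral => t _; rewrite EFinM GE//.
  have ms : measurable_fun setT (fun w => step (D x w) t).
    exact: (measurableT_comp (mstep x0) (pair2_measurable t)).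
  rewrite (integral_nnZl P ms (fun w => ler0n _ _) (expR_ge0 _)); congr (_ * _)%E.
  rewrite -[X in P X]setIT -integral_indic//; last exact: mDle.
  apply: eq_integral => w _; rewrite indicE /step; congr ((nat_of_bool _)%:R%:E).
  by apply/idP/idP; rewrite inE.
rewrite -(fubini_tonelli (m1 := P) (m2 := mu) _ m3 p3)/=.
transitivity (\int[P]_w ((s^-1)%:E * expeR (- (s%:E * D x w))))%E.
  by apply: eq_integral => w _; rewrite -laplace_step_at.
have mexp : measurable_fun setT (fun w => expeR (- (s%:E * D x w)))%E.
  have := measurable_fun_fubini_tonelli_F (m2 := mu) _ m3 p3.
  rewrite /fubini_F => h.
  rewrite (_ : (fun w => _) = (fun w => s%:E * laplace (step (D x w)) s)%E).
    exact: measurable_funeM.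
  by apply/funext => w; rewrite laplace_step_at// muleA -EFinM divff ?mul1e// gt_eqF.
rewrite ge0_integralZl//; last 2 first.
- by move=> w _; case: (- _)%E => //= a; rewrite lee_fin expR_ge0.
- by rewrite lee_fin invr_ge0 ltW.
by rewrite LD// -EFinM.
Qed.

Let mG x : 0 <= x -> measurable_fun setT (G x).
Proof.
move=> x0; apply: nondecreasing_measurable => // a b ab.
rewrite -lee_fin !GE//; apply: le_measure; rewrite ?inE; [exact: mDle|exact: mDle|].
by move=> w /= /le_trans; apply; rewrite lee_fin.
Qed.

(** A Markov bound: [G x] is nondecreasing, so its transform at 1, which is [expR (- (x * f 1))], is
    at least [G x t * expR (- t)]. *)
Let G_le t x : 0 <= x -> G x t <= expR t * expR (- (x * f 1)).
Proof.
move=> x0; have e1 := laplace_G x0 ltr01; have e2 := laplace_step_at t%:E ltr01.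
have G0 : 0 <= G x t by exact: fine_ge0.
have ms : measurable_fun setT (step t%:E : R -> R).
  by apply: nondecreasing_measurable => // a b ab; rewrite /step !lee_fin ler_nat; case: leP => //= h; rewrite (le_trans h ab).
have s0 (r : R) : 0 <= step t%:E r by rewrite ler0n.
have : (laplace (fun r : R => G x t * step t%:E r)%R 1 <= laplace (G x) 1)%E.
  apply: le_laplace; [by apply: measurable_funM|exact: mG|].
  move=> r; rewrite mulr_ge0//= /step lee_fin; case: (leP t r) => tr /=; last by rewrite mulr0 fine_ge0.
  rewrite mulr1 -lee_fin !GE//; apply: le_measure; rewrite ?inE; [exact: mDle|exact: mDle|].
  by move=> w /= /le_trans; apply; rewrite lee_fin.
rewrite (laplaceZ 1 ms s0 G0) e1 e2 -!EFinM lee_fin invr1 !mul1r => h.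
by rewrite -ler_pdivrMl ?expR_gt0// -expRN mulrC.
Qed.

Let PN t : P (N t) = 0%E.
Proof.
apply/eqP; rewrite eq_le measure_ge0 andbT; apply/lee_addgt0Pr => e e0; rewrite add0e.
have c1 : expR t * expR (- (f 1 * x)) @[x --> +oo] --> expR t * 0.
  by apply: cvgM; [exact: cvg_cst|exact: cvg_expRN_y (f0 ltr01)].
rewrite mulr0 in c1; have [M [_ hM]] : \forall x \near +oo, expR t * expR (- (f 1 * x)) <= e.
  exact: (cvgr_le _ c1).
have [n Mn] : exists n : nat, M < n%:R by exists (Num.truncn M).+1; exact: truncnS_gt.
apply: (@le_trans _ _ (P [set w | (D n%:R w <= t%:E)%E])).
  by rewrite le_measure ?inE//; [exact: mDle|move=> w; exact].
rewrite -GE ?ler0n// lee_fin; apply: (le_trans (G_le t (ler0n _ _))).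
by have := hM _ Mn; rewrite (mulrC (f 1)).
Qed.

Let mH_gt x t : measurable [set w | x < H t w].
Proof.
have := @measurable_inverse_subordinator t measurableT `]x, +oo[%classic (measurable_itv _).
rewrite setTI; congr measurable; apply/seteqP; split => w /=; rewrite in_itv/= andbT//.
Qed.

Definition survival (x t : R) : R := fine (P [set w | x < H t w]).

Lemma survivalE x t : (survival x t)%:E = P [set w | x < H t w].
Proof. by rewrite fineK// fin_num_measure. Qed.

Lemma survival_ge0 x t : 0 <= survival x t. Proof. exact: fine_ge0. Qed.

Let survival_ni x y t : x <= y -> survival y t <= survival x t.
Proof.
move=> xy; rewrite -lee_fin !survivalE; apply: le_measure; rewrite ?inE; [exact: mH_gt|exact: mH_gt|].
by move=> w /=; exact: le_lt_trans.
Qed.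

(** Off [N t], a higher level is passed later. On [N t] the default value of [inf] spoils this, but
    the event is null. *)
Lemma le_survival x s t : s <= t -> survival x s <= survival x t.
Proof.
move=> st; rewrite -lee_fin !survivalE -(measureU0 (mH_gt x t) (mN t) (PN t)).
apply: le_measure; rewrite ?inE; [exact: mH_gt|by apply: measurableU; [exact: mH_gt|exact: mN]|].
move=> w /= xH; have [e|/set0P ne] := eqVneq (passage t w) set0; [by right; exact: N_empty|left].
apply: (lt_le_trans xH); apply: lb_le_inf => // z [z0 tz].
apply: ge_inf; first by exists 0 => y [].
by split => //; apply: le_lt_trans tz; rewrite lee_fin.
Qed.

Lemma survivalN x t : 0 <= x -> t < 0 -> survival x t = 0.
Proof.
move=> x0 t0; have [A [mA PA hA]] := D0.
apply/EFin_inj; rewrite survivalE; apply/eqP; rewrite eq_le measure_ge0 andbT.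
apply: (@le_trans _ _ (P A)); last by rewrite PA.
apply: le_measure; rewrite ?inE; [exact: mH_gt|by []|].
move=> w /= xH; apply: hA => /= Dw.
have := H_gt_le (lexx 0) (le_lt_trans x0 xH); rewrite Dw lee_fin leNgt t0//.
Qed.

Let survival_right x t c : c < survival x t -> exists2 y, x < y & c < survival y t.
Proof.
move=> cF; pose A (n : nat) := [set w | x + n.+1%:R^-1 < H t w].
have UA : \bigcup_n A n = [set w | x < H t w].
  apply/seteqP; split => w /=.
    by move=> [n _] /=; apply: lt_trans; rewrite ltrDl invr_gt0.
  move=> xH; have h : 0 < H t w - x by rewrite subr_gt0.
  have [M _ hM] := near_infty_natSinv_lt (PosNum h).
  by exists M => //; rewrite /A/= -ltrBrDl; exact: (hM M (leqnn M)).
have cv : (P \o A) n @[n --> \oo] --> P (\bigcup_n A n).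
  apply: nondecreasing_cvg_mu; [by move=> n; exact: mH_gt|by rewrite UA; exact: mH_gt|].
  move=> a b ab; apply/subsetPset => w /=; apply: le_lt_trans.
  by rewrite lerD2l lef_pV2 ?posrE// ler_nat.
rewrite UA -survivalE in cv.
have cv' : (fine \o (P \o A)) n @[n --> \oo] --> survival x t by exact: fine_cvg cv.
have [M _ hM] := cvgr_gt _ cv' _ cF.
exists (x + M.+1%:R^-1); first by rewrite ltrDl invr_gt0.
exact: (hM M (leqnn M)).
Qed.

(** The function is nonincreasing and right-continuous in [x], so each strict superlevel set is a
    union of rectangles indexed by rational [x]; in [t] it is monotone. *)
Lemma measurable_survival : measurable_fun setT (fun z : R * R => survival z.1 z.2).
Proof.
move=> _; apply: (measurability _ (RGenOInfty.measurableE R)) => // _ [_ [c ->] <-].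
rewrite setTI.
have -> : (fun z : R * R => survival z.1 z.2) @^-1` `]c, +oo[%classic =
    \bigcup_(q : rat) ([set x : R | x < ratr q] `*` [set t | c < survival (ratr q) t]).
  apply/seteqP; split => [[x t]|[x t]] /=; rewrite in_itv/= andbT.
    move=> /survival_right[y xy cy].
    have [q /=] := rat_in_itvoo xy; rewrite in_itv/= => /andP[xq qy].
    exists q => //; split => //=; apply: (lt_le_trans cy); apply: survival_ni; exact: ltW.
  by move=> [q _ [/= xq cq]]; apply: (lt_le_trans cq); apply: survival_ni; exact: ltW.
apply: bigcupT_measurable_rat => q; apply: measurableX.
  by rewrite (_ : [set x : R | _] = `]-oo, ratr q[%classic)//; apply/seteqP; split => x /=; rewrite in_itv.
have mF : measurable_fun setT (survival (ratr q)) by apply: nondecreasing_measurable => //; exact: le_survival.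
have := mF measurableT `]c, +oo[%classic (measurable_itv _); rewrite setTI.
by congr measurable; apply/seteqP; split => s /=; rewrite in_itv/= andbT.
Qed.

(** Up to null events, [H t > x] implies [D x <= t] and is implied by [D y <= t] for any [y > x].
    The two bounds meet as [y] tends to [x] from the right. *)
Lemma laplace_survival x s : 0 <= x -> 0 < s ->
  laplace (survival x) s = (s^-1 * expR (- (x * f s)))%:E.
Proof.
move=> x0 s0.
have mF y : measurable_fun setT (survival y) by apply: nondecreasing_measurable => //; exact: le_survival.
have up : (laplace (survival x) s <= (s^-1 * expR (- (x * f s)))%:E)%E.
  rewrite -laplace_G//; apply: le_laplace => //; first exact: mG.
  move=> t; rewrite survival_ge0/= -lee_fin survivalE GE//; apply: le_measure; rewrite ?inE; [exact: mH_gt|exact: mDle|].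
  by move=> w /=; exact: H_gt_le.
have low y : x < y -> ((s^-1 * expR (- (y * f s)))%:E <= laplace (survival x) s)%E.
  move=> xy; have y0 : 0 <= y by rewrite (le_trans x0) ?ltW.
  rewrite -laplace_G//; apply: le_laplace => //; first exact: mG.
  move=> t; rewrite fine_ge0//= -lee_fin survivalE GE// -(measureU0 (mH_gt x t) (mN t) (PN t)).
  apply: le_measure; rewrite ?inE; [exact: mDle|by apply: measurableU; [exact: mH_gt|exact: mN]|].
  move=> w /= Dy; have [e|/set0P ne] := eqVneq (passage t w) set0; [by right; exact: N_empty|left].
  exact: D_le_lt xy Dy.
apply/eqP; rewrite eq_le up/=; apply/lee_addgt0Pr => e e0.
have cv : s^-1 * expR (- (y * f s)) @[y --> x^'+] --> s^-1 * expR (- (x * f s)).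
  apply: cvg_at_right_filter; apply: cvgM; first exact: cvg_cst.
  apply: continuous_cvg; first exact: continuous_expR.
  by apply: cvgN; apply: cvgM; [exact: cvg_id|exact: cvg_cst].
have c2 : \forall y \near x^'+, s^-1 * expR (- (x * f s)) - e <= s^-1 * expR (- (y * f s)).
  by apply: (cvgr_ge _ cv); rewrite ltrBlDr ltrDl.
near x^'+ => y.
have xy : x < y by near: y; exact: nbhs_right_gt.
have := low y xy; case: (laplace _ _) => [a| |] //; rewrite ?leey ?addye ?leey//.
rewrite -EFinD !lee_fin => h; rewrite -lerBlDr; apply: le_trans h; near: y; exact: c2.
Unshelve. all: by end_near. Qed.

End inverse_of_subordinator.

(** * Subordinated functions and their Laplace transforms *)

Section subordination.
Context d (T : measurableType d) (R : realType) (P : probability T R).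
Context (D : R -> T -> \bar R) (f : R -> R).
Notation mu := (@lebesgue_measure R).
Hypothesis mD : forall t, 0 <= t -> measurable_fun setT (D t).
Hypothesis D0 : {ae P, forall w, D 0 w = 0%E}.
Hypothesis Dnd : forall w s t, 0 <= s -> s <= t -> (D s w <= D t w)%E.
Hypothesis LD : forall t s : R, 0 <= t -> 0 < s ->
  (\int[P]_w expeR (- (s%:E * D t w)) = (expR (- (t * f s)))%:E)%E.
Hypothesis f0 : forall s, 0 < s -> 0 < f s.

Notation H := (inverse_subordinator D).
Notation F := (survival P D).

(** For [m] vanishing on the negative side, this is the expectation of the integral of [m] from 0 to
    [H t], with the expectation taken inside. *)
Definition subordinated (m : R -> R) (t : R) : R := fine (\int[mu]_y (m y * F y t)%:E)%E.

Section weight.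
Variables (m : R -> R) (C : R).
Hypotheses (mm : measurable_fun setT m) (m0 : forall y, 0 <= m y) (mC : forall y, m y <= C).
Hypothesis mN : forall y, y < 0 -> m y = 0.

Let mF := @measurable_survival _ _ _ P D f mD Dnd LD f0.

Let mF_swap : measurable_fun setT (fun z : R * R => F z.2 z.1).
Proof.
have h : measurable_fun setT ((fun z : R * R => F z.1 z.2) \o (fun z : R * R => (z.2, z.1))).
  by apply: measurableT_comp => //; exact: measurable_fun_pair.
exact: h.
Qed.

Let mmF t : measurable_fun setT (fun y : R => m y * F y t).
Proof.
apply: measurable_funM => //.
exact: (measurableT_comp mF (pair2_measurable t)).
Qed.

Let mF0 t y : 0 <= m y * F y t. Proof. by rewrite mulr_ge0// survival_ge0. Qed.

Let W t := (\int[mu]_y (m y * F y t)%:E)%E.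

Let W0 t : (0 <= W t)%E.
Proof. by apply: integral_ge0 => y _; rewrite lee_fin. Qed.

Let Wnd s t : s <= t -> (W s <= W t)%E.
Proof.
move=> st; apply: le_integral_nn; [exact: mmF|exact: mmF|exact: mF0|].
move=> y; apply: ler_wpM2l => //.
exact: (le_survival mD Dnd LD f0).
Qed.

Let mW : measurable_fun setT W.
Proof.
have m3 : measurable_fun setT (fun z : R * R => (m z.2 * F z.2 z.1)%:E).
  apply/measurable_EFinP; apply: measurable_funM; first exact: (measurableT_comp mm).
  exact: mF_swap.
have p3 (z : R * R) : (0 <= (m z.2 * F z.2 z.1)%:E)%E by rewrite lee_fin.
exact: (measurable_fun_fubini_tonelli_F (m2 := mu) _ m3 p3).
Qed.

Let laplaceW s : 0 < s ->
  (\int[mu]_t ((expR (- (s * t)))%:E * W t) = (s^-1)%:E * laplace m (f s))%E.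
Proof.
move=> s0; have me := @measurable_expRN R s.
have m3 : measurable_fun setT (fun z : R * R => (expR (- (s * z.1)) * (m z.2 * F z.2 z.1))%:E).
  apply/measurable_EFinP; apply: measurable_funM; first exact: (measurableT_comp me).
  apply: measurable_funM; first exact: (measurableT_comp mm).
  exact: mF_swap.
have p3 (z : R * R) : (0 <= (expR (- (s * z.1)) * (m z.2 * F z.2 z.1))%:E)%E.
  by rewrite lee_fin mulr_ge0 ?expR_ge0.
transitivity (\int[mu]_t \int[mu]_y (expR (- (s * t)) * (m y * F y t))%:E)%E.
  by apply: eq_integral => t _; rewrite -(integral_nnZl mu (mmF t) (mF0 t) (expR_ge0 _)).
rewrite (fubini_tonelli (m1 := mu) (m2 := mu) _ m3 p3)/=.
have si : 0 <= s^-1 by rewrite invr_ge0 ltW.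
have me' := @measurable_expRN R (f s).
rewrite /laplace -(integral_nnZl mu _ _ si); last 2 first.
- by apply: measurable_funM.
- by move=> y; rewrite mulr_ge0 ?expR_ge0.
apply: eq_integral => y _; have [y0|y0] := ltP y 0.
  rewrite mN// !mulr0 integral0_eq// => t _; by rewrite mul0r mulr0.
have mFy : measurable_fun setT (F y).
  by apply: nondecreasing_measurable => // a b; exact: (le_survival mD Dnd LD f0).
have mE : measurable_fun setT (fun t : R => expR (- (s * t)) * F y t) by exact: measurable_funM.
have pE (t : R) : 0 <= expR (- (s * t)) * F y t by rewrite mulr_ge0 ?expR_ge0// survival_ge0.
transitivity ((m y)%:E * laplace (F y) s)%E.
  rewrite /laplace -(integral_nnZl mu mE pE (m0 y)); apply: eq_integral => t _.
  by congr EFin; ring.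
rewrite (laplace_survival mD Dnd LD f0)// -EFinM; congr EFin; rewrite (mulrC y); ring.
Qed.

Let laplace_m s : 0 < s -> (laplace m s <= (C / s)%:E)%E.
Proof.
move=> s0; have C0 : 0 <= C := le_trans (m0 0) (mC 0).
have mh : measurable_fun setT (heaviside : R -> R) := cdf_like_measurable heaviside_cdf_like.
apply: (@le_trans _ _ (laplace (fun x => C * heaviside x)%R s)).
  apply: le_laplace => //; first exact: measurable_funM.
  move=> x; rewrite m0/= /heaviside; case: (leP 0 x) => x0 /=; first by rewrite mulr1.
  by rewrite mN// mulr0.
rewrite laplaceZ ?laplace_heaviside// => x; exact: ler0n.
Qed.

(** [W] is nondecreasing: an infinite value at [t] would persist on an interval of length 1 and make
    the transform at 1 infinite. *)
Let W_fin t : W t \is a fin_num.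
Proof.
have h1 := laplaceW ltr01; have h2 := laplace_m (f0 ltr01).
have h3 : (\int[mu]_t ((expR (- (1 * t)))%:E * W t) < +oo)%E.
  by rewrite h1 invr1 mul1e; apply: le_lt_trans h2 _; exact: ltry.
rewrite ge0_fin_numE// ltNge leye_eq; apply/negP => /eqP Wt.
move: h3; rewrite ltNge => /negP; apply.
have mI : measurable (`]t, (t + 1)[%classic : set (measurableTypeR R)) by exact: measurable_itv.
have pI r : (0 <= (expR (- (1 * r)))%:E * W r)%E by rewrite mule_ge0// lee_fin expR_ge0.
have mI2 : measurable_fun setT (fun r : R => (expR (- (1 * r)))%:E * W r)%E.
  by apply: emeasurable_funM; [apply/measurable_EFinP; exact: measurable_expRN|exact: mW].
apply: (@le_trans _ _ (\int[mu]_(r in `]t, (t + 1)%R[) ((expR (- (1 * r)))%:E * W r))%E); last first.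
  by apply: ge0_subset_integral => //.
rewrite (eq_integral (cst +oo%E)).
  rewrite integral_cst// [X in (_ * X)%E](lebesgue_measure_itv `]t, (t + 1)[)/= lte_fin ltrDl ltr01.
  by rewrite gt0_mulye// -EFinB lte_fin addrAC subrr add0r.
move=> r; rewrite inE/= in_itv/= => /andP[tr _].
have -> : W r = +oo%E by apply/eqP; rewrite -leye_eq -Wt Wnd// ltW.
by rewrite gt0_muley// lte_fin expR_gt0.
Qed.

Lemma subordinatedE t : (subordinated m t)%:E = (\int[mu]_y (m y * F y t)%:E)%E.
Proof. by rewrite /subordinated fineK// W_fin. Qed.

Lemma laplace_subordinated s : 0 < s -> laplace (subordinated m) s = ((s^-1)%:E * laplace m (f s))%E.
Proof.
by move=> s0; rewrite -laplaceW//; apply: eq_integral => t _; rewrite EFinM subordinatedE.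
Qed.

Lemma subordinated_cdf_like : cdf_like (subordinated m).
Proof.
split.
- by move=> s t st; rewrite -lee_fin !subordinatedE Wnd.
- by move=> t; rewrite fine_ge0// W0.
- move=> t t0; rewrite /subordinated integral0_eq// => y _; have [y0|y0] := ltP y 0; first by rewrite mN// mul0r.
  by rewrite (survivalN mD D0 Dnd)// mulr0.
- move=> s s0; rewrite laplace_subordinated// ge0_fin_numE.
    apply: lte_mul_pinfty => //; first by rewrite lee_fin invr_ge0 ltW.
    by apply: le_lt_trans (laplace_m (f0 s0)) _; exact: ltry.
  by rewrite mule_ge0 ?laplace_ge0// lee_fin invr_ge0 ltW.
Qed.

Lemma expectation_subordinated (p : R -> R) (p0 : R) t :
  measurable_fun setT p -> (forall x, 0 <= x -> 0 <= p x) -> 0 <= p0 ->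
  (forall x : R, 0 <= x -> ((p x)%:E = p0%:E + \int[mu]_y (m y * (y < x)%R%:R)%:E)%E) ->
  (\int[P]_w (p (H t w))%:E = (p0 + subordinated m t)%:E)%E.
Proof.
move=> mp pp p00 hp; rewrite EFinD subordinatedE.
have mH := measurable_inverse_subordinator mD Dnd t.
have mE : measurable [set z : T * R | z.2 < H t z.1].
  have := @measurable_lee _ (T * R)%type R setT measurableT (fun z => (H t z.1)%:E) (fun z => (z.2)%:E)
    (ltac:(by apply/measurable_EFinP; exact: (measurableT_comp mH))) (ltac:(by apply/measurable_EFinP)).
  rewrite setTI => h; rewrite (_ : [set z | _] = ~` [set z : T * R | ((H t z.1)%:E <= z.2%:E)%E]).
    exact: measurableC.
  by apply/seteqP; split => z /=; rewrite lee_fin leNgt; [move=> ->|move/negP; rewrite negbK].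
have mb : measurable_fun setT (fun z : T * R => (z.2 < H t z.1)%R%:R : R).
  rewrite (_ : (fun z => _) = \1_[set z : T * R | z.2 < H t z.1]); first exact: measurable_indic.
  by apply/funext => z; rewrite indicE; congr ((nat_of_bool _)%:R); apply/idP/idP; rewrite inE.
have m3 : measurable_fun setT (fun z : T * R => (m z.2 * (z.2 < H t z.1)%R%:R)%:E).
  by apply/measurable_EFinP; apply: measurable_funM => //; exact: (measurableT_comp mm).
have p3 (z : T * R) : (0 <= (m z.2 * (z.2 < H t z.1)%R%:R)%:E)%E by rewrite lee_fin mulr_ge0.
transitivity (\int[P]_w (p0%:E + \int[mu]_y (m y * (y < H t w)%R%:R)%:E))%E.
  by apply: eq_integral => w _; rewrite hp// inverse_subordinator_ge0.
rewrite ge0_integralD//; last 2 first.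
- by move=> w _; apply: integral_ge0 => y _; exact: (p3 (w, y)).
- exact: (measurable_fun_fubini_tonelli_F (m2 := mu) _ m3 p3).
have -> : (\int[P]_w p0%:E = p0%:E)%E.
  transitivity (p0%:E * P setT)%E; first exact: (@integral_cst _ _ _ P setT measurableT p0%:E).
  by rewrite (probability_setT P) mule1.
congr (_ + _)%E.
rewrite (fubini_tonelli (m1 := P) (m2 := mu) _ m3 p3)/=.
apply: eq_integral => y _; rewrite EFinM survivalE.
have mby : measurable_fun setT (fun w => (y < H t w)%R%:R : R).
  exact: (measurableT_comp mb (pair2_measurable y)).
rewrite (integral_nnZl P mby (fun w => ler0n _ _) (m0 y)); congr (_ * _)%E.
have mHy : measurable [set w | y < H t w].
  have := mH measurableT `]y, +oo[%classic (measurable_itv _).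
  by rewrite setTI; congr measurable; apply/seteqP; split => w /=; rewrite in_itv/= andbT.
transitivity (\int[P]_w (\1_[set w | y < H t w] w)%:E)%E.
  apply: eq_integral => w _; rewrite indicE; congr ((nat_of_bool _)%:R%:E).
  by apply/idP/idP; rewrite inE.
by rewrite integral_indic// setIT.
- exact: mD.
- exact: Dnd.
Qed.

End weight.

End subordination.

(** * State probabilities at an independent random time *)

Section int_paths.
Context d (T : measurableType d) (R : realType) (P : probability T R).

Lemma int_cvg_near (u : nat -> int) (a : int) : (u n)%:~R @[n --> \oo] --> (a%:~R : R) ->
  \forall n \near \oo, u n = a.
Proof.
move=> /cvgrPdist_lt/(_ _ (@ltr01 R)); apply: filterS => n.
rewrite -rmorphB/= -intr_norm (_ : (1 : R) = 1%:~R)// ltr_int => h.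
have : `|a - u n| = 0 by move: h (normr_ge0 (a - u n)); lia.
by move/normr0_eq0/eqP; rewrite subr_eq0 => /eqP.
Qed.

Variable S : R -> T -> int.
Hypothesis pS : int_process S.

Let mS t : 0 <= t -> measurable_fun setT (S t). Proof. by case: pS => h _; exact: h. Qed.

(** A convergent sequence of integers is eventually constant, so right-continuity makes the states
    along times decreasing to [Y] eventually equal to the state at [Y]; dominated convergence does
    the rest. *)
Lemma cvg_level (Y : T -> R) (v : nat -> T -> R) (n : int) : (forall w, 0 <= Y w) ->
  (forall w, v m w @[m --> \oo] --> (Y w)^'+) ->
  (forall m, measurable [set w | S (v m w) w = n]) ->
  measurable [set w | S (Y w) w = n] /\
  P [set w | S (v m w) w = n] @[m --> \oo] --> P [set w | S (Y w) w = n].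
Proof.
move=> Y0 hv mv.
have near_eq w : \forall m \near \oo, S (v m w) w = S (Y w) w.
  apply: int_cvg_near; have [_ cad] := pS; have [rc _] := cad w.
  exact: (cvg_comp _ _ (hv w) (rc _ (Y0 w))).
have lE : [set w | S (Y w) w = n] = \bigcup_(N : nat) \bigcap_(k : nat) [set w | S (v (N + k)%N w) w = n].
  apply/seteqP; split => w /=.
    by move=> <-; have [N _ hN] := near_eq w; exists N => // k _ /=; apply: hN; rewrite /= leq_addr.
  move=> [N _ hN]; have [N' _ hN'] := near_eq w.
  rewrite -(hN' (N + N')%N); last by rewrite /= leq_addl.
  exact: (hN N' I).
have mY : measurable [set w | S (Y w) w = n].
  by rewrite lE; apply: bigcupT_measurable => N; exact: bigcapT_measurable.
split => //.
have cv : (\int[P]_w (\1_[set w | S (v m w) w = n] w)%:E @[m --> \oo] -->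
    \int[P]_w (\1_[set w | S (Y w) w = n] w)%:E)%E.
  apply: (@dominated_cvg _ _ _ P setT measurableT _ _ (cst 1%E)).
  - by move=> m; apply/measurable_EFinP; exact: measurable_indic.
  - move=> w _; apply: cvg_near_cst; move: (near_eq w); apply: filterS => m hm.
    rewrite !indicE; congr ((nat_of_bool _)%:R%:E); apply/idP/idP; rewrite !inE/= hm//.
  - by [].
  - exact: finite_measure_integrable_cst.
  - by move=> m w _; rewrite indicE lee_fin ger0_norm// lern1 leq_b1.
move: cv; rewrite integral_indic// setIT.
by under eq_fun do rewrite integral_indic// setIT.
Qed.

Lemma state_prob_right_continuous n x : 0 <= x ->
  state_prob P S n u @[u --> x^'+] --> state_prob P S n x.
Proof.
move=> x0; apply/cvg_at_rightP => u [ux cu].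
have u0 m : 0 <= u m by rewrite (le_trans x0)// ltW.
have [mx cv] : measurable [set w | S x w = n] /\
    P [set w | S (u m) w = n] @[m --> \oo] --> P [set w | S x w = n].
  apply: (@cvg_level (cst x) (fun m => cst (u m)) n) => //.
  - move=> w A [e /= e0 hA]; have /cvgrPdist_lt/(_ _ e0)[N _ hN] := cu.
    by exists N => // m Nm /=; apply: hA; [exact: hN|exact: ux].
  - by move=> m; exact/measurable_int_level/mS.
apply: fine_cvg; rewrite fineK//; exact: fin_num_measure.
Qed.

Variable Y : T -> R.
Hypotheses (mY : measurable_fun setT Y) (Y0 : forall w, 0 <= Y w).

Let g n t := state_prob P S n t.

(** With [k.+1], [Yd] rounds [Y] strictly upwards: only right-continuity of the paths is
    available. *)
Let grid (m k : nat) : R := k.+1%:R / m.+1%:R.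
Let disc (m : nat) (y : R) : nat := Num.truncn (y * m.+1%:R).
Let Yd (m : nat) (w : T) : R := grid m (disc m (Y w)).

Let cellE m k : [set w | disc m (Y w) = k] = Y @^-1` `[(k%:R / m.+1%:R : R), (k.+1%:R / m.+1%:R : R)[%classic.
Proof.
have m0 : (0 : R) < m.+1%:R by [].
have ym w : 0 <= Y w * m.+1%:R by rewrite mulr_ge0.
apply/seteqP; split => w /=; rewrite in_itv/= ler_pdivrMr// ltr_pdivlMr//.
  by move=> /eqP; rewrite /disc truncn_eq.
by move=> h; apply/eqP; rewrite /disc truncn_eq.
Qed.

Let mcell m k : measurable [set w | disc m (Y w) = k].
Proof. by rewrite cellE -[X in measurable X]setTI; apply: mY => //; exact: measurable_itv. Qed.

Let Yd_gt m w : Y w < Yd m w.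
Proof. by rewrite /Yd /grid ltr_pdivlMr//; exact: truncnS_gt. Qed.

Let Yd_le m w : Yd m w <= Y w + m.+1%:R^-1.
Proof.
rewrite /Yd /grid -natr1 mulrDl mul1r lerD2r ler_pdivrMr//.
by rewrite truncn_le mulr_ge0.
Qed.

Let Yd_cvg w : Yd m w @[m --> \oo] --> (Y w)^'+.
Proof.
move=> A [e /= e0 hA]; have [N _ hN] := near_infty_natSinv_lt (PosNum e0).
exists N => // m Nm /=; apply: hA; last exact: Yd_gt.
rewrite /= distrC ger0_norm ?subr_ge0 ?(ltW (Yd_gt m w))//.
have := hN m Nm; rewrite /= => h; apply: le_lt_trans h.
by rewrite lerBlDl; exact: Yd_le.
Qed.

Let grid0 m k : 0 <= grid m k. Proof. by rewrite divr_ge0. Qed.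

Let levelE n m : [set w | S (Yd m w) w = n] =
  \bigcup_k ([set w | S (grid m k) w = n] `&` [set w | disc m (Y w) = k]).
Proof.
apply/seteqP; split => w /=; first by move=> h; exists (disc m (Y w)).
by move=> [k _ [h1 h2]]; rewrite /Yd h2.
Qed.

Let mlevel n m : measurable [set w | S (Yd m w) w = n].
Proof.
rewrite levelE; apply: bigcupT_measurable => k; apply: measurableI; last exact: mcell.
exact/measurable_int_level/mS.
Qed.

Lemma measurable_random_time n : measurable [set w | S (Y w) w = n].
Proof. by have [] := cvg_level Y0 Yd_cvg (mlevel n). Qed.

Hypothesis ind : forall (n : int) (u : R) (B : set R), 0 <= u -> measurable B ->
  P ([set w | S u w = n] `&` Y @^-1` B) = (P [set w | S u w = n] * P (Y @^-1` B))%E.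

Let mYd m : measurable_fun setT (Yd m).
Proof.
move=> _ B _; rewrite setTI (_ : _ @^-1` _ = \bigcup_(k in [set k | B (grid m k)]) [set w | disc m (Y w) = k]).
  by apply: bigcup_measurable => k _; exact: mcell.
apply/seteqP; split => w /=; first by move=> h; exists (disc m (Y w)).
by move=> [k /= Bk e]; rewrite /Yd e.
Qed.

Let gE n t : 0 <= t -> P [set w | S t w = n] = (g n t)%:E.
Proof. by move=> t0; rewrite fineK// fin_num_measure//; exact/measurable_int_level/mS. Qed.

Section expectation.
Variables (n : int) (p : R -> R).
Hypothesis pE : forall x, 0 <= x -> p x = state_prob P S n x.
Hypothesis mp : measurable_fun setT p.

Let discrete_time m : P [set w | S (Yd m w) w = n] = (\int[P]_w (p (Yd m w))%:E)%E.
Proof.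
have UT : \bigcup_k [set w | disc m (Y w) = k] = setT.
  by apply/seteqP; split => // w _; exists (disc m (Y w)).
have mpY : measurable_fun setT (fun w => (p (Yd m w))%:E).
  by apply/measurable_EFinP; exact: measurableT_comp.
rewrite -[in RHS]UT ge0_integral_bigcup//; last 3 first.
- by rewrite UT.
- by move=> w _; rewrite lee_fin pE ?fine_ge0// /Yd.
- by move=> i j _ _ [w [/= <- <-]].
rewrite levelE measure_bigcup; last 2 first.
- by move=> k _; apply: measurableI; [exact/measurable_int_level/mS|exact: mcell].
- by move=> i j _ _ [w [/= [_ <-] [_ <-]]].
rewrite (eq_eseriesl (Q := xpredT)); last by move=> k; rewrite in_setT.
apply: eq_eseriesr => k _.
rewrite -[LHS]/(P ([set w | S (grid m k) w = n] `&` [set w | disc m (Y w) = k])).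
rewrite cellE (ind n (grid0 m k) (measurable_itv _)).
rewrite gE// (_ : g n (grid m k) = p (grid m k)) -?cellE; last by rewrite pE.
transitivity (\int[P]_(w in [set w | disc m (Y w) = k]) cst (p (grid m k))%:E w)%E.
  by rewrite integral_cst//; exact: mcell.
by apply: eq_integral => w; rewrite inE /= => e; rewrite /Yd e.
Qed.

(** For the discretized time, the event splits over countably many deterministic times and
    independence applies to each; both sides converge by right-continuity. *)
Lemma state_prob_random_time : P [set w | S (Y w) w = n] = (\int[P]_w (p (Y w))%:E)%E.
Proof.
have [_ cv1] := cvg_level Y0 Yd_cvg (mlevel n).
have cv2 : (\int[P]_w (p (Yd m w))%:E @[m --> \oo] --> \int[P]_w (p (Y w))%:E)%E.
  apply: (@dominated_cvg _ _ _ P setT measurableT _ _ (cst 1%E)).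
  - by move=> m; apply/measurable_EFinP; exact: measurableT_comp.
  - move=> w _; have h : p (Yd m w) @[m --> \oo] --> p (Y w).
      rewrite pE//; have h := cvg_comp _ _ (@Yd_cvg w) (@state_prob_right_continuous n _ (Y0 w)).
      apply: cvg_trans h; apply: near_eq_cvg; apply: nearW => m /=.
      by rewrite pE// (ltW (le_lt_trans (Y0 w) (Yd_gt m w))).
    by apply: cvg_EFin; [exact: nearW|exact: h].
  - by [].
  - exact: finite_measure_integrable_cst.
  - move=> m w _; have y0 : 0 <= Yd m w := ltW (le_lt_trans (Y0 w) (Yd_gt m w)).
    rewrite gee0_abs ?lee_fin pE//; last by rewrite fine_ge0.
    by rewrite -lee_fin -gE// probability_le1//; exact/measurable_int_level/mS.
have cv3 : (\int[P]_w (p (Yd m w))%:E @[m --> \oo] --> P [set w | S (Y w) w = n])%E.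
  by move: cv1; under eq_fun do rewrite discrete_time.
exact: (cvg_unique _ cv3 cv2).
Qed.

End expectation.

End int_paths.

(** * Bounded weights and their primitives *)

Section bounded_weight.
Context {R : realType}.
Notation mu := (@lebesgue_measure R).

Lemma bounded_kernel (m : R -> R) (C : R) : measurable_fun setT m -> (forall y, 0 <= m y) ->
  (forall y, m y <= C) -> (forall y, y <= 0 -> m y = 0) -> is_kernel m.
Proof.
move=> mm m0 mC mN; split => // s s0; rewrite ge0_fin_numE ?laplace_ge0//.
have C0 : 0 <= C := le_trans (m0 0) (mC 0).
have mh : measurable_fun setT (heaviside : R -> R) := cdf_like_measurable heaviside_cdf_like.
apply: (@le_lt_trans _ _ (laplace (fun x => C * heaviside x)%R s)).
  apply: le_laplace => //; first exact: measurable_funM.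
  move=> x; rewrite m0/= /heaviside; case: (leP 0 x) => x0 /=; first by rewrite mulr1.
  by rewrite mN ?mulr0// ltW.
rewrite laplaceZ ?laplace_heaviside//; first exact: ltry.
Qed.

Variables (F h : R -> R).
Hypotheses (ch : continuous h) (cF : continuous F).
Hypothesis dF : forall x : R, 0 < x -> is_derive x 1 F (h x).
Hypothesis h0 : forall x, 0 <= h x.
Let m (x : R) := if 0 < x then h x else 0.

Lemma measurable_positive_part : measurable_fun setT m.
Proof.
have -> : m = (fun x => h x * \1_(`]0, +oo[%classic) x).
  apply/funext => x; rewrite /m indicE; case: ifPn => x0.
    by rewrite mem_set ?mulr1//= in_itv/= x0.
  by rewrite memNset ?mulr0//= in_itv/= (negbTE x0).
apply: measurable_funM; first exact: continuous_measurable_fun.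
by apply: measurable_indic; exact: measurable_itv.
Qed.

Lemma integral_positive_part x : 0 <= x ->
  (\int[mu]_y (m y * (y < x)%R%:R)%:E = (F x - F 0)%:E)%E.
Proof.
rewrite le_eqVlt => /predU1P[<-|x0].
  rewrite subrr integral0_eq// => y _; rewrite /m; case: ifPn => y0; last by rewrite mul0r.
  by rewrite ltNge (ltW y0) mulr0.
have e1 : (\int[mu]_(y in `[0%R, x]) (h y)%:E = (F x)%:E - (F 0)%:E)%E.
  apply: continuous_FTC2 => //.
  - by apply: continuous_subspaceT => y; exact: ch.
  - split.
    + by move=> y; rewrite in_itv/= => /andP[y0 _]; exact: (@ex_derive _ _ _ _ _ _ _ (dF y0)).
    + by apply: cvg_at_right_filter; exact: cF.
    + by apply: cvg_at_left_filter; exact: cF.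
  - move=> y; rewrite in_itv/= => /andP[y0 _]; rewrite derive1E.
    exact: (@derive_val _ _ _ _ _ _ _ (dF y0)).
rewrite EFinB -e1 (integral_itv_bndoo true false); last first.
  by apply/measurable_EFinP; apply: measurable_funTS; exact: continuous_measurable_fun.
rewrite [RHS]integral_mkcond; apply: eq_integral => y _.
rewrite patchE mem_setE in_itv/= /m; case: ltP => y0 /=; last by rewrite mul0r.
by case: ifP => _; rewrite ?mulr1 ?mulr0.
Qed.

Lemma primitive_positive_part C x : (forall y, h y <= C) -> 0 <= x -> primitive m x = F x - F 0.
Proof.
move=> hC x0; have mm := measurable_positive_part.
have m0 y : 0 <= m y by rewrite /m; case: ifP.
have C0 : 0 <= C := le_trans (h0 0) (hC 0).
have km : is_kernel m.
  apply: (bounded_kernel (C := C)) => // y; rewrite /m; first by case: ifP.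
  by move=> y0; rewrite ltNge y0.
apply/EFin_inj; rewrite primitiveE// -integral_positive_part//.
have ml : measurable_fun setT (fun y : R => (y < x)%R%:R : R).
  rewrite (_ : (fun y => _) = \1_(`]-oo, x[%classic)); first by apply: measurable_indic; exact: measurable_itv.
  by apply/funext => y; rewrite indicE; congr ((nat_of_bool _)%:R); apply/idP/idP; rewrite inE/= in_itv.
apply: ae_eq_integral => //.
- by apply/measurable_EFinP; apply: measurable_funM => //; exact: measurable_heaviside_sub.
- by apply/measurable_EFinP; exact: measurable_funM.
exists [set x]; split => //; first exact: lebesgue_measure_set1.
move=> y /= hy; apply: contrapT => yx; apply: hy => _; congr (_ * _)%:E.
rewrite /heaviside subr_ge0 le_eqVlt; congr ((nat_of_bool _)%:R).
by case: eqVneq => // yx'; case: yx.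
Qed.

(** Integration by parts, read on [F] as its value at 0 plus the convolution of its derivative with
    the Heaviside function. *)
Lemma laplace_positive_part C s : (forall y, h y <= C) -> 0 < s ->
  0 <= F 0 ->
  (s%:E * laplace (fun x : R => if 0 <= x then F x else 0)%R s = (F 0)%:E + laplace m s)%E.
Proof.
move=> hC s0 F0; have mm := measurable_positive_part.
have m0 y : 0 <= m y by rewrite /m; case: ifP.
have km : is_kernel m.
  apply: (bounded_kernel (C := C)) => // y; rewrite /m; first by case: ifP => // _; exact: le_trans (h0 0) (hC 0).
  by move=> y0; rewrite ltNge y0.
have cp := cdf_like_rconv km (@heaviside_cdf_like R).
have mh := cdf_like_measurable (@heaviside_cdf_like R).
have hh (x : R) : 0 <= heaviside x :> R by exact: ler0n.
have [_ _ _ Lm] := km.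
have -> : (fun x => if 0 <= x then F x else 0) = (fun x => F 0 * heaviside x + primitive m x).
  apply/funext => x; rewrite /heaviside; case: leP => x0 /=.
    by rewrite (primitive_positive_part hC x0) mulr1 addrC subrK.
  by rewrite mulr0 primitive_le0 ?addr0// ltW.
rewrite laplaceD; last 4 first.
- exact: measurable_funM.
- exact: cdf_like_measurable cp.
- by move=> x; rewrite mulr_ge0.
- by move=> x; exact: primitive_ge0.
rewrite laplaceZ// laplace_heaviside// laplace_rconv//; last exact: heaviside_cdf_like.
rewrite laplace_heaviside//; case: (laplace m s) (Lm s s0) => [L| |] // _.
rewrite -?EFinM -?EFinD -?EFinM; congr EFin; field.
by rewrite gt_eqF.
Qed.

Lemma primitive_lipschitz C a b : (forall y, h y <= C) -> a <= b ->
  `|primitive m b - primitive m a| <= C * (b - a).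
Proof.
move=> hC ab; have mm := measurable_positive_part.
have m0 y : 0 <= m y by rewrite /m; case: ifP.
have C0 : 0 <= C := le_trans (h0 0) (hC 0).
have mC y : m y <= C by rewrite /m; case: ifP.
have km : is_kernel m.
  by apply: (bounded_kernel (C := C)) => // y y0; rewrite /m ltNge y0.
rewrite ger0_norm ?subr_ge0; last exact: primitive_nd.
rewrite lerBlDl -lee_fin EFinD (primitiveB km ab) leeD2l// -integral_cst_itv//.
apply: le_integral_nn.
- by apply: measurable_funM => //; apply: measurable_indic; exact: measurable_itv.
- by apply: measurable_funM => //; apply: measurable_indic; exact: measurable_itv.
- by move=> x; rewrite mulr_ge0.
- by move=> x; rewrite ler_wpM2r.
Qed.

End bounded_weight.

Section primitive_derivative.
Context {R : realType} (h : R -> R).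
Hypotheses (ch : continuous h) (h0 : forall x, 0 <= h x).
Let m (x : R) := if 0 < x then h x else 0.

Lemma is_derive_primitive C (t : R) : (forall y, h y <= C) -> 0 < t -> is_derive t 1 (primitive m) (h t).
Proof.
move=> hC t0; have mm := measurable_positive_part ch.
have m0 y : 0 <= m y by rewrite /m; case: ifP.
have mC y : m y <= C by rewrite /m; case: ifP => // _; exact: le_trans (h0 0) (hC 0).
have km : is_kernel m.
  by apply: (bounded_kernel (C := C)) => // y y0; rewrite /m ltNge y0.
have key : u^-1 *: (primitive m (u *: (1 : R) + t) - primitive m t) @[u --> 0^'] --> h t.
  apply/cvgrPdist_le => e e0.
  have /cvgrPdist_le/(_ _ e0)[del /= del0 hd] := @ch t.
  have bnd a b : 0 < a -> a <= b -> (forall y, a <= y -> y <= b -> `|h t - h y| <= e) ->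
      `|primitive m b - primitive m a - h t * (b - a)| <= e * (b - a).
    move=> a0 ab hy; have ba : 0 <= b - a by rewrite subr_ge0.
    have mi : measurable_fun setT (\1_(`]a, b]%classic) : R -> R) by exact: measurable_indic.
    have up : primitive m b - primitive m a <= (h t + e) * (b - a).
      have he : 0 <= h t + e by rewrite addr_ge0// ltW.
      rewrite lerBlDl -lee_fin EFinD (primitiveB km ab) leeD2l// -integral_cst_itv//.
      apply: le_integral_nn; [by apply: measurable_funM|by apply: measurable_funM|by move=> x; rewrite mulr_ge0|].
      move=> x; rewrite indicE; have [/[!inE]/=|_] := boolP (x \in _); last by rewrite !mulr0.
      rewrite in_itv/= => /andP[ax xb]; rewrite !mulr1 /m (lt_trans a0 ax).
      by have := hy x (ltW ax) xb; rewrite ler_norml => /andP[]; lra.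
    have lo : (h t - e) * (b - a) <= primitive m b - primitive m a.
      (* The comparison is between integrals of nonnegative functions, so a negative lower constant
         is handled by the sign of the increment. *)
      have [he|he] := leP 0 (h t - e); last first.
        apply: (@le_trans _ _ 0); first by rewrite mulr_le0_ge0// ltW.
        by rewrite subr_ge0; exact: primitive_nd.
      rewrite lerBrDl -lee_fin EFinD (primitiveB km ab) leeD2l// -integral_cst_itv//.
      apply: le_integral_nn; [by apply: measurable_funM|by apply: measurable_funM|by move=> x; rewrite mulr_ge0|].
      move=> x; rewrite indicE; have [/[!inE]/=|_] := boolP (x \in _); last by rewrite !mulr0.
      rewrite in_itv/= => /andP[ax xb]; rewrite !mulr1 /m (lt_trans a0 ax).
      by have := hy x (ltW ax) xb; rewrite ler_norml => /andP[]; lra.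
    by rewrite ler_norml; apply/andP; split; move: up lo; rewrite !mulrDl ?mulNr; lra.
  have near0 : \forall u \near (0 : R)^', `|u| < Num.min del t.
    exists (Num.min del t) => /=; first by rewrite lt_min del0 t0.
    by move=> u /=; rewrite sub0r normrN.
  have near1 : \forall u \near (0 : R)^', u != 0 by exists 1 => //=.
  move: near0 near1; apply: filterS2 => u; rewrite lt_min => /andP[udel ut] u0.
  rewrite /GRing.scale/= mulr1 distrC.
  have hy y : `|y - t| <= `|u| -> `|h t - h y| <= e.
    by move=> yu; apply: hd; rewrite /= distrC; exact: le_lt_trans udel.
  have -> : u^-1 * (primitive m (u + t) - primitive m t) - h t =
      u^-1 * (primitive m (u + t) - primitive m t - h t * u) by field.
  rewrite normrM normfV ler_pdivrMl ?normr_gt0// [leRHS]mulrC.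
  have [upos|uneg] := ltP 0 u.
    have := bnd t (u + t) t0; rewrite lerDr (ltW upos) addrK (gtr0_norm upos); apply => // y ty yu.
    by apply: hy; rewrite (gtr0_norm upos) ger0_norm ?subr_ge0//; move: yu; lra.
  have ult : u < 0 by rewrite lt_neqAle u0.
  have utp : 0 < u + t by move: ut; rewrite ltr0_norm//; lra.
  have := bnd (u + t) t utp; rewrite gerDr uneg (ltr0_norm ult) => /(_ isT) h1.
  have -> : primitive m (u + t) - primitive m t - h t * u = - (primitive m t - primitive m (u + t) - h t * (- u)) by ring.
  rewrite normrN; have e2 : t - (u + t) = - u by ring.
  rewrite e2 in h1; apply: h1 => y ty yt.
  by apply: hy; rewrite ler0_norm ?subr_le0// (ltr0_norm ult); move: ty; lra.
by split; [exact: (cvgP _ key)|exact: (cvg_lim _ key)].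
Qed.

End primitive_derivative.

(** * The Skellam equations under the Laplace transform *)

Section skellam_laplace.
Context {R : realType} (Lam Mu : R) (p : int -> R -> R).
Hypotheses (Lam0 : 0 <= Lam) (Mu0 : 0 <= Mu).
Hypotheses (cp : forall n, continuous (p n)) (p01 : forall n x, 0 <= p n x <= 1).
Let K := Lam + Mu.

Lemma skellam_rhs_bound n x : 0 <= K + skellam_rhs Lam Mu p n x <= 2 * K /\
  0 <= K - skellam_rhs Lam Mu p n x <= 2 * K.
Proof.
rewrite /skellam_rhs /K; have /andP[a0 a1] := p01 n x; have /andP[b0 b1] := p01 (n - 1) x.
have /andP[d0 d1] := p01 (n + 1) x.
have h1 : Lam * (p (n - 1) x - p n x) <= Lam by rewrite -[leRHS]mulr1 ler_wpM2l//; lra.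
have h2 : Lam * (-1) <= Lam * (p (n - 1) x - p n x) by rewrite ler_wpM2l//; lra.
have h3 : Mu * (p n x - p (n + 1) x) <= Mu by rewrite -[leRHS]mulr1 ler_wpM2l//; lra.
have h4 : Mu * (-1) <= Mu * (p n x - p (n + 1) x) by rewrite ler_wpM2l//; lra.
by split; apply/andP; split; move: h1 h2 h3 h4; lra.
Qed.

Lemma continuous_skellam_rhs n : continuous (skellam_rhs Lam Mu p n).
Proof.
move=> x; apply: cvgB; (apply: cvgM; first exact: cvg_cst); apply: cvgB; exact: cp.
Qed.

Let mp n : measurable_fun setT (p n). Proof. exact: continuous_measurable_fun. Qed.

Let pos (h : R -> R) (x : R) : R := if 0 < x then h x else 0.
Let pos0 (h : R -> R) (x : R) : R := if 0 <= x then h x else 0.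

Let mpos h : continuous h -> measurable_fun setT (pos h).
Proof. exact: measurable_positive_part. Qed.

Let pos_kernel (h : R -> R) C : continuous h -> (forall x, 0 <= h x <= C) -> is_kernel (pos h).
Proof.
move=> ch hC; have hh x : 0 <= h x /\ h x <= C by apply/andP.
apply: (bounded_kernel (C := C)); first exact: mpos.
- by move=> x; rewrite /pos; case: ifP => // _; case: (hh x).
- by move=> x; rewrite /pos; case: ifP => _; case: (hh x) => // /le_trans; apply.
- by move=> x x0; rewrite /pos ltNge x0.
Qed.

Let kpos n := pos_kernel (@cp n) (p01 n).
Let c1 : continuous (cst 1 : R -> R). Proof. by move=> x; exact: cvg_cst. Qed.
Let kst : is_kernel (pos (cst 1)).
Proof. by apply: (pos_kernel (C := 1)) => // x; rewrite ler01 lexx. Qed.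

Lemma laplace_step1 s : 0 < s -> laplace (pos (cst 1)) s = (s^-1)%:E.
Proof.
move=> s0; rewrite -laplace_heaviside//; apply: laplace_ae.
- by have [] := kst.
- exact: cdf_like_measurable heaviside_cdf_like.
- by move=> x x0; rewrite /pos /heaviside (le_eqVlt 0 x) (eq_sym 0 x) (negbTE x0)/=; case: ifP.
Qed.

(** Each term stands on the side where it is nonnegative, so that additivity in [\bar R] applies
    without subtraction. *)
Lemma laplace_skellam_plus n s : 0 < s ->
  (laplace (pos (fun x : R => K + skellam_rhs Lam Mu p n x)%R) s + K%:E * laplace (pos (p n)) s =
   Lam%:E * laplace (pos (p (n - 1)%R)) s + Mu%:E * laplace (pos (p (n + 1)%R)) s + K%:E * (s^-1)%:E)%E.
Proof.
move=> s0; have K0 : 0 <= K by rewrite addr_ge0.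
have cr : continuous (fun x => K + skellam_rhs Lam Mu p n x).
  by move=> x; apply: cvgD; [exact: cvg_cst|exact: continuous_skellam_rhs].
have kr := pos_kernel cr (fun x => (skellam_rhs_bound n x).1).
have [m1 q1 _ _] := kr; have [ms qs _ _] := kst.
have mpn m : measurable_fun setT (pos (p m)) by case: (kpos m).
have qpn m x : 0 <= pos (p m) x by case: (kpos m).
have mz (a : R) m : measurable_fun setT (fun x : R => a * pos (p m) x) by exact: measurable_funM.
have qz (a : R) m x : 0 <= a -> 0 <= a * pos (p m) x by move=> a0; rewrite mulr_ge0.
have ms' : measurable_fun setT (fun x : R => K * pos (cst 1) x) by exact: measurable_funM.
have qs' x : 0 <= K * pos (cst 1) x by rewrite mulr_ge0.
rewrite -(laplace_step1 s0) -(laplaceZ s (mpn n) (qpn n) K0) -(laplaceZ s (mpn _) (qpn _) Lam0).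
rewrite -(laplaceZ s (mpn _) (qpn _) Mu0) -(laplaceZ s ms qs K0).
rewrite -(laplaceD s m1 (mz K n) q1 (fun x => qz K n x K0)).
rewrite -(laplaceD s (mz Lam _) (mz Mu _) (fun x => qz Lam _ x Lam0) (fun x => qz Mu _ x Mu0)).
rewrite -laplaceD//; last 2 first.
- exact: measurable_funD.
- by move=> x; rewrite addr_ge0 ?qz.
congr laplace; apply/funext => x; rewrite /pos; case: ifP => _; last by rewrite !mulr0 !addr0.
by rewrite /skellam_rhs /K /=; ring.
Qed.

Lemma laplace_skellam_minus n s : 0 < s ->
  (laplace (pos (fun x : R => K + skellam_rhs Lam Mu p n x)%R) s +
   laplace (pos (fun x : R => K - skellam_rhs Lam Mu p n x)%R) s = (2 * K)%:E * (s^-1)%:E)%E.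
Proof.
move=> s0; have K0 : 0 <= 2 * K by rewrite mulr_ge0// addr_ge0.
have cr : continuous (fun x => K + skellam_rhs Lam Mu p n x).
  by move=> x; apply: cvgD; [exact: cvg_cst|exact: continuous_skellam_rhs].
have cr' : continuous (fun x => K - skellam_rhs Lam Mu p n x).
  by move=> x; apply: cvgB; [exact: cvg_cst|exact: continuous_skellam_rhs].
have [m1 q1 _ _] := pos_kernel cr (fun x => (skellam_rhs_bound n x).1).
have [m2 q2 _ _] := pos_kernel cr' (fun x => (skellam_rhs_bound n x).2).
have [ms qs _ _] := kst.
rewrite -(laplace_step1 s0) -(laplaceZ s ms qs K0) -(laplaceD s m1 m2 q1 q2).
congr laplace; apply/funext => x; rewrite /pos; case: ifP => _; last by rewrite !mulr0 !addr0.
by rewrite /=; ring.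
Qed.

Lemma laplace_pos0 n s : laplace (pos0 (p n)) s = laplace (pos (p n)) s.
Proof.
have m1 : measurable_fun setT (pos (p n)) by case: (kpos n).
have pE : pos0 (p n) = fun x => p n x * heaviside x.
  by apply/funext => x; rewrite /pos0 /heaviside; case: ifP => _; rewrite ?mulr1 ?mulr0.
apply: laplace_ae => //.
  rewrite pE; apply: measurable_funM => //; exact: cdf_like_measurable heaviside_cdf_like.
by move=> x x0; rewrite /pos0 /pos (le_eqVlt 0 x) (eq_sym 0 x) (negbTE x0).
Qed.

Lemma laplace_pos_fin n s : 0 < s -> laplace (pos (p n)) s \is a fin_num.
Proof. by move=> s0; have [_ _ _ h] := kpos n; exact: h. Qed.

Lemma skellam_plus_kernel n : is_kernel (pos (fun x => K + skellam_rhs Lam Mu p n x)).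
Proof.
apply: pos_kernel => [|x]; last exact: (skellam_rhs_bound n x).1.
by move=> x; apply: cvgD; [exact: cvg_cst|exact: continuous_skellam_rhs].
Qed.

Lemma skellam_minus_kernel n : is_kernel (pos (fun x => K - skellam_rhs Lam Mu p n x)).
Proof.
apply: pos_kernel => [|x]; last exact: (skellam_rhs_bound n x).2.
by move=> x; apply: cvgB; [exact: cvg_cst|exact: continuous_skellam_rhs].
Qed.

End skellam_laplace.

Lemma half_difference_le {R : realType} (x x' a a' b b' : R) : a <= a' -> b <= b' ->
  a + b = 2 * x -> a' + b' = 2 * x' -> `|(a' - x') - (a - x)| <= x' - x.
Proof. by move=> h1 h2 h3 h4; rewrite ler_norml; apply/andP; split; lra. Qed.

(** * The time-changed process *)

Section time_changed_skellam.
Context d (T : measurableType d) (R : realType) (P : probability T R).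
Context (Lam Mu : R) (S : R -> T -> int) (c1 c2 : R) (nubar : {measure set R -> \bar R})
  (D : R -> T -> \bar R).
Notation mu := (@lebesgue_measure R).
Hypotheses (Lam0 : 0 < Lam) (Mu0 : 0 < Mu).
Hypothesis hS : skellam_state_equations P Lam Mu S.
Hypothesis hf : bernstein_triplet c1 c2 nubar.
Hypothesis hD : subordinator P c1 c2 nubar D.
Hypothesis hindep : independent_processes P S (inverse_subordinator D).
Hypothesis hinf : nubar `]0, +oo[%classic = +oo%E.
Hypothesis hac : forall a b, 0 < a -> a <= b -> abs_cont a b (levy_tail c1 nubar).

Notation H := (inverse_subordinator D).
Let f := bernstein c1 c2 nubar.
Let q := levy_kernel c1 nubar.
Let K := Lam + Mu.

Let K0 : 0 < K. Proof. exact: addr_gt0. Qed.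
Let f0 s : 0 < s -> 0 < f s. Proof. by move=> s0; exact: (bernstein_gt0 hf hinf s0). Qed.
Let mD t : 0 <= t -> measurable_fun setT (D t). Proof. by case: hD => h _ _ _ _; exact: h. Qed.
Let D0 : {ae P, forall w, D 0 w = 0%E}. Proof. by case: hD. Qed.
Let Dnd w s t : 0 <= s -> s <= t -> (D s w <= D t w)%E.
Proof. by case: hD => _ _ h _ _; have [_] := h w; exact. Qed.
Let LD (t s : R) : 0 <= t -> 0 < s ->
  (\int[P]_w expeR (- (s%:E * D t w)) = (expR (- (t * f s)))%:E)%E.
Proof. by case: hD => _ _ _ _ h; exact: h. Qed.

Let pS : int_process S. Proof. by case: hS. Qed.
(** Extending by the value at 0 makes [p n] continuous on the whole line; at 0 this rests on
    right-continuity of the state probabilities. *)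
Let p (n : int) (x : R) : R := state_prob P S n (Num.max x 0).

Let mS (t : R) n : 0 <= t -> measurable [set w | S t w = n].
Proof. by move=> t0; apply: measurable_int_level; case: pS => h _; exact: h. Qed.

Let p01 n x : 0 <= p n x <= 1.
Proof.
have x0 : 0 <= Num.max x 0 by rewrite le_max lexx orbT.
rewrite /p /state_prob fine_ge0//= -lee_fin fineK ?probability_le1// ?fin_num_measure//; exact: mS.
Qed.

Let dp n (x : R) : 0 < x -> is_derive x 1 (p n) (skellam_rhs Lam Mu p n x).
Proof.
move=> x0; have [_ _ _ h] := hS; have hx := h n x x0.
have rE : skellam_rhs Lam Mu p n x = skellam_rhs Lam Mu (state_prob P S) n x.
  by rewrite /skellam_rhs /p max_l// ltW.
rewrite rE; apply: (near_eq_is_derive _ hx).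
near=> u; rewrite /p max_l// ltW//; near: u; exact: lt_nbhsr.
Unshelve. all: by end_near. Qed.

Let cp n : continuous (p n).
Proof.
move=> x; have [x0|x0] := ltP 0 x.
  by apply: differentiable_continuous; apply/derivable1_diffP; exact: (@ex_derive _ _ _ _ _ _ _ (dp n x0)).
apply/cvgrPdist_lt => e e0.
have r0 := @state_prob_right_continuous _ _ _ P S pS n 0 (lexx 0).
have /cvgrPdist_lt/(_ e e0)[del /= del0 hd] := r0.
have pN y : y <= 0 -> p n y = state_prob P S n 0 by move=> y0; rewrite /p max_r.
exists del => //= y yx; rewrite (pN x x0).
have [y0|y0] := leP y 0; first by rewrite pN// subrr normr0.
rewrite /p max_l ?(ltW y0)//; apply: hd => //=; rewrite sub0r normrN gtr0_norm//.
apply: le_lt_trans yx; rewrite distrC; apply: le_trans (ler_norm _); move: x0; lra.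
Qed.

Let hplus n x := K + skellam_rhs Lam Mu p n x.
Let hminus n x := K - skellam_rhs Lam Mu p n x.
Let mplus n (x : R) : R := if 0 < x then hplus n x else 0.
Let mminus n (x : R) : R := if 0 < x then hminus n x else 0.
Let st (x : R) : R := if 0 < x then cst 1 x else 0.

Let rb n x := skellam_rhs_bound (ltW Lam0) (ltW Mu0) p01 n x.

Let chp n : continuous (hplus n).
Proof. by move=> x; apply: cvgD; [exact: cvg_cst|exact: continuous_skellam_rhs]. Qed.

Let hp0 n x : 0 <= hplus n x. Proof. by have [/andP[h _] _] := rb n x. Qed.
Let hp2 n x : hplus n x <= 2 * K. Proof. by have [/andP[_ h] _] := rb n x. Qed.

Let Fplus n x := p n x + K * x.

Let cF n : continuous (Fplus n).
Proof. by move=> x; apply: cvgD; [exact: cp|apply: cvgM; [exact: cvg_cst|exact: cvg_id]]. Qed.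

Let dF n (x : R) : 0 < x -> is_derive x 1 (Fplus n) (hplus n x).
Proof.
move=> x0; have h := is_deriveD (dp n x0) (is_deriveZ K (is_derive_id x 1)).
by rewrite /hplus addrC; have -> : K = K *: (1 : R) by rewrite /GRing.scale/= mulr1.
Qed.

Let c1' : continuous (cst 1 : R -> R). Proof. by move=> x; exact: cvg_cst. Qed.
Let kplus n : is_kernel (mplus n) := skellam_plus_kernel (ltW Lam0) (ltW Mu0) cp p01 n.
Let kminus n : is_kernel (mminus n) := skellam_minus_kernel (ltW Lam0) (ltW Mu0) cp p01 n.
Let mst : measurable_fun setT st. Proof. exact: measurable_positive_part c1'. Qed.
Let st0 x : 0 <= st x. Proof. by rewrite /st; case: ifP. Qed.
Let st1 x : st x <= 1. Proof. by rewrite /st; case: ifP. Qed.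
Let stN x : x < 0 -> st x = 0. Proof. by move=> x0; rewrite /st ltNge (ltW x0). Qed.
Let KK0 : 0 <= 2 * K. Proof. by rewrite mulr_ge0// ltW. Qed.
Let mp2 n x : mplus n x <= 2 * K.
Proof. by rewrite /mplus; case: ifP => _; [case: (rb n x) => /andP[]|]. Qed.
Let mm2 n x : mminus n x <= 2 * K.
Proof. by rewrite /mminus; case: ifP => _; [case: (rb n x) => _ /andP[]|]. Qed.

Let sub (m : R -> R) := subordinated P D m.
Let U := sub st.

Let subE (m : R -> R) (t C : R) : measurable_fun setT m -> (forall y, 0 <= m y) -> (forall y, m y <= C) ->
  (forall y, y < 0 -> m y = 0) ->
  (sub m t)%:E = (\int[mu]_y (m y * survival P D y t)%:E)%E.
Proof. by move=> h1 h2 h3 h4; exact: (subordinatedE mD Dnd LD f0 h1 h2 h3 h4). Qed.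

Let mplusF n : [/\ measurable_fun setT (mplus n), forall y, 0 <= mplus n y & forall y, y < 0 -> mplus n y = 0].
Proof. by have [h1 h2 h3 _] := kplus n; split => // y /ltW; exact: h3. Qed.

Let mminusF n : [/\ measurable_fun setT (mminus n), forall y, 0 <= mminus n y & forall y, y < 0 -> mminus n y = 0].
Proof. by have [h1 h2 h3 _] := kminus n; split => // y /ltW; exact: h3. Qed.

Let cdfU : cdf_like U.
Proof. exact: (subordinated_cdf_like mD D0 Dnd LD f0 mst st0 st1 stN). Qed.

Let cdfplus n : cdf_like (sub (mplus n)).
Proof. by have [h1 h2 h3] := mplusF n; exact: (subordinated_cdf_like mD D0 Dnd LD f0 h1 h2 (mp2 n) h3). Qed.

Let cdfminus n : cdf_like (sub (mminus n)).
Proof. by have [h1 h2 h3] := mminusF n; exact: (subordinated_cdf_like mD D0 Dnd LD f0 h1 h2 (mm2 n) h3). Qed.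

Let sub_sum n t : sub (mplus n) t + sub (mminus n) t = 2 * K * U t.
Proof.
have [a1 a2 a3] := mplusF n; have [b1 b2 b3] := mminusF n.
have ms : measurable_fun setT (fun y : R => survival P D y t).
  exact: (measurableT_comp (measurable_survival mD Dnd LD f0) (pair2_measurable t)).
have s0 y : 0 <= survival P D y t by exact: survival_ge0.
apply: EFin_inj; rewrite EFinD EFinM (subE t a1 a2 (mp2 n) a3) (subE t b1 b2 (mm2 n) b3) (subE t mst st0 st1 stN).
rewrite -integral_nnD; last 4 first.
- exact: measurable_funM.
- exact: measurable_funM.
- by move=> y; rewrite mulr_ge0.
- by move=> y; rewrite mulr_ge0.
rewrite -integral_nnZl; last 3 first.
- exact: measurable_funM.
- by move=> y; rewrite mulr_ge0.
- exact: KK0.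
apply: eq_integral => y _; congr EFin; rewrite /mplus /mminus /st /hplus /hminus.
by case: ifP => _ /=; ring.
Qed.

Let pf := state_prob P (time_change S H).

Let mH t : measurable_fun setT (H t). Proof. exact: (measurable_inverse_subordinator mD Dnd). Qed.

Let mpf t n : measurable [set w | S (H t w) w = n].
Proof. exact: (@measurable_random_time _ _ _ P S pS (H t) (mH t) (inverse_subordinator_ge0 D t)). Qed.

Let expectation_U t : (\int[P]_w (H t w)%:E = (U t)%:E)%E.
Proof.
have := @expectation_subordinated _ _ _ P D f mD Dnd LD f0 st 1 mst st0 st1 stN id 0 t.
rewrite add0r; apply => // x x0; rewrite add0e.
have -> : (id x)%:E = (id x - id 0)%:E :> \bar R by rewrite subr0.
by apply/esym; apply: (@integral_positive_part R id (cst 1)) => //; move=> y; exact: cvg_id.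
Qed.

Let mp n : measurable_fun setT (p n). Proof. exact: continuous_measurable_fun. Qed.

Let expectation_plus n t : (\int[P]_w (p n (H t w))%:E + K%:E * (U t)%:E = (p n 0 + sub (mplus n) t)%:E)%E.
Proof.
have [a1 a2 a3] := mplusF n.
have p0 x : 0 <= p n x by have /andP[] := p01 n x.
have h := @expectation_subordinated _ _ _ P D f mD Dnd LD f0 (mplus n) (2 * K) a1 a2 (mp2 n) a3 (Fplus n) (p n 0) t.
rewrite -h; first last.
- move=> x x0; have e := integral_positive_part (@chp n) (@cF n) (@dF n) x0.
  by rewrite /mplus e -EFinD; congr EFin; rewrite /Fplus; ring.
- exact: p0.
- by move=> x x0; rewrite addr_ge0// mulr_ge0// ltW.
- exact: continuous_measurable_fun.
have H0 w : 0 <= H t w by exact: inverse_subordinator_ge0.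
rewrite -expectation_U -(integral_nnZl P (mH t) H0 (ltW K0)) -integral_nnD//.
- exact: measurableT_comp.
- exact: measurable_funM.
- by move=> w; rewrite mulr_ge0// ltW.
Qed.

(** For [0 <= t] this is [expectation_plus] combined with independence. For negative [t], [D 0 = 0]
    already exceeds the level, so [H t = 0] almost surely; this case gives the identity on the whole
    line. *)
Let pfE n t : pf n t = p n 0 + (sub (mplus n) t - K * U t).
Proof.
have [t0|t0] := leP 0 t.
  have e := expectation_plus n t.
  have i (m : int) (u : R) (B : set R) : 0 <= u -> measurable B ->
      P ([set w | S u w = m] `&` H t @^-1` B) = (P [set w | S u w = m] * P (H t @^-1` B))%E.
    move=> u0 mB; apply: hindep.
      exact: (@process_sigma_preimage _ _ _ _ _ S _ u [set m]).
    exact: process_sigma_preimage.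
  have pE x : 0 <= x -> p n x = state_prob P S n x by move=> x0; rewrite /p max_l.
  have h := state_prob_random_time pS (mH t) (fun w => inverse_subordinator_ge0 D t w) i pE (mp n).
  have hP : P [set w | S (H t w) w = n] = (pf n t)%:E.
    by rewrite /pf /state_prob fineK//; apply: fin_num_measure; exact: mpf.
  by rewrite -h hP -EFinM -EFinD in e; have {}e := EFin_inj e; rewrite addrA -e addrK.
have [_ _ s0 _] := cdfplus n; have [_ _ u0 _] := cdfU.
rewrite s0// u0// mulr0 subrr addr0 /p maxxx /pf /state_prob.
have [N [mN PN hN]] := D0.
rewrite -(measureU0 (mpf t n) mN PN) -(measureU0 (mS n (lexx 0)) mN PN).
congr (fine (P _)); apply/seteqP.
have HE w : ~ N w -> H t w = 0.
  move=> nN; have Dw : D 0 w = 0%E by apply: contrapT => h; apply: nN; exact: hN.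
  apply/eqP; rewrite eq_le inverse_subordinator_ge0 andbT; apply: ge_inf; first by exists 0 => y [].
  by split => //; rewrite Dw lte_fin.
split => w [Sw|Nw]; [|by right| |by right].
  by have [Nw|nN] := pselect (N w); [right|left; move: Sw; rewrite /= /time_change HE].
by have [Nw|nN] := pselect (N w); [right|left; rewrite /= /time_change HE].
Qed.

Let qdec x y : 0 < x -> x <= y -> q y <= q x. Proof. exact: levy_kernel_dec hf x y. Qed.
Let qinf A : exists2 x, 0 < x & A <= q x. Proof. exact: levy_kernel_inf hf hinf A. Qed.
Let kq : is_kernel q. Proof. exact: levy_kernel_is_kernel hf. Qed.
Let c20 : 0 <= c2. Proof. by case: hf. Qed.

Let qac a b : 0 < a -> a <= b -> abs_cont a b q.
Proof.
move=> a0 ab e e0; have [del del0 hd] := hac a0 ab e0; exists del => // n x y hxy tr sd.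
have := hd n x y hxy tr sd; rewrite (eq_bigr (fun i => `|q (y i) - q (x i)|))// => i _.
have [ax [xy _]] := hxy i; have x0 : 0 < x i := lt_le_trans a0 ax.
by rewrite /q /levy_kernel x0 (lt_le_trans x0 xy).
Qed.

Let lap_q s : 0 < s -> (c2%:E + laplace q s)%E = (f s / s)%:E.
Proof. exact: laplace_levy_kernel hf s. Qed.

Let lap_sub (m : R -> R) (C s : R) : measurable_fun setT m -> (forall y, 0 <= m y) -> (forall y, m y <= C) ->
  (forall y, y < 0 -> m y = 0) -> 0 < s ->
  laplace (sub m) s = ((s^-1)%:E * laplace m (f s))%E.
Proof. by move=> h1 h2 h3 h4 s0; exact: (laplace_subordinated mD Dnd LD f0 h1 h2 h3 h4 s0). Qed.

Let lap_U s : 0 < s -> laplace U s = (s^-1 * (f s)^-1)%:E.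
Proof.
move=> s0; rewrite (lap_sub mst st0 st1 stN s0) EFinM; congr (_ * _)%E.
rewrite -(laplace_heaviside (f0 s0)); apply: laplace_ae => //.
  exact: cdf_like_measurable heaviside_cdf_like.
by move=> x x0; rewrite /st /heaviside (le_eqVlt 0 x) (eq_sym 0 x) (negbTE x0)/=; case: ifP.
Qed.

Let qU t : c2 * U t + rconv q U t = ramp t.
Proof.
apply: (convolution_equation c20 kq cdfU (@ramp_cdf_like R) (@continuous_ramp R)) => s s0.
rewrite lap_q// lap_U// laplace_ramp// -EFinM; congr EFin; field.
by rewrite !gt_eqF ?f0.
Qed.

Let ctU : continuous U. Proof. exact: (renewal_continuous c20 kq cdfU qdec qU qinf). Qed.

Let pf01 n t : 0 <= pf n t <= 1.
Proof. by rewrite /pf /state_prob fine_ge0//= -lee_fin fineK ?probability_le1// ?fin_num_measure//; exact: mpf. Qed.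

Let cpf n : continuous (pf n).
Proof.
apply: (continuous_dominated (ltW K0) _ ctU) => a b ab.
have [snd _ _ _] := cdfplus n; have [und _ _ _] := cdfminus n.
rewrite !pfE opprD addrACA subrr add0r mulrBr.
apply: (half_difference_le (snd _ _ ab) (und _ _ ab)); by rewrite mulrA sub_sum.
Qed.

Let r n := skellam_rhs Lam Mu pf n.
Let kr n := skellam_plus_kernel (ltW Lam0) (ltW Mu0) cpf pf01 n.
Let kr' n := skellam_minus_kernel (ltW Lam0) (ltW Mu0) cpf pf01 n.
Let BY n := primitive (fun x : R => if 0 < x then K + r n x else 0).
Let BZ n := primitive (fun x : R => if 0 < x then K - r n x else 0).

Let lap (h : R -> R) s := laplace (fun x : R => if 0 < x then h x else 0) s.

(** Subordination replaces [s] by [f s] in a transform and multiplies it by [f s / s]. The rule is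
    deduced from [laplace_subordinated] for the nonnegative weights [mplus n] and [st]. *)
Let lap_pf n s : 0 < s -> lap (pf n) s = ((f s / s)%:E * lap (p n) (f s))%E.
Proof.
move=> s0; have fs := f0 s0.
have [a1 a2 a3] := mplusF n; have p00 : 0 <= p n 0 by have /andP[] := p01 n 0.
have hh (x : R) : 0 <= heaviside x :> R by exact: ler0n.
have mh : measurable_fun setT (heaviside : R -> R) := cdf_like_measurable heaviside_cdf_like.
have F00 : Fplus n 0 = p n 0 by rewrite /Fplus mulr0 addr0.
have L1 := laplace_positive_part (@chp n) (@cF n) (@dF n) (hp0 n) (hp2 n) fs
  (ltac:(by rewrite F00)).
have pn0 x : 0 <= p n x by have /andP[] := p01 n x.
have pfn0 x : 0 <= pf n x by have /andP[] := pf01 n x.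
have ip : forall F : R -> R, (fun x => if 0 <= x then F x else 0) = (fun x => F x * heaviside x).
  by move=> F; apply/funext => x; rewrite /heaviside; case: ifP; rewrite ?mulr1 ?mulr0.
have m1 : measurable_fun setT (fun x : R => if 0 <= x then p n x else 0).
  by rewrite ip; exact: measurable_funM.
have m2 : measurable_fun setT (fun x : R => if 0 <= x then pf n x else 0).
  by rewrite ip; apply: measurable_funM => //; exact: continuous_measurable_fun.
have q1 x : 0 <= (if 0 <= x then p n x else 0) by case: ifP.
have q2 x : 0 <= (if 0 <= x then pf n x else 0) by case: ifP.
have mr : measurable_fun setT (ramp : R -> R) := cdf_like_measurable ramp_cdf_like.
have r0 (x : R) : 0 <= ramp x by rewrite /ramp le_max lexx orbT.
have mU := cdf_like_measurable cdfU; have [_ U0 UN _] := cdfU.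
have [_ s0' sN _] := cdfplus n.
have E1 : laplace (fun x : R => if 0 <= x then Fplus n x else 0) (f s) =
    (lap (p n) (f s) + K%:E * ((f s)^-1 * (f s)^-1)%:E)%E.
  rewrite /lap -(laplace_pos0 cp p01 n (f s)) -(laplace_ramp fs) -(laplaceZ _ mr r0 (ltW K0)).
  rewrite -laplaceD//; [|exact: measurable_funM|by move=> x; rewrite mulr_ge0// ltW].
  congr laplace; apply/funext => x; rewrite /Fplus /ramp.
  by case: leP => x0; rewrite ?mulr0 ?addr0.
have E2 : (lap (pf n) s + K%:E * laplace U s = (p n 0)%:E * (s^-1)%:E + laplace (sub (mplus n)) s)%E.
  rewrite /lap -(laplace_pos0 cpf pf01 n s) -(laplace_heaviside s0) -(laplaceZ _ mU U0 (ltW K0)).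
  rewrite -(laplaceZ _ mh hh p00) -laplaceD//; [|exact: measurable_funM|by move=> x; rewrite mulr_ge0// ltW].
  rewrite -laplaceD//; [|exact: measurable_funM|exact: cdf_like_measurable|by move=> x; rewrite mulr_ge0].
  congr laplace; apply/funext => x; rewrite /heaviside.
  case: leP => x0 /=; last by rewrite mulr0 UN// sN// mulr0.
  by rewrite pfE; ring.
rewrite E1 F00 -/(mplus n) in L1; rewrite (lap_U s0) (lap_sub a1 a2 (mp2 n) a3 s0) in E2.
have k1 := laplace_pos_fin cp p01 n fs; have k2 := laplace_pos_fin cpf pf01 n s0.
have [_ _ _ k3] := kplus n.
rewrite -/(lap (p n) (f s)) in k1; rewrite -/(lap (pf n) s) in k2.
case: (lap (p n) (f s)) k1 L1 => [a| |] // _.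
case: (lap (pf n) s) k2 E2 => [b| |] // _.
case: (laplace (mplus n) (f s)) (k3 _ fs) => [x| |] // _.
rewrite -?EFinM -?EFinD -?EFinM => h2 h1; congr EFin.
have e2 := EFin_inj h2; have e1 := EFin_inj h1.
have s1 : s != 0 by rewrite gt_eqF.
have f1 : f s != 0 by rewrite gt_eqF.
have e3 : f s * a = p n 0 + x - K * (f s)^-1.
  by rewrite -e1; field.
have -> : b = p n 0 * s^-1 + s^-1 * x - K * (s^-1 * (f s)^-1) by rewrite -e2 addrK.
rewrite mulrAC e3; field; by rewrite ?s1 ?f1.
Qed.

(** The right-hand side is linear in the state probabilities with constant coefficients, so it
    inherits the rule of [lap_pf]. As [f s / s] is also [c2] plus the transform of [q], this is the
    source of the convolution equations [qY] and [qZ]. *)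
Let lap_kr n s : 0 < s -> lap (fun x => K + r n x) s = ((f s / s)%:E * laplace (mplus n) (f s))%E.
Proof.
move=> s0; have fs := f0 s0.
have e1 := laplace_skellam_plus (ltW Lam0) (ltW Mu0) cpf pf01 n s0.
have e2 := laplace_skellam_plus (ltW Lam0) (ltW Mu0) cp p01 n fs.
have l1 := lap_pf n s0; have l2 := lap_pf (n - 1) s0; have l3 := lap_pf (n + 1) s0.
rewrite /lap in l1 l2 l3; rewrite l1 l2 l3 in e1; rewrite /lap.
have [_ _ _ k1] := kr n; have [_ _ _ k2] := kplus n.
have A0 m := laplace_pos_fin cp p01 m fs.
case: (laplace (fun x => if 0 < x then K + r n x else 0) s) (k1 s s0) e1 => [a| |] // _.
rewrite -/(mplus n) in e2.
case: (laplace (mplus n) (f s)) (k2 _ fs) e2 => [b| |] // _.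
case: (laplace _ (f s)) (A0 n) => [x| |] // _.
case: (laplace _ (f s)) (A0 (n - 1)) => [y| |] // _.
case: (laplace _ (f s)) (A0 (n + 1)) => [z| |] // _.
rewrite -!EFinM -!EFinD => h2 h1; congr EFin.
have {}e2 := EFin_inj h2; have {}e1 := EFin_inj h1.
have s1 : s != 0 by rewrite gt_eqF.
have f1 : f s != 0 by rewrite gt_eqF.
have -> : a = Lam * (f s / s * y) + Mu * (f s / s * z) + K * s^-1 - K * (f s / s * x) by rewrite -e1 addrK.
have -> : b = Lam * y + Mu * z + K * (f s)^-1 - K * x by rewrite -e2 addrK.
field; by rewrite ?s1 ?f1.
Qed.

Let lap_kr' n s : 0 < s -> lap (fun x => K - r n x) s = ((f s / s)%:E * laplace (mminus n) (f s))%E.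
Proof.
move=> s0; have fs := f0 s0.
have e1 := laplace_skellam_minus (ltW Lam0) (ltW Mu0) cpf pf01 n s0.
have e2 := laplace_skellam_minus (ltW Lam0) (ltW Mu0) cp p01 n fs.
have := lap_kr n s0; rewrite /lap => l1; rewrite l1 in e1.
have [_ _ _ k1] := kr' n; have [_ _ _ k2] := kplus n; have [_ _ _ k3] := kminus n.
rewrite -/(mplus n) -/(mminus n) in e2.
case: (laplace (fun x => if 0 < x then K - r n x else 0) s) (k1 s s0) e1 => [a| |] // _.
case: (laplace (mplus n) (f s)) (k2 _ fs) e2 => [b| |] // _.
case: (laplace (mminus n) (f s)) (k3 _ fs) => [x| |] // _.
rewrite -!EFinM -!EFinD => h2 h1; congr EFin.
have {}e2 := EFin_inj h2; have {}e1 := EFin_inj h1.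
have s1 : s != 0 by rewrite gt_eqF.
have f1 : f s != 0 by rewrite gt_eqF.
have -> : a = 2 * K * s^-1 - f s / s * b by rewrite -e1 addrC addKr.
have -> : x = 2 * K * (f s)^-1 - b by rewrite -e2 addrC addKr.
field; by rewrite ?s1 ?f1.
Qed.

Let rbpf n x := skellam_rhs_bound (ltW Lam0) (ltW Mu0) pf01 n x.

Let cBY n : cdf_like (BY n). Proof. exact: cdf_like_rconv (kr n) (@heaviside_cdf_like R). Qed.
Let cBZ n : cdf_like (BZ n). Proof. exact: cdf_like_rconv (kr' n) (@heaviside_cdf_like R). Qed.

Let chr n : continuous (fun x => K + r n x).
Proof. by move=> x; apply: cvgD; [exact: cvg_cst|exact: continuous_skellam_rhs]. Qed.
Let chr' n : continuous (fun x => K - r n x).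
Proof. by move=> x; apply: cvgB; [exact: cvg_cst|exact: continuous_skellam_rhs]. Qed.
Let hr0 n x : 0 <= K + r n x. Proof. by have [/andP[]] := rbpf n x. Qed.
Let hr2 n x : K + r n x <= 2 * K. Proof. by have [/andP[]] := rbpf n x. Qed.
Let hr0' n x : 0 <= K - r n x. Proof. by have [_ /andP[]] := rbpf n x. Qed.
Let hr2' n x : K - r n x <= 2 * K. Proof. by have [_ /andP[]] := rbpf n x. Qed.

Let ctBY n : continuous (BY n).
Proof.
apply: (continuous_dominated KK0 _ (g := id)); last by move=> x; exact: cvg_id.
by move=> a b ab; exact: (primitive_lipschitz (@chr n) (hr0 n) (hr2 n) ab).
Qed.
Let ctBZ n : continuous (BZ n).
Proof.
apply: (continuous_dominated KK0 _ (g := id)); last by move=> x; exact: cvg_id.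
by move=> a b ab; exact: (primitive_lipschitz (@chr' n) (hr0' n) (hr2' n) ab).
Qed.

Let YE n : (fun t => K * U t + (pf n t - p n 0)) = sub (mplus n).
Proof. by apply/funext => t; rewrite pfE; ring. Qed.
Let ZE n : (fun t => K * U t - (pf n t - p n 0)) = sub (mminus n).
Proof.
apply/funext => t; rewrite pfE; have := sub_sum n t; rewrite -mulrA => /(canRL (addKr _)) ->; ring.
Qed.

Let qY n t : c2 * (sub (mplus n)) t + rconv q (sub (mplus n)) t = BY n t.
Proof.
apply: (convolution_equation c20 kq (cdfplus n) (cBY n) (@ctBY n)) => s s0.
have [a1 a2 a3] := mplusF n; have [_ _ _ k2] := kplus n; have fs := f0 s0.
rewrite lap_q// (lap_sub a1 a2 (mp2 n) a3 s0) /BY (laplace_rconv s (kr n) (@heaviside_cdf_like R)).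
have := lap_kr n s0; rewrite /lap => ->; rewrite laplace_heaviside//.
case: (laplace _ _) (k2 _ fs) => [b| |] // _.
by rewrite -!EFinM; congr EFin; ring.
Qed.

Let qZ n t : c2 * (sub (mminus n)) t + rconv q (sub (mminus n)) t = BZ n t.
Proof.
apply: (convolution_equation c20 kq (cdfminus n) (cBZ n) (@ctBZ n)) => s s0.
have [a1 a2 a3] := mminusF n; have [_ _ _ k2] := kminus n; have fs := f0 s0.
rewrite lap_q// (lap_sub a1 a2 (mm2 n) a3 s0) /BZ (laplace_rconv s (kr' n) (@heaviside_cdf_like R)).
have := lap_kr' n s0; rewrite /lap => ->; rewrite laplace_heaviside//.
case: (laplace _ _) (k2 _ fs) => [b| |] // _.
by rewrite -!EFinM; congr EFin; ring.
Qed.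

Lemma time_changed_caputo n t : 0 < t ->
  gen_caputo_defined c2 (levy_tail c1 nubar) (pf n) t /\
  gen_caputo c2 (levy_tail c1 nubar) (pf n) t = skellam_rhs Lam Mu pf n t.
Proof.
move=> t0.
have nuq x : 0 < x -> levy_tail c1 nubar x = q x by move=> x0; rewrite /q /levy_kernel x0.
have cY : cdf_like (fun t => K * U t + (pf n t - p n 0)) by rewrite YE; exact: cdfplus.
have cZ : cdf_like (fun t => K * U t - (pf n t - p n 0)) by rewrite ZE; exact: cdfminus.
have eY u : c2 * (K * U u + (pf n u - p n 0)) + rconv q (fun t => K * U t + (pf n t - p n 0)) u = BY n u.
  by have := qY n u; rewrite -YE.
have eZ u : c2 * (K * U u - (pf n u - p n 0)) + rconv q (fun t => K * U t - (pf n t - p n 0)) u = BZ n u.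
  by have := qZ n u; rewrite -ZE.
have dY (u : R) : 0 < u -> is_derive u 1 (BY n) (K + r n u).
  by move=> u0; exact: (is_derive_primitive (@chr n) (hr0 n) (hr2 n) u0).
have dZ (u : R) : 0 < u -> is_derive u 1 (BZ n) (K - r n u).
  by move=> u0; exact: (is_derive_primitive (@chr' n) (hr0' n) (hr2' n) u0).
exact: (caputo_equation c20 K0 kq cdfU nuq qdec qinf qac qU cY cZ eY eZ dY dZ t0).
Qed.

(** [U 0 = 0] by continuity; the nonnegative parts [sub (mplus n)] and [sub (mminus n)], with sum
    [2 * K * U], therefore vanish at 0 as well. *)
Lemma time_changed_initial n : pf n 0 = state_prob P S n 0.
Proof.
have U00 : U 0 = 0 by exact: (renewal_at0 c20 kq cdfU qdec qU qinf (lexx 0)).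
have [_ a0 _ _] := cdfplus n; have [_ b0 _ _] := cdfminus n.
have /eqP := sub_sum n 0; rewrite U00 mulr0 paddr_eq0// => /andP[/eqP e _].
by rewrite pfE U00 e mulr0 subrr addr0 /p maxxx.
Qed.

End time_changed_skellam.

Theorem theorem4p1 (R : realType) (d : measure_display) (T : measurableType d)
    (P : probability T R)
    (k : nat) (hk : (1 <= k)%N) (lam mu : 'I_k -> R)
    (hlam : forall i, 0 < lam i) (hmu : forall i, 0 < mu i)
    (S : R -> T -> int)
    (hS : (k = 1%N /\ gsp P lam mu S) \/
          skellam_state_equations P (\sum_i lam i) (\sum_i mu i) S)
    (c1 c2 : R) (nubar : {measure set R -> \bar R})
    (hf : bernstein_triplet c1 c2 nubar)
    (D : R -> T -> \bar R) (hD : subordinator P c1 c2 nubar D)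
    (hindep : independent_processes P S (inverse_subordinator D))
    (hinf : nubar `]0, +oo[%classic = +oo%E)
    (hac : forall a b, 0 < a -> a <= b -> abs_cont a b (levy_tail c1 nubar)) :
  let pf := state_prob P (time_change S (inverse_subordinator D)) in
  let nu := levy_tail c1 nubar in
  [/\ forall (n : int) (t : R), 0 < t ->
        gen_caputo_defined c2 nu (pf n) t /\
        gen_caputo c2 nu (pf n) t =
          skellam_rhs (\sum_i lam i) (\sum_i mu i) pf n t,
      pf 0 0 = 1 &
      forall n : int, n != 0 -> pf n 0 = 0].
Proof.
have hS' : skellam_state_equations P (\sum_i lam i) (\sum_i mu i) S.
  (* With unit jumps the state equations follow from the definition of the process; in the other
     alternative they are the hypothesis itself. *)
  by case: hS => [[k1 g]|//]; subst k; exact: gsp_unit_state_equations g.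
have sum_gt0 (r : 'I_k -> R) : (forall i, 0 < r i) -> 0 < \sum_i r i.
  move=> r0; rewrite (bigD1 (Ordinal hk))//= ltr_pwDl// sumr_ge0// => i _.
  exact: ltW.
have L0 := sum_gt0 _ hlam; have M0 := sum_gt0 _ hmu.
have [_ S0 Sn _] := hS'.
have init n := time_changed_initial L0 M0 hS' hf hD hindep hinf n.
move=> pf nu; split.
- by move=> n t t0; exact: (time_changed_caputo L0 M0 hS' hf hD hindep hinf hac n t0).
- by rewrite /pf init.
- by move=> n n0; rewrite /pf init Sn.
Qed.
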